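(* Let $0<a<c$ be coprime integers with $c$ odd, let $h,k$ be coprime integers with $k\ge1$, and let $z\in\mathbb C$ with $\mathrm{Re}(z)>0$. Put $q:=e^{\frac{2\pi i}{k}(h+iz)}$ and $q_1:=e^{\frac{2\pi i}{k}(h'+\frac iz)}$. (1) If $c\mid k$, then \begin{multline*} N\left(\tfrac ac;q\right)=\frac{(-1)^{ak+1}i\sin(\frac{\pi a}{c})\,\omega_{h,k}}{\sin(\frac{\pi ah'}{c})\,z^{1/2}}e^{-\frac{3\pi ia^2k_1h'}{c}}e^{\frac{\pi}{12k}(z^{-1}-z)}N\left(\tfrac{ah'}{c};q_1\right)\\ +\frac{2\sin^2(\frac{\pi a}c)\,\omega_{h,k}}{k}e^{-\frac{\pi z}{12k}}z^{1/2}\sum_{\nu\pmod k}(-1)^\nu e^{-\frac{3\pi ih'\nu^2}{k}+\frac{\pi ih'\nu}{k}}I_{a,c,k,\nu}(z). \end{multline*} (2) If $c\nmid k$, then \begin{multline*} N\left(\tfrac ac;q\right)=\frac{4i(-1)^{ak+l+1}\sin(\frac{\pi a}c)\,\omega_{h,k}}{z^{1/2}}e^{-\frac{2\pi ih'sa}{c}-\frac{3\pi ia^2h'k_1}{cc_1}+\frac{6\pi ih'la}{cc_1}}q_1^{\frac{sl}{c_1}-\frac{3l^2}{2c_1^2}}e^{\frac{\pi}{12k}(z^{-1}-z)}N\left(ah',\tfrac{lc}{c_1},c;q_1\right)\\ +\frac{2\sin^2(\frac{\pi a}c)\,\omega_{h,k}}{k}e^{-\frac{\pi z}{12k}}z^{1/2}\sum_{\nu\pmod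 k}(-1)^\nu e^{-\frac{3\pi ih'\nu^2}{k}+\frac{\pi ih'\nu}{k}}I_{a,c,k,\nu}(z). \end{multline*}
   Context: $z^{1/2}$ is the principal branch. For $q=e^{2\pi i\tau}$ with $\mathrm{Im}\,\tau>0$ and real $\alpha$, $q^\alpha:=e^{2\pi i\alpha\tau}$; $(q;q)_\infty=\prod_{n\ge1}(1-q^n)$. For real $x$ (here $x=a/c$ or $x=ah'/c$), $$N(x;q):=\frac1{(q;q)_\infty}\left(1+\sum_{n\ge1}\frac{(-1)^n(1+q^n)(2-2\cos(2\pi x))}{1-2q^n\cos(2\pi x)+q^{2n}}q^{\frac{n(3n+1)}2}\right).$$ For integers $b,c$ with $b/c\in(0,1)\setminus\{\frac12,\frac16,\frac56\}$, $s(b,c)$ equals $0,1,2,3$ according as $b/c$ lies in $(0,\frac16),(\frac16,\frac12),(\frac12,\frac56),(\frac56,1)$, and $$N(a,b,c;q):=\frac{i}{2(q;q)_\infty}\left(\sum_{m\ge0}\frac{(-1)^me^{-\frac{\pi ia}{c}}q^{\frac m2(3m+1)+ms(b,c)+\frac{b}{2c}}}{1-e^{-\frac{2\pi ia}c}q^{m+\frac bc}}-\sum_{m\ge1}\frac{(-1)^me^{\frac{\pi ia}c}q^{\frac m2(3m+1)-ms(b,c)-\frac b{2c}}}{1-e^{\frac{2\pi ia}c}q^{m-\frac bc}}\right).$$ $h'$ is an integer with $hh'\equiv-1\pmod k$ if $k$ is odd, $hh'\equiv-1\pmod{2k}$ if $k$ is even. $k_1:=k/\gcd(k,c)$, $c_1:=c/\gcd(k,c)$;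 for $c\nmid k$, $l$ is the integer with $0<l<c_1$, $l\equiv ak_1\pmod{c_1}$, and $s:=s(l,c_1)$. With $((x)):=x-\lfloor x\rfloor-\frac12$ for $x\notin\mathbb Z$ and $0$ for $x\in\mathbb Z$, $\omega_{h,k}:=\exp(\pi i\sum_{\mu\bmod k}((\mu/k))((h\mu/k)))$. $H_{a,c}(x):=\frac{\cosh x}{\sinh(x+\frac{\pi ia}c)\sinh(x-\frac{\pi ia}c)}$ and, for $\nu\in\mathbb Z$, $I_{a,c,k,\nu}(z):=\int_{\mathbb R}e^{-\frac{3\pi zx^2}{k}}H_{a,c}\left(\frac{\pi i\nu}k-\frac{\pi i}{6k}-\frac{\pi zx}{k}\right)dx$. *)

(* Defs.v *)
From Stdlib Require Import Reals ZArith.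
From Coquelicot Require Import Coquelicot.

Coercion IZR : Z >-> R.

Local Open Scope C_scope.

Definition Cexp (z : C) : C := RtoC (exp (Re z)) * (cos (Im z), sin (Im z)).
Definition Ccosh (z : C) : C := (Cexp z + Cexp (- z)) / 2.
Definition Csinh (z : C) : C := (Cexp z - Cexp (- z)) / 2.

(* Principal argument, with values in (-PI, PI]; the value at 0 is junk. *)
Definition Carg (z : C) : R :=
  if Rle_dec 0 (Im z) then acos (Re z / Cmod z) else (- acos (Re z / Cmod z))%R.

(* Principal branch of z^(1/2), for z <> 0. *)
Definition Csqrt (z : C) : C := Cexp (((ln (Cmod z) : C) + Ci * Carg z) / 2).

(* Limit of a complex sequence; meaningful only for convergent sequences. *)
Definition Clim_seq (u : nat -> C) : C :=
  (real (Lim_seq (fun n => Re (u n))), real (Lim_seq (fun n => Im (u n)))).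

Lemma Clim_seq_unique (u : nat -> C) (l : C) :
  filterlim u eventually (locally l) -> Clim_seq u = l.
Proof.
intros H.
assert (Hre : is_lim_seq (fun n => Re (u n)) (Re l)).
{ apply (filterlim_comp _ _ _ u Re eventually (locally l) (locally (Re l))); [exact H|].
  intros P [e He]; exists e; intros y [Hy _]; exact (He _ Hy). }
assert (Him : is_lim_seq (fun n => Im (u n)) (Im l)).
{ apply (filterlim_comp _ _ _ u Im eventually (locally l) (locally (Im l))); [exact H|].
  intros P [e He]; exists e; intros y [_ Hy]; exact (He _ Hy). }
unfold Clim_seq.
rewrite (is_lim_seq_unique _ _ Hre), (is_lim_seq_unique _ _ Him).
now destruct l.
Qed.

Definition CSeries (u : nat -> C) : C := Clim_seq (sum_n u).

Fixpoint Cprod (u : nat -> C) (n : nat) : C :=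
  match n with O => 1 | S m => Cprod u m * u m end.

(* Improper integral over the real line of a complex-valued function. *)
Definition CInt_line (f : R -> C) : C :=
  RInt_gen (V := C_R_CompleteNormedModule) f
    (Rbar_locally m_infty) (Rbar_locally p_infty).

(* Since q has fractional powers, all functions of q = e^(2 pi i tau) are
   parametrised by tau, and [qpow tau alpha] is q^alpha. *)
Definition qpow (tau : C) (alpha : R) : C := Cexp (2 * PI * Ci * alpha * tau).

(* (q;q)_oo *)
Definition qpoch (tau : C) : C :=
  Clim_seq (Cprod (fun n => 1 - qpow tau (INR (S n)))).

(* N(x;q) *)
Definition rankN (x : R) (tau : C) : C :=
  1 / qpoch tau *
  (1 + CSeries (fun j => let n := INR (S j) in
     RtoC ((-1) ^ S j) * (1 + qpow tau n) * RtoC (2 - 2 * cos (2 * PI * x))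
     / (1 - 2 * qpow tau n * RtoC (cos (2 * PI * x)) + qpow tau (2 * n))
     * qpow tau (n * (3 * n + 1) / 2))).

(* Only meant for b/c in (0,1) different from 1/6, 1/2 and 5/6. *)
Definition s_idx (b c : Z) : Z :=
  if Rlt_dec (b / c) (1 / 6) then 0%Z
  else if Rlt_dec (b / c) (1 / 2) then 1%Z
  else if Rlt_dec (b / c) (5 / 6) then 2%Z
  else 3%Z.

(* N(a,b,c;q) *)
Definition rankN3 (a b c : Z) (tau : C) : C :=
  Ci / (2 * qpoch tau) *
  (CSeries (fun j => let m := INR j in
     RtoC ((-1) ^ j) * Cexp (- (PI * Ci * RtoC (a / c)))
     * qpow tau (m / 2 * (3 * m + 1) + m * s_idx b c + b / (2 * c))
     / (1 - Cexp (- (2 * PI * Ci * RtoC (a / c))) * qpow tau (m + b / c)))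
   - CSeries (fun j => let m := INR (S j) in
     RtoC ((-1) ^ S j) * Cexp (PI * Ci * RtoC (a / c))
     * qpow tau (m / 2 * (3 * m + 1) - m * s_idx b c - b / (2 * c))
     / (1 - Cexp (2 * PI * Ci * RtoC (a / c)) * qpow tau (m - b / c)))).

(* ((x)) *)
Definition sawtooth (x : R) : R :=
  if Req_dec_T (frac_part x) 0 then 0%R else (frac_part x - 1 / 2)%R.

(* omega_{h,k} for k >= 1; [sum_n] includes its upper bound. *)
Definition omega (h k : Z) : C :=
  Cexp (PI * Ci * RtoC
    (sum_n (fun mu => (sawtooth (INR mu / k) * sawtooth (h * INR mu / k))%R)
       (Z.to_nat (k - 1)))).

Definition Hfun (a c : Z) (x : C) : C :=
  Ccosh x
  / (Csinh (x + PI * Ci * RtoC (a / c)) * Csinh (x - PI * Ci * RtoC (a / c))).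

Definition Iint (a c k nu : Z) (z : C) : C :=
  CInt_line (fun x : R =>
    Cexp (- (3 * PI * z * RtoC (x ^ 2) / k))
    * Hfun a c (PI * Ci * nu / k - PI * Ci / (6 * k) - PI * z * x / k)).

(* Main.v *)
(* Write x = a/c, tau = (h + iz)/k. Pairing n with -n turns N(x;q) into sin(pi x)/(i (q)_oo) times the sum over n in Z of
   T_n = (-1)^n q^{3n^2/2}/sinh(pi i n tau - pi i x), and N(ah',lc/c_1,c;q_1) is a two-sided sum of the same kind.

   Let F_r = sum over mu mod k of F_{mu,r}, where F_{mu,r} is k-periodic in mu and has the factors
   1/sinh(pi i (mu/k - x) - pi z w/k) and 1/sin(pi (w + h' mu)/k). Then F_0 has residue (k/pi) T_n at w = n, while the
   remaining poles of the F_r lie on the line (-i/z) R and carry the terms of the dual sum. Integrate F_r over the lines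
   w = t - iy/z, t in R, with y = (2r-1)/6 and y = (2r+1)/6; a line that contains poles is crossed by subtracting their
   principal parts. At y = (2r+1)/6 the difference F_r - F_{r+1} no longer has the sine in its denominator, so that summing
   over r leaves Mordell integrals whose coefficients are theta series equal to 0 or to (q_1)_oo up to a factor.

   The same formula with exp in place of 1/sinh and x = 0 is the eta transformation up to a constant D. If P(z) denotes the
   product of the 1 - q^n over the n not divisible by k, then D is the limit of P(2z)^2/P(z) as z -> 0+; in the combination
   2 log P(2z) - log P(z) the divergent terms cancel, and a Taylor expansion of log(1 - zeta e^{-s}) gives D = 1/omega_{h,k}. *)

Require Import Defs.
From Stdlib Require Import Reals ZArith Znumtheory Lra Lia Psatz.
From Coquelicot Require Import Coquelicot.

Local Open Scope C_scope.

(** * Complex exponentials, differentiability and simple poles *)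

(** At height y the modulus of F_r carries the factor exp(pi Re(1/z) y(3y - 2r)/k). For a fixed r
    this grows like a Gaussian in |y|, so no single F_r can be pushed to infinity. The exponent is
    least at y = r/3, and passing from r to r + 1 halfway between r/3 and (r + 1)/3 makes y(3y - 2r)
    equal to (1 - 4r^2)/12 on both edges of strip r: the outermost integrals decay. This is the
    origin of the sixths. The pole lines of 1/sinh lie at the heights kx - M, one unit apart, hence
    in every third strip. They must avoid the edges, that is, 3kx must not be half an odd integer.
    An odd c guarantees this, and s(b,c) is nothing but the integer nearest to 3b/c, the number of
    the strip that contains the height b/c. The three classes of 2r + 1 modulo 6 are what produces
    the theta series: 1 and -1 give the pentagonal series, 3 gives a series that cancels under n ->
    -1 - n. In the eta transformation neither the Gaussian integral nor the finite exponential sums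
    in D are evaluated: as D does not depend on z, one limit along the positive reals fixes it. *)

Lemma C_ext (u v : C) : Re u = Re v -> Im u = Im v -> u = v.
Proof. destruct u, v; simpl; congruence. Qed.

Lemma Re_plus (u v : C) : Re (u + v) = (Re u + Re v)%R. Proof. reflexivity. Qed.
Lemma Im_plus (u v : C) : Im (u + v) = (Im u + Im v)%R. Proof. reflexivity. Qed.
Lemma Re_opp (u : C) : Re (- u) = (- Re u)%R. Proof. reflexivity. Qed.
Lemma Im_opp (u : C) : Im (- u) = (- Im u)%R. Proof. reflexivity. Qed.
Lemma Re_minus (u v : C) : Re (u - v) = (Re u - Re v)%R. Proof. reflexivity. Qed.
Lemma Im_minus (u v : C) : Im (u - v) = (Im u - Im v)%R. Proof. reflexivity. Qed.
Lemma Re_mult (u v : C) : Re (u * v) = (Re u * Re v - Im u * Im v)%R. Proof. reflexivity. Qed.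
Lemma Im_mult (u v : C) : Im (u * v) = (Re u * Im v + Im u * Re v)%R. Proof. reflexivity. Qed.
Lemma Re_Ci : Re Ci = 0%R. Proof. reflexivity. Qed.
Lemma Im_Ci : Im Ci = 1%R. Proof. reflexivity. Qed.
Lemma Ci2 : Ci * Ci = RtoC (-1).
Proof. apply C_ext; simpl; ring. Qed.

Ltac creim := repeat progress rewrite ?Re_plus, ?Im_plus, ?Re_opp, ?Im_opp, ?Re_minus, ?Im_minus,
  ?Re_mult, ?Im_mult, ?Re_Ci, ?Im_Ci, ?re_RtoC, ?im_RtoC.

Lemma RtoC_neq (x y : R) : x <> y -> RtoC x <> RtoC y.
Proof. intros H E. apply H. exact (RtoC_inj _ _ E). Qed.

Lemma Cmod_tri' (u v : C) : (Cmod (u - v) <= Cmod u + Cmod v)%R.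
Proof. unfold Cminus. eapply Rle_trans; [apply Cmod_triangle|]. rewrite Cmod_opp. lra. Qed.

Lemma Cmod_tri_rev (u v : C) : (Cmod u - Cmod v <= Cmod (u - v))%R.
Proof.
pose proof (Cmod_triangle (u - v) v) as H. replace (u - v + v) with u in H by ring. lra.
Qed.

Lemma Cmod_minus_sym (u v : C) : Cmod (u - v) = Cmod (v - u).
Proof. rewrite <- Cmod_opp. f_equal. ring. Qed.

Lemma im_le_Cmod (u : C) : (Rabs (Im u) <= Cmod u)%R.
Proof. eapply Rle_trans; [|apply Rmax_Cmod]. apply Rmax_r. Qed.

Lemma Cmod_le_abs (u : C) : (Cmod u <= Rabs (Re u) + Rabs (Im u))%R.
Proof.
replace u with (RtoC (Re u) + Ci * RtoC (Im u)) at 1.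
- eapply Rle_trans; [apply Cmod_triangle|]. rewrite Cmod_mult, Cmod_Ci, !Cmod_R. lra.
- apply C_ext; creim; ring.
Qed.

Lemma Cmod_sqr (u : C) : (Cmod u * Cmod u = Re u * Re u + Im u * Im u)%R.
Proof. pose proof (Cmod2_alt u). lra. Qed.

Lemma Re_Cexp (w : C) : Re (Cexp w) = (exp (Re w) * cos (Im w))%R.
Proof. unfold Cexp. creim. simpl. ring. Qed.

Lemma Im_Cexp (w : C) : Im (Cexp w) = (exp (Re w) * sin (Im w))%R.
Proof. unfold Cexp. creim. simpl. ring. Qed.

Lemma Cexp_plus (u v : C) : Cexp (u + v) = Cexp u * Cexp v.
Proof.
apply C_ext; creim; rewrite ?Re_Cexp, ?Im_Cexp; creim; rewrite exp_plus, ?cos_plus, ?sin_plus; ring.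
Qed.

Lemma Cexp_0 : Cexp 0 = 1.
Proof. apply C_ext; rewrite ?Re_Cexp, ?Im_Cexp; simpl; rewrite exp_0, ?cos_0, ?sin_0; ring. Qed.

Lemma Cmod_Cexp (w : C) : Cmod (Cexp w) = exp (Re w).
Proof.
pose proof (exp_pos (Re w)).
apply Rsqr_inj; [apply Cmod_ge_0|lra|]. unfold Rsqr. rewrite Cmod_sqr, Re_Cexp, Im_Cexp.
pose proof (sin2_cos2 (Im w)) as H1. unfold Rsqr in H1.
transitivity (exp (Re w) * exp (Re w) * (sin (Im w) * sin (Im w) + cos (Im w) * cos (Im w)))%R; [ring|].
rewrite H1. ring.
Qed.

Lemma Cexp_neq_0 (w : C) : Cexp w <> 0.
Proof. apply Cmod_gt_0. rewrite Cmod_Cexp. apply exp_pos. Qed.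

Lemma Cexp_opp (w : C) : Cexp (- w) = / Cexp w.
Proof.
pose proof (Cexp_neq_0 w).
assert (E : Cexp (- w) * Cexp w = 1) by (rewrite <- Cexp_plus; replace (- w + w) with (RtoC 0) by ring; apply Cexp_0).
rewrite <- (Cmult_1_l (/ Cexp w)), <- E. field; auto.
Qed.

Lemma Cexp_minus (u v : C) : Cexp (u - v) = Cexp u / Cexp v.
Proof. unfold Cminus, Cdiv. now rewrite Cexp_plus, Cexp_opp. Qed.

Lemma Cexp_RtoC (x : R) : Cexp (RtoC x) = RtoC (exp x).
Proof. apply C_ext; rewrite ?Re_Cexp, ?Im_Cexp; simpl; rewrite ?cos_0, ?sin_0; ring. Qed.

Lemma Cexp_Ci (x : R) : Cexp (Ci * RtoC x) = (cos x, sin x).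
Proof.
apply C_ext; rewrite ?Re_Cexp, ?Im_Cexp; creim;
 replace (0 * x - 1 * 0)%R with 0%R by ring; replace (0 * 0 + 1 * x)%R with x by ring;
 rewrite exp_0; simpl; ring.
Qed.

Lemma cos_2PIn (n : Z) : cos (2 * PI * n) = 1%R.
Proof.
destruct (Z_le_gt_dec 0 n) as [H|H].
- rewrite <- (Z2Nat.id n H), <- INR_IZR_INZ.
  replace (2 * PI * INR (Z.to_nat n))%R with (0 + 2 * INR (Z.to_nat n) * PI)%R by ring.
  rewrite cos_period. apply cos_0.
- rewrite <- cos_neg. replace (- (2 * PI * n))%R with (2 * PI * IZR (- n))%R by (rewrite opp_IZR; ring).
  rewrite <- (Z2Nat.id (- n)) by lia. rewrite <- INR_IZR_INZ.
  replace (2 * PI * INR (Z.to_nat (- n)))%R with (0 + 2 * INR (Z.to_nat (- n)) * PI)%R by ring.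
  rewrite cos_period. apply cos_0.
Qed.

Lemma sin_PIn (n : Z) : sin (PI * n) = 0%R.
Proof. apply sin_eq_0_1. exists n. ring. Qed.

Lemma Cexp_2PIn (n : Z) : Cexp (2 * PI * Ci * IZR n) = 1.
Proof.
replace (2 * PI * Ci * IZR n) with (Ci * RtoC (2 * PI * n)) by (rewrite !RtoC_mult; ring).
rewrite Cexp_Ci. apply C_ext; simpl.
- apply cos_2PIn.
- replace (2 * PI * n)%R with (PI * IZR (2 * n))%R by (rewrite mult_IZR; ring). apply sin_PIn.
Qed.

Lemma Cexp_eq (n : Z) (u v : C) : u - v = 2 * PI * Ci * IZR n -> Cexp u = Cexp v.
Proof.
intros H. replace u with (v + 2 * PI * Ci * IZR n) by (rewrite <- H; ring).
rewrite Cexp_plus, Cexp_2PIn. ring.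
Qed.

Lemma Cexp_PI : Cexp (PI * Ci) = - (1).
Proof.
replace (PI * Ci) with (Ci * RtoC PI) by ring. rewrite Cexp_Ci, cos_PI, sin_PI.
apply C_ext; simpl; ring.
Qed.

Lemma Cexp_eq_1 (u : C) : Cexp u = 1 -> exists n : Z, u = 2 * PI * Ci * IZR n.
Proof.
intros H.
assert (Hm : Cmod (Cexp u) = 1%R) by (rewrite H; apply Cmod_1).
rewrite Cmod_Cexp in Hm.
assert (Hr : Re u = 0%R) by (apply exp_inv; now rewrite exp_0).
assert (Hc : cos (Im u) = 1%R) by (pose proof (Re_Cexp u) as E; rewrite H, Hr, exp_0 in E; simpl in E; lra).
assert (Hs : sin (Im u / 2) = 0%R).
{ pose proof (cos_2a_sin (Im u / 2)) as E. replace (2 * (Im u / 2))%R with (Im u) in E by field. nra. }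
destruct (sin_eq_0_0 _ Hs) as [n Hn]. exists n. apply C_ext.
- rewrite Hr. creim. simpl. ring.
- creim. simpl. lra.
Qed.

Lemma Csinh_eq (u : C) : Csinh u = (Cexp u - Cexp (- u)) / 2.
Proof. reflexivity. Qed.

Lemma C2_neq_0 : RtoC 2 <> 0.
Proof. apply RtoC_neq; lra. Qed.

Lemma Csinh_eq_0 (u : C) : Csinh u = 0 -> exists n : Z, u = PI * Ci * IZR n.
Proof.
intros H. unfold Csinh in H.
assert (E : Cexp (2 * u) = 1).
{ assert (E0 : Cexp u - Cexp (- u) = 0).
  { pose proof C2_neq_0. replace (Cexp u - Cexp (- u)) with ((Cexp u - Cexp (- u)) / 2 * 2) by (field; auto).
    rewrite H. ring. }
  replace (2 * u) with (u + u) by ring. rewrite Cexp_plus.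
  replace (Cexp u * Cexp u) with (1 + (Cexp u - Cexp (- u)) * Cexp u).
  - rewrite E0. ring.
  - rewrite Cexp_opp. pose proof (Cexp_neq_0 u). field; auto. }
destruct (Cexp_eq_1 _ E) as [n Hn]. exists n.
replace u with (2 * u / 2) by (field; apply C2_neq_0). rewrite Hn. field; apply C2_neq_0.
Qed.

Lemma Csinh_opp (u : C) : Csinh (- u) = - Csinh u.
Proof. unfold Csinh. replace (- - u) with u by ring. field; apply C2_neq_0. Qed.

Lemma Csinh_PI (u : C) : Csinh (u + PI * Ci) = - Csinh u.
Proof.
unfold Csinh. replace (- (u + PI * Ci)) with (- u - PI * Ci) by ring.
rewrite Cexp_plus, Cexp_minus, Cexp_PI. field; split; try apply C2_neq_0; auto.
Qed.

(** Real and imaginary parts are estimated separately, from mean values of sin and cos and from 1 +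
    x <= exp x; the constant 4 rounds up the sum of the two bounds. This second-order remainder
    yields both the derivative of [Cexp] and the principal part of 1/sinh at 0. *)
Lemma Cexp_small (h : C) : (Cmod h <= / 2 -> Cmod (Cexp h - 1 - h) <= 4 * (Cmod h * Cmod h))%R.
Proof.
intros Hh. set (x := Re h). set (y := Im h).
assert (Hx : (Rabs x <= / 2)%R) by (eapply Rle_trans; [apply re_le_Cmod|exact Hh]).
assert (Hy : (Rabs y <= / 2)%R) by (eapply Rle_trans; [apply im_le_Cmod|exact Hh]).
rewrite Cmod_sqr. fold x y.
eapply Rle_trans; [apply Cmod_le_abs|]. creim. rewrite Re_Cexp, Im_Cexp. fold x y.
assert (E1 : (0 <= exp x - 1 - x <= 2 * (x * x))%R).
{ split; [pose proof (exp_ineq1_le x); lra|].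
  assert (exp x * (1 - x) <= 1)%R.
  { pose proof (exp_ineq1_le (- x)) as H1. pose proof (exp_pos x) as H2.
    assert (H3 : (exp x * exp (- x) = 1)%R) by (rewrite <- exp_plus, Rplus_opp_r; apply exp_0). nra. }
  apply Rabs_le_between in Hx. nra. }
assert (E2 : (0 <= 1 - cos y <= y * y / 2)%R).
{ split; [pose proof (COS_bound y); lra|].
  pose proof (cos_2a_sin (y / 2)) as H. replace (2 * (y / 2))%R with y in H by field.
  assert (Rabs (sin (y / 2)) <= Rabs (y / 2))%R.
  { destruct (MVT_gen sin 0 (y / 2) cos) as [c [_ Hc]].
    - intros; auto_derive; auto; ring.
    - intros t _. apply continuity_pt_filterlim. apply continuous_sin.
    - rewrite sin_0, Rminus_0_r, Rminus_0_r in Hc. rewrite Hc, Rabs_mult.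
      assert (Rabs (cos c) <= 1)%R by (apply Rabs_le; apply COS_bound). pose proof (Rabs_pos (y / 2)). nra. }
  apply Rsqr_le_abs_1 in H0. unfold Rsqr in H0. lra. }
assert (E3 : (Rabs (sin y - y) <= y * y)%R).
{ destruct (MVT_gen (fun t => sin t - t)%R 0 y (fun t => cos t - 1)%R) as [c [Hc1 Hc]].
  - intros; auto_derive; auto; ring.
  - intros t _. apply continuity_pt_minus; [apply continuity_sin|apply derivable_continuous_pt, derivable_pt_id].
  - rewrite sin_0 in Hc. replace (sin y - y - (0 - 0))%R with (sin y - y)%R in Hc by ring. rewrite Hc, Rabs_mult, Rminus_0_r.
    assert (HH : (Rabs (cos c - 1) <= Rabs y)%R).
    { destruct (MVT_gen cos 0 c (fun t => - sin t)%R) as [e [_ He]].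
      - intros; auto_derive; auto; ring.
      - intros t _. apply continuity_pt_filterlim. apply continuous_cos.
      - rewrite cos_0, Rminus_0_r in He. rewrite He, Rabs_mult, Rabs_Ropp.
        assert (Rabs (sin e) <= 1)%R by (apply Rabs_le; apply SIN_bound).
        assert (Rabs c <= Rabs y)%R.
        { unfold Rmin, Rmax in Hc1. destruct (Rle_dec 0 y); [rewrite !Rabs_right by lra; lra|rewrite !Rabs_left1 by lra; lra]. }
        pose proof (Rabs_pos c). nra. }
    replace (y * y)%R with (Rabs y * Rabs y)%R by (rewrite <- Rabs_mult; apply Rabs_right; nra).
    pose proof (Rabs_pos y). nra. }
assert (E4 : (Rabs (sin y) <= Rabs y + y * y)%R).
{ replace (sin y) with (y + (sin y - y))%R by ring. eapply Rle_trans; [apply Rabs_triang|]. lra. }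
apply Rabs_le_between in Hx. 
assert (E5 : (Rabs (exp x - 1) <= 2 * Rabs x)%R).
{ replace (exp x - 1)%R with (x + (exp x - 1 - x))%R by ring. eapply Rle_trans; [apply Rabs_triang|].
  rewrite (Rabs_right (exp x - 1 - x)) by lra.
  assert (x * x <= / 2 * Rabs x)%R.
  { replace (x * x)%R with (Rabs x * Rabs x)%R by (rewrite <- Rabs_mult; apply Rabs_right; nra).
    pose proof (Rabs_pos x). apply Rmult_le_compat_r; [lra|]. apply Rabs_le; lra. }
  lra. }
assert (E6 : (exp x <= 2)%R) by nra.
assert (F1 : (Rabs (exp x * cos y - 1 - x) <= 2 * (x * x) + y * y)%R).
{ replace (exp x * cos y - 1 - x)%R with ((exp x - 1 - x) - exp x * (1 - cos y))%R by ring.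
  pose proof (exp_pos x).
  assert (0 <= exp x * (1 - cos y) <= 2 * (y * y / 2))%R.
  { split; [apply Rmult_le_pos; lra|]. apply Rmult_le_compat; lra. }
  apply Rabs_le. pose proof (Rle_0_sqr x) as Q. unfold Rsqr in Q. pose proof (Rle_0_sqr y) as Q2. unfold Rsqr in Q2. lra. }
assert (Ey : (y * y <= / 2 * Rabs y)%R).
{ replace (y * y)%R with (Rabs y * Rabs y)%R by (rewrite <- Rabs_mult; apply Rabs_right; nra).
  pose proof (Rabs_pos y). nra. }
assert (F2 : (Rabs (exp x * sin y - y) <= 3 * (Rabs x * Rabs y) + y * y)%R).
{ replace (exp x * sin y - y)%R with ((exp x - 1) * sin y + (sin y - y))%R by ring.
  eapply Rle_trans; [apply Rabs_triang|]. rewrite Rabs_mult.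
  pose proof (Rabs_pos x). pose proof (Rabs_pos y). pose proof (Rabs_pos (exp x - 1)). pose proof (Rabs_pos (sin y)).
  assert (Rabs (exp x - 1) * Rabs (sin y) <= (2 * Rabs x) * (3 / 2 * Rabs y))%R by (apply Rmult_le_compat; lra).
  lra. }
assert (E7 : (2 * (Rabs x * Rabs y) <= x * x + y * y)%R).
{ pose proof (Rsqr_abs x) as Qx. pose proof (Rsqr_abs y) as Qy. unfold Rsqr in Qx, Qy. rewrite Qx, Qy.
  pose proof (Rle_0_sqr (Rabs x - Rabs y)) as Q. unfold Rsqr in Q. lra. }
rewrite ?Rminus_0_r.
lra.
Qed.

(** * Continuity and differentiability of complex functions *)

Definition Ccont (f : C -> C) (w : C) : Prop :=
  forall eps : R, (0 < eps)%R -> exists d : R, (0 < d)%R /\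
    forall w' : C, (Cmod (w' - w) < d -> Cmod (f w' - f w) < eps)%R.

Lemma Ccont_const (c w : C) : Ccont (fun _ => c) w.
Proof. intros e He. exists 1%R; split; [lra|]. intros. replace (c - c) with (RtoC 0) by ring. now rewrite Cmod_0. Qed.

Lemma Ccont_id (w : C) : Ccont (fun u => u) w.
Proof. intros e He. exists e; split; auto. Qed.

Lemma Ccont_ext_loc (f g : C -> C) (w : C) (d : R) :
  (0 < d)%R -> (forall u, (Cmod (u - w) < d)%R -> f u = g u) -> Ccont f w -> Ccont g w.
Proof.
intros Hd E H e He. destruct (H e He) as [d1 [Hd1 H1]].
exists (Rmin d d1); split; [apply Rmin_pos; auto|]. intros u Hu.
pose proof (Rmin_l d d1). pose proof (Rmin_r d d1).
rewrite <- !E; [apply H1; lra| |lra]. replace (w - w) with (RtoC 0) by ring. rewrite Cmod_0. lra.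
Qed.

Lemma Ccont_plus f g w : Ccont f w -> Ccont g w -> Ccont (fun u => f u + g u) w.
Proof.
intros Hf Hg e He.
destruct (Hf (e / 2)%R ltac:(lra)) as [d1 [Hd1 H1]]. destruct (Hg (e / 2)%R ltac:(lra)) as [d2 [Hd2 H2]].
exists (Rmin d1 d2); split; [apply Rmin_pos; auto|]. intros u Hu.
pose proof (Rmin_l d1 d2). pose proof (Rmin_r d1 d2).
replace (f u + g u - (f w + g w)) with ((f u - f w) + (g u - g w)) by ring.
eapply Rle_lt_trans; [apply Cmod_triangle|].
specialize (H1 u ltac:(lra)). specialize (H2 u ltac:(lra)). lra.
Qed.

Lemma Ccont_bound f w : Ccont f w -> exists d B : R, (0 < d)%R /\ (0 < B)%R /\
  forall u, (Cmod (u - w) < d -> Cmod (f u) <= B)%R.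
Proof.
intros H. destruct (H 1%R ltac:(lra)) as [d [Hd H1]].
exists d, (Cmod (f w) + 1)%R. pose proof (Cmod_ge_0 (f w)). repeat split; try lra.
intros u Hu. specialize (H1 u Hu). pose proof (Cmod_tri_rev (f u) (f w)). lra.
Qed.

Lemma Ccont_mult f g w : Ccont f w -> Ccont g w -> Ccont (fun u => f u * g u) w.
Proof.
intros Hf Hg e He.
destruct (Ccont_bound g w Hg) as [d0 [B [Hd0 [HB HBd]]]].
set (A := (Cmod (f w) + 1)%R). assert (HA : (0 < A)%R) by (unfold A; pose proof (Cmod_ge_0 (f w)); lra).
destruct (Hf (e / 2 / B)%R) as [d1 [Hd1 H1]]. { apply Rdiv_lt_0_compat; lra. }
destruct (Hg (e / 2 / A)%R) as [d2 [Hd2 H2]]. { apply Rdiv_lt_0_compat; lra. }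
exists (Rmin d0 (Rmin d1 d2)); split; [repeat apply Rmin_pos; auto|]. intros u Hu.
pose proof (Rmin_l d0 (Rmin d1 d2)). pose proof (Rmin_r d0 (Rmin d1 d2)). pose proof (Rmin_l d1 d2). pose proof (Rmin_r d1 d2).
replace (f u * g u - f w * g w) with ((f u - f w) * g u + f w * (g u - g w)) by ring.
eapply Rle_lt_trans; [apply Cmod_triangle|]. rewrite !Cmod_mult.
specialize (H1 u ltac:(lra)). specialize (H2 u ltac:(lra)). specialize (HBd u ltac:(lra)).
assert (G1 : (Cmod (f u - f w) * Cmod (g u) <= e / 2 / B * B)%R) by (apply Rmult_le_compat; try apply Cmod_ge_0; lra).
replace (e / 2 / B * B)%R with (e / 2)%R in G1 by (field; lra).
assert (G2 : (Cmod (f w) * Cmod (g u - g w) <= Cmod (f w) * (e / 2 / A))%R) by (apply Rmult_le_compat_l; [apply Cmod_ge_0|lra]).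
assert (G3 : (Cmod (f w) * (e / 2 / A) < A * (e / 2 / A))%R).
{ apply Rmult_lt_compat_r; [apply Rdiv_lt_0_compat; lra|unfold A; lra]. }
replace (A * (e / 2 / A))%R with (e / 2)%R in G3 by (field; lra). lra.
Qed.

Lemma Ccont_neq_0 f w : Ccont f w -> f w <> 0 -> exists d : R, (0 < d)%R /\
  forall u, (Cmod (u - w) < d -> Cmod (f w) / 2 <= Cmod (f u))%R.
Proof.
intros H Hn. apply Cmod_gt_0 in Hn.
destruct (H (Cmod (f w) / 2)%R ltac:(lra)) as [d [Hd H1]]. exists d; split; auto.
intros u Hu. specialize (H1 u Hu). pose proof (Cmod_tri_rev (f w) (f u)). rewrite Cmod_minus_sym in H0. lra.
Qed.

Lemma Ccont_inv f w : Ccont f w -> f w <> 0 -> Ccont (fun u => / f u) w.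
Proof.
intros Hf Hn e He. destruct (Ccont_neq_0 f w Hf Hn) as [d0 [Hd0 H0]].
pose proof (proj1 (Cmod_gt_0 _) Hn) as Hm. set (m := Cmod (f w)) in *.
destruct (Hf (e * (m * m / 2))%R) as [d1 [Hd1 H1]]. { apply Rmult_lt_0_compat; nra. }
exists (Rmin d0 d1); split; [apply Rmin_pos; auto|]. intros u Hu.
pose proof (Rmin_l d0 d1). pose proof (Rmin_r d0 d1).
specialize (H0 u ltac:(lra)). specialize (H1 u ltac:(lra)).
assert (Hu0 : f u <> 0) by (apply Cmod_gt_0; lra).
replace (/ f u - / f w) with (- (f u - f w) / (f u * f w)) by (field; auto).
rewrite Cmod_div by (apply Cmult_neq_0; auto). rewrite Cmod_opp, Cmod_mult. fold m.
apply Rmult_lt_reg_r with (Cmod (f u) * m)%R; [apply Rmult_lt_0_compat; lra|].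
unfold Rdiv. rewrite Rmult_assoc, Rinv_l, Rmult_1_r by (apply Rgt_not_eq; nra).
eapply Rlt_le_trans; [exact H1|]. apply Rmult_le_compat_l; nra.
Qed.

Lemma Ccont_comp f g w : Ccont f (g w) -> Ccont g w -> Ccont (fun u => f (g u)) w.
Proof.
intros Hf Hg e He. destruct (Hf e He) as [d [Hd H]]. destruct (Hg d Hd) as [d1 [Hd1 H1]].
exists d1; split; auto.
Qed.

(* Caratheodory's form of complex differentiability. *)
Definition Cder (f : C -> C) (w l : C) : Prop :=
  exists (g : C -> C) (d : R), (0 < d)%R /\ Ccont g w /\ g w = l /\
    forall u, (Cmod (u - w) < d)%R -> f u = f w + g u * (u - w).

Lemma Cder_cont f w l : Cder f w l -> Ccont f w.
Proof.
intros (g & d & Hd & Hg & _ & E).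
apply Ccont_ext_loc with (f := fun u => f w + g u * (u - w)) (d := d); auto.
- intros; symmetry; auto.
- apply Ccont_plus; [apply Ccont_const|]. apply Ccont_mult; auto. apply Ccont_plus; [apply Ccont_id|apply Ccont_const].
Qed.

Lemma Cder_ext f f0 w l : (forall u, f u = f0 u) -> Cder f w l -> Cder f0 w l.
Proof. intros E (g & d & Hd & Hg & Hl & H). exists g, d. repeat split; auto. intros u Hu. rewrite <- !E. auto. Qed.

Lemma Cder_const c w : Cder (fun _ => c) w 0.
Proof. exists (fun _ => 0), 1%R. repeat split; [lra|apply Ccont_const|intros; ring]. Qed.

Lemma Cder_id w : Cder (fun u => u) w 1.
Proof. exists (fun _ => 1), 1%R. repeat split; [lra|apply Ccont_const|intros; ring]. Qed.

Lemma Cder_plus f g w a b : Cder f w a -> Cder g w b -> Cder (fun u => f u + g u) w (a + b).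
Proof.
intros (p & d & Hd & Hp & Hl & H) (q & d' & Hd' & Hq & Hl' & H').
exists (fun u => p u + q u), (Rmin d d'). repeat split.
- apply Rmin_pos; auto.
- now apply Ccont_plus.
- congruence.
- intros u Hu. pose proof (Rmin_l d d'). pose proof (Rmin_r d d'). rewrite (H u), (H' u) by lra. ring.
Qed.

Lemma Cder_mult f g w a b : Cder f w a -> Cder g w b -> Cder (fun u => f u * g u) w (a * g w + f w * b).
Proof.
intros Hf Hg. pose proof (Cder_cont _ _ _ Hg) as Cg.
destruct Hf as (p & d & Hd & Hp & Hl & H). destruct Hg as (q & d' & Hd' & Hq & Hl' & H').
exists (fun u => p u * g u + f w * q u), (Rmin d d'). repeat split.
- apply Rmin_pos; auto.
- apply Ccont_plus; apply Ccont_mult; auto. apply Ccont_const.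
- congruence.
- intros u Hu. pose proof (Rmin_l d d'). pose proof (Rmin_r d d').
  rewrite (H u) by lra. rewrite (H' u) by lra. ring.
Qed.

Lemma Cder_inv f w a : Cder f w a -> f w <> 0 -> Cder (fun u => / f u) w (- a / (f w * f w)).
Proof.
intros Hf Hn. pose proof (Cder_cont _ _ _ Hf) as Cf.
destruct (Ccont_neq_0 _ _ Cf Hn) as [d0 [Hd0 H0]].
destruct Hf as (p & d & Hd & Hp & Hl & H).
exists (fun u => - p u * / (f u * f w)), (Rmin d d0). repeat split.
- apply Rmin_pos; auto.
- apply Ccont_mult.
  + apply Ccont_ext_loc with (f := fun u => (- (1)) * p u) (d := 1%R); [lra|intros; ring|].
    apply Ccont_mult; [apply Ccont_const|auto].
  + apply Ccont_inv; [|apply Cmult_neq_0; auto]. apply Ccont_mult; [auto|apply Ccont_const].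
- unfold Cdiv. congruence.
- intros u Hu. pose proof (Rmin_l d d0). pose proof (Rmin_r d d0).
  pose proof (proj1 (Cmod_gt_0 _) Hn). specialize (H0 u ltac:(lra)).
  assert (Hu0 : f u <> 0) by (apply Cmod_gt_0; lra).
  specialize (H u ltac:(lra)).
  assert (E : p u * (u - w) = f u - f w) by (rewrite H; ring).
  transitivity (/ f w - (p u * (u - w)) / (f u * f w)).
  + rewrite E. field; auto.
  + field; auto.
Qed.

Lemma Cder_comp f g w a b : Cder f (g w) a -> Cder g w b -> Cder (fun u => f (g u)) w (a * b).
Proof.
intros Hf Hg. pose proof (Cder_cont _ _ _ Hg) as Cg.
destruct Hf as (p & d & Hd & Hp & Hl & H). destruct Hg as (q & d' & Hd' & Hq & Hl' & H').
destruct (Cg d Hd) as [d1 [Hd1 H1]].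
exists (fun u => p (g u) * q u), (Rmin d1 d'). repeat split.
- apply Rmin_pos; auto.
- apply Ccont_mult; auto. now apply Ccont_comp.
- congruence.
- intros u Hu. pose proof (Rmin_l d1 d'). pose proof (Rmin_r d1 d').
  rewrite (H (g u)) by (apply H1; lra). f_equal. rewrite <- Cmult_assoc. f_equal.
  rewrite (H' u) by lra. ring.
Qed.

Lemma Cexp_sub1_bound (h : C) : (Cmod h <= / 2 -> Cmod (Cexp h - 1) <= 3 * Cmod h)%R.
Proof.
intros H. pose proof (Cexp_small h H). pose proof (Cmod_ge_0 h).
replace (Cexp h - 1) with ((Cexp h - 1 - h) + h) by ring.
eapply Rle_trans; [apply Cmod_triangle|]. nra.
Qed.

Lemma Cder_exp w : Cder Cexp w (Cexp w).
Proof.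
exists (fun u => if Ceq_dec u w then Cexp w else Cexp w * ((Cexp (u - w) - 1) / (u - w))), 1%R.
repeat split; [lra| | |].
- intros e He.
  set (m := Cmod (Cexp w)). assert (Hm : (0 < m)%R) by (apply Cmod_gt_0, Cexp_neq_0).
  exists (Rmin (/ 2) (e / (8 * m)))%R. split; [apply Rmin_pos; [lra|apply Rdiv_lt_0_compat; lra]|].
  intros u Hu. pose proof (Rmin_l (/ 2) (e / (8 * m))). pose proof (Rmin_r (/ 2) (e / (8 * m))).
  destruct (Ceq_dec w w) as [_|F]; [|now elim F].
  destruct (Ceq_dec u w) as [->|F].
  + replace (Cexp w - Cexp w) with (RtoC 0) by ring. now rewrite Cmod_0.
  + assert (Hh : u - w <> 0) by now apply Cminus_eq_contra.
    replace (Cexp w * ((Cexp (u - w) - 1) / (u - w)) - Cexp w)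
      with (Cexp w * ((Cexp (u - w) - 1 - (u - w)) / (u - w))) by (field; auto).
    rewrite Cmod_mult, Cmod_div by auto. fold m.
    pose proof (Cexp_small (u - w) ltac:(lra)) as Hs.
    pose proof (proj1 (Cmod_gt_0 _) Hh) as Hp. set (r := Cmod (u - w)) in *.
    apply Rle_lt_trans with (m * (4 * r))%R.
    * apply Rmult_le_compat_l; [lra|]. apply Rmult_le_reg_r with r; auto.
      unfold Rdiv. rewrite Rmult_assoc, Rinv_l by lra. lra.
    * assert (m * (4 * r) < m * (4 * (e / (8 * m))) )%R by (apply Rmult_lt_compat_l; lra).
      replace (m * (4 * (e / (8 * m))))%R with (e / 2)%R in H1 by (field; lra). lra.
- destruct (Ceq_dec w w) as [_|F]; [auto|now elim F].
- intros u _. destruct (Ceq_dec u w) as [->|F]; [ring|].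
  assert (Hh : u - w <> 0) by now apply Cminus_eq_contra.
  replace (Cexp u) with (Cexp w * Cexp (u - w)) by (rewrite <- Cexp_plus; f_equal; ring).
  field; auto.
Qed.

(** A continuous derivative is demanded because Cauchy's theorem is derived below by differentiating
    under the integral sign. The set D may be arbitrary: differentiability at a point of D refers to
    a full neighbourhood in the plane. *)
Definition HoloOn (D : C -> Prop) (f : C -> C) : Prop :=
  exists f' : C -> C, forall w, D w -> Cder f w (f' w) /\ Ccont f' w.

Lemma HoloOn_cont D f w : HoloOn D f -> D w -> Ccont f w.
Proof. intros [f' H] Hw. destruct (H w Hw) as [H1 _]. eapply Cder_cont, H1. Qed.

Lemma HoloOn_sub (D E : C -> Prop) f : (forall w, E w -> D w) -> HoloOn D f -> HoloOn E f.
Proof. intros S [f' H]. exists f'. intros w Hw. apply H, S, Hw. Qed.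

Lemma HoloOn_ext D f g : (forall w, f w = g w) -> HoloOn D f -> HoloOn D g.
Proof. intros E [f' H]. exists f'. intros w Hw. destruct (H w Hw). split; auto. now apply Cder_ext with f. Qed.

Lemma HoloOn_const D c : HoloOn D (fun _ => c).
Proof. exists (fun _ => 0). intros. split; [apply Cder_const|apply Ccont_const]. Qed.

Lemma HoloOn_id D : HoloOn D (fun u => u).
Proof. exists (fun _ => 1). intros. split; [apply Cder_id|apply Ccont_const]. Qed.

Lemma HoloOn_plus D f g : HoloOn D f -> HoloOn D g -> HoloOn D (fun u => f u + g u).
Proof.
intros [f' Hf] [g' Hg]. exists (fun u => f' u + g' u). intros w Hw.
destruct (Hf w Hw), (Hg w Hw). split; [now apply Cder_plus|now apply Ccont_plus].
Qed.

Lemma HoloOn_mult D f g : HoloOn D f -> HoloOn D g -> HoloOn D (fun u => f u * g u).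
Proof.
intros [f' Hf] [g' Hg]. exists (fun u => f' u * g u + f u * g' u). intros w Hw.
destruct (Hf w Hw) as [A B], (Hg w Hw) as [A' B']. split; [now apply Cder_mult|].
apply Ccont_plus; apply Ccont_mult; auto; eapply Cder_cont; eauto.
Qed.

Lemma HoloOn_opp D f : HoloOn D f -> HoloOn D (fun u => - f u).
Proof.
intros H. apply HoloOn_ext with (fun u => - (1) * f u); [intros; ring|].
apply HoloOn_mult; auto. apply HoloOn_const.
Qed.

Lemma HoloOn_inv (D : C -> Prop) f : HoloOn D f -> (forall w, D w -> f w <> 0) -> HoloOn D (fun u => / f u).
Proof.
intros [f' Hf] Hn. exists (fun u => - f' u / (f u * f u)). intros w Hw.
destruct (Hf w Hw) as [A B]. pose proof (Hn w Hw) as N. pose proof (Cder_cont _ _ _ A). split; [now apply Cder_inv|].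
unfold Cdiv. apply Ccont_mult.
- apply Ccont_ext_loc with (f := fun u => (- (1)) * f' u) (d := 1%R); [lra|intros; ring|].
  apply Ccont_mult; [apply Ccont_const|auto].
- apply Ccont_inv; [now apply Ccont_mult|now apply Cmult_neq_0].
Qed.

Lemma HoloOn_comp (D E : C -> Prop) f g :
  HoloOn E f -> HoloOn D g -> (forall w, D w -> E (g w)) -> HoloOn D (fun u => f (g u)).
Proof.
intros [f' Hf] [g' Hg] S. exists (fun u => f' (g u) * g' u). intros w Hw.
destruct (Hg w Hw) as [A B]. destruct (Hf _ (S w Hw)) as [A' B']. pose proof (Cder_cont _ _ _ A).
split; [now apply Cder_comp|]. apply Ccont_mult; auto. now apply Ccont_comp.
Qed.

Lemma HoloOn_exp D : HoloOn D Cexp.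
Proof. exists Cexp. intros w _. split; [apply Cder_exp|]. eapply Cder_cont, Cder_exp. Qed.

Lemma HoloOn_exp_comp D g : HoloOn D g -> HoloOn D (fun u => Cexp (g u)).
Proof. intros H. apply HoloOn_comp with (E := fun _ => True); auto. apply HoloOn_exp. Qed.

Lemma HoloOn_sinh D : HoloOn D Csinh.
Proof.
unfold Csinh. apply HoloOn_ext with (fun u => (Cexp u + - Cexp (- u)) * / 2).
{ intros; reflexivity. }
apply HoloOn_mult; [|apply HoloOn_const].
apply HoloOn_plus; [apply HoloOn_exp|]. apply HoloOn_opp, HoloOn_exp_comp, HoloOn_opp, HoloOn_id.
Qed.

(* Simple pole of residue rho, in a form stable under addition of regular terms:
   rho = 0 covers regular points. *)
Definition PoleAt (f : C -> C) (p rho : C) : Prop :=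
  exists eta B : R, (0 < eta)%R /\ (0 < B)%R /\
    forall w, (0 < Cmod (w - p) < eta)%R -> (Cmod (f w - rho / (w - p)) <= B)%R.

Lemma PoleAt_ext f g p rho rho' : (forall w, f w = g w) -> rho = rho' -> PoleAt f p rho -> PoleAt g p rho'.
Proof.
intros E <- (e & B & He & HB & H). exists e, B. repeat split; auto. intros w Hw. rewrite <- E. auto.
Qed.

Lemma PoleAt_cont f p : Ccont f p -> PoleAt f p 0.
Proof.
intros H. destruct (Ccont_bound f p H) as (d & B & Hd & HB & HH).
exists d, B. repeat split; auto. intros w [_ Hw].
replace (f w - 0 / (w - p)) with (f w) by (unfold Cdiv; ring). auto.
Qed.

Lemma PoleAt_plus f g p r s : PoleAt f p r -> PoleAt g p s -> PoleAt (fun w => f w + g w) p (r + s).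
Proof.
intros (e & B & He & HB & H) (e' & B' & He' & HB' & H').
exists (Rmin e e'), (B + B')%R. repeat split; [apply Rmin_pos; auto|lra|].
intros w [Hw1 Hw2]. pose proof (Rmin_l e e'). pose proof (Rmin_r e e').
replace (f w + g w - (r + s) / (w - p)) with ((f w - r / (w - p)) + (g w - s / (w - p))) by (unfold Cdiv; ring).
eapply Rle_trans; [apply Cmod_triangle|].
specialize (H w ltac:(lra)). specialize (H' w ltac:(lra)). lra.
Qed.

(** Splitting f g - r g(p)/(w - p) as (f - r/(w - p)) g + r q, with q the slope of g at p, leaves
    two bounded terms. This is why g has to be differentiable at p and not only continuous. *)
Lemma PoleAt_mult_reg f g p r l : PoleAt f p r -> Cder g p l -> PoleAt (fun w => f w * g w) p (r * g p).
Proof.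
intros (e & B & He & HB & H) Hg. pose proof (Cder_cont _ _ _ Hg) as Cg.
destruct (Ccont_bound _ _ Cg) as (d1 & B1 & Hd1 & HB1 & H1).
destruct Hg as (q & d2 & Hd2 & Hq & _ & E).
destruct (Ccont_bound _ _ Hq) as (d3 & B3 & Hd3 & HB3 & H3).
exists (Rmin (Rmin e d1) (Rmin d2 d3)), (B * B1 + Cmod r * B3 + 1)%R.
pose proof (Cmod_ge_0 r). repeat split; [repeat apply Rmin_pos; auto|nra|].
intros w [Hw1 Hw2].
pose proof (Rmin_l (Rmin e d1) (Rmin d2 d3)). pose proof (Rmin_r (Rmin e d1) (Rmin d2 d3)).
pose proof (Rmin_l e d1). pose proof (Rmin_r e d1). pose proof (Rmin_l d2 d3). pose proof (Rmin_r d2 d3).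
assert (Hn : w - p <> 0) by (apply Cmod_gt_0; lra).
replace (f w * g w - r * g p / (w - p)) with ((f w - r / (w - p)) * g w + r * q w).
- eapply Rle_trans; [apply Cmod_triangle|]. rewrite !Cmod_mult.
  specialize (H w ltac:(lra)). specialize (H1 w ltac:(lra)). specialize (H3 w ltac:(lra)).
  assert (Cmod (f w - r / (w - p)) * Cmod (g w) <= B * B1)%R by (apply Rmult_le_compat; auto; apply Cmod_ge_0).
  assert (Cmod r * Cmod (q w) <= Cmod r * B3)%R by (apply Rmult_le_compat_l; auto).
  lra.
- rewrite (E w) at 1 by lra.
  assert (E' : g w = g p + q w * (w - p)) by (apply E; lra).
  transitivity (f w * g w - r * (g w - q w * (w - p)) / (w - p)).
  + rewrite <- E'. field; auto.
  + rewrite E' at 2. field; auto.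
Qed.

Lemma PoleAt_comp_affine (f : C -> C) (p r a b : C) :
  a <> 0 -> PoleAt f (a * p + b) r -> PoleAt (fun w => f (a * w + b)) p (r / a).
Proof.
intros Ha (e & B & He & HB & H). pose proof (proj1 (Cmod_gt_0 _) Ha) as Hm.
exists (e / Cmod a)%R, B. repeat split; auto; [now apply Rdiv_lt_0_compat|].
intros w [Hw1 Hw2]. assert (Hn : w - p <> 0) by now apply Cmod_gt_0.
replace (r / a / (w - p)) with (r / (a * w + b - (a * p + b))).
- apply H. replace (a * w + b - (a * p + b)) with (a * (w - p)) by ring. rewrite Cmod_mult. split; [nra|].
  apply Rmult_lt_compat_l with (r := Cmod a) in Hw2; auto. replace (Cmod a * (e / Cmod a))%R with e in Hw2 by (field; lra). auto.
- replace (a * w + b - (a * p + b)) with (a * (w - p)) by ring. field; auto.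
Qed.

Lemma PoleAt_inv_sinh_0 : PoleAt (fun u => / Csinh u) 0 1.
Proof.
exists (/ 8)%R, 16%R. repeat split; [lra|lra|]. intros w [H1 H2].
replace (w - 0) with w in * by ring. set (r := Cmod w) in *.
(* The second-order remainders of exp at w and -w bound sinh w - w; hence |sinh w| >= |w|/2 near 0,
   and 1/sinh w - 1/w stays bounded. *)
assert (S : (Cmod (Csinh w - w) <= 4 * (r * r))%R).
{ unfold Csinh. pose proof (Cexp_small w ltac:(fold r; lra)) as A.
  pose proof (Cexp_small (- w)) as A'. rewrite Cmod_opp in A'. specialize (A' ltac:(fold r; lra)). fold r in A, A'.
  replace ((Cexp w - Cexp (- w)) / 2 - w) with (/ 2 * ((Cexp w - 1 - w) - (Cexp (- w) - 1 - - w))) by (field; apply C2_neq_0).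
  rewrite Cmod_mult. rewrite <- RtoC_inv by lra. rewrite Cmod_R, Rabs_right by lra.
  pose proof (Cmod_tri' (Cexp w - 1 - w) (Cexp (- w) - 1 - - w)). lra. }
assert (S2 : (r / 2 <= Cmod (Csinh w))%R).
{ pose proof (Cmod_tri_rev w (w - Csinh w)) as T. replace (w - (w - Csinh w)) with (Csinh w) in T by ring.
  rewrite (Cmod_minus_sym w) in T. fold r in T. nra. }
assert (Hw : w <> 0) by (apply Cmod_gt_0; fold r; lra).
assert (Hs : Csinh w <> 0) by (apply Cmod_gt_0; lra).
replace (/ Csinh w - 1 / w) with (- (Csinh w - w) / (Csinh w * w)) by (field; auto).
rewrite Cmod_div by (apply Cmult_neq_0; auto). rewrite Cmod_opp, Cmod_mult. fold r.
apply Rmult_le_reg_r with (Cmod (Csinh w) * r)%R; [nra|].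
unfold Rdiv. rewrite Rmult_assoc, Rinv_l, Rmult_1_r by (apply Rgt_not_eq; nra). nra.
Qed.

(** * Finite sums, limits and two-sided series *)

Fixpoint Csum (f : nat -> C) (n : nat) : C :=
  match n with O => 0 | S m => Csum f m + f m end.

Lemma Csum_ext (f g : nat -> C) (n : nat) :
  (forall i, (i < n)%nat -> f i = g i) -> Csum f n = Csum g n.
Proof.
induction n as [|n IH]; intros H; simpl; auto.
rewrite IH by (intros; apply H; lia). now rewrite H by lia.
Qed.

Lemma Csum_plus (f g : nat -> C) (n : nat) : Csum (fun i => f i + g i) n = Csum f n + Csum g n.
Proof. induction n as [|n IH]; simpl; [ring|rewrite IH; ring]. Qed.

Lemma Csum_scal (c : C) (f : nat -> C) (n : nat) : Csum (fun i => c * f i) n = c * Csum f n.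
Proof. induction n as [|n IH]; simpl; [ring|rewrite IH; ring]. Qed.

Lemma Csum_zero (f : nat -> C) (n : nat) : (forall i, (i < n)%nat -> f i = 0) -> Csum f n = 0.
Proof.
induction n as [|n IH]; intros H; simpl; auto. rewrite IH by (intros; apply H; lia).
rewrite H by lia. ring.
Qed.

Lemma Csum_add (f : nat -> C) (n m : nat) : Csum f (n + m) = Csum f n + Csum (fun i => f (n + i)%nat) m.
Proof.
induction m as [|m IH]; simpl; [rewrite Nat.add_0_r; ring|].
rewrite Nat.add_succ_r. simpl. rewrite IH. ring.
Qed.

Lemma Csum_S_l (f : nat -> C) (n : nat) : Csum f (S n) = f O + Csum (fun i => f (S i)) n.
Proof. replace (S n) with (1 + n)%nat by lia. rewrite Csum_add. simpl. ring. Qed.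

Lemma Csum_swap (f : nat -> nat -> C) (n m : nat) :
  Csum (fun i => Csum (f i) m) n = Csum (fun j => Csum (fun i => f i j) n) m.
Proof.
induction n as [|n IH]; simpl.
- symmetry. apply Csum_zero. auto.
- rewrite IH. rewrite <- Csum_plus. reflexivity.
Qed.

Lemma Csum_rev (f : nat -> C) (n : nat) : Csum f n = Csum (fun i => f (n - 1 - i)%nat) n.
Proof.
induction n as [|n IH]; auto. rewrite Csum_S_l with (f := fun i => f (S n - 1 - i)%nat).
simpl Csum at 1. rewrite IH, Cplus_comm. f_equal; [f_equal; lia|].
apply Csum_ext. intros. f_equal. lia.
Qed.

Lemma Cmod_Csum (f : nat -> C) (n : nat) (B : R) :
  (forall i, (i < n)%nat -> (Cmod (f i) <= B)%R) -> (Cmod (Csum f n) <= INR n * B)%R.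
Proof.
induction n as [|n IH]; intros H.
- simpl. rewrite Cmod_0. lra.
- rewrite S_INR. cbn [Csum]. eapply Rle_trans; [apply Cmod_triangle|].
  specialize (IH ltac:(intros; apply H; lia)). pose proof (H n ltac:(lia)). lra.
Qed.

Lemma sum_n_Csum (f : nat -> C) (n : nat) : sum_n f n = Csum f (S n).
Proof.
induction n as [|n IH]; [rewrite sum_O; simpl; ring|].
rewrite sum_Sn, IH. reflexivity.
Qed.

Lemma Csum_periodic (f : Z -> C) (k : nat) (s : Z) :
  (forall n, f (n + Z.of_nat k)%Z = f n) ->
  Csum (fun i => f (Z.of_nat i + s)%Z) k = Csum (fun i => f (Z.of_nat i)) k.
Proof.
intros P.
assert (S1 : forall s, Csum (fun i => f (Z.of_nat i + (s + 1))%Z) k = Csum (fun i => f (Z.of_nat i + s)%Z) k).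
{ intros t. assert (E : Csum (fun i => f (Z.of_nat i + t)%Z) (S k) = Csum (fun i => f (Z.of_nat i + t)%Z) k + f t).
  { simpl. f_equal. replace (Z.of_nat k + t)%Z with (t + Z.of_nat k)%Z by lia. apply P. }
  rewrite Csum_S_l in E. replace (Z.of_nat 0 + t)%Z with t in E by lia.
  replace (Csum (fun i => f (Z.of_nat (S i) + t)%Z) k)
    with (Csum (fun i => f (Z.of_nat i + (t + 1))%Z) k) in E by (apply Csum_ext; intros; f_equal; lia).
  assert (X : forall u v w : C, w + u = v + w -> u = v).
  { intros u v w H. replace u with (w + u - w) by ring. rewrite H. ring. }
  exact (X _ _ _ E). }
assert (S2 : forall n : nat, Csum (fun i => f (Z.of_nat i + Z.of_nat n)%Z) k = Csum (fun i => f (Z.of_nat i)) k /\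
   Csum (fun i => f (Z.of_nat i - Z.of_nat n)%Z) k = Csum (fun i => f (Z.of_nat i)) k).
{ induction n as [|n [IH1 IH2]].
  - split; apply Csum_ext; intros; f_equal; lia.
  - split.
    + rewrite <- IH1, <- (S1 (Z.of_nat n)). apply Csum_ext; intros; f_equal; lia.
    + rewrite <- IH2. replace (Csum (fun i => f (Z.of_nat i - Z.of_nat n)%Z) k)
        with (Csum (fun i => f (Z.of_nat i + (- Z.of_nat (S n) + 1))%Z) k) by (apply Csum_ext; intros; f_equal; lia).
      rewrite S1. apply Csum_ext; intros; f_equal; lia. }
destruct (Z_le_gt_dec 0 s).
- rewrite <- (proj1 (S2 (Z.to_nat s))). apply Csum_ext; intros; f_equal; lia.
- rewrite <- (proj2 (S2 (Z.to_nat (- s)))). apply Csum_ext; intros; f_equal; lia.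
Qed.

(** At each pole of the sum over mu modulo k a single class contributes for each family of poles;
    this collects its residue. *)
Lemma Csum_indicator (k : nat) (m : Z) (c : C) : (0 < k)%nat ->
  Csum (fun i => if Z.eq_dec ((Z.of_nat i - m) mod Z.of_nat k) 0 then c else 0) k = c.
Proof.
intros Hk.
rewrite <- (Csum_periodic (fun n => if Z.eq_dec ((n - m) mod Z.of_nat k) 0 then c else 0) k m).
- destruct k as [|k]; [lia|]. rewrite Csum_S_l.
  replace (Z.of_nat 0 + m - m)%Z with 0%Z by lia. rewrite Zmod_0_l. destruct (Z.eq_dec 0 0); [|lia].
  rewrite Csum_zero; [ring|]. intros i Hi. replace (Z.of_nat (S i) + m - m)%Z with (Z.of_nat (S i)) by lia.
  rewrite Z.mod_small by lia. destruct (Z.eq_dec (Z.of_nat (S i)) 0); [lia|auto].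
- intros n. replace (n + Z.of_nat k - m)%Z with (n - m + 1 * Z.of_nat k)%Z by lia. now rewrite Z_mod_plus_full.
Qed.

(** * Limits of complex sequences *)

Definition Clim (u : nat -> C) (l : C) : Prop :=
  forall eps : R, (0 < eps)%R -> exists N : nat, forall n, (N <= n)%nat -> (Cmod (u n - l) < eps)%R.

Lemma Clim_filterlim (u : nat -> C) (l : C) : Clim u l -> filterlim u eventually (locally l).
Proof.
intros H P [e He]. destruct (H e (cond_pos e)) as [N HN]. exists N. intros n Hn. apply He.
apply C_NormedModule_mixin_compat1. apply (HN n Hn).
Qed.

Lemma filterlim_Clim (u : nat -> C) (l : C) : filterlim u eventually (locally l) -> Clim u l.
Proof.
intros H e He.
(* The uniform ball of radius e/2 is only contained in a disc of radius sqrt 2 times e/2, hence the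
   halved radius. *)
assert (He' : (0 < e / 2)%R) by lra.
destruct (H (ball l (mkposreal _ He'))) as [N HN]; [apply locally_ball|].
exists N. intros n Hn. pose proof (C_NormedModule_mixin_compat2 _ _ _ (HN n Hn)) as B. simpl in B.
eapply Rlt_trans; [apply B|]. pose proof sqrt_lt_R0 2. 
assert (sqrt 2 < 2)%R. { rewrite <- (sqrt_square 2) at 2 by lra. apply sqrt_lt_1; lra. } nra.
Qed.

Lemma Clim_Clim_seq (u : nat -> C) (l : C) : Clim u l -> Clim_seq u = l.
Proof. intros H. apply Clim_seq_unique. now apply Clim_filterlim. Qed.

Lemma Clim_unique (u : nat -> C) (l m : C) : Clim u l -> Clim u m -> l = m.
Proof. intros H K. rewrite <- (Clim_Clim_seq _ _ H). now apply Clim_Clim_seq. Qed.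

Lemma Clim_ext (u v : nat -> C) (l : C) : (forall n, u n = v n) -> Clim u l -> Clim v l.
Proof. intros E H e He. destruct (H e He) as [N HN]. exists N. intros. rewrite <- E. auto. Qed.

Lemma Clim_const (c : C) : Clim (fun _ => c) c.
Proof. intros e He. exists O. intros. replace (c - c) with (RtoC 0) by ring. now rewrite Cmod_0. Qed.

Lemma Clim_plus (u v : nat -> C) (l m : C) : Clim u l -> Clim v m -> Clim (fun n => u n + v n) (l + m).
Proof.
intros H K e He. destruct (H (e / 2)%R ltac:(lra)) as [N HN]. destruct (K (e / 2)%R ltac:(lra)) as [M HM].
exists (Nat.max N M). intros n Hn. specialize (HN n ltac:(lia)). specialize (HM n ltac:(lia)).
replace (u n + v n - (l + m)) with ((u n - l) + (v n - m)) by ring.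
eapply Rle_lt_trans; [apply Cmod_triangle|]. lra.
Qed.

Lemma Clim_scal (c : C) (u : nat -> C) (l : C) : Clim u l -> Clim (fun n => c * u n) (c * l).
Proof.
intros H e He. pose proof (Cmod_ge_0 c).
destruct (H (e / (Cmod c + 1))%R) as [N HN]; [apply Rdiv_lt_0_compat; lra|].
exists N. intros n Hn. specialize (HN n Hn).
replace (c * u n - c * l) with (c * (u n - l)) by ring. rewrite Cmod_mult.
apply Rle_lt_trans with ((Cmod c) * (e / (Cmod c + 1)))%R; [apply Rmult_le_compat_l; lra|].
apply Rlt_le_trans with ((Cmod c + 1) * (e / (Cmod c + 1)))%R.
- apply Rmult_lt_compat_r; [apply Rdiv_lt_0_compat; lra|lra].
- right. field. lra.
Qed.

Lemma Clim_minus (u v : nat -> C) (l m : C) : Clim u l -> Clim v m -> Clim (fun n => u n - v n) (l - m).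
Proof.
intros H K. apply Clim_ext with (fun n => u n + (- (1)) * v n); [intros; ring|].
replace (l - m) with (l + (- (1)) * m) by ring. apply Clim_plus; auto. now apply Clim_scal.
Qed.

Lemma Clim_bound_le (u : nat -> C) (l : C) (B : R) :
  Clim u l -> (exists N, forall n, (N <= n)%nat -> (Cmod (u n) <= B)%R) -> (Cmod l <= B)%R.
Proof.
intros H [N HN]. apply Rnot_lt_le. intros Hl.
destruct (H (Cmod l - B)%R ltac:(lra)) as [M HM].
specialize (HM (Nat.max N M) ltac:(lia)). specialize (HN (Nat.max N M) ltac:(lia)).
pose proof (Cmod_tri_rev l (u (Nat.max N M))). rewrite Cmod_minus_sym in H0. lra.
Qed.

Lemma Clim_subseq (u : nat -> C) (l : C) (phi : nat -> nat) :
  (forall n, (n <= phi n)%nat) -> Clim u l -> Clim (fun n => u (phi n)) l.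
Proof. intros P H e He. destruct (H e He) as [N HN]. exists N. intros n Hn. apply HN. specialize (P n). lia. Qed.

(** * Sums over the integers *)

Definition zs (u : Z -> C) (a : Z) (n : nat) : C := Csum (fun i => u (a + Z.of_nat i)%Z) n.

Lemma zs_ext (u v : Z -> C) (a : Z) (n : nat) :
  (forall i : Z, (a <= i < a + Z.of_nat n)%Z -> u i = v i) -> zs u a n = zs v a n.
Proof. intros H. apply Csum_ext. intros. apply H. lia. Qed.

Lemma zs_add (u : Z -> C) (a : Z) (n m : nat) : zs u a (n + m) = zs u a n + zs u (a + Z.of_nat n) m.
Proof. unfold zs. rewrite Csum_add. f_equal. apply Csum_ext. intros. f_equal. lia. Qed.

Lemma zs_S (u : Z -> C) (a : Z) (n : nat) : zs u a (S n) = zs u a n + u (a + Z.of_nat n)%Z.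
Proof. reflexivity. Qed.

Lemma zs_S_l (u : Z -> C) (a : Z) (n : nat) : zs u a (S n) = u a + zs u (a + 1) n.
Proof.
replace (S n) with (1 + n)%nat by lia. rewrite zs_add. unfold zs at 1. simpl.
rewrite Z.add_0_r. f_equal. ring.
Qed.

(** Both ends of the summation window move independently. Shifts and the reflection n -> -n then
    preserve sums, and every exhausting family of windows computes the same value. *)
Definition is_zsum (u : Z -> C) (l : C) : Prop :=
  forall eps : R, (0 < eps)%R -> exists N : nat, forall (a : Z) (n : nat),
    (a <= - Z.of_nat N)%Z -> (Z.of_nat N <= a + Z.of_nat n)%Z -> (Cmod (zs u a n - l) < eps)%R.

Lemma is_zsum_Clim (u : Z -> C) (l : C) (a : nat -> Z) (n : nat -> nat) :
  is_zsum u l -> (forall i, (a i <= - Z.of_nat i)%Z) -> (forall i, (Z.of_nat i <= a i + Z.of_nat (n i))%Z) ->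
  Clim (fun i => zs u (a i) (n i)) l.
Proof.
intros H Ha Hn e He. destruct (H e He) as [N HN]. exists N. intros i Hi.
specialize (Ha i). specialize (Hn i). apply HN; lia.
Qed.

Lemma is_zsum_unique (u : Z -> C) (l m : C) : is_zsum u l -> is_zsum u m -> l = m.
Proof.
intros H K.
apply (Clim_unique (fun i => zs u (- Z.of_nat i) (2 * i))); apply is_zsum_Clim; auto; intros; lia.
Qed.

Lemma is_zsum_ext (u v : Z -> C) (l : C) : (forall n, u n = v n) -> is_zsum u l -> is_zsum v l.
Proof.
intros E H e He. destruct (H e He) as [N HN]. exists N. intros a n Ha Hn.
rewrite <- (zs_ext u v) by auto. auto.
Qed.

Lemma is_zsum_scal (c : C) (u : Z -> C) (l : C) : is_zsum u l -> is_zsum (fun n => c * u n) (c * l).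
Proof.
intros H e He. pose proof (Cmod_ge_0 c).
destruct (H (e / (Cmod c + 1))%R) as [N HN]; [apply Rdiv_lt_0_compat; lra|].
exists N. intros a n Ha Hn. specialize (HN a n Ha Hn).
unfold zs in *. rewrite Csum_scal.
replace (c * Csum (fun i => u (a + Z.of_nat i)%Z) n - c * l) with (c * (Csum (fun i => u (a + Z.of_nat i)%Z) n - l)) by ring. rewrite Cmod_mult.
apply Rle_lt_trans with ((Cmod c) * (e / (Cmod c + 1)))%R; [apply Rmult_le_compat_l; lra|].
apply Rlt_le_trans with ((Cmod c + 1) * (e / (Cmod c + 1)))%R.
- apply Rmult_lt_compat_r; [apply Rdiv_lt_0_compat; lra|lra].
- right. field. lra.
Qed.

Lemma is_zsum_shift (s : Z) (u : Z -> C) (l : C) : is_zsum u l -> is_zsum (fun n => u (n + s)%Z) l.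
Proof.
intros H e He. destruct (H e He) as [N HN]. exists (N + Z.abs_nat s)%nat. intros a n Ha Hn.
replace (zs (fun n => u (n + s)%Z) a n) with (zs u (a + s) n).
- apply HN; lia.
- apply Csum_ext. intros. f_equal. lia.
Qed.

Lemma is_zsum_opp (u : Z -> C) (l : C) : is_zsum u l -> is_zsum (fun n => u (- n)%Z) l.
Proof.
intros H e He. destruct (H e He) as [N HN]. exists (S N). intros a n Ha Hn.
replace (zs (fun n => u (- n)%Z) a n) with (zs u (- (a + Z.of_nat n) + 1) n).
- apply HN; lia.
- unfold zs. rewrite Csum_rev. apply Csum_ext. intros. f_equal. lia.
Qed.

(** For a residue i the first t with 3t + i >= a is the ceiling of (a - i)/3, written as (a - i +
    2)/3. Enlarging the window by one index affects only the class of that index. *)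
Lemma zs_interleave (u : Z -> C) (a : Z) (n : nat) :
  zs u a n = Csum (fun i => zs (fun t => u (3 * t + Z.of_nat i)%Z) ((a - Z.of_nat i + 2) / 3)
     (Z.to_nat ((a + Z.of_nat n - Z.of_nat i + 2) / 3 - (a - Z.of_nat i + 2) / 3))) 3.
Proof.
induction n as [|n IH].
- unfold zs at 1. simpl. rewrite !Z.add_0_r, !Z.sub_diag. unfold zs. simpl. ring.
- rewrite zs_S, IH. set (b := (a + Z.of_nat n)%Z).
  replace (a + Z.of_nat (S n))%Z with (b + 1)%Z by (unfold b; lia).
  assert (Hb : (a <= b)%Z) by (unfold b; lia). clearbody b. clear IH.
  assert (Same : forall i : nat, ((b + 1 - Z.of_nat i + 2) / 3 = (b - Z.of_nat i + 2) / 3)%Z ->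
     forall v, zs v ((a - Z.of_nat i + 2) / 3) (Z.to_nat ((b + 1 - Z.of_nat i + 2) / 3 - (a - Z.of_nat i + 2) / 3))
     = zs v ((a - Z.of_nat i + 2) / 3) (Z.to_nat ((b - Z.of_nat i + 2) / 3 - (a - Z.of_nat i + 2) / 3))).
  { intros i E v. now rewrite E. }
  assert (Incr : forall i : nat, (b = 3 * ((b - Z.of_nat i + 2) / 3) + Z.of_nat i)%Z -> 
     zs (fun t => u (3 * t + Z.of_nat i)%Z) ((a - Z.of_nat i + 2) / 3) (Z.to_nat ((b + 1 - Z.of_nat i + 2) / 3 - (a - Z.of_nat i + 2) / 3))
     = zs (fun t => u (3 * t + Z.of_nat i)%Z) ((a - Z.of_nat i + 2) / 3) (Z.to_nat ((b - Z.of_nat i + 2) / 3 - (a - Z.of_nat i + 2) / 3)) + u b).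
  { intros i E. assert (Hq : ((b + 1 - Z.of_nat i + 2) / 3 = (b - Z.of_nat i + 2) / 3 + 1)%Z) by (Z.to_euclidean_division_equations; lia).
    assert (Hm : ((a - Z.of_nat i + 2) / 3 <= (b - Z.of_nat i + 2) / 3)%Z) by (apply Z.div_le_mono; lia).
    rewrite Hq. replace (Z.to_nat ((b - Z.of_nat i + 2) / 3 + 1 - (a - Z.of_nat i + 2) / 3))
      with (S (Z.to_nat ((b - Z.of_nat i + 2) / 3 - (a - Z.of_nat i + 2) / 3))) by lia.
    rewrite zs_S. f_equal. f_equal. rewrite Z2Nat.id by lia. lia. }
  cbn [Csum].
  assert (Hr : (b mod 3 = 0 \/ b mod 3 = 1 \/ b mod 3 = 2)%Z) by (pose proof (Z.mod_pos_bound b 3); lia).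
  destruct Hr as [Hr|[Hr|Hr]].
  + rewrite (Incr O), (Same 1%nat), (Same 2%nat) by (Z.to_euclidean_division_equations; lia). ring.
  + rewrite (Same O), (Incr 1%nat), (Same 2%nat) by (Z.to_euclidean_division_equations; lia). ring.
  + rewrite (Same O), (Same 1%nat), (Incr 2%nat) by (Z.to_euclidean_division_equations; lia). ring.
Qed.

Lemma is_zsum_interleave (u : Z -> C) (l0 l1 l2 : C) :
  is_zsum (fun t => u (3 * t)%Z) l0 -> is_zsum (fun t => u (3 * t + 1)%Z) l1 -> is_zsum (fun t => u (3 * t + 2)%Z) l2 ->
  is_zsum u (l0 + l1 + l2).
Proof.
intros H0 H1 H2 e He.
destruct (H0 (e / 3)%R ltac:(lra)) as [N0 K0]. destruct (H1 (e / 3)%R ltac:(lra)) as [N1 K1].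
destruct (H2 (e / 3)%R ltac:(lra)) as [N2 K2].
exists (3 * (N0 + N1 + N2 + 2))%nat. intros a n Ha Hn. rewrite zs_interleave. cbn [Csum].
set (z0 := zs _ _ _). set (z1 := zs _ _ _). set (z2 := zs _ _ _).
assert (E0 : (Cmod (z0 - l0) < e / 3)%R).
{ unfold z0. replace (zs (fun t => u (3 * t + Z.of_nat 0)%Z)) with (zs (fun t => u (3 * t + Z.of_nat 0)%Z)) by auto.
  rewrite (zs_ext _ (fun t => u (3 * t)%Z)) by (intros; f_equal; lia).
  apply K0; Z.to_euclidean_division_equations; lia. }
assert (E1 : (Cmod (z1 - l1) < e / 3)%R) by (apply K1; Z.to_euclidean_division_equations; lia).
assert (E2 : (Cmod (z2 - l2) < e / 3)%R) by (apply K2; Z.to_euclidean_division_equations; lia).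
replace (0 + z0 + z1 + z2 - (l0 + l1 + l2)) with ((z0 - l0) + ((z1 - l1) + (z2 - l2))) by ring.
eapply Rle_lt_trans; [apply Cmod_triangle|]. pose proof (Cmod_triangle (z1 - l1) (z2 - l2)). lra.
Qed.

Lemma CSeries_correct (u : nat -> C) (th K : R) : (0 <= th < 1)%R ->
  (forall n, (Cmod (u n) <= K * th ^ n)%R) -> Clim (Csum u) (CSeries u).
Proof.
intros Ht Hu.
assert (X : ex_series (V := C_NormedModule) u).
{ apply (@ex_series_le C_AbsRing C_CompleteNormedModule u (fun n => (K * th ^ n)%R)).
  - intros n. apply Hu.
  - apply (@ex_series_scal_l R_AbsRing R_NormedModule K (fun n => (th ^ n)%R)).
    apply ex_series_geom. rewrite Rabs_right; lra. }
destruct X as [l Hl].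
assert (Hl' : Clim (sum_n u) l) by (apply filterlim_Clim; exact Hl).
assert (E : CSeries u = l) by (apply Clim_Clim_seq; exact Hl').
rewrite E. intros e He. destruct (Hl' e He) as [N HN]. exists (S N). intros n Hn.
(* [sum_n] with bound n has n + 1 terms, [Csum] has n. *)
destruct n as [|n]; [lia|]. rewrite <- sum_n_Csum. apply HN. lia.
Qed.

Definition zsummable (u : Z -> C) : Prop :=
  exists th K : R, (0 <= th < 1)%R /\ forall n : Z, (Cmod (u n) <= K * th ^ Z.abs_nat n)%R.

Lemma zsummable_CSeries (u : Z -> C) : zsummable u ->
  Clim (Csum (fun j => u (Z.of_nat j))) (CSeries (fun j => u (Z.of_nat j))) /\
  Clim (Csum (fun j => u (- Z.of_nat (S j))%Z)) (CSeries (fun j => u (- Z.of_nat (S j))%Z)) /\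
  is_zsum u (CSeries (fun j => u (Z.of_nat j)) + CSeries (fun j => u (- Z.of_nat (S j))%Z)).
Proof.
intros (th & K & Ht & H).
assert (H1 : Clim (Csum (fun j => u (Z.of_nat j))) (CSeries (fun j => u (Z.of_nat j)))).
{ apply CSeries_correct with th K; auto. intros n. eapply Rle_trans; [apply H|]. now rewrite Zabs2Nat.id; right. }
assert (H2 : Clim (Csum (fun j => u (- Z.of_nat (S j))%Z)) (CSeries (fun j => u (- Z.of_nat (S j))%Z))).
{ apply CSeries_correct with th (K * th)%R; auto. intros n. eapply Rle_trans; [apply H|]. right.
  replace (Z.abs_nat (- Z.of_nat (S n))) with (S n) by lia. simpl. ring. }
split; [|split]; auto. intros e He.
destruct (H1 (e / 2)%R ltac:(lra)) as [N1 K1]. destruct (H2 (e / 2)%R ltac:(lra)) as [N2 K2].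
exists (N1 + N2)%nat. intros a n Ha Hn.
replace n with (Z.to_nat (- a) + (n - Z.to_nat (- a)))%nat by lia. rewrite zs_add.
replace (a + Z.of_nat (Z.to_nat (- a)))%Z with 0%Z by lia.
assert (E1 : zs u 0 (n - Z.to_nat (- a)) = Csum (fun j => u (Z.of_nat j)) (n - Z.to_nat (- a))) by (apply Csum_ext; intros; f_equal; lia).
assert (E2 : zs u a (Z.to_nat (- a)) = Csum (fun j => u (- Z.of_nat (S j))%Z) (Z.to_nat (- a))).
{ unfold zs. rewrite Csum_rev. apply Csum_ext; intros; f_equal; lia. }
rewrite E1, E2. specialize (K1 (n - Z.to_nat (- a))%nat ltac:(lia)). specialize (K2 (Z.to_nat (- a)) ltac:(lia)).
match goal with |- (Cmod (?x + ?y - (?p + ?q)) < _)%R => replace (x + y - (p + q)) with ((x - q) + (y - p)) by ring end.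
eapply Rle_lt_trans; [apply Cmod_triangle|]. lra.
Qed.

Lemma pow_exp (x : R) (n : nat) : (exp x ^ n = exp (INR n * x))%R.
Proof.
induction n as [|n IH]; [simpl; now rewrite Rmult_0_l, exp_0|].
rewrite S_INR. simpl. rewrite IH, <- exp_plus. f_equal. ring.
Qed.

(** Completing the square: -c r^2 + d r + r is at most (d + 1)^2/(4c), so a Gaussian with a linear
    term in the exponent is dominated by a geometric sequence of ratio 1/e. *)
Lemma zsummable_gauss (u : Z -> C) (B c d : R) : (0 < c)%R -> (0 <= B)%R ->
  (forall n : Z, (Cmod (u n) <= B * exp (- c * (IZR n * IZR n) + d * Rabs (IZR n)))%R) -> zsummable u.
Proof.
intros Hc HB H. exists (exp (-1)), (B * exp ((d + 1) * (d + 1) / (4 * c)))%R. split.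
- split; [left; apply exp_pos|]. rewrite <- exp_0. apply exp_increasing. lra.
- intros n. eapply Rle_trans; [apply H|]. rewrite Rmult_assoc. apply Rmult_le_compat_l; auto.
  rewrite pow_exp, <- exp_plus. 
  assert (E : INR (Z.abs_nat n) = Rabs (IZR n)).
  { rewrite INR_IZR_INZ, Zabs2Nat.id_abs, abs_IZR. auto. }
  rewrite E. set (r := Rabs (IZR n)).
  replace (IZR n * IZR n)%R with (r * r)%R by (unfold r; rewrite <- Rabs_mult; apply Rabs_right; nra).
  assert (L : (- c * (r * r) + d * r <= (d + 1) * (d + 1) / (4 * c) + r * -1)%R).
  { apply Rmult_le_reg_l with (4 * c)%R; [lra|].
    replace (4 * c * ((d + 1) * (d + 1) / (4 * c) + r * -1))%R with ((d + 1) * (d + 1) - 4 * c * r)%R by (field; lra).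
    pose proof (Rle_0_sqr (2 * c * r - (d + 1))) as Q. unfold Rsqr in Q. nra. }
  destruct L as [L|L]; [left; now apply exp_increasing|right; now rewrite L].
Qed.

(** * Complex integrals, Cauchy's theorem and pole crossing *)

(** Real and imaginary parts are integrated separately, so that the real theory of [is_RInt],
    including derivatives of parametric integrals, applies directly. *)
Definition isCI (f : R -> C) (a b : R) (l : C) : Prop :=
  is_RInt (fun t => Re (f t)) a b (Re l) /\ is_RInt (fun t => Im (f t)) a b (Im l).

Lemma isCI_unique (f : R -> C) (a b : R) (l m : C) : isCI f a b l -> isCI f a b m -> l = m.
Proof.
intros [H1 H2] [K1 K2]. apply C_ext.
- rewrite <- (is_RInt_unique _ _ _ _ H1). now apply is_RInt_unique.
- rewrite <- (is_RInt_unique _ _ _ _ H2). now apply is_RInt_unique.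
Qed.

Lemma isCI_ext (f g : R -> C) (a b : R) (l : C) : (forall t, f t = g t) -> isCI f a b l -> isCI g a b l.
Proof.
intros E [H1 H2]. split.
- apply is_RInt_ext with (fun t => Re (f t)); auto. intros; now rewrite E.
- apply is_RInt_ext with (fun t => Im (f t)); auto. intros; now rewrite E.
Qed.

Lemma isCI_plus (f g : R -> C) (a b : R) (l m : C) :
  isCI f a b l -> isCI g a b m -> isCI (fun t => f t + g t) a b (l + m).
Proof.
intros [H1 H2] [K1 K2]. split.
- exact (is_RInt_plus _ _ _ _ _ _ H1 K1).
- exact (is_RInt_plus _ _ _ _ _ _ H2 K2).
Qed.

Lemma isCI_scal (c : C) (f : R -> C) (a b : R) (l : C) :
  isCI f a b l -> isCI (fun t => c * f t) a b (c * l).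
Proof.
intros [H1 H2]. split.
- exact (is_RInt_minus _ _ _ _ _ _ (is_RInt_scal _ _ _ (Re c) _ H1) (is_RInt_scal _ _ _ (Im c) _ H2)).
- exact (is_RInt_plus _ _ _ _ _ _ (is_RInt_scal _ _ _ (Re c) _ H2) (is_RInt_scal _ _ _ (Im c) _ H1)).
Qed.

Lemma isCI_minus (f g : R -> C) (a b : R) (l m : C) :
  isCI f a b l -> isCI g a b m -> isCI (fun t => f t - g t) a b (l - m).
Proof.
intros H K. apply isCI_ext with (fun t => f t + (- (1)) * g t); [intros; ring|].
replace (l - m) with (l + (- (1)) * m) by ring. apply isCI_plus; auto. now apply isCI_scal.
Qed.

Lemma isCI_zero (a b : R) : isCI (fun _ => 0) a b 0.
Proof.
assert (H : is_RInt (fun _ : R => 0%R) a b 0%R).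
{ refine (eq_rect _ (fun l => is_RInt (fun _ : R => 0%R) a b l) (is_RInt_const (V := R_NormedModule) a b 0%R) _ _).
  apply Rmult_0_r. }
split; exact H.
Qed.

Lemma isCI_Chasles (f : R -> C) (a b c : R) (l m : C) :
  isCI f a b l -> isCI f b c m -> isCI f a c (l + m).
Proof.
intros [H1 H2] [K1 K2]. split.
- exact (is_RInt_Chasles _ _ _ _ _ _ H1 K1).
- exact (is_RInt_Chasles _ _ _ _ _ _ H2 K2).
Qed.

(* The factor 2 comes from estimating real and imaginary parts separately. *)
Lemma isCI_bound_fun (f : R -> C) (g : R -> R) (a b : R) (l : C) (G : R) :
  (a <= b)%R -> isCI f a b l -> is_RInt g a b G ->
  (forall t, (a <= t <= b)%R -> (Cmod (f t) <= g t)%R) -> (Cmod l <= 2 * G)%R.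
Proof.
intros Hab [H1 H2] HG H. eapply Rle_trans; [apply Cmod_le_abs|].
assert (E : forall u L, is_RInt u a b L -> (forall t, (a <= t <= b)%R -> (Rabs (u t) <= Cmod (f t))%R) -> (Rabs L <= G)%R).
{ intros u L HL Hu. apply (@norm_RInt_le R_NormedModule u g a b L G); auto.
  intros t Ht. eapply Rle_trans; [apply (Hu t Ht)|auto]. }
pose proof (E _ _ H1 (fun t _ => re_le_Cmod (f t))). pose proof (E _ _ H2 (fun t _ => im_le_Cmod (f t))). lra.
Qed.

Lemma isCI_bound (f : R -> C) (a b : R) (l : C) (B : R) :
  (a <= b)%R -> isCI f a b l -> (forall t, (a <= t <= b)%R -> (Cmod (f t) <= B)%R) -> (Cmod l <= 2 * B * (b - a))%R.
Proof.
intros Hab H HB. replace (2 * B * (b - a))%R with (2 * ((b - a) * B))%R by ring.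
apply isCI_bound_fun with f (fun _ => B) a b; auto. exact (is_RInt_const a b B).
Qed.

Definition Rcont (f : R -> C) (t : R) : Prop :=
  forall eps : R, (0 < eps)%R -> exists d : R, (0 < d)%R /\
    forall s : R, (Rabs (s - t) < d -> Cmod (f s - f t) < eps)%R.

Lemma Rcont_Re (f : R -> C) (t : R) : Rcont f t -> continuous (fun s => Re (f s)) t.
Proof.
intros H. apply continuity_pt_filterlim. intros e He. destruct (H e He) as [d [Hd K]].
exists d. split; auto. intros s [_ Hs]. simpl in *. unfold R_dist in *.
replace (Re (f s) - Re (f t))%R with (Re (f s - f t)) by (creim; ring).
eapply Rle_lt_trans; [apply re_le_Cmod|auto].
Qed.

Lemma Rcont_Im (f : R -> C) (t : R) : Rcont f t -> continuous (fun s => Im (f s)) t.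
Proof.
intros H. apply continuity_pt_filterlim. intros e He. destruct (H e He) as [d [Hd K]].
exists d. split; auto. intros s [_ Hs]. simpl in *. unfold R_dist in *.
replace (Im (f s) - Im (f t))%R with (Im (f s - f t)) by (creim; ring).
eapply Rle_lt_trans; [apply im_le_Cmod|auto].
Qed.

Lemma isCI_exists (f : R -> C) (a b : R) : (a <= b)%R ->
  (forall t, (a <= t <= b)%R -> Rcont f t) -> exists l, isCI f a b l.
Proof.
intros Hab H.
destruct (ex_RInt_continuous (V := R_CompleteNormedModule) (fun t => Re (f t)) a b) as [l1 H1].
{ intros t Ht. rewrite Rmin_left, Rmax_right in Ht by lra. now apply Rcont_Re, H. }
destruct (ex_RInt_continuous (V := R_CompleteNormedModule) (fun t => Im (f t)) a b) as [l2 H2].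
{ intros t Ht. rewrite Rmin_left, Rmax_right in Ht by lra. now apply Rcont_Im, H. }
exists (l1, l2). split; auto.
Qed.

Lemma Rcont_comp_affine (f : C -> C) (p q : C) (t : R) :
  Ccont f (p + RtoC t * q) -> Rcont (fun s => f (p + RtoC s * q)) t.
Proof.
intros H e He. destruct (H e He) as [d [Hd K]].
exists (d / (Cmod q + 1))%R. pose proof (Cmod_ge_0 q). split; [apply Rdiv_lt_0_compat; lra|].
intros s Hs. apply K. replace (p + s * q - (p + t * q)) with (RtoC (s - t) * q) by (rewrite RtoC_minus; ring).
rewrite Cmod_mult, Cmod_R.
apply Rle_lt_trans with (Rabs (s - t) * (Cmod q + 1))%R; [apply Rmult_le_compat_l; [apply Rabs_pos|lra]|].
apply Rmult_lt_compat_r with (r := (Cmod q + 1)%R) in Hs; [|lra].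
replace (d / (Cmod q + 1) * (Cmod q + 1))%R with d in Hs by (field; lra). auto.
Qed.

Lemma Cder_path (f : C -> C) (p q l : C) (s : R) : Cder f (p + RtoC s * q) l ->
  is_derive (fun u : R => Re (f (p + RtoC u * q))) s (Re (q * l)) /\
  is_derive (fun u : R => Im (f (p + RtoC u * q))) s (Im (q * l)).
Proof.
intros (g & d & Hd & Hg & Hl & E).
pose proof (Rcont_comp_affine g p q s Hg) as Cg.
assert (D : forall eps, (0 < eps)%R -> exists de : R, (0 < de)%R /\ forall h : R, h <> 0%R -> (Rabs h < de)%R ->
  (Cmod ((f (p + RtoC (s + h) * q)%C - f (p + RtoC s * q)%C) * RtoC (/ h) - q * l) < eps)%R).
{ intros e He. pose proof (Cmod_ge_0 q) as Hq.
  destruct (Cg (e / (Cmod q + 1))%R) as [d1 [Hd1 K]]; [apply Rdiv_lt_0_compat; lra|].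
  exists (Rmin d1 (d / (Cmod q + 1))). split; [apply Rmin_pos; auto; apply Rdiv_lt_0_compat; lra|].
  intros h Hh Hs. pose proof (Rmin_l d1 (d / (Cmod q + 1))). pose proof (Rmin_r d1 (d / (Cmod q + 1))).
  assert (Hc : RtoC h <> 0) by now apply RtoC_neq.
  rewrite (E (p + RtoC (s + h) * q)).
  - replace ((f (p + s * q) + g (p + RtoC (s + h) * q) * (p + RtoC (s + h) * q - (p + s * q)) - f (p + s * q)) * RtoC (/ h) - q * l)
      with (q * (g (p + RtoC (s + h) * q) - g (p + RtoC s * q))).
    + rewrite Cmod_mult. specialize (K (s + h)%R). replace (s + h - s)%R with h in K by ring. specialize (K ltac:(lra)).
      apply Rle_lt_trans with (Cmod q * (e / (Cmod q + 1)))%R; [apply Rmult_le_compat_l; lra|].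
      apply Rlt_le_trans with ((Cmod q + 1) * (e / (Cmod q + 1)))%R; [|right; field; lra].
      apply Rmult_lt_compat_r; [apply Rdiv_lt_0_compat; lra|lra].
    + rewrite Hl, RtoC_inv, RtoC_plus by auto. field; auto.
  - replace (p + RtoC (s + h) * q - (p + s * q)) with (RtoC h * q) by (rewrite RtoC_plus; ring).
    rewrite Cmod_mult, Cmod_R.
    apply Rle_lt_trans with (Rabs h * (Cmod q + 1))%R; [apply Rmult_le_compat_l; [apply Rabs_pos|lra]|].
    assert (Hs' : (Rabs h < d / (Cmod q + 1))%R) by lra.
    apply Rmult_lt_compat_r with (r := (Cmod q + 1)%R) in Hs'; [|lra].
    replace (d / (Cmod q + 1) * (Cmod q + 1))%R with d in Hs' by (field; lra). auto. }
split; apply is_derive_Reals; intros e He; destruct (D e He) as [de [Hde K]];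
  exists (mkposreal _ Hde); intros h Hh Hs; (eapply Rle_lt_trans; [|apply (K h Hh Hs)]).
- eapply Rle_trans; [|apply re_le_Cmod]. right. f_equal. creim. unfold Rdiv. ring.
- eapply Rle_trans; [|apply im_le_Cmod]. right. f_equal. creim. unfold Rdiv. ring.
Qed.

Definition C2cont (F : R -> R -> C) (s t : R) : Prop :=
  forall eps : R, (0 < eps)%R -> exists d : R, (0 < d)%R /\
    forall s' t' : R, (Rabs (s' - s) < d -> Rabs (t' - t) < d -> Cmod (F s' t' - F s t) < eps)%R.

Lemma C2cont_Ccont (f : C -> C) (G : R -> R -> C) (s t : R) :
  Ccont f (G s t) -> C2cont G s t -> C2cont (fun s t => f (G s t)) s t.
Proof.
intros Hf HG e He. destruct (Hf e He) as [d [Hd K]]. destruct (HG d Hd) as [d1 [Hd1 K1]].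
exists d1. split; auto.
Qed.

Lemma C2cont_const (c : C) (s t : R) : C2cont (fun _ _ => c) s t.
Proof. intros e He. exists 1%R; split; [lra|]. intros. replace (c - c) with (RtoC 0) by ring. now rewrite Cmod_0. Qed.

Lemma C2cont_1 (s t : R) : C2cont (fun s _ => RtoC s) s t.
Proof. intros e He. exists e; split; auto. intros. rewrite <- RtoC_minus, Cmod_R. auto. Qed.

Lemma C2cont_2 (s t : R) : C2cont (fun _ t => RtoC t) s t.
Proof. intros e He. exists e; split; auto. intros. rewrite <- RtoC_minus, Cmod_R. auto. Qed.

Lemma C2cont_plus (F G : R -> R -> C) (s t : R) :
  C2cont F s t -> C2cont G s t -> C2cont (fun s t => F s t + G s t) s t.
Proof.
intros HF HG e He. destruct (HF (e / 2)%R ltac:(lra)) as [d [Hd K]]. destruct (HG (e / 2)%R ltac:(lra)) as [d1 [Hd1 K1]].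
exists (Rmin d d1); split; [apply Rmin_pos; auto|]. intros s' t' H1 H2.
pose proof (Rmin_l d d1). pose proof (Rmin_r d d1).
specialize (K s' t' ltac:(lra) ltac:(lra)). specialize (K1 s' t' ltac:(lra) ltac:(lra)).
replace (F s' t' + G s' t' - (F s t + G s t)) with ((F s' t' - F s t) + (G s' t' - G s t)) by ring.
eapply Rle_lt_trans; [apply Cmod_triangle|]. lra.
Qed.

Lemma C2cont_mult (F G : R -> R -> C) (s t : R) :
  C2cont F s t -> C2cont G s t -> C2cont (fun s t => F s t * G s t) s t.
Proof.
intros HF HG e He.
set (A := (Cmod (F s t) + 1)%R). set (B := (Cmod (G s t) + 1)%R).
assert (HA : (1 <= A)%R) by (unfold A; pose proof (Cmod_ge_0 (F s t)); lra).
assert (HB : (1 <= B)%R) by (unfold B; pose proof (Cmod_ge_0 (G s t)); lra).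
destruct (HF (e / 2 / B)%R) as [d [Hd K]]; [repeat apply Rdiv_lt_0_compat; lra|].
destruct (HG (Rmin 1 (e / 2 / A))%R) as [d1 [Hd1 K1]]; [apply Rmin_pos; [lra|repeat apply Rdiv_lt_0_compat; lra]|].
exists (Rmin d d1); split; [apply Rmin_pos; auto|]. intros s' t' H1 H2.
pose proof (Rmin_l d d1). pose proof (Rmin_r d d1).
specialize (K s' t' ltac:(lra) ltac:(lra)). specialize (K1 s' t' ltac:(lra) ltac:(lra)).
pose proof (Rmin_l 1 (e / 2 / A)). pose proof (Rmin_r 1 (e / 2 / A)).
replace (F s' t' * G s' t' - F s t * G s t) with ((F s' t' - F s t) * G s' t' + F s t * (G s' t' - G s t)) by ring.
eapply Rle_lt_trans; [apply Cmod_triangle|]. rewrite !Cmod_mult.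
assert (Hg : (Cmod (G s' t') <= B)%R).
{ pose proof (Cmod_tri_rev (G s' t') (G s t)). unfold B. lra. }
assert (E1 : (Cmod (F s' t' - F s t) * Cmod (G s' t') <= Cmod (F s' t' - F s t) * B)%R) by (apply Rmult_le_compat_l; [apply Cmod_ge_0|auto]).
assert (E2 : (Cmod (F s' t' - F s t) * B < e / 2 / B * B)%R) by (apply Rmult_lt_compat_r; lra).
replace (e / 2 / B * B)%R with (e / 2)%R in E2 by (field; lra).
assert (E3 : (Cmod (F s t) * Cmod (G s' t' - G s t) <= A * (e / 2 / A))%R).
{ apply Rmult_le_compat; try apply Cmod_ge_0; [unfold A; lra|lra]. }
replace (A * (e / 2 / A))%R with (e / 2)%R in E3 by (field; lra). lra.
Qed.

Lemma C2cont_Re (F : R -> R -> C) (s t : R) : C2cont F s t -> continuity_2d_pt (fun s t => Re (F s t)) s t.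
Proof.
intros H e. destruct (H e (cond_pos e)) as [d [Hd K]]. exists (mkposreal _ Hd). intros u v Hu Hv.
replace (Re (F u v) - Re (F s t))%R with (Re (F u v - F s t)) by (creim; ring).
eapply Rle_lt_trans; [apply re_le_Cmod|auto].
Qed.

Lemma C2cont_Im (F : R -> R -> C) (s t : R) : C2cont F s t -> continuity_2d_pt (fun s t => Im (F s t)) s t.
Proof.
intros H e. destruct (H e (cond_pos e)) as [d [Hd K]]. exists (mkposreal _ Hd). intros u v Hu Hv.
replace (Im (F u v) - Im (F s t))%R with (Im (F u v - F s t)) by (creim; ring).
eapply Rle_lt_trans; [apply im_le_Cmod|auto].
Qed.

Lemma C2cont_fst (F : R -> R -> C) (s t : R) : C2cont F s t -> Rcont (fun u => F u t) s.
Proof.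
intros H e He. destruct (H e He) as [d [Hd K]]. exists d; split; auto. intros u Hu. apply K; auto.
rewrite Rminus_diag, Rabs_R0; auto.
Qed.

Lemma C2cont_snd (F : R -> R -> C) (s t : R) : C2cont F s t -> Rcont (fun u => F s u) t.
Proof.
intros H e He. destruct (H e He) as [d [Hd K]]. exists d; split; auto. intros u Hu. apply K; auto.
rewrite Rminus_diag, Rabs_R0; auto.
Qed.

(** Since the s-derivative of F equals the t-derivative of H, the integral of F(s, t) over a <= t <=
    b has s-derivative H(s, b) - H(s, a); integrating this in s gives the formula. Joint continuity
    of the common derivative G permits the differentiation under the integral. *)
Lemma green_real (F H G : R -> R -> R) (A B S0 S1 a b s0 s1 : R) :
  (forall s t, (S0 < s < S1)%R -> (A < t < B)%R ->
     is_derive (fun u => F u t) s (G s t) /\ is_derive (fun u => H s u) t (G s t) /\ continuity_2d_pt G s t /\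
     continuous (fun u => F s u) t /\ continuous (fun u => H u t) s) ->
  (A < a)%R -> (a <= b)%R -> (b < B)%R -> (S0 < s0)%R -> (s0 <= s1)%R -> (s1 < S1)%R ->
  is_RInt (fun s => H s b - H s a)%R s0 s1 (RInt (F s1) a b - RInt (F s0) a b)%R.
Proof.
intros K HA Hab HB HS0 Hs HS1.
apply (is_RInt_derive (V := R_CompleteNormedModule) (fun s => RInt (F s) a b)).
- intros s Hs'. rewrite Rmin_left, Rmax_right in Hs' by lra.
  assert (HD : is_derive (fun x => RInt (fun t => F x t) a b) s (RInt (fun t => Derive (fun u => F u t) s) a b)).
  { apply (is_derive_RInt_param F a b s).
    - assert (Hd : (0 < Rmin (s - S0) (S1 - s))%R) by (apply Rmin_pos; lra).
      exists (mkposreal _ Hd). intros y Hy t Ht. rewrite Rmin_left, Rmax_right in Ht by lra.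
      change (Rabs (y - s) < Rmin (s - S0) (S1 - s))%R in Hy.
      pose proof (Rmin_l (s - S0) (S1 - s)). pose proof (Rmin_r (s - S0) (S1 - s)). apply Rabs_def2 in Hy.
      exists (G y t). apply K; lra.
    - intros t Ht. rewrite Rmin_left, Rmax_right in Ht by lra.
      apply continuity_2d_pt_ext_loc with G; [|apply K; lra].
      assert (Hd : (0 < Rmin (Rmin (s - S0) (S1 - s)) (Rmin (t - A) (B - t)))%R) by (repeat apply Rmin_pos; lra).
      exists (mkposreal _ Hd). simpl. intros u v Hu Hv. symmetry. apply is_derive_unique.
      pose proof (Rmin_l (Rmin (s - S0) (S1 - s)) (Rmin (t - A) (B - t))). pose proof (Rmin_r (Rmin (s - S0) (S1 - s)) (Rmin (t - A) (B - t))).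
      pose proof (Rmin_l (s - S0) (S1 - s)). pose proof (Rmin_r (s - S0) (S1 - s)).
      pose proof (Rmin_l (t - A) (B - t)). pose proof (Rmin_r (t - A) (B - t)).
      apply Rabs_def2 in Hu. apply Rabs_def2 in Hv. apply K; lra.
    - assert (Hd : (0 < Rmin (s - S0) (S1 - s))%R) by (apply Rmin_pos; lra).
      exists (mkposreal _ Hd). intros y Hy.
      change (Rabs (y - s) < Rmin (s - S0) (S1 - s))%R in Hy.
      pose proof (Rmin_l (s - S0) (S1 - s)). pose proof (Rmin_r (s - S0) (S1 - s)). apply Rabs_def2 in Hy.
      apply (ex_RInt_continuous (V := R_CompleteNormedModule)). intros t Ht. rewrite Rmin_left, Rmax_right in Ht by lra.
      apply (K y t); lra. }
  replace (H s b - H s a)%R with (RInt (fun t => Derive (fun u => F u t) s) a b); [exact HD|].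
  apply is_RInt_unique. apply is_RInt_ext with (G s).
  { intros t Ht. rewrite Rmin_left, Rmax_right in Ht by lra. symmetry. apply is_derive_unique. apply K; lra. }
  apply (is_RInt_derive (V := R_CompleteNormedModule) (H s)).
  + intros t Ht. rewrite Rmin_left, Rmax_right in Ht by lra. apply K; lra.
  + intros t Ht. rewrite Rmin_left, Rmax_right in Ht by lra.
    destruct (K s t ltac:(lra) ltac:(lra)) as (_ & _ & Q & _).
    apply continuity_pt_filterlim. intros e He. destruct (Q (mkposreal _ He)) as [d Hd].
    exists d. split; [apply cond_pos|]. intros u [_ Hu]. apply Hd; [rewrite Rminus_diag, Rabs_R0; apply cond_pos|exact Hu].
- intros s Hs'. rewrite Rmin_left, Rmax_right in Hs' by lra.
  apply (continuous_minus (V := R_NormedModule)); apply K; lra.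
Qed.

Lemma green (F H G : R -> R -> C) (A B S0 S1 a b s0 s1 : R) (I0 I1 : C) :
  (forall s t, (S0 < s < S1)%R -> (A < t < B)%R ->
     (is_derive (fun u => Re (F u t)) s (Re (G s t)) /\ is_derive (fun u => Im (F u t)) s (Im (G s t))) /\
     (is_derive (fun u => Re (H s u)) t (Re (G s t)) /\ is_derive (fun u => Im (H s u)) t (Im (G s t))) /\
     C2cont G s t /\ C2cont F s t /\ C2cont H s t) ->
  (A < a)%R -> (a <= b)%R -> (b < B)%R -> (S0 < s0)%R -> (s0 <= s1)%R -> (s1 < S1)%R ->
  isCI (F s0) a b I0 -> isCI (F s1) a b I1 ->
  isCI (fun s => H s b - H s a) s0 s1 (I1 - I0).
Proof.
intros K HA Hab HB HS0 Hs HS1 [H0 H0'] [H1 H1'].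
split.
- creim. rewrite <- (is_RInt_unique _ _ _ _ H0), <- (is_RInt_unique _ _ _ _ H1).
  apply (green_real (fun s t => Re (F s t)) (fun s t => Re (H s t)) (fun s t => Re (G s t)) A B S0 S1); auto.
  intros s t Hs' Ht. destruct (K s t Hs' Ht) as ((D1 & _) & (D2 & _) & C1 & C2 & C3).
  refine (conj D1 (conj D2 (conj _ (conj _ _)))); [now apply C2cont_Re|apply Rcont_Re; now apply C2cont_snd|].
  apply (Rcont_Re (fun u => H u t)). now apply C2cont_fst.
- creim. rewrite <- (is_RInt_unique _ _ _ _ H0'), <- (is_RInt_unique _ _ _ _ H1').
  apply (green_real (fun s t => Im (F s t)) (fun s t => Im (H s t)) (fun s t => Im (G s t)) A B S0 S1); auto.
  intros s t Hs' Ht. destruct (K s t Hs' Ht) as ((_ & D1) & (_ & D2) & C1 & C2 & C3).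
  refine (conj D1 (conj D2 (conj _ (conj _ _)))); [now apply C2cont_Im|apply Rcont_Im; now apply C2cont_snd|].
  apply (Rcont_Im (fun u => H u t)). now apply C2cont_fst.
Qed.

(* Cauchy's theorem on the parallelogram {t + v s}. *)
Lemma cauchy_skew (f : C -> C) (v : C) (A B S0 S1 a b s0 s1 Bd : R) (I0 I1 : C) :
  HoloOn (fun w => exists s t : R, (S0 < s < S1)%R /\ (A < t < B)%R /\ w = RtoC t + v * RtoC s) f ->
  (A < a)%R -> (a <= b)%R -> (b < B)%R -> (S0 < s0)%R -> (s0 <= s1)%R -> (s1 < S1)%R ->
  isCI (fun t => f (RtoC t + v * RtoC s0)) a b I0 -> isCI (fun t => f (RtoC t + v * RtoC s1)) a b I1 ->
  (forall s, (s0 <= s <= s1)%R -> (Cmod (f (RtoC a + v * RtoC s)%C) <= Bd)%R /\ (Cmod (f (RtoC b + v * RtoC s)%C) <= Bd)%R) ->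
  (Cmod (I1 - I0) <= 4 * Cmod v * Bd * (s1 - s0))%R.
Proof.
intros [f' Hf] HA Hab HB HS0 Hs HS1 H0 H1 Hbd.
assert (X : isCI (fun s => v * f (RtoC b + v * RtoC s) - v * f (RtoC a + v * RtoC s)) s0 s1 (I1 - I0)).
{ apply (green (fun s t => f (RtoC t + v * RtoC s)) (fun s t => v * f (RtoC t + v * RtoC s))
    (fun s t => v * f' (RtoC t + v * RtoC s)) A B S0 S1); auto.
  intros s t Hs' Ht.
  destruct (Hf (RtoC t + v * RtoC s)) as [D Cf']; [exists s, t; auto|].
  assert (L : C2cont (fun s t => RtoC t + v * RtoC s) s t).
  { apply C2cont_plus; [apply C2cont_2|]. apply C2cont_mult; [apply C2cont_const|apply C2cont_1]. }
  pose proof (Cder_cont _ _ _ D) as Cf.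
  split; [|split; [|split; [|split]]].
  - replace (RtoC t + v * RtoC s) with (RtoC t + RtoC s * v) in * by ring.
    destruct (Cder_path f (RtoC t) v _ s D) as [P1 P2].
    split; [eapply is_derive_ext; [|exact P1]|eapply is_derive_ext; [|exact P2]]; intros u; simpl; do 2 f_equal; ring.
  - replace (RtoC t + v * RtoC s) with (v * RtoC s + RtoC t * 1) in * by ring.
    pose proof (Cder_mult (fun _ => v) f _ _ _ (Cder_const v _) D) as D'.
    destruct (Cder_path (fun w => v * f w) (v * RtoC s) 1 _ t D') as [P1 P2].
    replace (1 * (0 * f (v * s + t * 1) + v * f' (v * s + t * 1))) with (v * f' (v * s + t * 1)) in P1, P2 by ring.
    split; [eapply is_derive_ext; [|exact P1]|eapply is_derive_ext; [|exact P2]]; intros u; simpl;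
     replace (v * s + u * 1) with (u + v * s) by ring; reflexivity.
  - apply C2cont_mult; [apply C2cont_const|]. now apply (C2cont_Ccont f').
  - now apply (C2cont_Ccont f).
  - apply C2cont_mult; [apply C2cont_const|]. now apply (C2cont_Ccont f). }
replace (4 * Cmod v * Bd * (s1 - s0))%R with (2 * (Cmod v * Bd + Cmod v * Bd) * (s1 - s0))%R by ring.
apply isCI_bound with (2 := X); auto.
intros s Hs'. destruct (Hbd s Hs') as [B1 B2].
eapply Rle_trans; [apply Cmod_tri'|]. rewrite !Cmod_mult. pose proof (Cmod_ge_0 v).
apply Rplus_le_compat; apply Rmult_le_compat_l; auto.
Qed.

(** * The jump of an integral across simple poles *)

Lemma ln_diff_bound (A B m : R) : (0 < m)%R -> (m <= A)%R -> (m <= B)%R -> (Rabs (ln A - ln B) <= Rabs (A - B) / m)%R.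
Proof.
intros Hm HA HB.
assert (E : forall x y, (m <= x)%R -> (m <= y)%R -> (ln x - ln y <= Rabs (x - y) / m)%R).
{ intros x y Hx Hy. rewrite <- ln_div by lra.
  pose proof (exp_ineq1_le (ln (x / y))) as H. rewrite exp_ln in H by (apply Rdiv_lt_0_compat; lra).
  assert (x / y - 1 <= Rabs (x - y) / m)%R.
  { replace (x / y - 1)%R with ((x - y) / y)%R by (field; lra).
    apply Rle_trans with (Rabs (x - y) / y)%R.
    - apply Rmult_le_compat_r; [left; apply Rinv_0_lt_compat; lra|apply Rle_abs].
    - apply Rmult_le_compat_l; [apply Rabs_pos|]. apply Rinv_le_contravar; lra. }
  lra. }
apply Rabs_le. pose proof (E A B HA HB). pose proof (E B A HB HA). rewrite Rabs_minus_sym in H0. lra.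
Qed.

Lemma atan_le_id (x : R) : (0 <= x)%R -> (0 <= atan x <= x)%R.
Proof.
intros Hx. destruct Hx as [Hx|<-]; [|rewrite atan_0; lra].
assert (H0 : (0 < atan x)%R) by (rewrite <- atan_0; now apply atan_increasing).
split; [lra|].
destruct (MVT_gen atan 0 x (fun t => / (1 + t * t))%R) as [c [_ Hc]].
- intros; auto_derive; auto. field. nra.
- intros t _. apply continuity_pt_filterlim. apply (ex_derive_continuous atan). auto_derive. auto.
- rewrite atan_0, !Rminus_0_r in Hc. rewrite Hc.
  assert (/ (1 + c * c) <= 1)%R. { rewrite <- Rinv_1. apply Rinv_le_contravar; nra. } nra.
Qed.

(** The primitive is the logarithm of the modulus plus i times an angle. Written as -atan((t + Re v
    e)/(Im v e)), with a denominator that is constant and nonzero, the angle is smooth on the whole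
    line and no branch of the argument interferes. *)
Lemma inv_line_integral (v : C) (e d : R) : Im v <> 0%R -> e <> 0%R ->
  isCI (fun t => / (RtoC t + v * RtoC e)) (- d) d
   ((/ 2 * ln ((d + Re v * e) ^ 2 + (Im v * e) ^ 2) - / 2 * ln ((- d + Re v * e) ^ 2 + (Im v * e) ^ 2))%R,
    (- atan ((d + Re v * e) / (Im v * e)) - - atan ((- d + Re v * e) / (Im v * e)))%R).
Proof.
intros Hv He. assert (Hve : (Im v * e <> 0)%R) by (apply Rmult_integral_contrapositive; auto).
assert (P : forall t, (0 < (t + Re v * e) ^ 2 + (Im v * e) ^ 2)%R).
{ intros t. pose proof (pow2_ge_0 (t + Re v * e)). assert (0 < (Im v * e) ^ 2)%R by (apply pow2_gt_0; auto). lra. }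
split.
- apply is_RInt_ext with (fun t => ((t + Re v * e) * / ((t + Re v * e) ^ 2 + (Im v * e) ^ 2))%R).
  { intros t _. simpl. unfold Re, Im, Rdiv. f_equal; [ring|f_equal; ring]. }
  apply (is_RInt_derive (V := R_CompleteNormedModule) (fun t => (/ 2 * ln ((t + Re v * e) ^ 2 + (Im v * e) ^ 2))%R)).
  + intros t _. specialize (P t). auto_derive; [simpl in *; lra|field; simpl in *; lra].
  + intros t _. specialize (P t). apply (ex_derive_continuous (fun t => ((t + Re v * e) * / ((t + Re v * e) ^ 2 + (Im v * e) ^ 2))%R)).
    auto_derive. simpl in *; lra.
- apply is_RInt_ext with (fun t => (- (Im v * e) * / ((t + Re v * e) ^ 2 + (Im v * e) ^ 2))%R).
  { intros t _. simpl. unfold Re, Im, Rdiv. f_equal; [ring|f_equal; ring]. }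
  apply (is_RInt_derive (V := R_CompleteNormedModule) (fun t => (- atan ((t + Re v * e) / (Im v * e)))%R)).
  + intros t _. specialize (P t). auto_derive; [exact I|]. field. split; [lra|auto].
  + intros t _. specialize (P t). apply (ex_derive_continuous (fun t => (- (Im v * e) * / ((t + Re v * e) ^ 2 + (Im v * e) ^ 2))%R)).
    auto_derive. simpl in *; lra.
Qed.

(** As Im v < 0, the first line passes below 0 and the second above it, so the difference
    approximates a counterclockwise loop around the pole of 1/w. The explicit primitives also give
    the error, which is linear in e. *)
Lemma inv_line_jump (v : C) (e d : R) (L L' : C) : (Im v < 0)%R -> (0 < e)%R -> (0 < d)%R -> (Cmod v * e <= d / 2)%R ->
  isCI (fun t => / (RtoC t + v * RtoC e)) (- d) d L -> isCI (fun t => / (RtoC t + v * RtoC (- e))) (- d) d L' ->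
  (Cmod (L - L' - 2 * PI * Ci) <= 24 * Cmod v * e / d)%R.
Proof.
intros Hv He Hd Hs HL HL'.
rewrite (isCI_unique _ _ _ _ _ HL (inv_line_integral v e d ltac:(lra) ltac:(lra))).
rewrite (isCI_unique _ _ _ _ _ HL' (inv_line_integral v (- e) d ltac:(lra) ltac:(lra))).
clear HL HL'.
set (p := Re v). set (m := (- Im v)%R). assert (Hm : (0 < m)%R) by (unfold m; lra).
replace (Im v) with (- m)%R by (unfold m; ring).
assert (Hp : (Rabs p <= Cmod v)%R) by apply re_le_Cmod.
assert (Hmv : (m <= Cmod v)%R).
{ pose proof (im_le_Cmod v) as Q. rewrite Rabs_left in Q by lra. exact Q. }
assert (Hpe : (Rabs (p * e) <= d / 2)%R).
{ rewrite Rabs_mult, (Rabs_right e) by lra. apply Rle_trans with (Cmod v * e)%R; [apply Rmult_le_compat_r; lra|lra]. }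
assert (Hpe' := Hpe). apply Rabs_le_between in Hpe'.
set (V := Cmod v) in *.
eapply Rle_trans; [apply Cmod_le_abs|].
assert (E1 : Re (((/ 2 * ln ((d + p * e) ^ 2 + (- m * e) ^ 2) - / 2 * ln ((- d + p * e) ^ 2 + (- m * e) ^ 2))%R,
    (- atan ((d + p * e) / (- m * e)) - - atan ((- d + p * e) / (- m * e)))%R) -
   ((/ 2 * ln ((d + p * - e) ^ 2 + (- m * - e) ^ 2) - / 2 * ln ((- d + p * - e) ^ 2 + (- m * - e) ^ 2))%R,
    (- atan ((d + p * - e) / (- m * - e)) - - atan ((- d + p * - e) / (- m * - e)))%R) - 2 * PI * Ci)
  = (ln ((d + p * e) ^ 2 + (m * e) ^ 2) - ln ((d - p * e) ^ 2 + (m * e) ^ 2))%R).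
{ creim. unfold Re, Im. cbn [fst snd].
  replace ((d + p * - e) ^ 2 + (- m * - e) ^ 2)%R with ((d - p * e) ^ 2 + (m * e) ^ 2)%R by ring.
  replace ((- d + p * - e) ^ 2 + (- m * - e) ^ 2)%R with ((d + p * e) ^ 2 + (m * e) ^ 2)%R by ring.
  replace ((- d + p * e) ^ 2 + (- m * e) ^ 2)%R with ((d - p * e) ^ 2 + (m * e) ^ 2)%R by ring.
  replace ((d + p * e) ^ 2 + (- m * e) ^ 2)%R with ((d + p * e) ^ 2 + (m * e) ^ 2)%R by ring.
  field. }
assert (Hme : (0 < m * e)%R) by nra.
assert (Q1 : (0 < (m * e) / (d + p * e))%R) by (apply Rdiv_lt_0_compat; lra).
assert (Q2 : (0 < (m * e) / (d - p * e))%R) by (apply Rdiv_lt_0_compat; lra).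
(* The reflection atan y = PI/2 - atan(1/y) turns the four large angles into PI/2 minus small ones;
   the four quarter turns add up to 2 PI. *)
assert (A1 : (atan ((d + p * e) / (m * e)) = PI / 2 - atan ((m * e) / (d + p * e)))%R).
{ rewrite <- atan_inv by auto. f_equal. field. split; lra. }
assert (A2 : (atan ((d - p * e) / (m * e)) = PI / 2 - atan ((m * e) / (d - p * e)))%R).
{ rewrite <- atan_inv by auto. f_equal. field. split; lra. }
assert (E2 : Im (((/ 2 * ln ((d + p * e) ^ 2 + (- m * e) ^ 2) - / 2 * ln ((- d + p * e) ^ 2 + (- m * e) ^ 2))%R,
    (- atan ((d + p * e) / (- m * e)) - - atan ((- d + p * e) / (- m * e)))%R) -
   ((/ 2 * ln ((d + p * - e) ^ 2 + (- m * - e) ^ 2) - / 2 * ln ((- d + p * - e) ^ 2 + (- m * - e) ^ 2))%R,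
    (- atan ((d + p * - e) / (- m * - e)) - - atan ((- d + p * - e) / (- m * - e)))%R) - 2 * PI * Ci)
  = (- 2 * atan ((m * e) / (d + p * e)) - 2 * atan ((m * e) / (d - p * e)))%R).
{ creim. unfold Re, Im. cbn [fst snd].
  replace ((d + p * e) / (- m * e))%R with (- ((d + p * e) / (m * e)))%R by (field; lra).
  replace ((- d + p * e) / (- m * e))%R with ((d - p * e) / (m * e))%R by (field; lra).
  replace ((d + p * - e) / (- m * - e))%R with ((d - p * e) / (m * e))%R by (field; lra).
  replace ((- d + p * - e) / (- m * - e))%R with (- ((d + p * e) / (m * e)))%R by (field; lra).
  rewrite !atan_opp, A1, A2. field. }
fold p. rewrite E1, E2.
pose proof (atan_le_id _ (Rlt_le _ _ Q1)) as B1. pose proof (atan_le_id _ (Rlt_le _ _ Q2)) as B2.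
assert (D1 : (m * e / (d + p * e) <= 2 * V * e / d)%R).
{ apply Rmult_le_reg_r with ((d + p * e) * d)%R; [nra|].
  replace (m * e / (d + p * e) * ((d + p * e) * d))%R with (m * e * d)%R by (field; lra).
  replace (2 * V * e / d * ((d + p * e) * d))%R with (2 * V * e * (d + p * e))%R by (field; lra).
  apply Rle_trans with (V * e * d)%R; [apply Rmult_le_compat_r; [lra|apply Rmult_le_compat_r; lra]|].
  replace (2 * V * e * (d + p * e))%R with (V * e * (2 * (d + p * e)))%R by ring.
  apply Rmult_le_compat_l; nra. }
assert (D2 : (m * e / (d - p * e) <= 2 * V * e / d)%R).
{ apply Rmult_le_reg_r with ((d - p * e) * d)%R; [nra|].
  replace (m * e / (d - p * e) * ((d - p * e) * d))%R with (m * e * d)%R by (field; lra).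
  replace (2 * V * e / d * ((d - p * e) * d))%R with (2 * V * e * (d - p * e))%R by (field; lra).
  apply Rle_trans with (V * e * d)%R; [apply Rmult_le_compat_r; [lra|apply Rmult_le_compat_r; lra]|].
  replace (2 * V * e * (d - p * e))%R with (V * e * (2 * (d - p * e)))%R by ring.
  apply Rmult_le_compat_l; nra. }
assert (D3 : (Rabs (ln ((d + p * e) ^ 2 + (m * e) ^ 2) - ln ((d - p * e) ^ 2 + (m * e) ^ 2)) <= 16 * V * e / d)%R).
{ eapply Rle_trans; [apply (ln_diff_bound _ _ (d * d / 4)); nra|].
  replace ((d + p * e) ^ 2 + (m * e) ^ 2 - ((d - p * e) ^ 2 + (m * e) ^ 2))%R with (4 * d * (p * e))%R by ring.
  rewrite Rabs_mult, (Rabs_right (4 * d)) by lra. rewrite Rabs_mult, (Rabs_right e) by lra.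
  replace (4 * d * (Rabs p * e) / (d * d / 4))%R with (16 * (Rabs p * e) / d)%R by (field; lra).
  apply Rmult_le_compat_r; [left; apply Rinv_0_lt_compat; lra|]. 
  assert (Rabs p * e <= V * e)%R by (apply Rmult_le_compat_r; lra). lra. }
assert (D4 : (Rabs (- 2 * atan (m * e / (d + p * e)) - 2 * atan (m * e / (d - p * e))) <= 8 * V * e / d)%R).
{ replace (8 * V * e / d)%R with (4 * (2 * V * e / d))%R by (field; lra). apply Rabs_le. lra. }
replace (24 * V * e / d)%R with (16 * V * e / d + 8 * V * e / d)%R by (field; lra). lra.
Qed.

Lemma Rcont_line (f : C -> C) (v : C) (s t : R) :
  Ccont f (RtoC t + v * RtoC s) -> Rcont (fun t => f (RtoC t + v * RtoC s)) t.
Proof.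
intros H. replace (RtoC t + v * RtoC s) with (v * RtoC s + RtoC t * 1) in H by ring.
pose proof (Rcont_comp_affine f _ _ _ H) as K. intros e He. destruct (K e He) as [d [Hd Q]].
exists d; split; auto. intros u Hu. specialize (Q u Hu).
replace (v * s + u * 1) with (RtoC u + v * RtoC s) in Q by ring.
replace (v * s + t * 1) with (RtoC t + v * RtoC s) in Q by ring. exact Q.
Qed.

Lemma line_exists (D : C -> Prop) (f : C -> C) (v : C) (s a b : R) : (a <= b)%R -> HoloOn D f ->
  (forall t, (a <= t <= b)%R -> D (RtoC t + v * RtoC s)) -> exists l, isCI (fun t => f (RtoC t + v * RtoC s)) a b l.
Proof.
intros Hab Hf HD. apply isCI_exists; auto. intros t Ht. apply Rcont_line. eapply HoloOn_cont; eauto.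
Qed.

Lemma bound_near (f : C -> C) (v : C) (t y0 : R) : Ccont f (RtoC t + v * RtoC y0) ->
  exists d B : R, (0 < d)%R /\ (0 < B)%R /\ forall s, (Cmod v * Rabs (s - y0) < d)%R -> (Cmod (f (RtoC t + v * RtoC s)%C) <= B)%R.
Proof.
intros H. destruct (Ccont_bound _ _ H) as (d & B & Hd & HB & K). exists d, B. repeat split; auto.
intros s Hs. apply K. replace (t + v * s - (t + v * y0)) with (v * RtoC (s - y0)) by (rewrite RtoC_minus; ring).
now rewrite Cmod_mult, Cmod_R.
Qed.

Definition punctured (v : C) (t0 y0 T S : R) (w : C) : Prop :=
  exists s t : R, (Rabs (s - y0) < S)%R /\ (Rabs (t - t0) < T)%R /\ ~ (s = y0 /\ t = t0) /\ w = RtoC t + v * RtoC s.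

(** The cell is cut at t0 - dl and t0 + dl. On the outer pieces f is holomorphic, and Cauchy's
    theorem bounds the difference of the two lines by a multiple of e. On the middle piece f differs
    from rho/(w - p) by a bounded function, and [inv_line_jump] treats the principal part. *)
Lemma cell_jump (f : C -> C) (v : C) (t0 y0 T S r : R) (rho : C) :
  (Im v < 0)%R -> (0 < r < T)%R -> (0 < S)%R -> HoloOn (punctured v t0 y0 T S) f ->
  PoleAt f (RtoC t0 + v * RtoC y0) rho ->
  forall eps : R, (0 < eps)%R -> exists d : R, (0 < d)%R /\ forall (e : R) (I I' : C), (0 < e < d)%R ->
    isCI (fun t => f (RtoC t + v * RtoC (y0 + e))) (t0 - r) (t0 + r) I ->
    isCI (fun t => f (RtoC t + v * RtoC (y0 - e))) (t0 - r) (t0 + r) I' ->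
    (Cmod (I - I' - 2 * PI * Ci * rho) < eps)%R.
Proof.
intros Hv Hr HS Hf (eta & B & Heta & HB & HP) eps Heps.
set (V := Cmod v). assert (HV : (0 < V)%R).
{ apply Cmod_gt_0. intros E. rewrite E in Hv. simpl in Hv. lra. }
(* dl is fixed first: the bounded remainder costs at most 8 B dl <= eps/8. Only then is e taken
   small, because the bounds on the cuts and the error of the principal part depend on dl. *)
set (dl := Rmin (r / 2) (Rmin (eta / 4) (eps / (64 * B)))).
assert (Hdl : (0 < dl)%R) by (unfold dl; repeat apply Rmin_pos; try lra; apply Rdiv_lt_0_compat; lra).
assert (dl1 : (dl <= r / 2)%R) by apply Rmin_l.
assert (dl2 : (dl <= eta / 4)%R) by (eapply Rle_trans; [apply Rmin_r|apply Rmin_l]).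
assert (dl3 : (dl <= eps / (64 * B))%R) by (eapply Rle_trans; [apply Rmin_r|apply Rmin_r]).
assert (Dom : forall s t, (Rabs (s - y0) < S)%R -> (Rabs (t - t0) < T)%R -> s <> y0 \/ t <> t0 -> punctured v t0 y0 T S (RtoC t + v * RtoC s)).
{ intros s t H1 H2 H3. exists s, t. repeat split; auto. intros [? ?]. tauto. }
assert (Side : forall t, (Rabs (t - t0) < T)%R -> t <> t0 -> exists d B : R, (0 < d)%R /\ (0 < B)%R /\
  forall s, (V * Rabs (s - y0) < d)%R -> (Cmod (f (RtoC t + v * RtoC s)%C) <= B)%R).
{ intros t H1 H2. apply bound_near. eapply HoloOn_cont; [exact Hf|]. apply Dom; auto. rewrite Rminus_diag, Rabs_R0; auto. }
assert (Ab : forall t, (- r <= t - t0 <= r)%R -> (Rabs (t - t0) < T)%R) by (intros; apply Rabs_def1; lra).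
destruct (Side (t0 - r)%R) as (d1 & B1 & Hd1 & HB1 & K1); [apply Ab; lra|lra|].
destruct (Side (t0 - dl)%R) as (d2 & B2 & Hd2 & HB2 & K2); [apply Ab; lra|lra|].
destruct (Side (t0 + dl)%R) as (d3 & B3 & Hd3 & HB3 & K3); [apply Ab; lra|lra|].
destruct (Side (t0 + r)%R) as (d4 & B4 & Hd4 & HB4 & K4); [apply Ab; lra|lra|].
set (Bd := (B1 + B2 + B3 + B4)%R).
set (mm := Rmin (Rmin (Rmin d1 d2) (Rmin d3 d4)) (Rmin (eta / 4) (dl / 2))).
assert (Hmm : (0 < mm)%R) by (unfold mm; repeat apply Rmin_pos; lra).
pose proof (Cmod_ge_0 rho) as Hrho.
set (W := (16 * V * Bd + 24 * V * Cmod rho / dl + 1)%R).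
assert (HVB : (0 < V * Bd)%R) by (apply Rmult_lt_0_compat; unfold Bd; lra).
assert (HVr : (0 <= 24 * V * Cmod rho / dl)%R).
{ apply Rmult_le_pos; [nra|left; apply Rinv_0_lt_compat; lra]. }
assert (HW : (0 < W)%R) by (unfold W; lra).
exists (Rmin (S / 2) (Rmin (mm / V) (eps / (4 * W)))). split.
{ repeat apply Rmin_pos; try lra; apply Rdiv_lt_0_compat; lra. }
intros e I I' [He0 He] HI HI'.
assert (e1 : (e < S / 2)%R) by (eapply Rlt_le_trans; [exact He|apply Rmin_l]).
assert (e2 : (V * e < mm)%R).
{ assert (e < mm / V)%R by (eapply Rlt_le_trans; [exact He|eapply Rle_trans; [apply Rmin_r|apply Rmin_l]]).
  apply Rmult_lt_compat_l with (r := V) in H; auto. replace (V * (mm / V))%R with mm in H by (field; lra). auto. }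
assert (e3 : (e * W < eps / 4)%R).
{ assert (e < eps / (4 * W))%R by (eapply Rlt_le_trans; [exact He|eapply Rle_trans; [apply Rmin_r|apply Rmin_r]]).
  apply Rmult_lt_compat_r with (r := W) in H; auto. replace (eps / (4 * W) * W)%R with (eps / 4)%R in H by (field; lra). auto. }
assert (mm1 : (mm <= d1 /\ mm <= d2 /\ mm <= d3 /\ mm <= d4 /\ mm <= eta / 4 /\ mm <= dl / 2)%R).
{ unfold mm. pose proof (Rmin_l (Rmin (Rmin d1 d2) (Rmin d3 d4)) (Rmin (eta / 4) (dl / 2))).
  pose proof (Rmin_r (Rmin (Rmin d1 d2) (Rmin d3 d4)) (Rmin (eta / 4) (dl / 2))).
  pose proof (Rmin_l (Rmin d1 d2) (Rmin d3 d4)). pose proof (Rmin_r (Rmin d1 d2) (Rmin d3 d4)).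
  pose proof (Rmin_l d1 d2). pose proof (Rmin_r d1 d2). pose proof (Rmin_l d3 d4). pose proof (Rmin_r d3 d4).
  pose proof (Rmin_l (eta / 4) (dl / 2)). pose proof (Rmin_r (eta / 4) (dl / 2)). repeat split; lra. }
assert (Ys : forall s, (y0 - e <= s <= y0 + e)%R -> (V * Rabs (s - y0) < mm)%R).
{ intros s Hs. apply Rle_lt_trans with (V * e)%R; auto. apply Rmult_le_compat_l; [lra|]. apply Rabs_le; lra. }
assert (YS : forall s, (y0 - e <= s <= y0 + e)%R -> (Rabs (s - y0) < S)%R) by (intros; apply Rabs_def1; lra).
assert (Ex : forall s a b, (a <= b)%R -> (t0 - r <= a)%R -> (b <= t0 + r)%R -> (y0 - e <= s <= y0 + e)%R -> s <> y0 ->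
  exists l, isCI (fun t => f (RtoC t + v * RtoC s)) a b l).
{ intros s a b Hab Ha Hb Hs Hn. apply (line_exists _ _ _ _ _ _ Hab Hf). intros t Ht. apply Dom; auto. apply Ab; lra. }
destruct (Ex (y0 + e)%R (t0 - r)%R (t0 - dl)%R) as [P1 HP1]; try lra.
destruct (Ex (y0 + e)%R (t0 - dl)%R (t0 + dl)%R) as [P2 HP2]; try lra.
destruct (Ex (y0 + e)%R (t0 + dl)%R (t0 + r)%R) as [P3 HP3]; try lra.
destruct (Ex (y0 - e)%R (t0 - r)%R (t0 - dl)%R) as [M1 HM1]; try lra.
destruct (Ex (y0 - e)%R (t0 - dl)%R (t0 + dl)%R) as [M2 HM2]; try lra.
destruct (Ex (y0 - e)%R (t0 + dl)%R (t0 + r)%R) as [M3 HM3]; try lra.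
assert (EI : I = P1 + P2 + P3) by (eapply isCI_unique; [exact HI|]; repeat (eapply isCI_Chasles; eauto)).
assert (EI' : I' = M1 + M2 + M3) by (eapply isCI_unique; [exact HI'|]; repeat (eapply isCI_Chasles; eauto)).
assert (Out1 : (Cmod (P1 - M1) <= 8 * V * Bd * e)%R).
{ replace (8 * V * Bd * e)%R with (4 * Cmod v * Bd * ((y0 + e) - (y0 - e)))%R by (unfold V; ring).
  apply (cauchy_skew f v (t0 - T) (t0 - dl / 2) (y0 - S) (y0 + S) (t0 - r) (t0 - dl)); auto; try lra.
  - eapply HoloOn_sub; [|exact Hf]. intros w (s & t & Hs & Ht & ->). apply Dom; [apply Rabs_def1; lra|apply Rabs_def1; lra|right; lra].
  - intros s Hs. specialize (Ys s Hs). specialize (K1 s ltac:(lra)). specialize (K2 s ltac:(lra)). unfold Bd. lra. }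
assert (Out3 : (Cmod (P3 - M3) <= 8 * V * Bd * e)%R).
{ replace (8 * V * Bd * e)%R with (4 * Cmod v * Bd * ((y0 + e) - (y0 - e)))%R by (unfold V; ring).
  apply (cauchy_skew f v (t0 + dl / 2) (t0 + T) (y0 - S) (y0 + S) (t0 + dl) (t0 + r)); auto; try lra.
  - eapply HoloOn_sub; [|exact Hf]. intros w (s & t & Hs & Ht & ->). apply Dom; [apply Rabs_def1; lra|apply Rabs_def1; lra|right; lra].
  - intros s Hs. specialize (Ys s Hs). specialize (K3 s ltac:(lra)). specialize (K4 s ltac:(lra)). unfold Bd. lra. }
assert (Inn : forall s X, s <> y0 -> (y0 - e <= s <= y0 + e)%R -> isCI (fun t => f (RtoC t + v * RtoC s)) (t0 - dl) (t0 + dl) X ->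
   forall L, isCI (fun t => / (RtoC t + v * RtoC (s - y0))) (- dl) dl L -> (Cmod (X - rho * L) <= 4 * B * dl)%R).
{ intros s X Hs Hs' HX L HL.
  replace (4 * B * dl)%R with (2 * B * ((t0 + dl) - (t0 - dl)))%R by ring.
  apply isCI_bound with (fun t => f (RtoC t + v * RtoC s) - rho * / (RtoC (t - t0) + v * RtoC (s - y0))); [lra| |].
  - apply isCI_minus; auto. apply isCI_scal. 
    assert (HL2 : isCI (fun t => / (RtoC (1 * t + - t0) + v * RtoC (s - y0))) (t0 - dl) (t0 + dl) L).
    { destruct HL as [L1 L2]. split.
      - replace (- dl)%R with (1 * (t0 - dl) + - t0)%R in L1 by ring. replace dl with (1 * (t0 + dl) + - t0)%R in L1 at 2 by ring.
        pose proof (is_RInt_comp_lin _ _ _ _ _ _ L1) as Q. eapply is_RInt_ext; [|exact Q].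
        intros u _. unfold scal; simpl; unfold mult; simpl. ring.
      - replace (- dl)%R with (1 * (t0 - dl) + - t0)%R in L2 by ring. replace dl with (1 * (t0 + dl) + - t0)%R in L2 at 2 by ring.
        pose proof (is_RInt_comp_lin _ _ _ _ _ _ L2) as Q. eapply is_RInt_ext; [|exact Q].
        intros u _. unfold scal; simpl; unfold mult; simpl. ring. }
    eapply isCI_ext; [|exact HL2]. intros t. simpl. do 3 f_equal. ring.
  - intros t Ht. 
    replace (rho * / (RtoC (t - t0) + v * RtoC (s - y0))) with (rho / (RtoC t + v * RtoC s - (RtoC t0 + v * RtoC y0))).
    + apply HP. replace (RtoC t + v * RtoC s - (RtoC t0 + v * RtoC y0)) with (RtoC (t - t0) + v * RtoC (s - y0)) by (rewrite !RtoC_minus; ring).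
      split.
      * apply Cmod_gt_0. intros E. apply (f_equal Im) in E. rewrite Im_plus, Im_mult, !im_RtoC, re_RtoC in E.
        replace (0 + (Re v * 0 + Im v * (s - y0)))%R with (Im v * (s - y0))%R in E by ring. apply Rmult_integral in E. lra.
      * eapply Rle_lt_trans; [apply Cmod_triangle|]. rewrite Cmod_mult, !Cmod_R. fold V.
        specialize (Ys s Hs'). assert (Rabs (t - t0) <= dl)%R by (apply Rabs_le; lra). lra.
    + unfold Cdiv. do 2 f_equal. rewrite !RtoC_minus; ring. }
assert (HvN : Im v <> 0%R) by lra.
pose proof (inv_line_integral v e dl HvN ltac:(lra)) as HLp.
pose proof (inv_line_integral v (- e) dl HvN ltac:(lra)) as HLm.
match type of HLp with isCI _ _ _ ?l => set (Lp := l) in * end.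
match type of HLm with isCI _ _ _ ?l => set (Lm := l) in * end.
pose proof (inv_line_jump v e dl Lp Lm Hv He0 Hdl ltac:(fold V; lra) HLp HLm) as HJ. fold V in HJ.
pose proof (Inn (y0 + e)%R P2 ltac:(lra) ltac:(lra) HP2 Lp ltac:(replace (y0 + e - y0)%R with e by ring; exact HLp)) as J1.
pose proof (Inn (y0 - e)%R M2 ltac:(lra) ltac:(lra) HM2 Lm ltac:(replace (y0 - e - y0)%R with (- e)%R by ring; exact HLm)) as J2.
replace (I - I' - 2 * PI * Ci * rho) with
  ((P1 - M1) + ((P3 - M3) + ((P2 - rho * Lp) - (M2 - rho * Lm) + rho * (Lp - Lm - 2 * PI * Ci)))) by (rewrite EI, EI'; ring).
eapply Rle_lt_trans; [apply Cmod_triangle|].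
pose proof (Cmod_triangle (P3 - M3) ((P2 - rho * Lp) - (M2 - rho * Lm) + rho * (Lp - Lm - 2 * PI * Ci))).
pose proof (Cmod_triangle ((P2 - rho * Lp) - (M2 - rho * Lm)) (rho * (Lp - Lm - 2 * PI * Ci))).
pose proof (Cmod_tri' (P2 - rho * Lp) (M2 - rho * Lm)).
rewrite Cmod_mult in H0.
assert (Jr : (Cmod rho * Cmod (Lp - Lm - 2 * PI * Ci) <= 24 * V * Cmod rho / dl * e)%R).
{ replace (24 * V * Cmod rho / dl * e)%R with (Cmod rho * (24 * V * e / dl))%R by (field; lra). apply Rmult_le_compat_l; auto. }
assert (Jd : (8 * B * dl <= eps / 8)%R).
{ apply Rmult_le_compat_l with (r := (8 * B)%R) in dl3; [|lra]. replace (8 * B * (eps / (64 * B)))%R with (eps / 8)%R in dl3 by (field; lra). lra. }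
unfold W in e3. lra.
Qed.

Definition off_integers (v : C) (y0 S0 S1 : R) (w : C) : Prop :=
  exists s t : R, (S0 < s < S1)%R /\ ~ (s = y0 /\ exists m : Z, t = IZR m) /\ w = RtoC t + v * RtoC s.

(* Crossing the line s = y0, where all poles sit at integer t. *)
Lemma height_cross (f : C -> C) (v : C) (y0 y1 y2 S0 S1 Bd : R) (n0 : Z) (n : nat) (rho : Z -> C) (I1 I2 : C) :
  (Im v < 0)%R -> (S0 < y1)%R -> (y1 < y0)%R -> (y0 < y2)%R -> (y2 < S1)%R ->
  HoloOn (off_integers v y0 S0 S1) f ->
  (forall m : Z, PoleAt f (RtoC (IZR m) + v * RtoC y0) (rho m)) ->
  isCI (fun t => f (RtoC t + v * RtoC y1)) (IZR n0 - / 2) (IZR n0 - / 2 + INR n) I1 ->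
  isCI (fun t => f (RtoC t + v * RtoC y2)) (IZR n0 - / 2) (IZR n0 - / 2 + INR n) I2 ->
  (forall s, (y1 <= s <= y2)%R -> (Cmod (f (RtoC (IZR n0 - / 2) + v * RtoC s)%C) <= Bd)%R /\
     (Cmod (f (RtoC (IZR n0 - / 2 + INR n) + v * RtoC s)%C) <= Bd)%R) ->
  (Cmod (I2 - I1 - 2 * PI * Ci * zs rho n0 n) <= 4 * Cmod v * Bd * (y2 - y1))%R.
Proof.
intros Hv H1 H2 H3 H4 Hf HP HI1 HI2 HB.
assert (HBd : (0 <= Bd)%R) by (eapply Rle_trans; [apply Cmod_ge_0|apply (HB y1); lra]).
assert (Cell : forall c, off_integers v y0 S0 S1 c -> Ccont f c) by (intros; eapply HoloOn_cont; eauto).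
set (S := Rmin (y0 - S0) (S1 - y0)). assert (HS : (0 < S)%R) by (apply Rmin_pos; lra).
assert (S_1 : (S <= y0 - S0)%R) by apply Rmin_l. assert (S_2 : (S <= S1 - y0)%R) by apply Rmin_r.
assert (Ex : forall s a b, (a <= b)%R -> (S0 < s < S1)%R -> s <> y0 -> exists l, isCI (fun t => f (RtoC t + v * RtoC s)) a b l).
{ intros s a b Hab Hs Hn. apply (line_exists _ _ _ _ _ _ Hab Hf). intros t _. exists s, t. split; [lra|split; [tauto|auto]]. }
(* Very close to the line s = y0 the unit cells around the integers are treated one by one; their
   sides, at half-integers, meet no pole, and the jumps add up. *)
assert (Jump : forall n eps, (0 < eps)%R -> exists d : R, (0 < d)%R /\ forall (e : R) (I I' : C), (0 < e < d)%R -> (e < S)%R ->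
    isCI (fun t => f (RtoC t + v * RtoC (y0 + e))) (IZR n0 - / 2) (IZR n0 - / 2 + INR n) I ->
    isCI (fun t => f (RtoC t + v * RtoC (y0 - e))) (IZR n0 - / 2) (IZR n0 - / 2 + INR n) I' ->
    (Cmod (I - I' - 2 * PI * Ci * zs rho n0 n) < eps)%R).
{ clear n I1 I2 HI1 HI2 HB. induction n as [|n IH]; intros eps Heps.
  - exists 1%R. split; [lra|]. intros e I I' He HeS HI HI'.
    assert (Z0 : forall g l, isCI g (IZR n0 - / 2) (IZR n0 - / 2 + INR 0) l -> l = 0).
    { intros g l Hl. replace (IZR n0 - / 2 + INR 0)%R with (IZR n0 - / 2)%R in Hl by (simpl; ring).
      assert (Q : (Cmod l <= 0)%R).
      { destruct Hl as [K1 K2].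
        pose proof (is_RInt_unique _ _ _ _ K1) as E1. pose proof (is_RInt_unique _ _ _ _ K2) as E2.
        rewrite RInt_point in E1, E2.
        eapply Rle_trans; [apply Cmod_le_abs|]. rewrite <- E1, <- E2. unfold zero; simpl. rewrite Rabs_R0. lra. }
      apply Cmod_eq_0. pose proof (Cmod_ge_0 l). lra. }
    rewrite (Z0 _ _ HI), (Z0 _ _ HI'). unfold zs; simpl.
    replace (0 - 0 - 2 * PI * Ci * 0) with (RtoC 0) by ring. now rewrite Cmod_0.
  - destruct (IH (eps / 2)%R ltac:(lra)) as (d1 & Hd1 & K1).
    set (c := (n0 + Z.of_nat n)%Z).
    destruct (cell_jump f v (IZR c) y0 1 S (/ 2) (rho c) Hv ltac:(lra) HS) with (eps := (eps / 2)%R) as (d2 & Hd2 & K2); auto; try lra.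
    { eapply HoloOn_sub; [|exact Hf]. intros w (s & t & Hs & Ht & Hn & ->).
      apply Rabs_def2 in Hs. apply Rabs_def2 in Ht. exists s, t. repeat split; try lra.
      intros [-> [m ->]]. apply Hn. split; auto. f_equal.
      assert (IZR (m - c) < IZR 1)%R by (rewrite minus_IZR; lra). assert (IZR (-1) < IZR (m - c))%R by (rewrite minus_IZR; lra).
      apply lt_IZR in H. apply lt_IZR in H0. lia. }
    exists (Rmin d1 d2). split; [apply Rmin_pos; auto|]. intros e I I' He HeS HI HI'.
    pose proof (Rmin_l d1 d2). pose proof (Rmin_r d1 d2).
    rewrite S_INR in HI, HI'.
    assert (Ec1 : (IZR n0 - / 2 + INR n)%R = (IZR c - / 2)%R) by (unfold c; rewrite plus_IZR, <- INR_IZR_INZ; ring).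
    assert (Ec2 : (IZR n0 - / 2 + (INR n + 1))%R = (IZR c + / 2)%R) by (unfold c; rewrite plus_IZR, <- INR_IZR_INZ; field).
    pose proof (pos_INR n).
    destruct (Ex (y0 + e)%R (IZR n0 - / 2)%R (IZR n0 - / 2 + INR n)%R) as [P1 HP1]; try lra.
    destruct (Ex (y0 - e)%R (IZR n0 - / 2)%R (IZR n0 - / 2 + INR n)%R) as [M1 HM1]; try lra.
    destruct (Ex (y0 + e)%R (IZR c - / 2)%R (IZR c + / 2)%R) as [P2 HP2]; try lra.
    destruct (Ex (y0 - e)%R (IZR c - / 2)%R (IZR c + / 2)%R) as [M2 HM2]; try lra.
    assert (EI : I = P1 + P2).
    { eapply isCI_unique; [exact HI|]. rewrite Ec2. eapply isCI_Chasles; [exact HP1|]. rewrite Ec1. exact HP2. }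
    assert (EI' : I' = M1 + M2).
    { eapply isCI_unique; [exact HI'|]. rewrite Ec2. eapply isCI_Chasles; [exact HM1|]. rewrite Ec1. exact HM2. }
    rewrite zs_S. fold c.
    replace (I - I' - 2 * PI * Ci * (zs rho n0 n + rho c)) with
      ((P1 - M1 - 2 * PI * Ci * zs rho n0 n) + (P2 - M2 - 2 * PI * Ci * rho c)) by (rewrite EI, EI'; ring).
    eapply Rle_lt_trans; [apply Cmod_triangle|].
    pose proof (K1 e P1 M1 ltac:(lra) ltac:(lra) HP1 HM1). pose proof (K2 e P2 M2 ltac:(lra) HP2 HM2). lra. }
(* The heights y0 - e and y0 + e split the crossing into two pole-free parallelograms and a thin
   layer, whose error eps absorbs. *)
apply le_epsilon. intros eps Heps.
destruct (Jump n eps Heps) as (d & Hd & K).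
set (e := Rmin (d / 2) (Rmin (S / 2) (Rmin ((y0 - y1) / 2) ((y2 - y0) / 2)))).
assert (He : (0 < e)%R) by (unfold e; repeat apply Rmin_pos; lra).
assert (E1 : (e <= d / 2)%R) by apply Rmin_l.
assert (E2 : (e <= S / 2)%R) by (eapply Rle_trans; [apply Rmin_r|apply Rmin_l]).
assert (E3 : (e <= (y0 - y1) / 2)%R) by (eapply Rle_trans; [apply Rmin_r|eapply Rle_trans; [apply Rmin_r|apply Rmin_l]]).
assert (E4 : (e <= (y2 - y0) / 2)%R) by (eapply Rle_trans; [apply Rmin_r|eapply Rle_trans; [apply Rmin_r|apply Rmin_r]]).
pose proof (pos_INR n).
destruct (Ex (y0 + e)%R (IZR n0 - / 2)%R (IZR n0 - / 2 + INR n)%R) as [P HPp]; try lra.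
destruct (Ex (y0 - e)%R (IZR n0 - / 2)%R (IZR n0 - / 2 + INR n)%R) as [M HMm]; try lra.
pose proof (K e P M ltac:(lra) ltac:(lra) HPp HMm) as K1.
assert (K2 : (Cmod (I2 - P) <= 4 * Cmod v * Bd * (y2 - (y0 + e)))%R).
{ apply (cauchy_skew f v (IZR n0 - 1) (IZR n0 + INR n) y0 S1 (IZR n0 - / 2) (IZR n0 - / 2 + INR n)); auto; try lra.
  - eapply HoloOn_sub; [|exact Hf]. intros w (s & t & Hs & Ht & ->). exists s, t. split; [lra|split; [intros [? _]; lra|auto]].
  - intros s Hs. apply HB; lra. }
assert (K3 : (Cmod (M - I1) <= 4 * Cmod v * Bd * (y0 - e - y1))%R).
{ apply (cauchy_skew f v (IZR n0 - 1) (IZR n0 + INR n) S0 y0 (IZR n0 - / 2) (IZR n0 - / 2 + INR n)); auto; try lra.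
  - eapply HoloOn_sub; [|exact Hf]. intros w (s & t & Hs & Ht & ->). exists s, t. split; [lra|split; [intros [? _]; lra|auto]].
  - intros s Hs. apply HB; lra. }
replace (I2 - I1 - 2 * PI * Ci * zs rho n0 n) with ((I2 - P) + ((M - I1) + (P - M - 2 * PI * Ci * zs rho n0 n))) by ring.
eapply Rle_trans; [apply Cmod_triangle|].
pose proof (Cmod_triangle (M - I1) (P - M - 2 * PI * Ci * zs rho n0 n)).
assert (0 <= Cmod v * Bd * e)%R by (apply Rmult_le_pos; [apply Rmult_le_pos; [apply Cmod_ge_0|lra]|lra]).
lra.
Qed.

(** * Integrals over the real line *)

Definition is_line (f : R -> C) (l : C) : Prop :=
  forall eps : R, (0 < eps)%R -> exists T : R, forall (a b : R) (I : C), (a <= - T)%R -> (T <= b)%R -> isCI f a b I ->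
    (Cmod (I - l) < eps)%R.

Lemma is_line_ext (f g : R -> C) (l : C) : (forall t, f t = g t) -> is_line f l -> is_line g l.
Proof.
intros E H e He. destruct (H e He) as [T HT]. exists T. intros a b I Ha Hb HI. apply (HT a b); auto.
now apply isCI_ext with g.
Qed.

(** [is_line] speaks about those integrals that exist and is vacuous for an f without integrals over
    large intervals. Continuity of f supplies them, here and in the lemmas on sums and
    uniqueness. *)
Lemma is_line_scal (c : C) (f : R -> C) (l : C) : (forall t, Rcont f t) -> is_line f l -> is_line (fun t => c * f t) (c * l).
Proof.
intros Hf H e He. pose proof (Cmod_ge_0 c) as Hc.
destruct (H (e / (Cmod c + 1))%R) as [T HT]; [apply Rdiv_lt_0_compat; lra|].
exists (Rmax T 0). pose proof (Rmax_l T 0). pose proof (Rmax_r T 0). intros a b I Ha Hb HI.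
destruct (isCI_exists f a b ltac:(lra) (fun t _ => Hf t)) as [J HJ].
rewrite (isCI_unique _ _ _ _ _ HI (isCI_scal c _ _ _ _ HJ)).
specialize (HT a b J ltac:(lra) ltac:(lra) HJ).
replace (c * J - c * l) with (c * (J - l)) by ring. rewrite Cmod_mult.
apply Rle_lt_trans with ((Cmod c) * (e / (Cmod c + 1)))%R; [apply Rmult_le_compat_l; lra|].
apply Rlt_le_trans with ((Cmod c + 1) * (e / (Cmod c + 1)))%R; [|right; field; lra].
apply Rmult_lt_compat_r; [apply Rdiv_lt_0_compat; lra|lra].
Qed.

Lemma is_line_plus (f g : R -> C) (l m : C) : (forall t, Rcont f t) -> (forall t, Rcont g t) ->
  is_line f l -> is_line g m -> is_line (fun t => f t + g t) (l + m).
Proof.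
intros Hf Hg H K e He.
destruct (H (e / 2)%R ltac:(lra)) as [T HT]. destruct (K (e / 2)%R ltac:(lra)) as [S HS].
exists (Rmax (Rmax T S) 0). pose proof (Rmax_l (Rmax T S) 0). pose proof (Rmax_r (Rmax T S) 0).
pose proof (Rmax_l T S). pose proof (Rmax_r T S). intros a b I Ha Hb HI.
destruct (isCI_exists f a b ltac:(lra) (fun t _ => Hf t)) as [J HJ].
destruct (isCI_exists g a b ltac:(lra) (fun t _ => Hg t)) as [J' HJ'].
rewrite (isCI_unique _ _ _ _ _ HI (isCI_plus _ _ _ _ _ _ HJ HJ')).
specialize (HT a b J ltac:(lra) ltac:(lra) HJ). specialize (HS a b J' ltac:(lra) ltac:(lra) HJ').
replace (J + J' - (l + m)) with ((J - l) + (J' - m)) by ring.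
eapply Rle_lt_trans; [apply Cmod_triangle|]. lra.
Qed.

(** The slack of 1 at both ends admits the windows from 1/2 - kN to 1/2 + kN that serve for the
    contour integrals. *)
Lemma is_line_Clim (f : R -> C) (l : C) (a b : nat -> R) (I : nat -> C) : is_line f l ->
  (forall N, (a N <= - INR N + 1)%R) -> (forall N, (INR N - 1 <= b N)%R) -> (forall N, isCI f (a N) (b N) (I N)) -> Clim I l.
Proof.
intros H Ha Hb HI e He. destruct (H e He) as [T HT].
destruct (INR_unbounded (T + 1)) as [N0 HN0]. exists N0. intros N HN. apply le_INR in HN.
apply (HT (a N) (b N)); auto; [specialize (Ha N); lra|specialize (Hb N); lra].
Qed.

Lemma is_line_unique (f : R -> C) (l m : C) : (forall t, Rcont f t) -> is_line f l -> is_line f m -> l = m.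
Proof.
intros Hf H K.
assert (E : forall N : nat, (- INR N <= INR N)%R) by (intros; pose proof (pos_INR N); lra).
set (I := fun N : nat => (RInt (fun t => Re (f t)) (- INR N) (INR N), RInt (fun t => Im (f t)) (- INR N) (INR N)) : C).
assert (HI : forall N, isCI f (- INR N) (INR N) (I N)).
{ intros N. destruct (isCI_exists f _ _ (E N) (fun t _ => Hf t)) as [J [J1 J2]]. unfold I, isCI. cbn [Re Im fst snd].
  rewrite (is_RInt_unique _ _ _ _ J1), (is_RInt_unique _ _ _ _ J2). split; assumption. }
apply (Clim_unique I); [apply (is_line_Clim f l (fun N => - INR N)%R INR)|apply (is_line_Clim f m (fun N => - INR N)%R INR)]; auto; intros; lra.
Qed.

(** G/(1 + t^2) has the primitive G atan t, and PI/2 - atan a = atan(1/a) <= 1/a; the factor 2 is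
    that of [isCI_bound_fun]. *)
Lemma tail_bound (f : R -> C) (G a b : R) (I : C) : (0 <= G)%R -> (0 < a)%R -> (a <= b)%R ->
  (forall t, (a <= t)%R -> (Cmod (f t) <= G / (1 + t * t))%R) -> isCI f a b I -> (Cmod I <= 2 * G / a)%R.
Proof.
intros HG Ha Hab Hf HI.
assert (HG2 : is_RInt (fun t => G / (1 + t * t))%R a b (G * atan b - G * atan a)%R).
{ apply (is_RInt_derive (V := R_CompleteNormedModule) (fun t => (G * atan t)%R)).
  + intros t _. auto_derive; auto. field. nra.
  + intros t _. apply (ex_derive_continuous (fun t => G / (1 + t * t))%R). auto_derive. nra. }
eapply Rle_trans; [apply (isCI_bound_fun f _ a b I _ Hab HI HG2)|].
- intros t Ht. apply Hf. lra.
- pose proof (atan_bound b) as Hb. pose proof (atan_inv a Ha) as Hi.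
  pose proof (atan_le_id (/ a) (Rlt_le _ _ (Rinv_0_lt_compat _ Ha))) as Hl.
  unfold Rdiv. nra.
Qed.

Lemma isCI_neg (f : R -> C) (a b : R) (I : C) : isCI f a b I -> isCI (fun t => f (- t)%R) (- b) (- a) I.
Proof.
intros [H1 H2]. split.
- replace b with (- - b)%R in H1 by ring. replace a with (- - a)%R in H1 by ring.
  pose proof (is_RInt_comp_opp _ _ _ _ (is_RInt_swap _ _ _ _ H1)) as Q.
  apply (is_RInt_ext _ _ _ _ _ (fun x _ => eq_refl)) in Q.
  apply is_RInt_opp in Q. rewrite opp_opp in Q. eapply is_RInt_ext; [|exact Q]. intros t _. apply opp_opp.
- replace b with (- - b)%R in H2 by ring. replace a with (- - a)%R in H2 by ring.
  pose proof (is_RInt_comp_opp _ _ _ _ (is_RInt_swap _ _ _ _ H2)) as Q.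
  apply is_RInt_opp in Q. rewrite opp_opp in Q. eapply is_RInt_ext; [|exact Q]. intros t _. apply opp_opp.
Qed.

Lemma is_line_exists (f : R -> C) (G : R) : (0 <= G)%R -> (forall t, Rcont f t) ->
  (forall t, (Cmod (f t) <= G / (1 + t * t))%R) -> exists l, is_line f l.
Proof.
intros HG Hc Hf.
assert (E : forall N : nat, (- INR N <= INR N)%R) by (intros; pose proof (pos_INR N); lra).
set (I := fun N : nat => (RInt (fun t => Re (f t)) (- INR N) (INR N), RInt (fun t => Im (f t)) (- INR N) (INR N)) : C).
assert (HI : forall N, isCI f (- INR N) (INR N) (I N)).
{ intros N. destruct (isCI_exists f _ _ (E N) (fun t _ => Hc t)) as [J [J1 J2]]. unfold I, isCI. cbn [Re Im fst snd].
  rewrite (is_RInt_unique _ _ _ _ J1), (is_RInt_unique _ _ _ _ J2). split; assumption. }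
assert (Cmp : forall a b a' b' X Y, (0 < a)%R -> (0 < b)%R -> (a <= a')%R -> (b <= b')%R -> isCI f (- a) b X -> isCI f (- a') b' Y ->
  (Cmod (Y - X) <= 2 * G / a + 2 * G / b)%R).
{ intros a b a' b' X Y Ha Hb Haa Hbb HX HY.
  destruct (isCI_exists f (- a') (- a) ltac:(lra) (fun t _ => Hc t)) as [P HP].
  destruct (isCI_exists f b b' ltac:(lra) (fun t _ => Hc t)) as [Q HQ].
  assert (EY : Y = P + X + Q) by (eapply isCI_unique; [exact HY|]; repeat (eapply isCI_Chasles; eauto)).
  replace (Y - X) with (P + Q) by (rewrite EY; ring). eapply Rle_trans; [apply Cmod_triangle|].
  apply Rplus_le_compat.
  - apply isCI_neg in HP. rewrite !Ropp_involutive in HP. apply (tail_bound (fun t => f (- t)%R) G a a'); auto.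
    intros t Ht. eapply Rle_trans; [apply Hf|]. right. f_equal. ring.
  - apply (tail_bound f G b b'); auto. }
assert (Cau : forall e, (0 < e)%R -> exists N0 : nat, forall N M : nat, (N0 <= N)%nat -> (N0 <= M)%nat -> (Cmod (I M - I N) < e)%R).
{ intros e He. destruct (INR_unbounded (8 * G / e + 1)) as [N0 HN0]. exists N0.
  assert (W : forall N M : nat, (N0 <= N)%nat -> (N <= M)%nat -> (Cmod (I M - I N) < e)%R).
  { intros N M H1 H2. apply le_INR in H1. apply le_INR in H2.
    assert (HGe : (0 <= 8 * G / e)%R) by (apply Rmult_le_pos; [lra|left; now apply Rinv_0_lt_compat]).
    eapply Rle_lt_trans; [apply (Cmp (INR N) (INR N) (INR M) (INR M)); auto; lra|].
    assert (Q : (2 * G / INR N < e / 2)%R).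
    { apply Rmult_lt_reg_r with (INR N / e)%R; [apply Rdiv_lt_0_compat; lra|].
      replace (2 * G / INR N * (INR N / e))%R with (8 * G / e / 4)%R by (field; lra).
      replace (e / 2 * (INR N / e))%R with (INR N / 2)%R by (field; lra). lra. }
    lra. }
  intros N M H1 H2. destruct (Nat.le_ge_cases N M); [apply W; auto|]. rewrite Cmod_minus_sym. apply W; auto. }
assert (L : exists l, Clim I l).
{ assert (X1 : ex_finite_lim_seq (fun n => Re (I n))).
  { apply ex_lim_seq_cauchy_corr. intros e. destruct (Cau e (cond_pos e)) as [N0 HN]. exists N0. intros n m Hn Hm.
    eapply Rle_lt_trans; [|apply (HN m n Hm Hn)]. eapply Rle_trans; [|apply re_le_Cmod]. creim. lra. }
  assert (X2 : ex_finite_lim_seq (fun n => Im (I n))).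
  { apply ex_lim_seq_cauchy_corr. intros e. destruct (Cau e (cond_pos e)) as [N0 HN]. exists N0. intros n m Hn Hm.
    eapply Rle_lt_trans; [|apply (HN m n Hm Hn)]. eapply Rle_trans; [|apply im_le_Cmod]. creim. lra. }
  destruct X1 as [l1 H1]. destruct X2 as [l2 H2]. exists (l1, l2). intros e He.
  apply is_lim_seq_spec in H1. apply is_lim_seq_spec in H2.
  assert (He2 : (0 < e / 2)%R) by lra.
  destruct (H1 (mkposreal _ He2)) as [N1 K1]. destruct (H2 (mkposreal _ He2)) as [N2 K2].
  exists (Nat.max N1 N2). intros n Hn. specialize (K1 n ltac:(lia)). specialize (K2 n ltac:(lia)).
  change (Rabs (Re (I n) - l1) < e / 2)%R in K1. change (Rabs (Im (I n) - l2) < e / 2)%R in K2. eapply Rle_lt_trans; [apply Cmod_le_abs|]. creim. change (Re (l1, l2)) with l1. change (Im (l1, l2)) with l2. lra. }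
destruct L as [l Hl]. exists l. intros e He.
destruct (Hl (e / 2)%R ltac:(lra)) as [N1 K1].
destruct (INR_unbounded (8 * G / e + 1 + INR N1)) as [N0 HN0].
assert (HGe : (0 <= 8 * G / e)%R) by (apply Rmult_le_pos; [lra|left; now apply Rinv_0_lt_compat]).
pose proof (pos_INR N1) as HP1.
exists (INR N0). intros a b J Ha Hb HJ.
assert (HN : (N1 <= N0)%nat) by (apply INR_le; lra).
replace (J - l) with ((J - I N0) + (I N0 - l)) by ring. eapply Rle_lt_trans; [apply Cmod_triangle|].
specialize (K1 N0 HN).
assert (Q : (Cmod (J - I N0) <= 2 * G / INR N0 + 2 * G / INR N0)%R).
{ apply (Cmp (INR N0) (INR N0) (- a)%R b); auto; try lra. rewrite Ropp_involutive. auto. }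
assert (Q2 : (2 * G / INR N0 < e / 4)%R).
{ apply Rmult_lt_reg_r with (INR N0 / e)%R; [apply Rdiv_lt_0_compat; lra|].
  replace (2 * G / INR N0 * (INR N0 / e))%R with (8 * G / e / 4)%R by (field; lra).
  replace (e / 4 * (INR N0 / e))%R with (INR N0 / 4)%R by (field; lra). lra. }
lra.
Qed.

Lemma is_line_CInt (f : R -> C) (l : C) : (forall t, Rcont f t) -> is_line f l -> CInt_line f = l.
Proof.
intros Hc H. unfold CInt_line.
refine (@is_RInt_gen_unique C_R_CompleteNormedModule (Rbar_locally m_infty) (Rbar_locally p_infty) _ _ f l _).
intros P HP. destruct HP as [e He]. 
destruct (H (e / 1)%R) as [T HT]; [pose proof (cond_pos e); lra|].
assert (K : forall a b, (a < - Rabs T - 1)%R -> (Rabs T + 1 < b)%R -> exists y, is_RInt (V := C_R_NormedModule) f a b y /\ P y).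
{ intros a b Ha Hb. pose proof (Rle_abs T). pose proof (Rabs_pos T).
  destruct (isCI_exists f a b ltac:(lra) (fun t _ => Hc t)) as [J HJ]. exists J. split.
  - destruct HJ as [J1 J2]. pose proof (is_RInt_fct_extend_pair (U := R_NormedModule) (V := R_NormedModule) f a b (Re J) (Im J) J1 J2) as Q.
    destruct J. exact Q.
  - apply He. apply C_NormedModule_mixin_compat1. specialize (HT a b J ltac:(lra) ltac:(lra) HJ).
    unfold Rdiv in HT. rewrite Rinv_1, Rmult_1_r in HT. exact HT. }
apply Filter_prod with (fun a => (a < - Rabs T - 1)%R) (fun b => (Rabs T + 1 < b)%R).
- exists (- Rabs T - 1)%R. auto.
- exists (Rabs T + 1)%R. auto.
- intros a b Ha Hb. apply K; auto.
Qed.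

(** With q = e^{2 pi i tau} this is (-1)^n q^{(3n^2 + dn)/2}. The value d = 1 gives Euler's
    pentagonal series; d = -1, 1, 3 arise from the Mordell terms. *)
Definition pent (d : Z) (tau : C) (n : Z) : C :=
  Cexp (PI * Ci * IZR n + PI * Ci * tau * (3 * IZR n * IZR n + IZR d * IZR n)).

Lemma pent_summable (d : Z) (tau : C) : (0 < Im tau)%R -> zsummable (pent d tau).
Proof.
intros Ht. pose proof PI_RGT_0 as Hpi.
apply (zsummable_gauss _ 1 (3 * PI * Im tau) (PI * Im tau * Rabs (IZR d))); [nra|lra|].
intros n. unfold pent. rewrite Cmod_Cexp, Rmult_1_l.
assert (E : Re (PI * Ci * IZR n + PI * Ci * tau * (3 * IZR n * IZR n + IZR d * IZR n)) =
  (- (3 * PI * Im tau) * (IZR n * IZR n) - PI * Im tau * (IZR d * IZR n))%R).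
{ creim. ring. }
rewrite E.
assert (L : (- (3 * PI * Im tau) * (IZR n * IZR n) - PI * Im tau * (IZR d * IZR n) <=
   - (3 * PI * Im tau) * (IZR n * IZR n) + PI * Im tau * Rabs (IZR d) * Rabs (IZR n))%R).
{ rewrite Rmult_assoc with (r3 := Rabs (IZR n)). rewrite <- Rabs_mult. pose proof (Rle_abs (- (IZR d * IZR n))) as Q. rewrite Rabs_Ropp in Q.
  assert (0 < PI * Im tau)%R by nra. nra. }
destruct L as [L|L]; [left; now apply exp_increasing|right; now rewrite L].
Qed.

Lemma pent_neg (tau : C) (l : C) : is_zsum (pent 1 tau) l -> is_zsum (pent (-1) tau) l.
Proof.
intros H. apply is_zsum_opp in H. eapply is_zsum_ext; [|exact H]. intros n. unfold pent.
apply Cexp_eq with (- n)%Z. rewrite !opp_IZR, !RtoC_opp. ring.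
Qed.

(** The substitution n -> -1 - n preserves 3n^2 + 3n and changes the sign, so the sum is its own
    negative. *)
Lemma pent_3 (tau : C) : (0 < Im tau)%R -> is_zsum (pent 3 tau) 0.
Proof.
intros Ht. destruct (zsummable_CSeries _ (pent_summable 3 tau Ht)) as (_ & _ & H).
match type of H with is_zsum _ ?l => set (S := l) in * end.
assert (H2 : is_zsum (pent 3 tau) (- (1) * S)).
{ pose proof (is_zsum_scal (- (1)) _ _ (is_zsum_opp _ _ (is_zsum_shift (-1) _ _ H))) as Q.
  eapply is_zsum_ext; [|exact Q]. intros n. simpl. rewrite <- Cexp_PI. unfold pent. rewrite <- Cexp_plus.
  apply Cexp_eq with (- n)%Z. rewrite !plus_IZR, !opp_IZR, !RtoC_plus, !RtoC_opp. ring. }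
assert (E : S = - (1) * S) by (eapply is_zsum_unique; eauto).
assert (S0 : S = 0).
{ replace S with ((S + S) / 2) by (field; apply C2_neq_0). rewrite E at 2. unfold Cdiv. ring. }
rewrite <- S0. exact H.
Qed.

(** * Signs, bounds for sinh and Gaussian domination *)

Ltac cpush := repeat progress rewrite ?plus_IZR, ?minus_IZR, ?mult_IZR, ?opp_IZR, ?RtoC_plus, ?RtoC_minus, ?RtoC_mult, ?RtoC_opp.

(** (-1)^n as an exponential: signs merge with the other exponentials, and parity questions become
    choices of the integer in [Cexp_eq]. *)
Definition sgn (n : Z) : C := Cexp (PI * Ci * IZR n).

Lemma sgn_plus (m n : Z) : sgn (m + n) = sgn m * sgn n.
Proof. unfold sgn. rewrite <- Cexp_plus. f_equal. cpush. ring. Qed.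

Lemma sgn_sqr (n : Z) : sgn n * sgn n = 1.
Proof. unfold sgn. rewrite <- Cexp_plus. rewrite <- (Cexp_2PIn n). f_equal. ring. Qed.

Lemma sgn_inv (n : Z) : / sgn n = sgn n.
Proof.
assert (H : sgn n <> 0) by apply Cexp_neq_0.
rewrite <- (Cmult_1_l (/ sgn n)), <- (sgn_sqr n). field. auto.
Qed.

Lemma sgn_1 : sgn 1 = - (1).
Proof. unfold sgn. rewrite Cmult_1_r. apply Cexp_PI. Qed.

Lemma sgn_0 : sgn 0 = 1.
Proof. unfold sgn. rewrite Cmult_0_r. apply Cexp_0. Qed.

Lemma antiper_sgn (f : C -> C) (n : Z) (u : C) :
  (forall u, f (u + PI * Ci) = - f u) -> f (u + PI * Ci * IZR n) = sgn n * f u.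
Proof.
intros H.
assert (S : forall n : nat, forall u, f (u + PI * Ci * IZR (Z.of_nat n)) = sgn (Z.of_nat n) * f u).
{ clear n u. induction n as [|n IH]; intros u.
  - simpl. rewrite sgn_0. replace (u + PI * Ci * 0) with u by ring. ring.
  - replace (Z.of_nat (Datatypes.S n)) with (Z.of_nat n + 1)%Z by lia.
    rewrite sgn_plus, sgn_1. replace (u + PI * Ci * IZR (Z.of_nat n + 1)) with (u + PI * Ci * IZR (Z.of_nat n) + PI * Ci) by (cpush; ring).
    rewrite H, IH. ring. }
destruct (Z_le_gt_dec 0 n) as [Hn|Hn].
- rewrite <- (Z2Nat.id n Hn). apply S.
- pose proof (S (Z.to_nat (- n)) (u + PI * Ci * IZR n)) as E. rewrite Z2Nat.id in E by lia.
  replace (u + PI * Ci * IZR n + PI * Ci * IZR (- n)) with u in E by (cpush; ring).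
  assert (E2 : sgn n * sgn (- n) = 1) by (rewrite <- sgn_plus, Z.add_opp_diag_r; apply sgn_0).
  rewrite E. rewrite Cmult_assoc, E2. ring.
Qed.

Lemma Csinh_sgn (n : Z) (u : C) : Csinh (u + PI * Ci * IZR n) = sgn n * Csinh u.
Proof. apply antiper_sgn. apply Csinh_PI. Qed.

Lemma Rabs_sinh_le_Cmod (u : C) : (sinh (Rabs (Re u)) <= Cmod (Csinh u))%R.
Proof.
unfold Csinh. rewrite Cmod_div by apply C2_neq_0. rewrite Cmod_R, (Rabs_right 2) by lra. unfold sinh.
apply Rmult_le_compat_r; [lra|].
unfold Rabs. destruct (Rcase_abs (Re u)) as [Hneg|Hpos].
- rewrite Ropp_involutive. pose proof (Cmod_tri_rev (Cexp (- u)) (Cexp u)) as H. rewrite !Cmod_Cexp, Re_opp in H.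
  rewrite Cmod_minus_sym. lra.
- pose proof (Cmod_tri_rev (Cexp u) (Cexp (- u))) as H. rewrite !Cmod_Cexp, Re_opp in H. lra.
Qed.

Lemma sinh_incr_le (a b : R) : (a <= b)%R -> (sinh a <= sinh b)%R.
Proof. intros [H| ->]; [|lra]. unfold sinh. pose proof (exp_increasing _ _ H). pose proof (exp_increasing (- b) (- a) ltac:(lra)). lra. Qed.

Lemma sinh_pos (a : R) : (0 < a)%R -> (0 < sinh a)%R.
Proof. intros H. unfold sinh. pose proof (exp_increasing (- a) a ltac:(lra)). lra. Qed.

(** With this default value, identities such as the antiperiodicity of 1/sinh hold at the poles as
    well. *)
Lemma Cinv_0 : / (RtoC 0) = 0.
Proof. apply C_ext; simpl; unfold Rdiv; rewrite ?Rmult_0_l, ?Ropp_0, ?Rmult_0_l; auto. Qed.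

Lemma PoleAt_Csum (f : nat -> C -> C) (p : C) (r : nat -> C) (n : nat) :
  (forall i, (i < n)%nat -> PoleAt (f i) p (r i)) -> PoleAt (fun w => Csum (fun i => f i w) n) p (Csum r n).
Proof.
induction n as [|n IH]; intros H; simpl.
- apply PoleAt_cont, Ccont_const.
- apply PoleAt_plus; [apply IH; intros; apply H; lia|apply H; lia].
Qed.

Lemma HoloOn_Csum (D : C -> Prop) (f : nat -> C -> C) (n : nat) :
  (forall i, (i < n)%nat -> HoloOn D (f i)) -> HoloOn D (fun w => Csum (fun i => f i w) n).
Proof.
induction n as [|n IH]; intros H; simpl; [apply HoloOn_const|].
apply HoloOn_plus; [apply IH; intros; apply H; lia|apply H; lia].
Qed.

Lemma HoloOn_Cder (D : C -> Prop) (f : C -> C) (w : C) : HoloOn D f -> D w -> exists l, Cder f w l.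
Proof. intros [f' H] Hw. exists (f' w). apply H; auto. Qed.

Lemma zs_zero (u : Z -> C) (a : Z) (n : nat) :
  (forall i : Z, (a <= i < a + Z.of_nat n)%Z -> u i = 0) -> zs u a n = 0.
Proof. intros H. apply Csum_zero. intros. apply H. lia. Qed.

Lemma zs_delta (c : C) (a : Z) (n : nat) : (a <= 0 < a + Z.of_nat n)%Z ->
  zs (fun m => if Z.eq_dec m 0 then c else 0) a n = c.
Proof.
intros H. replace n with (Z.to_nat (- a) + (1 + (n - 1 - Z.to_nat (- a))))%nat by lia.
rewrite zs_add, zs_add. replace (a + Z.of_nat (Z.to_nat (- a)))%Z with 0%Z by lia.
rewrite zs_zero.
2:{ intros i Hi. destruct (Z.eq_dec i 0); [lia|auto]. }
rewrite (zs_zero _ (0 + Z.of_nat 1)).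
2:{ intros i Hi. destruct (Z.eq_dec i 0); [lia|auto]. }
unfold zs. simpl. ring.
Qed.

(** As 1 + t^2 <= e^{2|t|}, it remains to maximise -al t^2 + (B + 2)|t|, which gives the exponent (B
    + 2)^2/(4 al). *)
Lemma gauss_dom (al B : R) : (0 < al)%R -> exists G : R, (0 < G)%R /\
  forall t, (exp (- al * (t * t) + B * Rabs t) <= G / (1 + t * t))%R.
Proof.
intros Hal. exists (exp ((B + 2) * (B + 2) / (4 * al))). split; [apply exp_pos|]. intros t.
assert (Ht : (0 < 1 + t * t)%R) by nra.
apply Rmult_le_reg_r with (1 + t * t)%R; auto. unfold Rdiv at 1. rewrite Rmult_assoc, Rinv_l, Rmult_1_r by lra.
set (s := Rabs t). assert (Hs : (t * t = s * s)%R) by (unfold s; rewrite <- Rabs_mult; symmetry; apply Rabs_right; nra).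
rewrite Hs. assert (Hs0 : (0 <= s)%R) by apply Rabs_pos.
assert (E1 : (1 + s * s <= exp (2 * s))%R).
{ pose proof (exp_ineq1_le s). replace (2 * s)%R with (s + s)%R by ring. rewrite exp_plus. nra. }
apply Rle_trans with (exp (- al * (s * s) + B * s) * exp (2 * s))%R.
- apply Rmult_le_compat_l; [left; apply exp_pos|auto].
- rewrite <- exp_plus.
  assert (L : (- al * (s * s) + B * s + 2 * s <= (B + 2) * (B + 2) / (4 * al))%R).
  { apply Rmult_le_reg_l with (4 * al)%R; [lra|].
    replace (4 * al * ((B + 2) * (B + 2) / (4 * al)))%R with ((B + 2) * (B + 2))%R by (field; lra).
    pose proof (Rle_0_sqr (2 * al * s - (B + 2))) as Q. unfold Rsqr in Q. nra. }
  destruct L as [L|L]; [left; now apply exp_increasing|right; now rewrite L].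
Qed.

Lemma int_dom (a b : R) (G : R) : (a <= b)%R -> exists L, is_RInt (fun t => G / (1 + t * t))%R a b L /\ (0 <= G -> L <= G * PI)%R.
Proof.
intros Hab. exists (G * atan b - G * atan a)%R. split.
- apply (is_RInt_derive (V := R_CompleteNormedModule) (fun t => (G * atan t)%R)).
  + intros t _. auto_derive; auto. field. nra.
  + intros t _. apply (ex_derive_continuous (fun t => G / (1 + t * t))%R). auto_derive. nra.
- intros HG. pose proof (atan_bound a). pose proof (atan_bound b). nra.
Qed.

Lemma Cmod_sgn (n : Z) : Cmod (sgn n) = 1%R.
Proof. unfold sgn. rewrite Cmod_Cexp. replace (Re (PI * Ci * IZR n)) with 0%R; [apply exp_0|]. creim. ring. Qed.

Lemma finite_bounds (P : nat -> R -> R -> Prop) (n : nat) :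
  (forall i G G' T T', (G <= G')%R -> (T <= T')%R -> P i G T -> P i G' T') ->
  (forall i, exists G T : R, (0 <= G)%R /\ P i G T) -> exists G T : R, (0 <= G)%R /\ forall i, (i < n)%nat -> P i G T.
Proof.
intros Mon H. induction n as [|n IH].
- exists 0%R, 0%R. split; [lra|]. intros; lia.
- destruct IH as (G & T & HG & IH). destruct (H n) as (G' & T' & HG' & H').
  exists (G + G')%R, (Rmax T T'). split; [lra|]. intros i Hi.
  destruct (Nat.eq_dec i n) as [->|Hn].
  + apply Mon with G' T'; auto; [lra|apply Rmax_r].
  + apply Mon with G T; [lra|apply Rmax_l|apply IH; lia].
Qed.

Lemma HoloOn_poly2 (D : C -> Prop) (a b c : C) : HoloOn D (fun w => a * w * w + b * w + c).
Proof.
repeat apply HoloOn_plus; repeat apply HoloOn_mult; auto using HoloOn_const, HoloOn_id.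
Qed.

Lemma HoloOn_lin (D : C -> Prop) (a b : C) : HoloOn D (fun w => a * w + b).
Proof. apply HoloOn_plus; [apply HoloOn_mult|]; auto using HoloOn_const, HoloOn_id. Qed.

(** * The contour-integral form of Poisson summation *)

(* Xi = 1/sinh (with [sg = true], rho = 1) gives the rank functions, Xi = exp (with [sg = false], rho = 0) gives the eta function. *)
Section LerchPoisson.

Variables (h h' g : Z) (kn : nat) (z : C) (x : R) (Xi : C -> C) (rho : C) (sg : bool) (r0 : Z).
Hypothesis Hkn : (0 < kn)%nat.
Hypothesis Hg : (h * h' = -1 + Z.of_nat kn * g)%Z.
Hypothesis Hev : Z.Even (Z.of_nat kn) -> Z.Even g.
Hypothesis Hz : (0 < Re z)%R.
Hypothesis HXper : forall u, Xi (u + PI * Ci) = - Xi u.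
Hypothesis HXhol : HoloOn (fun u => sg = true -> forall j : Z, u <> PI * Ci * IZR j) Xi.
Hypothesis HXpole : PoleAt Xi 0 rho.
Hypothesis Hsg : sg = false -> rho = 0.
(** r0 is the integer nearest to 3kx. The strict inequality keeps the heights kx - M of the poles of
    Xi off the lines y = (2r + 1)/6. *)
Hypothesis Hr0 : (Rabs (3 * INR kn * x - IZR r0) < / 2)%R.
(** If kx = M is an integer, a pole of Xi falls on w = 0, where the sine has a zero as well. The two
    belong to the classes of M and of 0 modulo k; the condition says that these differ, so all poles
    stay simple. *)
Hypothesis Hx : sg = true -> forall M : Z, (INR kn * x)%R = IZR M -> ~ (Z.of_nat kn | M)%Z.
(** Exponential growth is allowed, since the Gaussian factor beats it. This bound serves the lateral
    sides, far from t = 0; the next one serves the lines between the strips and has to hold down to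
    t = 0. *)
Hypothesis HXbig : exists B T : R, (0 <= B)%R /\ (0 < T)%R /\ forall th t : R, (T <= Rabs t)%R ->
  (Cmod (Xi (PI * Ci * RtoC th - PI * z * RtoC t / RtoC (INR kn))%C) <= B * exp (B * Rabs t))%R.
Hypothesis HXline : exists B : R, (0 <= B)%R /\ forall (mu r : Z) (t : R),
  (Cmod (Xi (PI * Ci * RtoC (IZR (6 * mu + (2 * r + 1)) / (6 * INR kn) - x) - PI * z * RtoC t / RtoC (INR kn))%C) <= B * exp (B * Rabs t))%R.

Let k : Z := Z.of_nat kn.
Let K : C := RtoC (INR kn).
(** In this direction pi z w/k moves along the imaginary axis: the height s of w = t + v s enters
    the argument of Xi only as a shift of mu. *)
Let v : C := - Ci / z.
Let sigma : R := Re (/ z).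

Lemma kpos : (0 < INR kn)%R. Proof. apply lt_0_INR; auto. Qed.
Lemma K_neq : K <> 0. Proof. apply RtoC_neq. pose proof kpos. lra. Qed.
Lemma z_neq : z <> 0. Proof. intros E. rewrite E in Hz. simpl in Hz. lra. Qed.
Lemma IZRk : RtoC (IZR k) = K. Proof. unfold k, K. now rewrite <- INR_IZR_INZ. Qed.
Lemma sigma_pos : (0 < sigma)%R.
Proof.
unfold sigma. assert (E : forall w : C, Re (/ w) = (Re w / (Re w ^ 2 + Im w ^ 2))%R) by (intros [a b]; reflexivity).
rewrite E. apply Rdiv_lt_0_compat; auto. pose proof (pow2_ge_0 (Im z)). nra.
Qed.
Lemma Im_v : Im v = (- sigma)%R.
Proof. unfold v, sigma, Cdiv. creim. ring. Qed.
Lemma Im_v_neg : (Im v < 0)%R.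
Proof. rewrite Im_v. pose proof sigma_pos. lra. Qed.

(** Replacing mu by mu + k multiplies F1 by (-1)^((k+1)(h'+1)); this is the parity behind
    [F1_per]. *)
Lemma parity_h' : exists j : Z, ((k + 1) * (h' + 1) = 2 * j)%Z.
Proof.
destruct (Z.Even_or_Odd k) as [Hk|[a Hk]].
- destruct (Hev Hk) as [b Hb]. destruct (Z.Even_or_Odd h') as [[d Hd]|[d Hd]].
  + exfalso. unfold k in *. rewrite Hb, Hd in Hg. lia.
  + exists ((k + 1) * (d + 1))%Z. rewrite Hd. ring.
- exists ((a + 1) * (h' + 1))%Z. rewrite Hk. ring.
Qed.

(** Compared with T_n, the residue at w = n carries the extra sign (-1)^(n(g+1)(h+1)); see
    [pole1]. *)
Lemma parity_h : exists j : Z, ((g + 1) * (h + 1) = 2 * j)%Z.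
Proof.
destruct (Z.Even_or_Odd g) as [[a Ha]|[a Ha]].
- destruct (Z.Even_or_Odd h) as [[d Hd]|[d Hd]].
  + exfalso. rewrite Ha, Hd in Hg. lia.
  + exists ((g + 1) * (d + 1))%Z. rewrite Hd. ring.
- exists ((a + 1) * (h + 1))%Z. rewrite Ha. ring.
Qed.

(* F_{mu,r}(w) = (-1)^mu e^{-3 pi i h' mu^2/k} e^{-3 pi z w^2/k} Xi(pi i (mu/k - x) - pi z w/k) * i e^{-2 i r S}/sinh(i S)
   with S = pi (w + h' mu)/k: [EX] collects the exponents, [Uu] is the argument of Xi and [Ss] is i S. *)
Definition EX (mu r : Z) (w : C) : C :=
  PI * Ci * IZR mu - 3 * PI * Ci * IZR h' * IZR mu * IZR mu / K - 3 * PI * z * w * w / K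
  - 2 * Ci * IZR r * (PI * (w + IZR h' * IZR mu) / K).
Definition Uu (mu : Z) (w : C) : C := PI * Ci * (IZR mu / K - RtoC x) - PI * z * w / K.
Definition Ss (mu : Z) (w : C) : C := Ci * (PI * (w + IZR h' * IZR mu) / K).
Definition F1 (mu r : Z) (w : C) : C := Ci * Cexp (EX mu r w) * Xi (Uu mu w) * / Csinh (Ss mu w).

Lemma F1_per (mu r : Z) (w : C) : F1 (mu + k) r w = F1 mu r w.
Proof.
destruct parity_h' as [j Hj]. pose proof K_neq as HK. unfold F1.
assert (EU : Uu (mu + k) w = Uu mu w + PI * Ci * IZR 1).
{ unfold Uu. cpush. rewrite IZRk. field; auto. }
assert (ES : Ss (mu + k) w = Ss mu w + PI * Ci * IZR h').
{ unfold Ss. cpush. rewrite IZRk. field; auto. }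
rewrite EU, ES, Csinh_sgn, (antiper_sgn Xi 1 _ HXper).
assert (EE : Cexp (EX (mu + k) r w) * sgn 1 * sgn h' = Cexp (EX mu r w)).
{ unfold sgn. rewrite <- !Cexp_plus. apply Cexp_eq with (j - 3 * h' * mu - 2 * h' * k - r * h')%Z.
  assert (Hj' : 2 * RtoC (IZR j) = (K + 1) * (IZR h' + 1)).
  { rewrite <- IZRk. rewrite <- !RtoC_plus, <- !RtoC_mult, <- !plus_IZR, <- !mult_IZR. now rewrite Hj. }
  unfold EX. cpush. rewrite IZRk.
  replace (2 * PI * Ci * (IZR j - 3 * IZR h' * IZR mu - 2 * IZR h' * K - IZR r * IZR h'))
   with (PI * Ci * (2 * IZR j - 6 * IZR h' * IZR mu - 4 * IZR h' * K - 2 * IZR r * IZR h')) by ring.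
  rewrite Hj'. field; auto. }
rewrite <- EE. 
(* At the zeros of sinh this holds by the default value of the inverse at 0. *)
assert (HI : / (sgn h' * Csinh (Ss mu w)) = sgn h' * / Csinh (Ss mu w)).
{ destruct (Ceq_dec (Csinh (Ss mu w)) 0) as [E0|N0].
  - rewrite E0. replace (sgn h' * 0) with (RtoC 0) by ring.
    assert (I0 : / 0 = 0) by (apply C_ext; simpl; unfold Rdiv; rewrite ?Rmult_0_l, ?Ropp_0, ?Rmult_0_l; auto).
    rewrite I0. ring.
  - rewrite <- (sgn_inv h') at 2. field. split; auto. apply Cexp_neq_0. }
rewrite HI. ring.
Qed.

Lemma F1_per_mul (mu r j : Z) (w : C) : F1 (mu + k * j) r w = F1 mu r w.
Proof.
assert (S : forall n mu, F1 (mu + k * Z.of_nat n) r w = F1 mu r w).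
{ induction n as [|n IH]; intros m; [f_equal; lia|].
  replace (m + k * Z.of_nat (S n))%Z with (m + k * Z.of_nat n + k)%Z by lia. rewrite F1_per. apply IH. }
destruct (Z_le_gt_dec 0 j).
- rewrite <- (Z2Nat.id j) by lia. apply S.
- rewrite <- (S (Z.to_nat (- j)) (mu + k * j)%Z). f_equal. rewrite Z2Nat.id by lia. lia.
Qed.

Lemma Uu_line (mu : Z) (t s : R) :
  Uu mu (RtoC t + v * RtoC s) = PI * Ci * ((IZR mu + RtoC s) / K - RtoC x) - PI * z * RtoC t / K.
Proof. unfold Uu, v. pose proof K_neq. pose proof z_neq. field. auto. Qed.

(** Since z v = -i, the mixed term of z w^2 is imaginary, and t and s separate in the modulus. The
    exponent in s is least at s = r/3, the centre of strip r. *)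
Lemma Re_EX (mu r : Z) (t s : R) :
  Re (EX mu r (RtoC t + v * RtoC s)) =
  (- (3 * PI * Re z / INR kn) * (t * t) + PI * sigma * s / INR kn * (3 * s - 2 * IZR r))%R.
Proof.
assert (E : EX mu r (RtoC t + v * RtoC s) =
  Ci * (RtoC (PI * IZR mu - 3 * PI * IZR h' * IZR mu * IZR mu / INR kn + 6 * PI * t * s / INR kn - 2 * IZR r * PI * (t + IZR h' * IZR mu) / INR kn))
  - RtoC (3 * PI * t * t / INR kn) * z + RtoC (PI * s / INR kn * (3 * s - 2 * IZR r)) * / z).
{ pose proof kpos. unfold EX, v, K. unfold Rdiv. cpush. rewrite RtoC_inv by lra. fold K.
  pose proof K_neq. pose proof z_neq. pose proof Ci2 as H2. field [H2]. auto. }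
rewrite E. creim. fold sigma. pose proof kpos. field. lra.
Qed.

Definition dom (w : C) : Prop :=
  exists s t : R, w = RtoC t + v * RtoC s /\ ~ (s = 0%R /\ exists n : Z, t = IZR n) /\
    ~ (t = 0%R /\ exists M : Z, s = (INR kn * x - IZR M)%R).

Lemma IZR_k_INR : IZR k = INR kn. Proof. unfold k. now rewrite <- INR_IZR_INZ. Qed.

Lemma Ss_zero (mu : Z) (t s : R) (j : Z) : Ss mu (RtoC t + v * RtoC s) = PI * Ci * IZR j ->
  s = 0%R /\ t = IZR (k * j - h' * mu).
Proof.
intros E. pose proof PI_neq0. pose proof kpos. pose proof sigma_pos.
assert (Ew : RtoC t + v * RtoC s = RtoC (IZR (k * j - h' * mu))).
{ assert (P : RtoC PI <> 0) by now apply RtoC_neq. 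
  replace (RtoC t + v * RtoC s) with (Ss mu (RtoC t + v * RtoC s) * K / (Ci * PI) - IZR h' * IZR mu).
  - rewrite E. cpush. rewrite IZRk. field. split; auto. apply Ci_nz.
  - unfold Ss. field. repeat split; auto using K_neq, Ci_nz. }
assert (s = 0%R).
{ apply (f_equal Im) in Ew. rewrite Im_plus, Im_mult, !im_RtoC, re_RtoC, Im_v in Ew.
  replace (0 + (Re v * 0 + - sigma * s))%R with (- (sigma * s))%R in Ew by ring.
  assert (sigma * s = 0)%R by lra. apply Rmult_integral in H2. lra. }
split; auto. subst s. apply (f_equal Re) in Ew. rewrite Re_plus, Re_mult, !re_RtoC, im_RtoC in Ew. lra.
Qed.

Lemma Uu_zero (mu : Z) (t s : R) (j : Z) : Uu mu (RtoC t + v * RtoC s) = PI * Ci * IZR j ->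
  t = 0%R /\ s = (INR kn * x - IZR (mu - k * j))%R.
Proof.
intros E. pose proof PI_RGT_0. pose proof kpos. rewrite Uu_line in E.
assert (E' : Ci * RtoC (PI * ((IZR mu + s) / INR kn - x - IZR j)) = RtoC (PI * t / INR kn) * z).
{ unfold Rdiv. cpush. rewrite RtoC_inv by lra. fold K.
  replace (PI * t * / K * z) with (PI * Ci * ((IZR mu + s) / K - x) - (PI * Ci * ((IZR mu + s) / K - x) - PI * z * t / K)) by (field; apply K_neq).
  rewrite E. field. apply K_neq. }
assert (Ht : t = 0%R).
{ apply (f_equal Re) in E'. revert E'. creim. intros E'.
  assert (PI * t / INR kn * Re z = 0)%R by lra.
  apply Rmult_integral in H1. destruct H1; [|lra].
  replace t with (PI * t / INR kn * (INR kn / PI))%R by (field; lra). rewrite H1. ring. }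
split; auto. subst t. apply (f_equal Im) in E'. revert E'. creim. intros E'.
assert (E2 : (PI * ((IZR mu + s) / INR kn - x - IZR j) = 0)%R) by (replace (PI * 0 / INR kn)%R with 0%R in E' by (field; lra); lra).
apply Rmult_integral in E2. destruct E2 as [E2|E2]; [lra|].
rewrite minus_IZR, mult_IZR, IZR_k_INR.
replace s with (INR kn * ((IZR mu + s) / INR kn - x - IZR j) + INR kn * x - IZR mu + INR kn * IZR j)%R at 1 by (field; lra).
rewrite E2. ring.
Qed.

Definition regU (mu : Z) (w : C) : Prop := sg = true -> forall j : Z, Uu mu w <> PI * Ci * IZR j.
Definition regS (mu : Z) (w : C) : Prop := forall j : Z, Ss mu w <> PI * Ci * IZR j.

Lemma HoloOn_EX (D : C -> Prop) (mu r : Z) : HoloOn D (fun w => Cexp (EX mu r w)).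
Proof.
apply HoloOn_exp_comp.
apply HoloOn_ext with (fun w => (- 3 * PI * z / K) * w * w + (- 2 * Ci * IZR r * PI / K) * w +
  (PI * Ci * IZR mu - 3 * PI * Ci * IZR h' * IZR mu * IZR mu / K - 2 * Ci * IZR r * (PI * (IZR h' * IZR mu) / K))).
- intros w. unfold EX. field. apply K_neq.
- apply HoloOn_poly2.
Qed.

Lemma Uu_lin (mu : Z) (w : C) : Uu mu w = (- PI * z / K) * w + PI * Ci * (IZR mu / K - RtoC x).
Proof. unfold Uu. field. apply K_neq. Qed.

Lemma Ss_lin (mu : Z) (w : C) : Ss mu w = (Ci * PI / K) * w + Ci * (PI * (IZR h' * IZR mu) / K).
Proof. unfold Ss. field. apply K_neq. Qed.

Lemma HoloOn_XiU (mu : Z) : HoloOn (regU mu) (fun w => Xi (Uu mu w)).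
Proof.
eapply HoloOn_comp; [exact HXhol| |].
- eapply HoloOn_ext; [intros; symmetry; apply Uu_lin|apply HoloOn_lin].
- intros w Hw. exact Hw.
Qed.

Lemma HoloOn_iS (mu : Z) : HoloOn (regS mu) (fun w => / Csinh (Ss mu w)).
Proof.
apply HoloOn_inv.
- apply HoloOn_comp with (fun _ => True); auto; [apply HoloOn_sinh|].
  eapply HoloOn_ext; [intros; symmetry; apply Ss_lin|apply HoloOn_lin].
- intros w Hw E. destruct (Csinh_eq_0 _ E) as [n Hn]. exact (Hw n Hn).
Qed.

Lemma HoloOn_F1 (mu r : Z) : HoloOn (fun w => regU mu w /\ regS mu w) (F1 mu r).
Proof.
unfold F1. apply HoloOn_mult; [apply HoloOn_mult; [apply HoloOn_mult|]|].
- apply HoloOn_const.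
- apply HoloOn_EX.
- eapply HoloOn_sub; [|apply HoloOn_XiU]. tauto.
- eapply HoloOn_sub; [|apply HoloOn_iS]. tauto.
Qed.

Lemma HoloOn_F1_dom (mu r : Z) : HoloOn dom (F1 mu r).
Proof.
eapply HoloOn_sub; [|apply HoloOn_F1]. intros w (s & t & -> & H1 & H2). split.
- intros _ j E. apply Uu_zero in E. apply H2. destruct E as [E1 E2]. split; auto. now exists (mu - k * j)%Z.
- intros j E. apply Ss_zero in E. apply H1. destruct E as [E1 E2]. split; auto. now exists (k * j - h' * mu)%Z.
Qed.

Lemma PoleAt_XiU (mu j : Z) (p : C) : Uu mu p = PI * Ci * IZR j ->
  PoleAt (fun w => Xi (Uu mu w)) p (sgn j * rho * - (K / (PI * z))).
Proof.
intros E. assert (P : RtoC PI <> 0) by (apply RtoC_neq, PI_neq0). pose proof z_neq. pose proof K_neq.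
set (a := - PI * z / K). set (b := PI * Ci * (IZR mu / K - RtoC x) - PI * Ci * IZR j).
assert (Ha : a <> 0).
{ unfold a, Cdiv. repeat apply Cmult_neq_0; auto; [|].
  - intros Q. apply P. replace (RtoC PI) with (- - RtoC PI) by ring. rewrite Q. ring.
  - intros Q. apply C1_nz. rewrite <- (Cinv_r K) by auto. rewrite Q. ring. }
assert (E0 : a * p + b = 0).
{ rewrite Uu_lin in E. unfold a, b. replace (- PI * z / K * p + (PI * Ci * (IZR mu / K - x) - PI * Ci * IZR j))
    with (- PI * z / K * p + PI * Ci * (IZR mu / K - x) - PI * Ci * IZR j) by ring. rewrite E. ring. }
pose proof (PoleAt_comp_affine Xi p rho a b Ha) as Q. rewrite E0 in Q. specialize (Q HXpole).
pose proof (PoleAt_mult_reg _ (fun _ => sgn j) p _ _ Q (Cder_const (sgn j) p)) as Q2.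
eapply PoleAt_ext; [| |exact Q2].
- intros w. simpl. rewrite Uu_lin. fold a.
  replace (a * w + PI * Ci * (IZR mu / K - x)) with (a * w + b + PI * Ci * IZR j) by (unfold b; ring).
  rewrite (antiper_sgn Xi j _ HXper). ring.
- unfold a. field. auto.
Qed.

Lemma PoleAt_iS (mu j : Z) (p : C) : Ss mu p = PI * Ci * IZR j ->
  PoleAt (fun w => / Csinh (Ss mu w)) p (sgn j * (K / (PI * Ci))).
Proof.
intros E. assert (P : RtoC PI <> 0) by (apply RtoC_neq, PI_neq0). pose proof K_neq.
set (a := Ci * PI / K). set (b := Ci * (PI * (IZR h' * IZR mu) / K) - PI * Ci * IZR j).
assert (Ha : a <> 0).
{ unfold a, Cdiv. repeat apply Cmult_neq_0; auto using Ci_nz.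
  intros Q. apply C1_nz. rewrite <- (Cinv_r K) by auto. rewrite Q. ring. }
assert (E0 : a * p + b = 0).
{ rewrite Ss_lin in E. unfold a, b. replace (Ci * PI / K * p + (Ci * (PI * (IZR h' * IZR mu) / K) - PI * Ci * IZR j))
    with (Ci * PI / K * p + Ci * (PI * (IZR h' * IZR mu) / K) - PI * Ci * IZR j) by ring. rewrite E. ring. }
pose proof (PoleAt_comp_affine (fun u => / Csinh u) p 1 a b Ha) as Q. rewrite E0 in Q. specialize (Q PoleAt_inv_sinh_0).
pose proof (PoleAt_mult_reg _ (fun _ => sgn j) p _ _ Q (Cder_const (sgn j) p)) as Q2.
eapply PoleAt_ext; [| |exact Q2].
- intros w. simpl. rewrite Ss_lin. fold a.
  replace (a * w + Ci * (PI * (IZR h' * IZR mu) / K)) with (a * w + b + PI * Ci * IZR j) by (unfold b; ring).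
  rewrite Csinh_sgn. rewrite <- (sgn_inv j) at 1.
  destruct (Ceq_dec (Csinh (a * w + b)) 0) as [Z0|N0].
  + rewrite Z0. replace (sgn j * 0) with (RtoC 0) by ring.
    assert (I0 : / 0 = 0) by (apply C_ext; simpl; unfold Rdiv; rewrite ?Rmult_0_l, ?Ropp_0, ?Rmult_0_l; auto).
    rewrite I0. ring.
  + field. split; auto. apply Cexp_neq_0.
- unfold a. field. repeat split; auto using Ci_nz.
Qed.

Definition Fr (r : Z) (w : C) : C := Csum (fun mu => F1 (Z.of_nat mu) r w) kn.

(** The residue at the zero of [Uu M], which has the height kx - M: the factor -K/(pi z) is the
    reciprocal of the slope of [Uu]. *)
Definition res2 (M r : Z) : C :=
  Ci * Cexp (EX M r (v * RtoC (INR kn * x - IZR M))) * (rho * - (K / (PI * z))) * / Csinh (Ss M (v * RtoC (INR kn * x - IZR M))).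

Definition Tn (n : Z) : C :=
  Cexp (PI * Ci * IZR n + 3 * PI * Ci * IZR n * IZR n * ((IZR h + Ci * z) / K)) *
  Xi (PI * Ci * IZR n * ((IZR h + Ci * z) / K) - PI * Ci * RtoC x).

Lemma F1_reg_pole (mu r : Z) (p : C) : regU mu p -> regS mu p -> PoleAt (F1 mu r) p 0.
Proof. intros H1 H2. apply PoleAt_cont. apply (HoloOn_cont _ _ _ (HoloOn_F1 mu r)). split; auto. Qed.

Definition pM (M : Z) : C := RtoC 0 + v * RtoC (INR kn * x - IZR M).

Lemma divk (m : Z) : (m mod k = 0)%Z -> exists j, (m = k * j)%Z.
Proof. intros H. exists (m / k)%Z. apply Z_div_exact_full_2; auto. unfold k. lia. Qed.

Lemma ndivk (m j : Z) : (m mod k <> 0)%Z -> (m <> k * j)%Z.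
Proof. intros H ->. apply H. rewrite Z.mul_comm. apply Z_mod_mult. Qed.

Lemma pole2 (mu M r : Z) : regS M (pM M) -> regS mu (pM M) ->
  PoleAt (F1 mu r) (pM M) (if Z.eq_dec ((mu - M) mod k) 0 then res2 M r else 0).
Proof.
intros HM Hmu. destruct (Z.eq_dec ((mu - M) mod k) 0) as [E|E].
- destruct (divk _ E) as [j Hj]. replace mu with (M + k * j)%Z by lia.
  assert (E0 : Uu M (pM M) = PI * Ci * IZR 0).
  { unfold pM. rewrite Uu_line. unfold K. rewrite RtoC_minus, RtoC_mult. fold K. field. apply K_neq. }
  pose proof (PoleAt_XiU M 0 (pM M) E0) as Q.
  assert (HR : HoloOn (regS M) (fun w => Ci * Cexp (EX M r w) * / Csinh (Ss M w))).
  { apply HoloOn_mult; [apply HoloOn_mult; [apply HoloOn_const|apply HoloOn_EX]|apply HoloOn_iS]. }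
  destruct (HoloOn_Cder _ _ _ HR HM) as [l Hl].
  pose proof (PoleAt_mult_reg _ _ _ _ _ Q Hl) as Q2.
  eapply PoleAt_ext; [| |exact Q2].
  + intros w. simpl. rewrite F1_per_mul. unfold F1. ring.
  + unfold res2. replace (v * RtoC (INR kn * x - IZR M)) with (pM M) by (unfold pM; ring). rewrite sgn_0. ring.
- apply F1_reg_pole; auto. intros _ j Ej. unfold pM in Ej. apply Uu_zero in Ej. destruct Ej as [_ Ej].
  assert (IZR M = IZR (mu - k * j)) by lra. apply eq_IZR in H. apply (ndivk _ j E). lia.
Qed.

Lemma pole1 (mu n : Z) : regU mu (RtoC (IZR n)) ->
  PoleAt (F1 mu 0) (RtoC (IZR n)) (if Z.eq_dec ((mu - h * n) mod k) 0 then K / PI * Tn n else 0).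
Proof.
intros Hmu.
assert (P : RtoC PI <> 0) by (apply RtoC_neq, PI_neq0). pose proof K_neq as HK.
assert (Hgc : RtoC (IZR h) * IZR h' = - (1) + K * IZR g).
{ rewrite <- IZRk, <- !RtoC_mult, <- !mult_IZR. unfold k. rewrite Hg, plus_IZR, RtoC_plus. f_equal. cpush. ring. }
destruct (Z.eq_dec ((mu - h * n) mod k) 0) as [E|E].
- destruct (divk _ E) as [j Hj].
  assert (Hh : regU (h * n) (RtoC (IZR n))).
  { intros Hs i Ei. apply (Hmu Hs (i + j)%Z). replace mu with (h * n + k * j)%Z by lia.
    unfold Uu in *. cpush. rewrite IZRk. rewrite mult_IZR, RtoC_mult in Ei.
    transitivity (PI * Ci * (IZR h * IZR n / K - x) - PI * z * IZR n / K + PI * Ci * IZR j); [field; auto|]. rewrite Ei. ring. }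
  (* The class mu = h n is the one with a pole at w = n: by 1 + h h' = k g the sine vanishes
     there. *)
  assert (ES : Ss (h * n) (RtoC (IZR n)) = PI * Ci * IZR (g * n)).
  { unfold Ss. cpush. replace (IZR n + IZR h' * (IZR h * IZR n)) with (IZR n * (1 + IZR h * IZR h')) by ring.
    rewrite Hgc. field; auto. }
  pose proof (PoleAt_iS (h * n) (g * n) _ ES) as Q.
  assert (HR : HoloOn (regU (h * n)) (fun w => Ci * Cexp (EX (h * n) 0 w) * Xi (Uu (h * n) w))).
  { apply HoloOn_mult; [apply HoloOn_mult; [apply HoloOn_const|apply HoloOn_EX]|apply HoloOn_XiU]. }
  destruct (HoloOn_Cder _ _ _ HR Hh) as [l Hl].
  pose proof (PoleAt_mult_reg _ _ _ _ _ Q Hl) as Q2.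
  eapply PoleAt_ext; [| |exact Q2].
  + intros w. replace mu with (h * n + k * j)%Z by lia. rewrite F1_per_mul. unfold F1. ring.
  + cbv beta. replace (Uu (h * n) (RtoC (IZR n))) with (PI * Ci * IZR n * ((IZR h + Ci * z) / K) - PI * Ci * x)
      by (unfold Uu; pose proof Ci2 as H2; cpush; field [H2]; auto).
    assert (EE : sgn (g * n) * Cexp (EX (h * n) 0 (RtoC (IZR n))) =
      Cexp (PI * Ci * IZR n + 3 * PI * Ci * IZR n * IZR n * ((IZR h + Ci * z) / K))).
    { unfold sgn. rewrite <- Cexp_plus. destruct parity_h as [i Hi].
      (* n^2 and n have the same parity, which removes the square from the sign. *)
      assert (Hn : exists m, (n * n = n + 2 * m)%Z).
      { destruct (Z.Even_or_Odd n) as [[a Ha]|[a Ha]].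
        - exists (a * (n - 1))%Z. rewrite Ha. ring.
        - exists (n * a)%Z. rewrite Ha. ring. }
      destruct Hn as [m Hm].
      apply Cexp_eq with (n * (i - 1 - 2 * g * h) - 3 * g * h * m)%Z.
      assert (Hi' : 2 * RtoC (IZR i) = (IZR g + 1) * (IZR h + 1)).
      { rewrite <- !RtoC_plus, <- !RtoC_mult, <- !plus_IZR, <- !mult_IZR. now rewrite Hi. }
      assert (Hm' : 2 * RtoC (IZR m) = IZR n * IZR n - IZR n).
      { rewrite <- !RtoC_mult, <- RtoC_minus, <- !mult_IZR, <- minus_IZR. f_equal. f_equal. lia. }
      unfold EX. cpush.
      replace (2 * PI * Ci * (IZR n * (IZR i - 1 - 2 * IZR g * IZR h) - 3 * IZR g * IZR h * IZR m))
        with (PI * Ci * (IZR n * (2 * IZR i - 2 - 4 * IZR g * IZR h) - 3 * IZR g * IZR h * (2 * IZR m))) by ring.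
      rewrite Hi', Hm'. pose proof Ci2 as H2.
      replace (3 * PI * Ci * IZR h' * (IZR h * IZR n) * (IZR h * IZR n)) with (3 * PI * Ci * (IZR h * IZR h') * (IZR h * IZR n * IZR n)) by ring.
      rewrite Hgc. field [H2]. auto. }
    unfold Tn. rewrite <- EE. field. split; auto using Ci_nz.
- apply F1_reg_pole; auto. intros j Ej.
  replace (RtoC (IZR n)) with (RtoC (IZR n) + v * RtoC 0) in Ej by ring. apply Ss_zero in Ej.
  destruct Ej as [_ Ej]. apply eq_IZR in Ej. apply (ndivk _ (g * mu - h * j) E). unfold k in *.
  rewrite Ej. replace (mu - h * (Z.of_nat kn * j - h' * mu))%Z with (mu + (h * h') * mu - h * Z.of_nat kn * j)%Z by ring.
  rewrite Hg. ring.
Qed.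

Lemma regS_pM (mu M : Z) : (INR kn * x)%R <> IZR M -> regS mu (pM M).
Proof. intros H j E. apply Ss_zero in E. destruct E as [E _]. apply H. lra. Qed.

Lemma Fr_pole2 (M r : Z) : (INR kn * x)%R <> IZR M -> PoleAt (Fr r) (pM M) (res2 M r).
Proof.
intros H. eapply PoleAt_ext; [intros; reflexivity| |apply PoleAt_Csum].
2:{ intros i _. apply (pole2 (Z.of_nat i) M r); apply regS_pM; auto. }
apply Csum_indicator; auto.
Qed.

Lemma Fr_pole1 (n : Z) : (forall M, (INR kn * x)%R = IZR M -> n <> 0%Z \/ sg = false) ->
  PoleAt (Fr 0) (RtoC (IZR n)) (K / PI * Tn n).
Proof.
intros H. eapply PoleAt_ext; [intros; reflexivity| |apply PoleAt_Csum].
2:{ intros i _. apply (pole1 (Z.of_nat i) n). intros Hs j E.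
  replace (RtoC (IZR n)) with (RtoC (IZR n) + v * RtoC 0) in E by ring. apply Uu_zero in E.
  destruct E as [E1 E2]. destruct (H (Z.of_nat i - k * j)%Z); [lra| |congruence].
  apply H0. apply eq_IZR. exact E1. }
apply Csum_indicator; auto.
Qed.

(** Both families of poles meet at w = 0. If sg is true they sit in different classes mu by [Hx],
    and the residues add up class by class; otherwise rho = 0 and the second residue is 0. *)
Lemma Fr_pole12 (M : Z) : (INR kn * x)%R = IZR M -> PoleAt (Fr 0) 0 (K / PI * Tn 0 + res2 M 0).
Proof.
intros H. assert (E0 : pM M = 0) by (unfold pM; rewrite H, Rminus_diag; ring).
assert (C1 : Csum (fun i => if Z.eq_dec ((Z.of_nat i - h * 0) mod k) 0 then K / PI * Tn 0 else 0) kn = K / PI * Tn 0)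
  by (apply Csum_indicator; auto).
assert (C2 : Csum (fun i => if Z.eq_dec ((Z.of_nat i - M) mod k) 0 then res2 M 0 else 0) kn = res2 M 0)
  by (apply Csum_indicator; auto).
rewrite <- C1, <- C2, <- Csum_plus. apply PoleAt_Csum. intros i _.
destruct (Bool.bool_dec sg true) as [Esg|Esg]; [|apply Bool.not_true_is_false in Esg].
- pose proof (Hx Esg M H) as HnM. fold k in HnM.
  destruct (Z.eq_dec ((Z.of_nat i - h * 0) mod k) 0) as [E|E].
  + destruct (divk _ E) as [j Hj].
    destruct (Z.eq_dec ((Z.of_nat i - M) mod k) 0) as [E'|E'].
    * exfalso. apply HnM. destruct (divk _ E') as [j' Hj']. exists (j - j')%Z. lia.
    * rewrite Cplus_0_r. 
      eapply PoleAt_ext; [intros; reflexivity| |apply (pole1 (Z.of_nat i) 0)].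
      -- destruct (Z.eq_dec ((Z.of_nat i - h * 0) mod k) 0); [auto|contradiction].
      -- intros _ a Ea. replace (RtoC (IZR 0)) with (RtoC 0 + v * RtoC 0) in Ea by ring. apply Uu_zero in Ea.
         destruct Ea as [_ Ea]. assert (IZR M = IZR (Z.of_nat i - k * a)) by lra. apply eq_IZR in H0.
         apply (ndivk _ a E'). lia.
  + rewrite Cplus_0_l.
    assert (R1 : forall mu, ~ (k | mu)%Z -> regS mu (pM M)).
    { intros mu Hd j Ej. unfold pM in Ej. apply Ss_zero in Ej. destruct Ej as [_ Ej]. apply eq_IZR in Ej.
      apply Hd. exists (g * mu - h * j)%Z. unfold k in *.
      assert (h * (Z.of_nat kn * j - h' * mu) = 0)%Z by (rewrite <- Ej; ring).
      assert (mu = mu + h * (Z.of_nat kn * j - h' * mu))%Z by lia.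
      replace (mu + h * (Z.of_nat kn * j - h' * mu))%Z with (mu - (h * h') * mu + h * Z.of_nat kn * j)%Z in H1 by ring.
      rewrite Hg in H1. lia. }
    assert (Hi : ~ (k | Z.of_nat i)%Z) by (intros [j Hj]; apply (ndivk _ j E); lia).
    pose proof (pole2 (Z.of_nat i) M 0 (R1 _ HnM) (R1 _ Hi)) as Q. rewrite E0 in Q. exact Q.
- assert (Hres : res2 M 0 = 0) by (unfold res2; rewrite (Hsg Esg); ring).
  rewrite Hres.
  assert (Q : PoleAt (F1 (Z.of_nat i) 0) 0 (if Z.eq_dec ((Z.of_nat i - h * 0) mod k) 0 then K / PI * Tn 0 else 0))
    by (apply (pole1 (Z.of_nat i) 0); intros Q; congruence).
  destruct (Z.eq_dec ((Z.of_nat i - M) mod k) 0); rewrite Cplus_0_r; exact Q.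
Qed.

Lemma Fr_holo (r : Z) (y0 S0 S1 : R) :
  (forall M, (S0 < INR kn * x - IZR M < S1)%R -> (INR kn * x - IZR M)%R = y0) -> ((S0 < 0 < S1)%R -> y0 = 0%R) ->
  HoloOn (off_integers v y0 S0 S1) (Fr r).
Proof.
intros H1 H2. apply HoloOn_sub with dom.
- intros w (s & t & Hs & Hn & ->). exists s, t. split; auto. split.
  + intros [E [n En]]. apply Hn. split; [symmetry; rewrite E; apply H2; lra|eauto].
  + intros [E [M EM]]. apply Hn. split; [rewrite EM; apply H1; lra|exists 0%Z; auto].
- apply HoloOn_Csum. intros. apply HoloOn_F1_dom.
Qed.

(** * Strips around the heights r/3 *)

Definition gap : R := ((/ 2 - Rabs (3 * INR kn * x - IZR r0)) / 3)%R.
Lemma gap_pos : (0 < gap)%R. Proof. unfold gap. lra. Qed.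
Lemma gap_le : (gap <= / 6)%R. Proof. unfold gap. pose proof (Rabs_pos (3 * INR kn * x - IZR r0)). lra. Qed.

(** [gap] is the distance from the pole lines to the nearest edges of their strips. Enlarging a
    strip by it lets in no further pole line, which provides the open neighbourhood for Cauchy's
    theorem. *)
Lemma strip_of_pole (M r : Z) :
  (IZR (2 * r - 1) / 6 - gap < INR kn * x - IZR M < IZR (2 * r + 1) / 6 + gap)%R -> (r = r0 - 3 * M)%Z.
Proof.
intros [H1 H2]. unfold gap in *. set (th := (3 * INR kn * x - IZR r0)%R) in *.
assert (Hk : (INR kn * x = (th + IZR r0) / 3)%R) by (unfold th; field). rewrite Hk in *.
rewrite minus_IZR, mult_IZR in H1. rewrite plus_IZR, mult_IZR in H2.
assert (A1 : (th <= Rabs th)%R) by apply Rle_abs.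
assert (A2 : (- th <= Rabs th)%R) by (rewrite <- Rabs_Ropp; apply Rle_abs).
assert (B1 : (IZR (r0 - 3 * M - r) < 1)%R) by (rewrite !minus_IZR, mult_IZR; lra).
assert (B2 : (-1 < IZR (r0 - 3 * M - r))%R) by (rewrite !minus_IZR, mult_IZR; lra).
apply lt_IZR in B1. apply lt_IZR in B2. lia.
Qed.

Lemma strip_bounds (M : Z) :
  (IZR (2 * (r0 - 3 * M) - 1) / 6 + gap <= INR kn * x - IZR M <= IZR (2 * (r0 - 3 * M) + 1) / 6 - gap)%R.
Proof.
unfold gap. set (th := (3 * INR kn * x - IZR r0)%R) in *.
assert (Hk : (INR kn * x = (th + IZR r0) / 3)%R) by (unfold th; field). rewrite Hk in *.
rewrite minus_IZR, plus_IZR, mult_IZR, minus_IZR, mult_IZR.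
assert (A1 : (th <= Rabs th)%R) by apply Rle_abs.
assert (A2 : (- th <= Rabs th)%R) by (rewrite <- Rabs_Ropp; apply Rle_abs). lra.
Qed.

Lemma strip_zero (r : Z) :
  (IZR (2 * r - 1) / 6 - gap < 0 < IZR (2 * r + 1) / 6 + gap)%R -> r = 0%Z.
Proof.
pose proof gap_le as G. intros [H1 H2]. rewrite minus_IZR, mult_IZR in H1. rewrite plus_IZR, mult_IZR in H2.
assert (B1 : (IZR r < 1)%R) by lra. assert (B2 : (-1 < IZR r)%R) by lra.
apply lt_IZR in B1. apply lt_IZR in B2. lia.
Qed.

(** The windows run from 1/2 - kN to 1/2 + kN: half-integers avoid the poles at the integers, and
    moving by multiples of k changes 1/sinh(Ss) only by a sign, see [iS_side_bound]. *)
Definition n0 (N : nat) : Z := (1 - k * Z.of_nat N)%Z.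
Definition nn (N : nat) : nat := (2 * kn * N)%nat.
Definition lo (N : nat) : R := (IZR (n0 N) - / 2)%R.
Definition hi (N : nat) : R := (lo N + INR (nn N))%R.
Definition y1 (r : Z) : R := (IZR (2 * r - 1) / 6)%R.
Definition y2 (r : Z) : R := (IZR (2 * r + 1) / 6)%R.

Lemma lo_eq (N : nat) : lo N = (/ 2 + INR kn * - INR N)%R.
Proof. unfold lo, n0. rewrite minus_IZR, mult_IZR, IZR_k_INR, <- INR_IZR_INZ. field. Qed.
Lemma hi_eq (N : nat) : hi N = (/ 2 + INR kn * INR N)%R.
Proof. unfold hi. rewrite lo_eq. unfold nn. rewrite !mult_INR. simpl. field. Qed.
Lemma y12 (r : Z) : (y2 r = y1 r + / 3)%R.
Proof. unfold y1, y2. rewrite minus_IZR, plus_IZR. field. Qed.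

Definition isJ (r : Z) (s : R) (N : nat) (I : C) : Prop := isCI (fun t => Fr r (RtoC t + v * RtoC s)) (lo N) (hi N) I.

Definition stripres (r : Z) (N : nat) : C :=
  (if Z.eq_dec r 0 then zs (fun n => K / PI * Tn n) (n0 N) (nn N) else 0) +
  (if Z.eq_dec ((r0 - r) mod 3) 0 then res2 ((r0 - r) / 3) r else 0).

Lemma dom_cont (r : Z) (w : C) : dom w -> Ccont (Fr r) w.
Proof. intros H. apply (HoloOn_cont dom); auto. apply HoloOn_Csum. intros. apply HoloOn_F1_dom. Qed.

(** Strip r contains the real line when r = 0, and one pole line of Xi when r is congruent to r0
    modulo 3. If both occur at different heights, the strip is cut halfway between them and crossed
    in two steps; if the heights coincide, [Fr_pole12] combines the residues. *)
Lemma strip (r : Z) (N : nat) (Bd : R) (I1 I2 : C) : (1 <= N)%nat ->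
  isJ r (y1 r) N I1 -> isJ r (y2 r) N I2 ->
  (forall s, (y1 r <= s <= y2 r)%R -> (Cmod (Fr r (RtoC (lo N) + v * RtoC s)%C) <= Bd)%R /\
     (Cmod (Fr r (RtoC (hi N) + v * RtoC s)%C) <= Bd)%R) ->
  (Cmod (I2 - I1 - 2 * PI * Ci * stripres r N) <= 4 * Cmod v * Bd)%R.
Proof.
intros HN H1 H2 HB. pose proof gap_pos as Hg0. pose proof (y12 r) as Hy. pose proof Im_v_neg as Hv.
assert (HBd : (0 <= Bd)%R) by (eapply Rle_trans; [apply Cmod_ge_0|apply (HB (y1 r)); lra]).
assert (HcB : (0 <= Cmod v * Bd)%R) by (apply Rmult_le_pos; auto; apply Cmod_ge_0).
assert (Hin : (n0 N <= 0 < n0 N + Z.of_nat (nn N))%Z).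
{ unfold n0, nn, k. nia. }
assert (Vz : forall m : Z, RtoC (IZR m) + v * RtoC 0 = RtoC (IZR m)) by (intros; ring).
unfold stripres.
destruct (Z.eq_dec ((r0 - r) mod 3) 0) as [E3|E3].
- set (M := ((r0 - r) / 3)%Z). assert (HM : (r = r0 - 3 * M)%Z) by (unfold M; Z.to_euclidean_division_equations; lia).
  set (ys := (INR kn * x - IZR M)%R).
  assert (Hys : (y1 r + gap <= ys <= y2 r - gap)%R) by (unfold ys, y1, y2; rewrite HM; apply strip_bounds).
  assert (Huniq : forall M', (y1 r - gap < INR kn * x - IZR M' < y2 r + gap)%R -> (INR kn * x - IZR M')%R = ys).
  { intros M' HM'. assert (r = r0 - 3 * M')%Z by (apply strip_of_pole; exact HM'). unfold ys. do 2 f_equal. lia. }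
  destruct (Z.eq_dec r 0) as [Er|Er].
  + destruct (Req_dec_T ys 0) as [Ey|Ey].
    * assert (Q : (Cmod (I2 - I1 - 2 * PI * Ci * zs (fun m => (K / PI * Tn m + (if Z.eq_dec m 0 then res2 M r else 0))%C) (n0 N) (nn N)) <= 4 * Cmod v * Bd * (y2 r - y1 r))%R).
      { apply (height_cross (Fr r) v 0 (y1 r) (y2 r) (y1 r - gap) (y2 r + gap)); auto; try lra.
        - apply Fr_holo; auto. intros M' HM'. rewrite (Huniq M' HM'). auto.
        - intros m. rewrite Vz. rewrite Er. destruct (Z.eq_dec m 0) as [->|Hm].
          + apply Fr_pole12. unfold ys in Ey. lra.
          + rewrite Cplus_0_r. apply Fr_pole1. auto. }
      replace (zs (fun m => (K / PI * Tn m + (if Z.eq_dec m 0 then res2 M r else 0))%C) (n0 N) (nn N))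
        with (zs (fun n => K / PI * Tn n) (n0 N) (nn N) + res2 M r) in Q.
      { eapply Rle_trans; [exact Q|]. rewrite Hy. lra. }
      unfold zs at 2. rewrite Csum_plus. f_equal. symmetry. apply (zs_delta (res2 M r)). exact Hin.
    * set (ym := (ys / 2)%R).
      assert (Y0 : (y1 r < 0 < y2 r)%R) by (unfold y1, y2; rewrite Er; simpl; lra).
      destruct (line_exists dom (Fr r) v ym (lo N) (hi N)) as [Im0 HIm0].
      { unfold hi. pose proof (pos_INR (nn N)). lra. }
      { apply HoloOn_Csum. intros. apply HoloOn_F1_dom. }
      { intros t _. exists ym, t. split; auto. split; [intros [Q _]; unfold ym in Q; lra|].
        intros [_ [M' HM']]. assert (Q : ym = ys) by (rewrite HM'; apply Huniq; rewrite <- HM'; unfold ym; lra).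
        unfold ym in Q. lra. }
      assert (R0 : forall m, PoleAt (Fr r) (RtoC (IZR m) + v * RtoC 0) (K / PI * Tn m)).
      { intros m. rewrite Vz. rewrite Er. apply Fr_pole1. intros M' HM'. exfalso. apply Ey. rewrite <- (Huniq M'); lra. }
      assert (RY : forall m, PoleAt (Fr r) (RtoC (IZR m) + v * RtoC ys) (if Z.eq_dec m 0 then res2 M r else 0)).
      { intros m. destruct (Z.eq_dec m 0) as [->|Hm].
        - apply Fr_pole2. unfold ys in Ey. lra.
        - apply PoleAt_cont, dom_cont. exists ys, (IZR m). split; auto. split; [tauto|].
          intros [Q _]. apply Hm. now apply eq_IZR. }
      destruct (Rdichotomy _ _ Ey) as [Hneg|Hpos].
      -- assert (Q1 : (Cmod (Im0 - I1 - 2 * PI * Ci * zs (fun m => (if Z.eq_dec m 0 then res2 M r else 0)%C) (n0 N) (nn N)) <= 4 * Cmod v * Bd * (ym - y1 r))%R).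
         { apply (height_cross (Fr r) v ys (y1 r) ym (y1 r - gap) 0); auto; try (unfold ym; lra).
           - apply Fr_holo; [|lra]. intros M' HM'. apply Huniq. lra.
           - intros s Hs. apply HB. unfold ym in Hs; lra. }
         assert (Q2 : (Cmod (I2 - Im0 - 2 * PI * Ci * zs (fun m => (K / PI * Tn m)%C) (n0 N) (nn N)) <= 4 * Cmod v * Bd * (y2 r - ym))%R).
         { apply (height_cross (Fr r) v 0 ym (y2 r) ys (y2 r + gap)); auto; try (unfold ym; lra).
           - apply Fr_holo; auto. intros M' HM'. exfalso. rewrite (Huniq M') in HM'; lra.
           - intros s Hs. apply HB. unfold ym in Hs; lra. }
         rewrite (zs_delta _ _ _ Hin) in Q1.
         match goal with |- (Cmod ?X <= _)%R =>
           replace X with ((I2 - Im0 - 2 * PI * Ci * zs (fun m => (K / PI * Tn m)%C) (n0 N) (nn N)) + (Im0 - I1 - 2 * PI * Ci * res2 M r)) by ring end.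
         eapply Rle_trans; [apply Cmod_triangle|]. rewrite Hy in Q2. nra.
      -- assert (Q1 : (Cmod (Im0 - I1 - 2 * PI * Ci * zs (fun m => (K / PI * Tn m)%C) (n0 N) (nn N)) <= 4 * Cmod v * Bd * (ym - y1 r))%R).
         { apply (height_cross (Fr r) v 0 (y1 r) ym (y1 r - gap) ys); auto; try (unfold ym; lra).
           - apply Fr_holo; auto. intros M' HM'. exfalso. rewrite (Huniq M') in HM'; lra.
           - intros s Hs. apply HB. unfold ym in Hs; lra. }
         assert (Q2 : (Cmod (I2 - Im0 - 2 * PI * Ci * zs (fun m => (if Z.eq_dec m 0 then res2 M r else 0)%C) (n0 N) (nn N)) <= 4 * Cmod v * Bd * (y2 r - ym))%R).
         { apply (height_cross (Fr r) v ys ym (y2 r) 0 (y2 r + gap)); auto; try (unfold ym; lra).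
           - apply Fr_holo; [|lra]. intros M' HM'. apply Huniq. lra.
           - intros s Hs. apply HB. unfold ym in Hs; lra. }
         rewrite (zs_delta _ _ _ Hin) in Q2.
         match goal with |- (Cmod ?X <= _)%R =>
           replace X with ((I2 - Im0 - 2 * PI * Ci * res2 M r) + (Im0 - I1 - 2 * PI * Ci * zs (fun m => (K / PI * Tn m)%C) (n0 N) (nn N))) by ring end.
         eapply Rle_trans; [apply Cmod_triangle|]. rewrite Hy in Q2. nra.
  + assert (Ey : ys <> 0%R).
    { intros Q. apply Er. apply strip_zero. fold (y1 r) (y2 r). lra. }
    assert (Q : (Cmod (I2 - I1 - 2 * PI * Ci * zs (fun m => (if Z.eq_dec m 0 then res2 M r else 0)%C) (n0 N) (nn N)) <= 4 * Cmod v * Bd * (y2 r - y1 r))%R).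
    { apply (height_cross (Fr r) v ys (y1 r) (y2 r) (y1 r - gap) (y2 r + gap)); auto; try lra.
      - apply Fr_holo; auto. intros H0. exfalso. apply Er. apply strip_zero. exact H0.
      - intros m. destruct (Z.eq_dec m 0) as [->|Hm].
        + apply Fr_pole2. unfold ys in Ey. lra.
        + apply PoleAt_cont, dom_cont. exists ys, (IZR m). split; auto. split; [tauto|].
          intros [Q _]. apply Hm. now apply eq_IZR. }
    rewrite (zs_delta _ _ _ Hin) in Q. rewrite Cplus_0_l. eapply Rle_trans; [exact Q|]. rewrite Hy. lra.
- assert (Hno : forall M', ~ (y1 r - gap < INR kn * x - IZR M' < y2 r + gap)%R).
  { intros M' HM'. apply E3. assert (r = r0 - 3 * M')%Z by (apply strip_of_pole; exact HM'). Z.to_euclidean_division_equations; lia. }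
  rewrite Cplus_0_r. destruct (Z.eq_dec r 0) as [Er|Er].
  + assert (Y0 : (y1 r < 0 < y2 r)%R) by (unfold y1, y2; rewrite Er; simpl; lra).
    assert (Q : (Cmod (I2 - I1 - 2 * PI * Ci * zs (fun m => (K / PI * Tn m)%C) (n0 N) (nn N)) <= 4 * Cmod v * Bd * (y2 r - y1 r))%R).
    { apply (height_cross (Fr r) v 0 (y1 r) (y2 r) (y1 r - gap) (y2 r + gap)); auto; try lra.
      - apply Fr_holo; auto. intros M' HM'. elim (Hno M' HM').
      - intros m. rewrite Vz. rewrite Er. apply Fr_pole1. intros M' HM'. elim (Hno M'). lra. }
    eapply Rle_trans; [exact Q|]. rewrite Hy. lra.
  + replace (I2 - I1 - 2 * PI * Ci * 0) with (I2 - I1) by ring.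
    eapply Rle_trans; [apply (cauchy_skew (Fr r) v (lo N - 1) (hi N + 1) (y1 r - gap) (y2 r + gap) (lo N) (hi N) (y1 r) (y2 r) Bd)|]; auto; try lra.
    * eapply HoloOn_sub; [|apply (HoloOn_Csum dom); intros; apply HoloOn_F1_dom].
      intros w (s & t & Hs & _ & ->). exists s, t. split; auto. split.
      -- intros [-> _]. apply Er. apply strip_zero. exact Hs.
      -- intros [_ [M' ->]]. exact (Hno M' Hs).
    * unfold hi. pose proof (pos_INR (nn N)). lra.
    * rewrite Hy. lra.
Qed.

(** * Decay on the lateral sides and for large r *)

Lemma Cmod_F1 (mu r : Z) (t s : R) : Cmod (F1 mu r (RtoC t + v * RtoC s)) =
  (exp (- (3 * PI * Re z / INR kn) * (t * t)) * exp (PI * sigma * s / INR kn * (3 * s - 2 * IZR r)) *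
   Cmod (Xi (PI * Ci * RtoC ((IZR mu + s) / INR kn - x) - PI * z * RtoC t / K)) *
   Cmod (/ Csinh (Ss mu (RtoC t + v * RtoC s))))%R.
Proof.
unfold F1. rewrite !Cmod_mult, Cmod_Ci, Cmod_Cexp, Re_EX, exp_plus. rewrite Rmult_1_l. do 4 f_equal.
rewrite Uu_line. pose proof kpos. unfold Rdiv. cpush. rewrite RtoC_inv by lra. fold K. unfold Cdiv. ring.
Qed.

(** A shift of t by k multiplies sinh(Ss) by a sign, so compactness of the single segment at t = 1/2
    bounds all lateral sides at once. *)
Lemma iS_side_bound (mu : Z) (a b : R) : (a <= b)%R -> exists B : R, (0 <= B)%R /\
  forall (m : Z) (s : R), (a <= s <= b)%R -> (Cmod (/ Csinh (Ss mu (RtoC (/ 2 + INR kn * IZR m) + v * RtoC s))) <= B)%R.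
Proof.
intros Hab.
set (f := fun s => Cmod (/ Csinh (Ss mu (RtoC (/ 2) + v * RtoC s)))).
assert (Hreg : forall s, regS mu (RtoC (/ 2) + v * RtoC s)).
{ intros s j E. apply Ss_zero in E. destruct E as [_ E].
  assert (E2 : IZR 1 = IZR (2 * (k * j - h' * mu))) by (rewrite mult_IZR; lra). apply eq_IZR in E2. lia. }
destruct (continuity_ab_maj f a b Hab) as [c [Hc1 Hc2]].
{ intros s _ e He.
  pose proof (HoloOn_cont _ _ _ (HoloOn_iS mu) (Hreg s)) as Q.
  pose proof (Rcont_comp_affine (fun w => / Csinh (Ss mu w)) (RtoC (/ 2)) v s) as Q2.
  replace (RtoC (/ 2) + RtoC s * v) with (RtoC (/ 2) + v * RtoC s) in Q2 by ring. specialize (Q2 Q).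
  destruct (Q2 e He) as [d [Hd Q3]]. exists d. split; auto. intros u [_ Hu]. simpl in *. unfold R_dist in *.
  specialize (Q3 u Hu). replace (RtoC (/ 2) + RtoC u * v) with (RtoC (/ 2) + v * RtoC u) in Q3 by ring.
  replace (RtoC (/ 2) + RtoC s * v) with (RtoC (/ 2) + v * RtoC s) in Q3 by ring.
  unfold f. eapply Rle_lt_trans; [|exact Q3]. apply Rabs_le.
  pose proof (Cmod_tri_rev (/ Csinh (Ss mu (RtoC (/ 2) + v * RtoC u))) (/ Csinh (Ss mu (RtoC (/ 2) + v * RtoC s)))).
  pose proof (Cmod_tri_rev (/ Csinh (Ss mu (RtoC (/ 2) + v * RtoC s))) (/ Csinh (Ss mu (RtoC (/ 2) + v * RtoC u)))).
  rewrite Cmod_minus_sym in H0. lra. }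
exists (f c). split; [apply Cmod_ge_0|]. intros m s Hs. specialize (Hc1 s Hs).
eapply Rle_trans; [|exact Hc1]. right. unfold f.
assert (E : Ss mu (RtoC (/ 2 + INR kn * IZR m) + v * RtoC s) = Ss mu (RtoC (/ 2) + v * RtoC s) + PI * Ci * IZR m).
{ unfold Ss. cpush. fold K. field. apply K_neq. }
rewrite E, Csinh_sgn.
assert (N0 : Csinh (Ss mu (RtoC (/ 2) + v * RtoC s)) <> 0).
{ intros Q. destruct (Csinh_eq_0 _ Q) as [j Hj]. exact (Hreg s j Hj). }
rewrite !Cmod_inv, Cmod_mult, Cmod_sgn, Rmult_1_l; auto. apply Cmult_neq_0; auto. apply Cexp_neq_0.
Qed.

Lemma al_pos : (0 < 3 * PI * Re z / INR kn)%R.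
Proof. pose proof kpos. pose proof PI_RGT_0. apply Rdiv_lt_0_compat; nra. Qed.

Lemma side_F1 (mu r : Z) : exists G T : R, (0 <= G)%R /\ forall (m : Z) (s : R), (y1 r <= s <= y2 r)%R ->
  (T <= Rabs (/ 2 + INR kn * IZR m))%R ->
  (Cmod (F1 mu r (RtoC (/ 2 + INR kn * IZR m) + v * RtoC s)) <= G / (1 + (/ 2 + INR kn * IZR m) * (/ 2 + INR kn * IZR m)))%R.
Proof.
destruct HXbig as (B & T & HB & HT & HX1).
destruct (iS_side_bound mu (y1 r) (y2 r)) as (Bs & HBs & HS); [rewrite y12; lra|].
destruct (gauss_dom _ B al_pos) as (G & HG & HGd).
pose proof kpos as Hk. pose proof sigma_pos as Hs0. pose proof PI_RGT_0 as Hpi.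
set (Y := (Rabs (y1 r) + 1)%R).
set (E := exp (PI * sigma * Y / INR kn * (3 * Y + 2 * Rabs (IZR r)))).
exists (E * B * Bs * G)%R, T. assert (HE : (0 < E)%R) by apply exp_pos.
split; [repeat apply Rmult_le_pos; lra|].
intros m s Hs Ht. set (t := (/ 2 + INR kn * IZR m)%R) in *. rewrite Cmod_F1.
specialize (HX1 ((IZR mu + s) / INR kn - x)%R t Ht). specialize (HS m s Hs). fold t in HS. fold K in HX1.
assert (HE2 : (exp (PI * sigma * s / INR kn * (3 * s - 2 * IZR r)) <= E)%R).
{ assert (Hsa : (Rabs s <= Y)%R).
  { rewrite y12 in Hs. unfold Y. pose proof (Rle_abs (y1 r)). pose proof (Rle_abs (- y1 r)). rewrite Rabs_Ropp in *.
    apply Rabs_le; lra. }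
  assert (L : (PI * sigma * s / INR kn * (3 * s - 2 * IZR r) <= PI * sigma * Y / INR kn * (3 * Y + 2 * Rabs (IZR r)))%R).
  { replace (PI * sigma * s / INR kn * (3 * s - 2 * IZR r))%R with (PI * sigma / INR kn * (s * (3 * s - 2 * IZR r)))%R by (field; lra).
    replace (PI * sigma * Y / INR kn * (3 * Y + 2 * Rabs (IZR r)))%R with (PI * sigma / INR kn * (Y * (3 * Y + 2 * Rabs (IZR r))))%R by (field; lra).
    apply Rmult_le_compat_l; [apply Rlt_le, Rdiv_lt_0_compat; nra|].
    eapply Rle_trans; [apply Rle_abs|]. rewrite Rabs_mult. apply Rmult_le_compat; try apply Rabs_pos; auto.
    unfold Rminus. eapply Rle_trans; [apply Rabs_triang|]. rewrite Rabs_Ropp, !Rabs_mult, (Rabs_right 3), (Rabs_right 2) by lra. lra. }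
  destruct L as [L|L]; [left; now apply exp_increasing|right; unfold E; now rewrite L]. }
specialize (HGd t). rewrite exp_plus in HGd.
set (e1 := exp (- (3 * PI * Re z / INR kn) * (t * t))) in *.
set (e2 := exp (PI * sigma * s / INR kn * (3 * s - 2 * IZR r))) in *.
set (X := Cmod (Xi _)) in *. set (S := Cmod (/ Csinh _)) in *.
assert (H1 : (0 <= e1)%R) by (left; apply exp_pos). assert (H2 : (0 <= e2)%R) by (left; apply exp_pos).
assert (HX0 : (0 <= X)%R) by apply Cmod_ge_0. assert (HS0 : (0 <= S)%R) by apply Cmod_ge_0.
pose proof (exp_pos (B * Rabs t)) as H3.
apply Rle_trans with (e1 * E * (B * exp (B * Rabs t)) * Bs)%R.
- apply Rmult_le_compat; auto; [apply Rmult_le_pos; [apply Rmult_le_pos|]; auto|].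
  apply Rmult_le_compat; auto; [apply Rmult_le_pos; auto|]. apply Rmult_le_compat_l; auto.
- replace (e1 * E * (B * exp (B * Rabs t)) * Bs)%R with (E * B * Bs * (e1 * exp (B * Rabs t)))%R by ring.
  replace (E * B * Bs * G / (1 + t * t))%R with (E * B * Bs * (G / (1 + t * t)))%R by (unfold Rdiv; ring).
  apply Rmult_le_compat_l; auto. repeat apply Rmult_le_pos; lra.
Qed.

Lemma side_Fr (r : Z) (eps : R) : (0 < eps)%R -> exists N0 : nat, forall N, (N0 <= N)%nat -> forall s, (y1 r <= s <= y2 r)%R ->
  (Cmod (Fr r (RtoC (lo N) + v * RtoC s)%C) <= eps)%R /\ (Cmod (Fr r (RtoC (hi N) + v * RtoC s)%C) <= eps)%R.
Proof.
intros He. pose proof kpos as Hk.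
assert (Hk1 : (1 <= INR kn)%R) by (replace 1%R with (INR 1) by reflexivity; apply le_INR; lia).
destruct (finite_bounds (fun i G T => forall (m : Z) (s : R), (y1 r <= s <= y2 r)%R ->
  (T <= Rabs (/ 2 + INR kn * IZR m))%R ->
  (Cmod (F1 (Z.of_nat i) r (RtoC (/ 2 + INR kn * IZR m) + v * RtoC s)%C) <= G / (1 + (/ 2 + INR kn * IZR m) * (/ 2 + INR kn * IZR m)))%R) kn)
  as (G & T & HG & HGT).
{ intros i G G' T T' HG HT H m s Hs Ht. eapply Rle_trans; [apply H; auto; lra|].
  apply Rmult_le_compat_r; auto. left. apply Rinv_0_lt_compat. nra. }
{ intros i. destruct (side_F1 (Z.of_nat i) r) as (G & T & HG & H). exists G, T. split; auto. }
assert (Hm : exists N0 : nat, forall N, (N0 <= N)%nat -> forall m : Z, Rabs (IZR m) = INR N ->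
   (T <= Rabs (/ 2 + INR kn * IZR m))%R /\ (INR kn * (G / (1 + (/ 2 + INR kn * IZR m) * (/ 2 + INR kn * IZR m))) <= eps)%R).
{ destruct (INR_unbounded (Rabs T + INR kn * G / eps + 2)) as [N0 HN0]. exists N0. intros N HN m Em.
  apply le_INR in HN. set (t := (/ 2 + INR kn * IZR m)%R).
  assert (Ht : (INR N - / 2 <= Rabs t)%R).
  { unfold t. pose proof (Rabs_triang (/ 2 + INR kn * IZR m) (- / 2)) as Q.
    replace (/ 2 + INR kn * IZR m + - / 2)%R with (INR kn * IZR m)%R in Q by ring.
    rewrite Rabs_mult, Em, Rabs_Ropp, (Rabs_right (/ 2)), (Rabs_right (INR kn)) in Q by lra.
    pose proof (pos_INR N). nra. }
  pose proof (Rle_abs T). pose proof (Rabs_pos T).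
  assert (HGe : (0 <= INR kn * G / eps)%R) by (apply Rmult_le_pos; [nra|left; apply Rinv_0_lt_compat; lra]).
  split; [lra|].
  assert (H1 : (1 <= Rabs t)%R) by lra. assert (H2 : (INR kn * G / eps <= Rabs t)%R) by lra.
  assert (H3 : (t * t = Rabs t * Rabs t)%R) by (rewrite <- Rabs_mult; symmetry; apply Rabs_right; nra).
  apply Rmult_le_reg_r with ((1 + t * t) / eps)%R; [apply Rdiv_lt_0_compat; nra|].
  replace (INR kn * (G / (1 + t * t)) * ((1 + t * t) / eps))%R with (INR kn * G / eps)%R by (field; split; [lra|nra]).
  replace (eps * ((1 + t * t) / eps))%R with (1 + t * t)%R by (field; lra). nra. }
destruct Hm as [N0 HN0]. exists N0. intros N HN s Hs.
assert (Z1 : forall m, Rabs (IZR m) = INR N -> (Cmod (Fr r (RtoC (/ 2 + INR kn * IZR m) + v * RtoC s)%C) <= eps)%R).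
{ intros m Em. destruct (HN0 N HN m Em) as [A1 A2]. eapply Rle_trans; [|exact A2].
  apply Cmod_Csum. intros i Hi. apply HGT; auto. }
split.
- rewrite lo_eq. replace (- INR N)%R with (IZR (- Z.of_nat N)) by (rewrite opp_IZR, <- INR_IZR_INZ; auto). apply Z1.
  rewrite opp_IZR, Rabs_Ropp, <- INR_IZR_INZ. apply Rabs_right. apply Rle_ge, pos_INR.
- rewrite hi_eq. replace (INR N)%R with (IZR (Z.of_nat N)) by (rewrite <- INR_IZR_INZ; auto). apply Z1.
  rewrite <- INR_IZR_INZ. apply Rabs_right. apply Rle_ge, pos_INR.
Qed.

(** On both edges of strip r, s = (2r - 1)/6 and s = (2r + 1)/6, one has s(3s - 2r) = (1 - 4r^2)/12,
    which makes the exponent cc - 4 cc r^2. *)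
Definition cc : R := (PI * sigma / (12 * INR kn))%R.
Lemma cc_pos : (0 < cc)%R.
Proof. unfold cc. pose proof kpos. pose proof sigma_pos. pose proof PI_RGT_0. apply Rdiv_lt_0_compat; nra. Qed.

Lemma Re_Ss (mu : Z) (t s : R) : Re (Ss mu (RtoC t + v * RtoC s)) = (PI * sigma / INR kn * s)%R.
Proof.
pose proof kpos.
replace (Ss mu (RtoC t + v * RtoC s)) with (Ci * RtoC (PI * (t + IZR h' * IZR mu) / INR kn) + RtoC (PI * s / INR kn) * / z).
- creim. fold sigma. field. lra.
- unfold Ss, v, Rdiv. cpush. rewrite RtoC_inv by lra. fold K. pose proof K_neq. pose proof z_neq. pose proof Ci2 as H2. field [H2]. auto.
Qed.

(** The edge in question faces away from the real line. There |s| >= 1/6, so that |sinh(Ss)| >= sinh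
    |Re Ss| is bounded below uniformly in t and r. *)
Lemma line_bound : exists G : R, (0 <= G)%R /\ forall (r : Z) (s t : R),
  ((1 <= r)%Z /\ s = y2 r) \/ ((r <= -1)%Z /\ s = y1 r) ->
  (Cmod (Fr r (RtoC t + v * RtoC s)%C) <= G * exp (- (4 * cc) * (IZR r * IZR r)) / (1 + t * t))%R.
Proof.
destruct HXline as (B & HB & HX1).
destruct (gauss_dom _ B al_pos) as (G & HG & HGd).
pose proof kpos as Hk. pose proof sigma_pos as Hs0. pose proof PI_RGT_0 as Hpi. pose proof cc_pos as Hcc.
set (a1 := (PI * sigma / INR kn * / 6)%R).
assert (Ha1 : (0 < a1)%R) by (unfold a1; apply Rmult_lt_0_compat; [apply Rdiv_lt_0_compat; nra|lra]).
pose proof (sinh_pos a1 Ha1) as Hsh.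
exists (INR kn * (exp cc * B * / sinh a1 * G))%R. pose proof (exp_pos cc) as Hec.
assert (Hish : (0 < / sinh a1)%R) by (apply Rinv_0_lt_compat; auto).
split; [repeat apply Rmult_le_pos; lra|].
intros r s t Hrs.
assert (Hr2 : (/ 6 <= Rabs s)%R).
{ destruct Hrs as [[Hr ->]|[Hr ->]].
  - apply IZR_le in Hr. unfold y2. rewrite plus_IZR, mult_IZR. rewrite Rabs_right; lra.
  - apply IZR_le in Hr. unfold y1. rewrite minus_IZR, mult_IZR. rewrite Rabs_left1; lra. }
assert (Hexp : (PI * sigma * s / INR kn * (3 * s - 2 * IZR r) = cc + - (4 * cc) * (IZR r * IZR r))%R).
{ destruct Hrs as [[Hr ->]|[Hr ->]]; unfold y1, y2, cc; rewrite ?plus_IZR, ?minus_IZR, mult_IZR; field; lra. }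
assert (HX2 : forall mu, (Cmod (Xi (PI * Ci * RtoC ((IZR mu + s) / INR kn - x) - PI * z * RtoC t / K)%C) <= B * exp (B * Rabs t))%R).
{ intros mu. destruct Hrs as [[Hr ->]|[Hr ->]].
  - replace ((IZR mu + y2 r) / INR kn - x)%R with (IZR (6 * mu + (2 * r + 1)) / (6 * INR kn) - x)%R; [apply HX1|].
    unfold y2. rewrite !plus_IZR, !mult_IZR. field. lra.
  - replace ((IZR mu + y1 r) / INR kn - x)%R with (IZR (6 * mu + (2 * (r - 1) + 1)) / (6 * INR kn) - x)%R; [apply HX1|].
    unfold y1. rewrite !plus_IZR, !minus_IZR, !mult_IZR, minus_IZR. field. lra. }
replace (INR kn * (exp cc * B * / sinh a1 * G) * exp (- (4 * cc) * (IZR r * IZR r)) / (1 + t * t))%R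
 with (INR kn * (exp cc * B * / sinh a1 * G * exp (- (4 * cc) * (IZR r * IZR r)) / (1 + t * t)))%R by (unfold Rdiv; ring).
apply Cmod_Csum. intros i _. set (mu := Z.of_nat i). rewrite Cmod_F1, Hexp, exp_plus.
specialize (HX2 mu). specialize (HGd t). rewrite exp_plus in HGd.
assert (HSs : (Cmod (/ Csinh (Ss mu (RtoC t + v * RtoC s))) <= / sinh a1)%R).
{ pose proof (Rabs_sinh_le_Cmod (Ss mu (RtoC t + v * RtoC s))) as Q. rewrite Re_Ss in Q.
  assert (Q2 : (a1 <= Rabs (PI * sigma / INR kn * s))%R).
  { rewrite Rabs_mult. rewrite (Rabs_right (PI * sigma / INR kn)) by (apply Rle_ge, Rlt_le, Rdiv_lt_0_compat; nra).
    unfold a1. apply Rmult_le_compat_l; auto. apply Rlt_le, Rdiv_lt_0_compat; nra. }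
  pose proof (sinh_incr_le _ _ Q2).
  rewrite Cmod_inv by (apply Cmod_gt_0; lra). apply Rinv_le_contravar; lra. }
set (e1 := exp (- (3 * PI * Re z / INR kn) * (t * t))) in *.
set (e2 := exp (- (4 * cc) * (IZR r * IZR r))) in *.
set (X := Cmod (Xi _)) in *. set (S := Cmod (/ Csinh _)) in *.
assert (H1 : (0 <= e1)%R) by (left; apply exp_pos). assert (H2 : (0 <= e2)%R) by (left; apply exp_pos).
assert (HX0 : (0 <= X)%R) by apply Cmod_ge_0. assert (HS0 : (0 <= S)%R) by apply Cmod_ge_0.
pose proof (exp_pos (B * Rabs t)) as H3.
assert (H4 : (0 <= exp cc * e2)%R) by (apply Rmult_le_pos; lra).
apply Rle_trans with (e1 * (exp cc * e2) * (B * exp (B * Rabs t)) * / sinh a1)%R.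
- apply Rmult_le_compat; auto; [apply Rmult_le_pos; [apply Rmult_le_pos|]; auto|].
  apply Rmult_le_compat; auto; [apply Rmult_le_pos; auto|lra].
- replace (e1 * (exp cc * e2) * (B * exp (B * Rabs t)) * / sinh a1)%R with (exp cc * B * / sinh a1 * e2 * (e1 * exp (B * Rabs t)))%R by ring.
  replace (exp cc * B * / sinh a1 * G * e2 / (1 + t * t))%R with (exp cc * B * / sinh a1 * e2 * (G / (1 + t * t)))%R by (unfold Rdiv; ring).
  apply Rmult_le_compat_l; auto. repeat apply Rmult_le_pos; lra.
Qed.

(** * Mordell integrals between adjacent strips *)

Definition lc (mu r : Z) : C :=
  Cexp (PI * Ci * IZR mu - 3 * PI * Ci * IZR h' * IZR mu * IZR mu / K - Ci * IZR (2 * r + 1) * PI * IZR h' * IZR mu / K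
   - PI * IZR (2 * r + 1) * IZR (2 * r + 1) / (12 * K * z)).
(** mu and r enter the integrand only through j = 6 mu + 2r + 1; this lets different strips share
    their integrals. *)
Definition Gint (j : Z) (t : R) : C :=
  Cexp (- (3 * PI * z * RtoC t * RtoC t / K)) * Xi (PI * Ci * RtoC (IZR j / (6 * INR kn) - x) - PI * z * RtoC t / K).

(** r occurs only in e^{-2r Ss}, so the difference has the factor 1 - e^{-2 Ss} = 2 e^{-Ss}
    sinh(Ss), which cancels the denominator. *)
Lemma line_diff (mu r : Z) (t : R) :
  F1 mu r (RtoC t + v * RtoC (y2 r)) - F1 mu (r + 1) (RtoC t + v * RtoC (y2 r)) =
  2 * Ci * (lc mu r * Gint (6 * mu + (2 * r + 1)) t).
Proof.
pose proof K_neq as HK. pose proof z_neq as Hzn. pose proof kpos as Hk.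
set (w := RtoC t + v * RtoC (y2 r)).
assert (HS : Csinh (Ss mu w) <> 0).
{ intros Q. destruct (Csinh_eq_0 _ Q) as [j Hj]. apply Ss_zero in Hj. destruct Hj as [Hj _].
  assert (E : IZR (2 * r + 1) = IZR 0) by (unfold y2 in Hj; lra). apply eq_IZR in E. lia. }
assert (E1 : EX mu (r + 1) w = EX mu r w - Ss mu w - Ss mu w).
{ unfold EX, Ss. cpush. field. auto. }
unfold F1. rewrite E1, !Cexp_minus. 
assert (EU : Uu mu w = PI * Ci * RtoC (IZR (6 * mu + (2 * r + 1)) / (6 * INR kn) - x) - PI * z * RtoC t / K).
{ unfold w. rewrite Uu_line. unfold y2, Rdiv. cpush. rewrite !RtoC_inv, RtoC_mult by lra. fold K. field. auto. }
rewrite EU.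
assert (EL : lc mu r * Cexp (- (3 * PI * z * RtoC t * RtoC t / K)) = Cexp (EX mu r w) / Cexp (Ss mu w)).
{ unfold lc. rewrite <- Cexp_plus, <- Cexp_minus. f_equal. unfold EX, Ss, w, v, y2, Rdiv. cpush. rewrite RtoC_inv by lra.
  pose proof Ci2 as H2. field [H2]. auto. }
unfold Gint. rewrite Cmult_assoc with (x := lc mu r). rewrite EL. unfold Csinh in *. rewrite Cexp_opp in *.
pose proof (Cexp_neq_0 (Ss mu w)) as N1. set (e := Cexp (Ss mu w)) in *.
assert (N2 : e * e - 1 <> 0).
{ intros Q. apply HS. replace ((e - / e) / 2) with ((e * e - 1) / (2 * e)) by (field; auto using C2_neq_0). rewrite Q. unfold Cdiv. ring. }
field. split; auto.
Qed.

Definition Mint (j : Z) : C := CInt_line (Gint j).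

Lemma not_pole_height (r M : Z) : y2 r <> (INR kn * x - IZR M)%R.
Proof.
intros HM. pose proof gap_pos.
pose proof (strip_of_pole M r ltac:(rewrite <- HM; fold (y1 r) (y2 r); rewrite y12; lra)) as E1.
pose proof (strip_of_pole M (r + 1) ltac:(rewrite <- HM; replace (2 * (r + 1) - 1)%Z with (2 * r + 1)%Z by ring;
  fold (y2 r); fold (y2 (r + 1)); unfold y2; rewrite !plus_IZR, !mult_IZR, plus_IZR; lra)) as E2. lia.
Qed.

(** On the line of height (2j + 1)/6 the second factor is Xi(Uu 0 w), and no pole of Xi has this
    height. *)
Lemma Gint_cont (j : Z) (t : R) : Rcont (Gint (2 * j + 1)) t.
Proof.
pose proof kpos as Hk. pose proof K_neq as HK.
assert (HU : regU 0 (RtoC t + v * RtoC (y2 j))).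
{ intros _ i E. apply Uu_zero in E. destruct E as [_ E]. exact (not_pole_height j _ E). }
pose proof (HoloOn_cont _ _ _ (HoloOn_XiU 0) HU) as C1.
pose proof (Rcont_line (fun w => Xi (Uu 0 w)) v (y2 j) t C1) as R1.
assert (R2 : Rcont (fun s => Cexp (- (3 * PI * z * RtoC s * RtoC s / K))) t).
{ assert (Hh : HoloOn (fun _ => True) (fun w => Cexp (- (3 * PI * z * w * w / K)))).
  { apply HoloOn_exp_comp. apply HoloOn_ext with (fun w => (- (3 * PI * z / K)) * w * w + 0 * w + 0).
    - intros w. field. auto.
    - apply HoloOn_poly2. }
  pose proof (HoloOn_cont _ _ (0 + RtoC t * 1) Hh I) as C2.
  pose proof (Rcont_comp_affine _ 0 1 t C2) as Q.
  intros e He. destruct (Q e He) as [d [Hd Q2]]. exists d. split; auto. intros s Hs. specialize (Q2 s Hs).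
  replace (0 + RtoC s * 1) with (RtoC s) in Q2 by ring. replace (0 + RtoC t * 1) with (RtoC t) in Q2 by ring. exact Q2. }
assert (E : forall s, Gint (2 * j + 1) s = Cexp (- (3 * PI * z * RtoC s * RtoC s / K)) * Xi (Uu 0 (RtoC s + v * RtoC (y2 j)))).
{ intros s. unfold Gint. do 2 f_equal. rewrite Uu_line. unfold y2, Rdiv. cpush. rewrite !RtoC_inv, RtoC_mult by lra. fold K.
  field. auto. }
assert (P : C2cont (fun s _ => Cexp (- (3 * PI * z * RtoC s * RtoC s / K)) * Xi (Uu 0 (RtoC s + v * RtoC (y2 j)))) t 0).
{ apply (C2cont_mult (fun s _ => Cexp (- (3 * PI * z * RtoC s * RtoC s / K))) (fun s _ => Xi (Uu 0 (RtoC s + v * RtoC (y2 j))))).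
  - intros e He. destruct (R2 e He) as [d [Hd Q]]. exists d. split; auto.
  - intros e He. destruct (R1 e He) as [d [Hd Q]]. exists d. split; auto. }
intros e He. destruct (C2cont_fst _ _ _ P e He) as [d [Hd Q]]. exists d. split; auto. intros s Hs. rewrite !E. apply Q, Hs.
Qed.

Lemma Gint_dom : exists G : R, (0 <= G)%R /\ forall (j : Z) (t : R), (Cmod (Gint (2 * j + 1) t) <= G / (1 + t * t))%R.
Proof.
destruct HXline as (B & HB & HX1). destruct (gauss_dom _ B al_pos) as (G & HG & HGd). pose proof kpos as Hk.
exists (B * G)%R. split; [nra|]. intros j t. unfold Gint. rewrite Cmod_mult, Cmod_Cexp.
specialize (HX1 0%Z j t). replace (6 * 0 + (2 * j + 1))%Z with (2 * j + 1)%Z in HX1 by ring. fold K in HX1.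
assert (E : Re (- (3 * PI * z * RtoC t * RtoC t / K)) = (- (3 * PI * Re z / INR kn) * (t * t))%R).
{ replace (- (3 * PI * z * RtoC t * RtoC t / K)) with (RtoC (- (3 * PI / INR kn) * (t * t)) * z).
  - creim. field. lra.
  - unfold Rdiv. cpush. rewrite RtoC_inv by lra. fold K. field. apply K_neq. }
rewrite E. specialize (HGd t). rewrite exp_plus in HGd.
set (e1 := exp (- (3 * PI * Re z / INR kn) * (t * t))) in *. assert (0 < e1)%R by apply exp_pos.
apply Rle_trans with (e1 * (B * exp (B * Rabs t)))%R; [apply Rmult_le_compat_l; lra|].
replace (B * G / (1 + t * t))%R with (B * (G / (1 + t * t)))%R by (unfold Rdiv; ring).
replace (e1 * (B * exp (B * Rabs t)))%R with (B * (e1 * exp (B * Rabs t)))%R by ring. now apply Rmult_le_compat_l.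
Qed.

Lemma Mint_line (j : Z) : is_line (Gint (2 * j + 1)) (Mint (2 * j + 1)).
Proof.
destruct Gint_dom as (G & HG & HGd).
destruct (is_line_exists _ G HG (Gint_cont j) (HGd j)) as [l Hl].
unfold Mint. now rewrite (is_line_CInt _ l (Gint_cont j) Hl).
Qed.

Lemma lo_le_hi (N : nat) : (lo N <= hi N)%R.
Proof. unfold hi. pose proof (pos_INR (nn N)). lra. Qed.

Lemma HMint (j : Z) : exists I : nat -> C,
  (forall N, isCI (Gint (2 * j + 1)) (lo N) (hi N) (I N)) /\ Clim I (Mint (2 * j + 1)).
Proof.
set (I := fun N : nat => (RInt (fun t => Re (Gint (2 * j + 1) t)) (lo N) (hi N), RInt (fun t => Im (Gint (2 * j + 1) t)) (lo N) (hi N)) : C).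
assert (HI : forall N, isCI (Gint (2 * j + 1)) (lo N) (hi N) (I N)).
{ intros N. destruct (isCI_exists _ _ _ (lo_le_hi N) (fun t _ => Gint_cont j t)) as [J [J1 J2]]. unfold I, isCI. cbn [Re Im fst snd].
  rewrite (is_RInt_unique _ _ _ _ J1), (is_RInt_unique _ _ _ _ J2). split; assumption. }
exists I. split; auto. pose proof kpos as Hk.
assert (Hk1 : (1 <= INR kn)%R) by (replace 1%R with (INR 1) by reflexivity; apply le_INR; lia).
apply (is_line_Clim _ _ lo hi I (Mint_line j)); auto; intros N; [rewrite lo_eq|rewrite hi_eq]; pose proof (pos_INR N); nra.
Qed.

(** Raising the index by 6k adds pi i to the argument of Xi. *)
Lemma Mint_per (j : Z) : Mint (2 * j + 1 + 6 * k) = - Mint (2 * j + 1).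
Proof.
pose proof kpos as Hk. pose proof K_neq as HK.
assert (E : forall t, Gint (2 * (j + 3 * k) + 1) t = - (1) * Gint (2 * j + 1) t).
{ intros t. unfold Gint.
  replace (PI * Ci * RtoC (IZR (2 * (j + 3 * k) + 1) / (6 * INR kn) - x) - PI * z * RtoC t / K)
    with (PI * Ci * RtoC (IZR (2 * j + 1) / (6 * INR kn) - x) - PI * z * RtoC t / K + PI * Ci).
  - rewrite HXper. ring.
  - unfold Rdiv. cpush. rewrite IZRk, !RtoC_inv, RtoC_mult by lra. fold K. field. auto. }
replace (2 * j + 1 + 6 * k)%Z with (2 * (j + 3 * k) + 1)%Z by ring.
apply (is_line_unique (Gint (2 * (j + 3 * k) + 1))); [apply Gint_cont|apply Mint_line|].
eapply is_line_ext; [intros t; symmetry; apply E|].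
replace (- Mint (2 * j + 1)) with (- (1) * Mint (2 * j + 1)) by ring.
apply is_line_scal; [apply Gint_cont|apply Mint_line].
Qed.

Definition er (r : Z) : C := Csum (fun i => lc (Z.of_nat i) r * Mint (6 * Z.of_nat i + (2 * r + 1))) kn.

Lemma er_lim (r : Z) : exists I : nat -> C,
  (forall N, isCI (fun t => Fr r (RtoC t + v * RtoC (y2 r)) - Fr (r + 1) (RtoC t + v * RtoC (y2 r))) (lo N) (hi N) (I N)) /\
  Clim I (2 * Ci * er r).
Proof.
assert (Hi : forall mu : Z, exists I : nat -> C, (forall N, isCI (fun t => F1 mu r (RtoC t + v * RtoC (y2 r)) - F1 mu (r + 1) (RtoC t + v * RtoC (y2 r))) (lo N) (hi N) (I N)) /\
  Clim I (2 * Ci * (lc mu r * Mint (6 * mu + (2 * r + 1))))).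
{ intros mu. destruct (HMint (3 * mu + r)) as (I & H1 & H2).
  replace (2 * (3 * mu + r) + 1)%Z with (6 * mu + (2 * r + 1))%Z in * by ring.
  exists (fun N => 2 * Ci * (lc mu r * I N)). split.
  - intros N. apply isCI_ext with (fun t => 2 * Ci * (lc mu r * Gint (6 * mu + (2 * r + 1)) t)).
    + intros t. now rewrite line_diff.
    + apply isCI_scal, isCI_scal, H1.
  - apply Clim_scal, Clim_scal, H2. }
assert (Hn : forall n, exists I : nat -> C, (forall N, isCI (fun t => Csum (fun i => F1 (Z.of_nat i) r (RtoC t + v * RtoC (y2 r))) n - Csum (fun i => F1 (Z.of_nat i) (r + 1) (RtoC t + v * RtoC (y2 r))) n) (lo N) (hi N) (I N)) /\
  Clim I (2 * Ci * Csum (fun i => lc (Z.of_nat i) r * Mint (6 * Z.of_nat i + (2 * r + 1))) n)).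
{ induction n as [|n (I & H1 & H2)].
  - exists (fun _ => 0). split.
    + intros N. simpl. apply isCI_ext with (fun _ => 0); [intros; ring|apply isCI_zero].
    + simpl. replace (2 * Ci * 0) with (RtoC 0) by ring. apply Clim_const.
  - destruct (Hi (Z.of_nat n)) as (I' & H1' & H2'). exists (fun N => I N + I' N). split.
    + intros N. eapply isCI_ext; [|apply isCI_plus; [apply H1|apply H1']]. intros t. cbn [Csum]. ring.
    + cbn [Csum]. rewrite Cmult_plus_distr_l. now apply Clim_plus. }
exact (Hn kn).
Qed.

(** * Summation over the strips *)

Lemma isJ_exists (r r' : Z) (N : nat) : exists I, isJ r (y2 r') N I.
Proof.
apply (line_exists dom).
- unfold hi. pose proof (pos_INR (nn N)). lra.
- apply HoloOn_Csum. intros. apply HoloOn_F1_dom.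
- intros t _. exists (y2 r'), t. split; auto. split.
  + intros [Q _]. assert (E : IZR (2 * r' + 1) = IZR 0) by (unfold y2 in Q; lra). apply eq_IZR in E. lia.
  + intros [_ [M HM]]. pose proof gap_pos.
    pose proof (strip_of_pole M r' ltac:(rewrite <- HM; fold (y1 r') (y2 r'); rewrite y12; lra)) as E1.
    pose proof (strip_of_pole M (r' + 1) ltac:(rewrite <- HM; replace (2 * (r' + 1) - 1)%Z with (2 * r' + 1)%Z by ring;
      fold (y2 r'); fold (y2 (r' + 1)); unfold y2; rewrite !plus_IZR, !mult_IZR, plus_IZR; lra)) as E2. lia.
Qed.

Lemma isJ_choice (r : Z) (s : R) : (forall N, exists I, isJ r s N I) -> exists I : nat -> C, forall N, isJ r s N (I N).
Proof.
intros H. exists (fun N => (RInt (fun t => Re (Fr r (RtoC t + v * RtoC s))) (lo N) (hi N),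
  RInt (fun t => Im (Fr r (RtoC t + v * RtoC s))) (lo N) (hi N))).
intros N. destruct (H N) as [I [K1 K2]]. unfold isJ, isCI. cbn [Re Im fst snd].
rewrite (is_RInt_unique _ _ _ _ K1), (is_RInt_unique _ _ _ _ K2). split; assumption.
Qed.

Lemma y1_y2 (r : Z) : y1 r = y2 (r - 1).
Proof. unfold y1, y2. do 2 f_equal. ring. Qed.

Definition rres (r : Z) : C := if Z.eq_dec ((r0 - r) mod 3) 0 then res2 ((r0 - r) / 3) r else 0.

Lemma strip_lim (r : Z) (L : C) (I1 I2 : nat -> C) : is_zsum Tn L ->
  (forall N, isJ r (y1 r) N (I1 N)) -> (forall N, isJ r (y2 r) N (I2 N)) ->
  Clim (fun N => I2 N - I1 N) (2 * PI * Ci * ((if Z.eq_dec r 0 then K / PI * L else 0) + rres r)).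
Proof.
intros HL H1 H2.
assert (A : Clim (fun N => stripres r N) ((if Z.eq_dec r 0 then K / PI * L else 0) + rres r)).
{ unfold stripres. apply Clim_plus; [|apply Clim_const].
  destruct (Z.eq_dec r 0) as [Er|Er]; [|apply Clim_const].
  pose proof (is_zsum_scal (K / PI) _ _ HL) as Q. intros e He. destruct (Q e He) as [N0 HN0].
  exists (S N0). intros N HN. apply HN0; unfold n0, nn, k; nia. }
assert (B : Clim (fun N => I2 N - I1 N - 2 * PI * Ci * stripres r N) 0).
{ intros e He. pose proof (Cmod_ge_0 v) as Hv.
  destruct (side_Fr r (e / (8 * (Cmod v + 1)))%R) as [N0 HN0]; [apply Rdiv_lt_0_compat; lra|].
  exists (S N0). intros N HN.
  match goal with |- (Cmod (?X - _) < _)%R => replace (X - 0) with X by ring end.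
  eapply Rle_lt_trans; [apply (strip r N (e / (8 * (Cmod v + 1))))|]; auto; [lia|apply HN0; lia|].
  apply Rle_lt_trans with (4 * (Cmod v + 1) * (e / (8 * (Cmod v + 1))))%R.
  - apply Rmult_le_compat_r; [left; apply Rdiv_lt_0_compat; lra|lra].
  - replace (4 * (Cmod v + 1) * (e / (8 * (Cmod v + 1))))%R with (e / 2)%R by (field; lra). lra. }
apply Clim_ext with (fun N => (I2 N - I1 N - 2 * PI * Ci * stripres r N) + 2 * PI * Ci * stripres r N); [intros; ring|].
match goal with |- Clim _ ?X => replace X with (0 + X) by ring end.
apply Clim_plus; auto. apply Clim_scal. exact A.
Qed.

(** Adjacent strips share an edge, as [y1 (r + 1)] is [y2 r], but carry F_r and F_{r+1} on it.
    Adding the strips therefore telescopes up to the integrals of F_r - F_{r+1}, whose limits are 2i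
    times [er r]. *)
Lemma strips_lim (a : Z) (n : nat) (L : C) (Ia Ib : nat -> C) : is_zsum Tn L ->
  (forall N, isJ a (y1 a) N (Ia N)) -> (forall N, isJ (a + Z.of_nat n) (y2 (a + Z.of_nat n)) N (Ib N)) ->
  Clim (fun N => Ib N - Ia N) (2 * PI * Ci * zs (fun r => (if Z.eq_dec r 0 then K / PI * L else 0) + rres r) a (S n)
     - 2 * Ci * zs er a n).
Proof.
intros HL Ha. revert Ib. induction n as [|n IH]; intros Ib Hb.
- replace (a + Z.of_nat 0)%Z with a in Hb by lia.
  unfold zs. cbn [Csum]. replace (a + Z.of_nat 0)%Z with a by lia.
  match goal with |- Clim _ ?X => replace X with (2 * PI * Ci * ((if Z.eq_dec a 0 then K / PI * L else 0) + rres a)) by ring end.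
  now apply strip_lim.
- set (r := (a + Z.of_nat n)%Z) in *. assert (Er : (a + Z.of_nat (S n))%Z = (r + 1)%Z) by (unfold r; lia).
  rewrite Er in Hb.
  destruct (isJ_choice r (y2 r) (isJ_exists r r)) as [I1 HI1].
  destruct (isJ_choice (r + 1)%Z (y1 (r + 1))) as [I2 HI2].
  { intros N. rewrite y1_y2. apply isJ_exists. }
  specialize (IH I1 HI1).
  destruct (er_lim r) as (Ie & He1 & He2).
  pose proof (strip_lim (r + 1) L I2 Ib HL HI2 Hb) as Hs.
  rewrite zs_S. rewrite (zs_S er). rewrite Er. fold r.
  apply Clim_ext with (fun N => (I1 N - Ia N) + (Ib N - I2 N) - Ie N).
  + intros N. assert (E : Ie N = I1 N - I2 N).
    { eapply isCI_unique; [apply He1|]. apply isCI_minus; [apply HI1|].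
      specialize (HI2 N). rewrite y1_y2 in HI2. replace (r + 1 - 1)%Z with r in HI2 by ring. exact HI2. }
    rewrite E. ring.
  + match type of IH with Clim _ ?X => match type of Hs with Clim _ ?Y => match type of He2 with Clim _ ?W =>
      match goal with |- Clim _ ?G => replace G with (X + Y - W) by ring end end end end.
    apply Clim_minus; auto. now apply Clim_plus.
Qed.

Lemma J_bound : exists G : R, (0 <= G)%R /\ forall (r : Z) (s : R) (N : nat) (I : C),
  ((1 <= r)%Z /\ s = y2 r) \/ ((r <= -1)%Z /\ s = y1 r) -> isJ r s N I ->
  (Cmod I <= G * exp (- (4 * cc) * (IZR r * IZR r)))%R.
Proof.
destruct line_bound as (G & HG & H). pose proof PI_RGT_0.
exists (2 * (G * PI))%R. split; [nra|]. intros r s N I Hrs HI.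
assert (Hlh : (lo N <= hi N)%R) by (unfold hi; pose proof (pos_INR (nn N)); lra).
set (e := exp (- (4 * cc) * (IZR r * IZR r))). assert (He : (0 < e)%R) by apply exp_pos.
destruct (int_dom (lo N) (hi N) (G * e) Hlh) as (L & HL1 & HL2).
eapply Rle_trans; [apply (isCI_bound_fun _ _ _ _ _ _ Hlh HI HL1)|].
- intros t _. apply H. exact Hrs.
- specialize (HL2 ltac:(nra)). lra.
Qed.

(** Pole lines occur only in the strips r = r0 - 3M. Of the three classes of r modulo 3, one carries
    the sum over M, in reversed order, and the others vanish. *)
Lemma rres_zsum (Rv : C) : is_zsum (fun M => res2 M (r0 - 3 * M)) Rv -> is_zsum rres Rv.
Proof.
intros H.
assert (S : forall i : Z, ((r0 - i) mod 3 = 0)%Z -> is_zsum (fun t => rres (3 * t + i)) Rv).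
{ intros i Hi. set (m0 := ((r0 - i) / 3)%Z).
  apply is_zsum_ext with (fun t => (fun n => (fun M => res2 M (r0 - 3 * M)) (n + m0)%Z) (- t)%Z).
  - intros t. unfold rres. 
    assert (E : (r0 - (3 * t + i) = 3 * (- t + m0))%Z) by (unfold m0; Z.to_euclidean_division_equations; lia).
    rewrite E, (Z.mul_comm 3), Z_mod_mult, Z.div_mul by lia. destruct (Z.eq_dec 0 0); [|lia]. f_equal. lia.
  - apply (is_zsum_opp (fun n => (fun M => res2 M (r0 - 3 * M)) (n + m0)%Z)). apply (is_zsum_shift m0 (fun M => res2 M (r0 - 3 * M))), H. }
assert (Zr : forall i : Z, ((r0 - i) mod 3 <> 0)%Z -> is_zsum (fun t => rres (3 * t + i)) 0).
{ intros i Hi. intros e He. exists O. intros a n _ _. rewrite zs_zero; [replace (0 - 0) with (RtoC 0) by ring; now rewrite Cmod_0|].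
  intros t _. unfold rres. destruct (Z.eq_dec ((r0 - (3 * t + i)) mod 3) 0) as [E|E]; auto.
  exfalso. apply Hi. Z.to_euclidean_division_equations; lia. }
assert (S0 : forall l, is_zsum (fun t => rres (3 * t + 0)) l -> is_zsum (fun t => rres (3 * t)) l).
{ intros l. apply is_zsum_ext. intros t. f_equal. lia. }
assert (Hr : ((r0 - 0) mod 3 = 0 \/ (r0 - 1) mod 3 = 0 \/ (r0 - 2) mod 3 = 0)%Z) by (Z.to_euclidean_division_equations; lia).
destruct Hr as [Hr|[Hr|Hr]].
- replace Rv with (Rv + 0 + 0) by ring. apply is_zsum_interleave; [apply S0, S; auto|apply Zr|apply Zr]; Z.to_euclidean_division_equations; lia.
- replace Rv with (0 + Rv + 0) by ring. apply is_zsum_interleave; [apply S0, Zr|apply S; auto|apply Zr]; Z.to_euclidean_division_equations; lia.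
- replace Rv with (0 + 0 + Rv) by ring. apply is_zsum_interleave; [apply S0, Zr|apply Zr|apply S; auto]; Z.to_euclidean_division_equations; lia.
Qed.

(** The windows grow first, for a fixed finite range of strips. The two outermost integrals are
    bounded uniformly in N by a Gaussian in the number of the outermost strip, so they disappear
    when the range of strips grows. *)
Theorem lerch_poisson (L Rv Ev : C) :
  is_zsum Tn L -> is_zsum (fun M => res2 M (r0 - 3 * M)) Rv -> is_zsum er Ev -> K * L + PI * Rv = Ev.
Proof.
intros HL HR HE. pose proof (rres_zsum Rv HR) as HR'. pose proof cc_pos as Hcc.
destruct J_bound as (G & HG & HJ).
set (P := 2 * PI * Ci * (K / PI * L + Rv) - 2 * Ci * Ev).
assert (E0 : Clim (fun m : nat => 2 * PI * Ci * zs (fun r => (if Z.eq_dec r 0 then K / PI * L else 0) + rres r) (- Z.of_nat (S m)) (S (2 * S m))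
     - 2 * Ci * zs er (- Z.of_nat (S m)) (2 * S m)) P).
{ unfold P. apply Clim_minus; apply Clim_scal.
  - apply Clim_ext with (fun m => K / PI * L + zs rres (- Z.of_nat (S m)) (S (2 * S m))).
    { intros m. transitivity (zs (fun n => if Z.eq_dec n 0 then K / PI * L else 0) (- Z.of_nat (S m)) (S (2 * S m)) + zs rres (- Z.of_nat (S m)) (S (2 * S m))).
      - rewrite zs_delta by lia. reflexivity.
      - unfold zs. rewrite <- Csum_plus. reflexivity. }
    apply Clim_plus; [apply Clim_const|]. apply is_zsum_Clim; auto; intros; lia.
  - apply is_zsum_Clim; auto; intros; lia. }
assert (E1 : forall m : nat, (Cmod (2 * PI * Ci * zs (fun r => (if Z.eq_dec r 0 then K / PI * L else 0) + rres r)%C (- Z.of_nat (S m)) (S (2 * S m))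
     - 2 * Ci * zs er (- Z.of_nat (S m)) (2 * S m)) <= 2 * (G * exp (- (4 * cc) * (IZR (Z.of_nat (S m)) * IZR (Z.of_nat (S m))))))%R).
{ intros m. set (a := (- Z.of_nat (S m))%Z). set (n := (2 * S m)%nat).
  destruct (isJ_choice a (y1 a)) as [Ia HIa]; [intros N; rewrite y1_y2; apply isJ_exists|].
  destruct (isJ_choice (a + Z.of_nat n)%Z (y2 (a + Z.of_nat n)) (isJ_exists _ _)) as [Ib HIb].
  apply (Clim_bound_le _ _ _ (strips_lim a n L Ia Ib HL HIa HIb)). exists O. intros N _.
  eapply Rle_trans; [apply Cmod_tri'|].
  assert (B1 : (Cmod (Ia N) <= G * exp (- (4 * cc) * (IZR (Z.of_nat (S m)) * IZR (Z.of_nat (S m)))))%R).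
  { replace (IZR (Z.of_nat (S m)) * IZR (Z.of_nat (S m)))%R with (IZR a * IZR a)%R by (unfold a; rewrite opp_IZR; ring).
    apply (HJ a (y1 a) N); auto. right. split; auto. unfold a. lia. }
  assert (B2 : (Cmod (Ib N) <= G * exp (- (4 * cc) * (IZR (Z.of_nat (S m)) * IZR (Z.of_nat (S m)))))%R).
  { replace (Z.of_nat (S m)) with (a + Z.of_nat n)%Z by (unfold a, n; lia).
    apply (HJ _ (y2 (a + Z.of_nat n)) N); auto. left. split; auto. unfold a, n. lia. }
  lra. }
assert (P0 : P = 0).
{ apply Cmod_eq_0. apply Rle_antisym; [|apply Cmod_ge_0]. apply le_epsilon. intros e He.
  apply (Clim_bound_le _ _ _ E0).
  destruct (INR_unbounded (2 * G / (4 * cc) / e)) as [N0 HN0]. exists N0. intros m Hm. apply le_INR in Hm.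
  eapply Rle_trans; [apply E1|]. rewrite Rplus_0_l. rewrite <- INR_IZR_INZ, S_INR. pose proof (pos_INR m) as Hm0.
  set (y := (4 * cc * ((INR m + 1) * (INR m + 1)))%R).
  assert (Hy : (0 < y)%R) by (unfold y; nra).
  replace (- (4 * cc) * ((INR m + 1) * (INR m + 1)))%R with (- y)%R by (unfold y; ring).
  assert (Hexp : (exp (- y) <= / y)%R).
  { rewrite exp_Ropp. apply Rinv_le_contravar; auto. pose proof (exp_ineq1_le y). lra. }
  assert (Hy2 : (2 * G / e <= y)%R).
  { assert (Q : (2 * G / (4 * cc) / e <= INR m)%R) by lra.
    apply Rmult_le_compat_l with (r := (4 * cc)%R) in Q; [|lra].
    replace (4 * cc * (2 * G / (4 * cc) / e))%R with (2 * G / e)%R in Q by (field; lra). unfold y. nra. }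
  apply Rle_trans with (2 * G * / y)%R; [nra|].
  apply Rmult_le_reg_r with (y / e)%R; [apply Rdiv_lt_0_compat; lra|].
  replace (2 * G * / y * (y / e))%R with (2 * G / e)%R by (field; lra). replace (e * (y / e))%R with y by (field; lra). auto. }
assert (Pn : RtoC PI <> 0) by (apply RtoC_neq, PI_neq0).
replace (K * L + PI * Rv) with (P / (2 * Ci) + Ev).
- rewrite P0. unfold Cdiv. ring.
- unfold P. field. repeat split; auto using Ci_nz, C2_neq_0.
Qed.

(** * Grouping the Mordell terms by 2r + 1 modulo 6 *)

Definition Wsum (d : Z) : C :=
  Csum (fun i => Cexp (PI * Ci * IZR (Z.of_nat i) - PI * Ci * IZR h' * (3 * IZR (Z.of_nat i) * IZR (Z.of_nat i) + IZR d * IZR (Z.of_nat i)) / K)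
    * Mint (6 * Z.of_nat i + d)) kn.

Definition tau1 : C := (IZR h' + Ci / z) / K.

Lemma Im_tau1_pos : (0 < Im tau1)%R.
Proof.
pose proof kpos as Hk. pose proof sigma_pos as Hs.
replace tau1 with (RtoC (IZR h' / INR kn) + Ci * (RtoC (/ INR kn) * / z)).
- creim. fold sigma. assert (0 < / INR kn)%R by (apply Rinv_0_lt_compat; auto). nra.
- unfold tau1, Rdiv. cpush. rewrite RtoC_inv by lra. fold K. field. split; [apply z_neq|apply K_neq].
Qed.

(** For 2r + 1 = 6t + d the shift of mu by -t, allowed by k-periodicity, turns 6 mu + 2r + 1 into 6
    mu + d. The integrals no longer depend on t, and what remains of the exponentials is a term of a
    theta series in [tau1]. *)
Lemma er_split (t d r : Z) : (2 * r + 1 = 6 * t + d)%Z ->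
  er r = Cexp (- (PI * IZR d * IZR d / (12 * K * z))) * Wsum d * pent d tau1 t.
Proof.
intros Hr. pose proof K_neq as HK. pose proof z_neq as Hzn.
set (f := fun mu : Z => lc mu r * Mint (6 * mu + (2 * r + 1))).
assert (Hper : forall n, f (n + Z.of_nat kn)%Z = f n).
{ intros n. unfold f. fold k. replace (6 * (n + k) + (2 * r + 1))%Z with (2 * (3 * n + r) + 1 + 6 * k)%Z by ring.
  rewrite Mint_per. replace (2 * (3 * n + r) + 1)%Z with (6 * n + (2 * r + 1))%Z by ring.
  assert (E : lc (n + k) r * Cexp (PI * Ci) = lc n r).
  { destruct parity_h' as [j Hj]. unfold lc. rewrite <- Cexp_plus.
    apply Cexp_eq with (j - 2 * h' * k - h' - 3 * h' * n - r * h')%Z.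
    assert (Hj' : 2 * RtoC (IZR j) = (K + 1) * (IZR h' + 1)).
    { rewrite <- IZRk. rewrite <- !RtoC_plus, <- !RtoC_mult, <- !plus_IZR, <- !mult_IZR. now rewrite Hj. }
    cpush. rewrite IZRk.
    replace (2 * PI * Ci * (IZR j - 2 * IZR h' * K - IZR h' - 3 * IZR h' * IZR n - IZR r * IZR h'))
      with (PI * Ci * (2 * IZR j - 4 * IZR h' * K - 2 * IZR h' - 6 * IZR h' * IZR n - 2 * IZR r * IZR h')) by ring.
    rewrite Hj'. field. auto. }
  rewrite <- E, Cexp_PI. ring. }
unfold er. transitivity (Csum (fun i => f (Z.of_nat i)) kn); [reflexivity|].
rewrite <- (Csum_periodic f kn (- t) Hper).
unfold Wsum. rewrite <- (Cmult_comm (pent d tau1 t)), Cmult_assoc. rewrite <- Csum_scal.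
apply Csum_ext. intros i _. unfold f.
replace (6 * (Z.of_nat i + - t) + (2 * r + 1))%Z with (6 * Z.of_nat i + d)%Z by lia.
rewrite Cmult_assoc. f_equal. unfold lc, pent. rewrite <- !Cexp_plus. 
rewrite Hr. apply Cexp_eq with (- t)%Z. unfold tau1. cpush. pose proof Ci2 as H2. field [H2]. auto.
Qed.

Lemma er_zsum (Q : C) : is_zsum (pent 1 tau1) Q ->
  is_zsum er (Cexp (- (PI / (12 * K * z))) * Q * (Wsum (-1) + Wsum 1)).
Proof.
intros HQ.
assert (S : forall d l, is_zsum (pent d tau1) l -> forall i, (2 * i = d + 1)%Z ->
   is_zsum (fun t => er (3 * t + i + -1)) (Cexp (- (PI * IZR d * IZR d / (12 * K * z))) * Wsum d * l)).
{ intros d l Hl i Hi. eapply is_zsum_ext; [|apply is_zsum_scal, Hl]. intros t. symmetry. apply er_split. lia. }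
assert (S0 := S (-1)%Z Q (pent_neg _ _ HQ) 0%Z eq_refl).
assert (S1 := S 1%Z Q HQ 1%Z eq_refl).
assert (S2 := S 3%Z 0 (pent_3 _ Im_tau1_pos) 2%Z eq_refl).
(* The shift by -1 aligns r = 3t - 1, 3t, 3t + 1, which belong to d = -1, 1, 3, with the indices 3t,
   3t + 1, 3t + 2. *)
assert (T : is_zsum (fun n => er (n + -1)) (Cexp (- (PI * IZR (-1) * IZR (-1) / (12 * K * z))) * Wsum (-1) * Q +
   Cexp (- (PI * IZR 1 * IZR 1 / (12 * K * z))) * Wsum 1 * Q + Cexp (- (PI * IZR 3 * IZR 3 / (12 * K * z))) * Wsum 3 * 0)).
{ apply is_zsum_interleave; [|exact S1|exact S2]. eapply is_zsum_ext; [|exact S0]. intros t. simpl. f_equal. lia. }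
apply (is_zsum_shift 1) in T.
match type of T with is_zsum _ ?X => replace (Cexp (- (PI / (12 * K * z))) * Q * (Wsum (-1) + Wsum 1)) with X end.
- eapply is_zsum_ext; [|exact T]. intros n. simpl. f_equal. lia.
- replace (PI * IZR (-1) * IZR (-1) / (12 * K * z)) with (PI / (12 * K * z)) by (replace (RtoC (IZR (-1))) with (- RtoC 1) by (rewrite <- RtoC_opp; f_equal; simpl; ring); unfold Cdiv; ring).
  replace (PI * IZR 1 * IZR 1 / (12 * K * z)) with (PI / (12 * K * z)) by (unfold Cdiv; ring). ring.
Qed.

Theorem lerch_transform (L Rv Q : C) :
  is_zsum Tn L -> is_zsum (fun M => res2 M (r0 - 3 * M)) Rv -> is_zsum (pent 1 tau1) Q ->
  K * L + PI * Rv = Cexp (- (PI / (12 * K * z))) * Q * (Wsum (-1) + Wsum 1).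
Proof. intros HL HR HQ. apply lerch_poisson; auto. now apply er_zsum. Qed.

End LerchPoisson.

(** * The pentagonal number theorem, by Shanks' finite identity *)

Definition qprod (q : C) (s m : nat) : C := Cprod (fun i => 1 - q ^ (s + 1 + i)) m.

Fixpoint tri (s : nat) : nat := match s with O => O | S m => (tri m + S m)%nat end.

Lemma tri_eq (s : nat) : (2 * tri s = s * s + s)%nat.
Proof. induction s; simpl in *; lia. Qed.

Lemma Cprod_S_l (u : nat -> C) (m : nat) : Cprod u (S m) = u O * Cprod (fun i => u (S i)) m.
Proof. induction m as [|m IH]; [simpl; ring|]. cbn [Cprod] in *. rewrite IH. ring. Qed.

Lemma Cprod_ext (u v : nat -> C) (m : nat) : (forall i, (i < m)%nat -> u i = v i) -> Cprod u m = Cprod v m.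
Proof. induction m as [|m IH]; intros H; simpl; auto. rewrite IH by (intros; apply H; lia). now rewrite H by lia. Qed.

Lemma qprod_S_l (q : C) (s m : nat) : qprod q s (S m) = (1 - q ^ (S s)) * qprod q (S s) m.
Proof.
unfold qprod. rewrite Cprod_S_l. replace (s + 1 + 0)%nat with (S s) by lia. f_equal.
apply Cprod_ext. intros i _. do 2 f_equal. lia.
Qed.

(** Shanks' term (-1)^s ((q)_n/(q)_s) q^{sn + s(s+1)/2}. The quotient is written as the product of 1
    - q^i over s < i <= n, so the term s = 0 is (q)_n itself. *)
Definition Xs (q : C) (n s : nat) : C := (- (1)) ^ s * qprod q s (n - s) * q ^ (s * n + tri s).
Definition Fs (q : C) (n : nat) : C := Csum (Xs q n) (S n).

Lemma Cpow_add (q : C) (a b : nat) : q ^ (a + b) = q ^ a * q ^ b.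
Proof. induction a as [|a IH]; simpl; [ring|rewrite IH; ring]. Qed.

Lemma Xs_step (q : C) (n s : nat) : (s < n)%nat ->
  (1 - q ^ (S s)) * Xs q n (S s) = - (q ^ (n + 1 + s)) * Xs q n s.
Proof.
intros H. unfold Xs. replace (n - s)%nat with (S (n - S s)) by lia. rewrite qprod_S_l.
replace (S s * n + tri (S s))%nat with ((n + 1 + s) + (s * n + tri s))%nat by (simpl; lia).
rewrite (Cpow_add q (n + 1 + s)). replace ((- (1)) ^ (S s)) with (- (1) * (- (1)) ^ s) by reflexivity. ring.
Qed.

(** The partial sums of Xs(n + 1, s) - Xs(n, s) over s <= m have the closed form -q^{n+1+m} Xs(n,
    m); at m = n this joins the new last term. With N = n + 1 the two exponents are the pentagonal
    numbers (3N^2 - N)/2 and (3N^2 + N)/2. *)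
Lemma Fs_step (q : C) (n : nat) : Fs q (S n) - Fs q n =
  (- (1)) ^ (S n) * (q ^ (S n * S n + tri n) + q ^ (S n * S n + tri (S n))).
Proof.
assert (A : forall m, (m <= n)%nat -> Csum (fun s => Xs q (S n) s - Xs q n s) (S m) = - (q ^ (n + 1 + m)) * Xs q n m).
{ induction m as [|m IH]; intros Hm.
  - cbn [Csum]. unfold Xs. rewrite !Nat.sub_0_r. simpl tri. rewrite !Nat.mul_0_l, Nat.add_0_l. simpl (q ^ 0).
    unfold qprod at 1. cbn [Cprod]. fold (qprod q 0 n). replace (0 + 1 + n)%nat with (n + 1 + 0)%nat by lia. simpl ((- (1)) ^ 0). ring.
  - cbn [Csum] in *. rewrite IH by lia.
    assert (E : Xs q (S n) (S m) = (1 - q ^ (S n)) * q ^ (S m) * Xs q n (S m)).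
    { unfold Xs. replace (S n - S m)%nat with (S (n - S m)) by lia.
      unfold qprod at 1. cbn [Cprod]. fold (qprod q (S m) (n - S m)).
      replace (S m + 1 + (n - S m))%nat with (S n) by lia.
      replace (S m * S n + tri (S m))%nat with (S m + (S m * n + tri (S m)))%nat by lia. rewrite (Cpow_add q (S m)). ring. }
    rewrite E. 
    replace (- (q ^ (n + 1 + m)) * Xs q n m) with ((1 - q ^ (S m)) * Xs q n (S m)) by (apply Xs_step; lia).
    replace (n + 1 + S m)%nat with (S n + S m)%nat by lia. rewrite (Cpow_add q (S n)). ring. }
unfold Fs. cbn [Csum].
assert (B := A n (le_n n)). cbn [Csum] in B.
assert (D : Csum (fun s => Xs q (S n) s - Xs q n s) n = Csum (Xs q (S n)) n - Csum (Xs q n) n).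
{ rewrite (Csum_ext _ (fun s => Xs q (S n) s + (- (1)) * Xs q n s)) by (intros; ring).
  rewrite Csum_plus, Csum_scal. ring. }
rewrite D in B.
transitivity ((Csum (Xs q (S n)) n - Csum (Xs q n) n + (Xs q (S n) n - Xs q n n)) + Xs q (S n) (S n)); [ring|].
rewrite B. unfold Xs. rewrite !Nat.sub_diag. unfold qprod. cbn [Cprod].
replace (S n * S n + tri n)%nat with ((n + 1 + n) + (n * n + tri n))%nat by lia.
rewrite (Cpow_add q (n + 1 + n)). replace ((- (1)) ^ (S n)) with (- (1) * (- (1)) ^ n) by reflexivity. ring.
Qed.

Fixpoint geo (r : R) (n : nat) : R := match n with O => 0%R | S m => (geo r m + r ^ m)%R end.

Lemma geo_le (r : R) (n : nat) : (0 <= r < 1)%R -> (geo r n <= / (1 - r))%R.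
Proof.
intros Hr. assert (E : (geo r n * (1 - r) = 1 - r ^ n)%R).
{ induction n as [|n IH]; simpl; [ring|]. rewrite Rmult_plus_distr_r, IH. ring. }
assert (0 <= r ^ n)%R by (apply pow_le; lra).
apply Rmult_le_reg_r with (1 - r)%R; [lra|]. rewrite E, Rinv_l by lra. lra.
Qed.

Lemma geo_pos (r : R) (n : nat) : (0 <= r)%R -> (0 <= geo r n)%R.
Proof. intros Hr. induction n; simpl; [lra|]. pose proof (pow_le r n Hr). lra. Qed.

Lemma qprod_bound (q : C) (s m : nat) : (Cmod q < 1)%R ->
  (Cmod (qprod q s m) <= exp (Cmod q * geo (Cmod q) m))%R.
Proof.
intros Hq. pose proof (Cmod_ge_0 q) as Hq0. set (r := Cmod q) in *. unfold qprod. induction m as [|m IH].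
- simpl. rewrite Cmod_1, Rmult_0_r, exp_0. lra.
- cbn [Cprod geo]. rewrite Cmod_mult, Rmult_plus_distr_l, exp_plus.
  apply Rmult_le_compat; try apply Cmod_ge_0; auto.
  eapply Rle_trans; [apply Cmod_tri'|]. rewrite Cmod_1, Cmod_pow. fold r.
  pose proof (exp_ineq1_le (r * r ^ m)).
  assert (r ^ (s + 1 + m) <= r * r ^ m)%R.
  { replace (s + 1 + m)%nat with (s + (1 + m))%nat by lia. rewrite pow_add. change (r ^ (1 + m))%R with (r * r ^ m)%R.
    assert (0 <= r * r ^ m)%R by (apply Rmult_le_pos; [lra|apply pow_le; lra]).
    assert (r ^ s <= 1)%R by (rewrite <- (pow1 s); apply pow_incr; lra). nra. }
  lra.
Qed.

(** Each factor is at least 1 - r^{m+1} >= exp(-r^m/(1 - r)), because 1/(1 - y) <= 1 + r^m/(1 - r)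
    for y = r^{m+1}. This keeps the infinite product away from 0. *)
Lemma qprod_lower (q : C) (m : nat) : (Cmod q < 1)%R ->
  (exp (- (geo (Cmod q) m / (1 - Cmod q))) <= Cmod (qprod q 0 m))%R.
Proof.
intros Hq. pose proof (Cmod_ge_0 q) as Hq0. set (r := Cmod q) in *. unfold qprod. induction m as [|m IH].
- simpl. rewrite Cmod_1. unfold Rdiv. rewrite Rmult_0_l, Ropp_0, exp_0. lra.
- cbn [Cprod geo]. rewrite Cmod_mult.
  replace (- ((geo r m + r ^ m) / (1 - r)))%R with (- (geo r m / (1 - r)) + - (r ^ m / (1 - r)))%R by (field; lra).
  rewrite exp_plus. apply Rmult_le_compat; auto; try (left; apply exp_pos).
  pose proof (Cmod_tri_rev 1 (q ^ (0 + 1 + m))) as T. rewrite Cmod_1, Cmod_pow in T. fold r in T.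
  eapply Rle_trans; [|exact T]. change (r ^ (0 + 1 + m))%R with (r * r ^ m)%R.
  assert (Hm : (0 <= r ^ m)%R) by (apply pow_le; lra).
  assert (Hm1 : (r ^ m <= 1)%R) by (rewrite <- (pow1 m); apply pow_incr; lra).
  set (y := (r * r ^ m)%R). assert (Hy : (0 <= y <= r)%R) by (unfold y; nra).
  rewrite exp_Ropp. rewrite <- (Rinv_inv (1 - y)). apply Rinv_le_contravar; [apply Rinv_0_lt_compat; lra|].
  apply Rle_trans with (1 + r ^ m / (1 - r))%R; [|apply exp_ineq1_le].
  apply Rmult_le_reg_r with ((1 - y) * (1 - r))%R; [nra|].
  replace (/ (1 - y) * ((1 - y) * (1 - r)))%R with (1 - r)%R by (field; lra).
  replace ((1 + r ^ m / (1 - r)) * ((1 - y) * (1 - r)))%R with ((1 - r + r ^ m) * (1 - y))%R by (field; lra).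
  unfold y. set (p := (r ^ m)%R) in *.
  assert (0 <= p * ((1 - r) * (1 - r) + r * (1 - p)))%R.
  { apply Rmult_le_pos; auto. apply Rplus_le_le_0_compat; apply Rmult_le_pos; lra. }
  lra.
Qed.

(** The term s = 0 is the product; all others contain the factor q^{n+1}, and their moduli form a
    geometric sum. *)
Lemma Fs_minus_prod (q : C) (n : nat) : (Cmod q < 1)%R ->
  (Cmod (Fs q (S n) - qprod q 0 (S n)) <= exp (/ (1 - Cmod q)) * (Cmod q ^ (S n) * / (1 - Cmod q)))%R.
Proof.
intros Hq. pose proof (Cmod_ge_0 q) as Hq0. set (r := Cmod q) in *.
unfold Fs. rewrite Csum_S_l.
replace (Xs q (S n) 0) with (qprod q 0 (S n)).
2:{ unfold Xs. rewrite Nat.sub_0_r, Nat.mul_0_l. simpl ((- (1)) ^ 0). simpl tri. simpl (q ^ (0 + 0)). ring. }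
match goal with |- (Cmod (?a + ?b - ?a) <= _)%R => replace (a + b - a) with b by ring end.
assert (H1 : (0 < / (1 - r))%R) by (apply Rinv_0_lt_compat; lra).
set (E := exp (/ (1 - r))). assert (HE : (0 < E)%R) by apply exp_pos.
assert (A : forall m, (Cmod (Csum (fun i => Xs q (S n) (S i)) m) <= E * (r ^ (S n) * geo r m))%R).
{ induction m as [|m IH].
  - simpl. rewrite Cmod_0. nra.
  - cbn [Csum geo]. eapply Rle_trans; [apply Cmod_triangle|].
    assert (B : (Cmod (Xs q (S n) (S m)) <= E * (r ^ (S n) * r ^ m))%R).
    { unfold Xs. rewrite !Cmod_mult, !Cmod_pow. fold r.
      replace (Cmod (- (1))) with 1%R by (rewrite Cmod_opp, Cmod_1; auto). rewrite pow1, Rmult_1_l.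
      apply Rmult_le_compat; try apply Cmod_ge_0; [apply pow_le; lra| |].
      - eapply Rle_trans; [apply qprod_bound; auto|]. fold r.
        assert (L : (r * geo r (S n - S m) <= / (1 - r))%R).
        { pose proof (geo_le r (S n - S m) ltac:(lra)). pose proof (geo_pos r (S n - S m) Hq0). nra. }
        destruct L as [L|L]; [left; now apply exp_increasing|right; unfold E; now rewrite L].
      - rewrite <- pow_add. replace (S m * S n + tri (S m))%nat with ((S n + m) + (m * n + tri (S m)))%nat by lia.
        rewrite pow_add. assert (0 <= r ^ (S n + m))%R by (apply pow_le; lra).
        assert (r ^ (m * n + tri (S m)) <= 1)%R by (rewrite <- (pow1 (m * n + tri (S m))); apply pow_incr; lra). nra. }
    nra. }
eapply Rle_trans; [apply A|]. apply Rmult_le_compat_l; [lra|]. apply Rmult_le_compat_l; [apply pow_le; lra|]. apply geo_le. lra.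
Qed.

Lemma Cexp_pow (u : C) (n : nat) : Cexp u ^ n = Cexp (RtoC (INR n) * u).
Proof.
induction n as [|n IH].
- simpl. replace (0 * u) with (RtoC 0) by ring. now rewrite Cexp_0.
- rewrite S_INR. simpl Cpow. rewrite IH, <- Cexp_plus. f_equal. rewrite RtoC_plus. ring.
Qed.

Definition nome (tau : C) : C := Cexp (2 * PI * Ci * tau).

Lemma Cmod_nome (tau : C) : Cmod (nome tau) = exp (- (2 * PI * Im tau)).
Proof. unfold nome. rewrite Cmod_Cexp. f_equal. creim. ring. Qed.

Lemma Cmod_nome_lt (tau : C) : (0 < Im tau)%R -> (Cmod (nome tau) < 1)%R.
Proof. intros H. rewrite Cmod_nome, <- exp_0. apply exp_increasing. pose proof PI_RGT_0. nra. Qed.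

Lemma qpow_nome (tau : C) (n : nat) : qpow tau (INR n) = nome tau ^ n.
Proof. unfold qpow, nome. rewrite Cexp_pow. f_equal. ring. Qed.

Lemma pent_Fs (tau : C) (n : nat) : zs (pent 1 tau) (- Z.of_nat n) (S (2 * n)) = Fs (nome tau) n.
Proof.
assert (N1 : forall n : nat, (- (1)) ^ n = Cexp (PI * Ci * RtoC (INR n))).
{ intros m. rewrite <- Cexp_PI, Cexp_pow. f_equal. ring. }
assert (T2 : forall m, 2 * RtoC (INR (tri m)) = RtoC (INR m) * RtoC (INR m) + RtoC (INR m)).
{ intros m. rewrite <- !RtoC_mult, <- RtoC_plus. f_equal. rewrite <- mult_INR, <- plus_INR.
  replace 2%R with (INR 2) by reflexivity. rewrite <- mult_INR. f_equal. apply tri_eq. }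
induction n as [|n IH].
- unfold zs, Fs. cbn [Csum]. unfold pent, Xs, qprod. simpl.
  replace (PI * Ci * 0 + PI * Ci * tau * (3 * 0 * 0 + 1 * 0)) with (RtoC 0) by ring. rewrite Cexp_0. ring.
- replace (S (2 * S n)) with (S (S (S (2 * n)))) by lia. rewrite zs_S, zs_S_l.
  replace (- Z.of_nat (S n) + 1)%Z with (- Z.of_nat n)%Z by lia. rewrite IH.
  replace (- Z.of_nat (S n) + Z.of_nat (S (S (2 * n))))%Z with (Z.of_nat (S n)) by lia.
  replace (Fs (nome tau) (S n)) with ((Fs (nome tau) (S n) - Fs (nome tau) n) + Fs (nome tau) n) by ring.
  rewrite Fs_step.
  assert (E1 : (- (1)) ^ (S n) * nome tau ^ (S n * S n + tri n) = pent 1 tau (- Z.of_nat (S n))).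
  { unfold nome. rewrite N1, Cexp_pow, <- Cexp_plus. unfold pent. apply Cexp_eq with (Z.of_nat (S n)).
    rewrite opp_IZR, <- INR_IZR_INZ, RtoC_opp. rewrite plus_INR, mult_INR, RtoC_plus, RtoC_mult.
    replace ((RtoC (INR (S n)) * RtoC (INR (S n)) + RtoC (INR (tri n))) * (2 * PI * Ci * tau))
      with ((2 * RtoC (INR (S n)) * RtoC (INR (S n)) + 2 * RtoC (INR (tri n))) * (PI * Ci * tau)) by ring.
    rewrite T2, S_INR, RtoC_plus. ring. }
  assert (E2 : (- (1)) ^ (S n) * nome tau ^ (S n * S n + tri (S n)) = pent 1 tau (Z.of_nat (S n))).
  { unfold nome. rewrite N1, Cexp_pow, <- Cexp_plus. unfold pent. f_equal.
    rewrite <- INR_IZR_INZ. rewrite plus_INR, mult_INR, RtoC_plus, RtoC_mult.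
    replace ((RtoC (INR (S n)) * RtoC (INR (S n)) + RtoC (INR (tri (S n)))) * (2 * PI * Ci * tau))
      with ((2 * RtoC (INR (S n)) * RtoC (INR (S n)) + 2 * RtoC (INR (tri (S n)))) * (PI * Ci * tau)) by ring.
    rewrite T2. ring. }
  rewrite <- E1, <- E2. ring.
Qed.

Lemma qprod_lim (tau : C) : (0 < Im tau)%R -> exists Q, Clim (qprod (nome tau) 0) Q /\ is_zsum (pent 1 tau) Q.
Proof.
intros Ht. destruct (zsummable_CSeries _ (pent_summable 1 tau Ht)) as (_ & _ & HQ).
match type of HQ with is_zsum _ ?l => exists l; set (Q := l) in * end. split; auto.
pose proof (Cmod_nome_lt tau Ht) as Hq. pose proof (Cmod_ge_0 (nome tau)) as Hq0. set (q := nome tau) in *. set (r := Cmod q) in *.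
assert (HF : Clim (Fs q) Q).
{ eapply Clim_ext; [intros n; apply pent_Fs|]. apply is_zsum_Clim; auto; intros; lia. }
assert (HD : Clim (fun n => Fs q n - qprod q 0 n) 0).
{ intros e He. set (B := (exp (/ (1 - r)) * / (1 - r))%R).
  assert (HB : (0 < B)%R) by (apply Rmult_lt_0_compat; [apply exp_pos|apply Rinv_0_lt_compat; lra]).
  destruct (pow_lt_1_zero r ltac:(rewrite Rabs_right; lra) (e / B)%R ltac:(apply Rdiv_lt_0_compat; lra)) as [N HN].
  exists (S N). intros n Hn. destruct n as [|n]; [lia|]. replace (Fs q (S n) - qprod q 0 (S n) - 0) with (Fs q (S n) - qprod q 0 (S n)) by ring.
  eapply Rle_lt_trans; [apply Fs_minus_prod; auto|]. fold r.
  specialize (HN (S n) ltac:(lia)). rewrite Rabs_right in HN by (apply Rle_ge, pow_le; lra).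
  replace (exp (/ (1 - r)) * (r ^ S n * / (1 - r)))%R with (r ^ S n * B)%R by (unfold B; ring).
  apply Rmult_lt_reg_r with (/ B)%R; [now apply Rinv_0_lt_compat|]. rewrite Rmult_assoc, Rinv_r by lra. rewrite Rmult_1_r. exact HN. }
apply Clim_ext with (fun n => Fs q n - (Fs q n - qprod q 0 n)); [intros; ring|].
replace Q with (Q - 0) by ring. now apply Clim_minus.
Qed.

Lemma qpoch_Clim (tau Q : C) : Clim (qprod (nome tau) 0) Q -> qpoch tau = Q.
Proof.
intros H. unfold qpoch. apply Clim_Clim_seq. eapply Clim_ext; [|exact H]. intros n. unfold qprod. apply Cprod_ext.
intros i _. rewrite qpow_nome. do 2 f_equal.
Qed.

Lemma qpoch_prod (tau : C) : (0 < Im tau)%R -> Clim (qprod (nome tau) 0) (qpoch tau).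
Proof. intros Ht. destruct (qprod_lim tau Ht) as (Q & H & _). now rewrite (qpoch_Clim _ _ H). Qed.

Theorem pentagonal (tau : C) : (0 < Im tau)%R -> is_zsum (pent 1 tau) (qpoch tau).
Proof. intros Ht. destruct (qprod_lim tau Ht) as (Q & H & HQ). now rewrite (qpoch_Clim _ _ H). Qed.

Lemma qpoch_neq_0 (tau : C) : (0 < Im tau)%R -> qpoch tau <> 0.
Proof.
intros Ht E. pose proof (qpoch_prod tau Ht) as H. rewrite E in H.
pose proof (Cmod_nome_lt tau Ht) as Hq. pose proof (Cmod_ge_0 (nome tau)) as Hq0. set (r := Cmod (nome tau)) in *.
destruct (H (exp (- (/ (1 - r) / (1 - r)))) (exp_pos _)) as [N HN]. specialize (HN N (le_n N)).
pose proof (qprod_lower (nome tau) N Hq) as L. fold r in L.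
replace (qprod (nome tau) 0 N - 0) with (qprod (nome tau) 0 N) in HN by ring.
assert (M : (exp (- (/ (1 - r) / (1 - r))) <= exp (- (geo r N / (1 - r))))%R).
{ pose proof (geo_le r N ltac:(lra)) as G. assert (0 < / (1 - r))%R by (apply Rinv_0_lt_compat; lra).
  assert (L2 : (- (/ (1 - r) / (1 - r)) <= - (geo r N / (1 - r)))%R) by (unfold Rdiv; nra).
  destruct L2 as [L2|L2]; [left; now apply exp_increasing|right; now rewrite L2]. }
lra.
Qed.

(** Serves the limit z -> 0+, in which the dual nome tends to 0 and the dual product to 1. *)
Lemma qpoch_near_1 (tau : C) : (0 < Im tau)%R -> (Cmod (nome tau) <= / 4)%R -> (Cmod (qpoch tau - 1) <= 4 * Cmod (nome tau))%R.
Proof.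
intros Ht Hq. pose proof (qpoch_prod tau Ht) as H. pose proof (Cmod_ge_0 (nome tau)) as Hq0. set (q := nome tau) in *. set (r := Cmod q) in *.
assert (A : forall m, (Cmod (qprod q 0 m - 1) <= exp (r * geo r m) - 1)%R).
{ induction m as [|m IH].
  - unfold qprod. simpl. replace (1 - 1) with (RtoC 0) by ring. rewrite Cmod_0, Rmult_0_r, exp_0. lra.
  - unfold qprod. cbn [Cprod geo]. fold (qprod q 0 m).
    replace (qprod q 0 m * (1 - q ^ (0 + 1 + m)) - 1) with ((qprod q 0 m - 1) - qprod q 0 m * q ^ (0 + 1 + m)) by ring.
    eapply Rle_trans; [apply Cmod_tri'|]. rewrite Cmod_mult, Cmod_pow. fold r.
    pose proof (qprod_bound q 0 m ltac:(fold r; lra)) as B. fold r in B.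
    rewrite Rmult_plus_distr_l, exp_plus. change (r ^ (0 + 1 + m))%R with (r * r ^ m)%R.
    pose proof (exp_ineq1_le (r * r ^ m)). assert (0 <= r * r ^ m)%R by (apply Rmult_le_pos; [lra|apply pow_le; lra]).
    pose proof (exp_pos (r * geo r m)).
    assert (Cmod (qprod q 0 m) * (r * r ^ m) <= exp (r * geo r m) * (r * r ^ m))%R by (apply Rmult_le_compat_r; auto). nra. }
pose proof (Clim_minus _ _ _ _ H (Clim_const 1)) as H2.
apply (Clim_bound_le _ _ _ H2). exists O. intros n _. eapply Rle_trans; [apply A|].
pose proof (geo_le r n ltac:(lra)) as G. pose proof (geo_pos r n Hq0).
assert (G2 : (geo r n <= 4 / 3)%R).
{ eapply Rle_trans; [exact G|]. apply Rmult_le_reg_r with (1 - r)%R; [lra|]. rewrite Rinv_l by lra. lra. }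
set (y := (r * geo r n)%R). assert (Hy : (0 <= y <= 4 / 3 * r)%R) by (unfold y; nra).
assert (exp y * (1 - y) <= 1)%R.
{ pose proof (exp_ineq1_le (- y)) as H1. pose proof (exp_pos y). 
  assert (Hyy : (exp y * exp (- y) = 1)%R) by (rewrite <- exp_plus, Rplus_opp_r; apply exp_0). nra. }
nra.
Qed.

(** * The eta transformation up to a constant *)

Lemma is_line_shift (s : R) (f : R -> C) (l : C) : is_line f l -> is_line (fun t => f (t + s)%R) l.
Proof.
intros H e He. destruct (H e He) as [T HT]. exists (Rabs T + Rabs s)%R. intros a b I Ha Hb HI.
pose proof (Rle_abs T). pose proof (Rle_abs s). pose proof (Rle_abs (- s)). rewrite Rabs_Ropp in H2.
apply (HT (a + s)%R (b + s)%R); [lra|lra|].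
destruct HI as [H3 H4]. split.
- replace a with (1 * (a + s) + - s)%R in H3 by ring. replace b with (1 * (b + s) + - s)%R in H3 by ring.
  pose proof (is_RInt_comp_lin _ _ _ _ _ _ H3) as Q. eapply is_RInt_ext; [|exact Q].
  intros t _. simpl. unfold scal; simpl; unfold mult; simpl. rewrite Rmult_1_l. do 2 f_equal. ring.
- replace a with (1 * (a + s) + - s)%R in H4 by ring. replace b with (1 * (b + s) + - s)%R in H4 by ring.
  pose proof (is_RInt_comp_lin _ _ _ _ _ _ H4) as Q. eapply is_RInt_ext; [|exact Q].
  intros t _. simpl. unfold scal; simpl; unfold mult; simpl. rewrite Rmult_1_l. do 2 f_equal. ring.
Qed.

Definition Eg (u : C) : C := Cexp (- (u * u)).

Lemma Cder_Eg (u : C) : Cder Eg u (- 2 * u * Eg u).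
Proof.
assert (H : Cder (fun w => - (1) * (w * w)) u (0 * (u * u) + - (1) * (1 * u + u * 1))).
{ apply (Cder_mult (fun _ => - (1)) (fun w => w * w)); [apply Cder_const|].
  apply (Cder_mult (fun w => w) (fun w => w)); apply Cder_id. }
pose proof (Cder_comp Cexp _ u _ _ (Cder_exp (- (1) * (u * u))) H) as Q.
replace (- 2 * u * Eg u) with (Cexp (- (1) * (u * u)) * (0 * (u * u) + - (1) * (1 * u + u * 1))).
- eapply Cder_ext; [|exact Q]. intros w. unfold Eg. f_equal. ring.
- unfold Eg. replace (- (1) * (u * u)) with (- (u * u)) by ring. ring.
Qed.

Lemma Ccont_Eg (u : C) : Ccont Eg u.
Proof. eapply Cder_cont, Cder_Eg. Qed.

Lemma Cmod_Eg (w : C) (t : R) : Cmod (Eg (w * RtoC t)) = exp (- (Re (w * w) * (t * t))).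
Proof. unfold Eg. rewrite Cmod_Cexp. f_equal. creim. ring. Qed.

Lemma Rcont_Eg (w : C) (t : R) : Rcont (fun t => Eg (w * RtoC t)) t.
Proof.
pose proof (Rcont_comp_affine Eg 0 w t (Ccont_Eg _)) as Q. intros e He. destruct (Q e He) as [d [Hd K]].
exists d. split; auto. intros s Hs. specialize (K s Hs).
replace (w * s) with (0 + RtoC s * w) by ring. replace (w * t) with (0 + RtoC t * w) by ring. exact K.
Qed.

(* Rotating the line of integration, w(s) = 1 + s (w - 1) : w dt stays closed along the homotopy. *)
Lemma gauss_homotopy (w : C) (a b : R) (I0 I1 : C) : (a <= b)%R ->
  isCI (fun t => Eg (1 * RtoC t)) a b I0 -> isCI (fun t => w * Eg (w * RtoC t)) a b I1 ->
  isCI (fun s => (w - 1) * RtoC b * Eg ((1 + RtoC s * (w - 1)) * RtoC b) - (w - 1) * RtoC a * Eg ((1 + RtoC s * (w - 1)) * RtoC a)) 0 1 (I1 - I0).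
Proof.
intros Hab H0 H1. set (be := w - 1).
apply (green (fun s t => (1 + RtoC s * be) * Eg ((1 + RtoC s * be) * RtoC t)) (fun s t => be * RtoC t * Eg ((1 + RtoC s * be) * RtoC t))
  (fun s t => be * (Eg ((1 + RtoC s * be) * RtoC t) + (1 + RtoC s * be) * RtoC t * (- 2 * ((1 + RtoC s * be) * RtoC t) * Eg ((1 + RtoC s * be) * RtoC t))))
  (a - 1) (b + 1) (-1) 2 a b 0 1); auto; try lra.
- intros s t _ _.
  assert (CW : C2cont (fun s t => 1 + RtoC s * be) s t) by (apply C2cont_plus; [apply C2cont_const|apply C2cont_mult; [apply C2cont_1|apply C2cont_const]]).
  assert (CWt : C2cont (fun s t => (1 + RtoC s * be) * RtoC t) s t) by (apply C2cont_mult; [exact CW|apply C2cont_2]).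
  assert (CE : C2cont (fun s t => Eg ((1 + RtoC s * be) * RtoC t)) s t) by (apply (C2cont_Ccont Eg); [apply Ccont_Eg|exact CWt]).
  split; [|split; [|split; [|split]]].
  + assert (D : Cder (fun u => u * Eg (u * RtoC t)) (1 + RtoC s * be) (1 * Eg ((1 + RtoC s * be) * RtoC t) +
      (1 + RtoC s * be) * ((- 2 * ((1 + RtoC s * be) * RtoC t) * Eg ((1 + RtoC s * be) * RtoC t)) * (1 * RtoC t + (1 + RtoC s * be) * 0)))).
    { apply (Cder_mult (fun u => u) (fun u => Eg (u * RtoC t))); [apply Cder_id|]. apply (Cder_comp Eg (fun u => u * RtoC t)); [apply Cder_Eg|].
      apply (Cder_mult (fun u => u) (fun _ => RtoC t)); [apply Cder_id|apply Cder_const]. }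
    destruct (Cder_path _ 1 be _ s D) as [P1 P2].
    match type of P1 with is_derive _ _ (Re ?X) => match goal with |- context [is_derive _ s (Re ?Y)] => replace Y with X by ring end end.
    split; [exact P1|exact P2].
  + assert (D : Cder (fun u => be * u * Eg ((1 + RtoC s * be) * u)) (0 + RtoC t * 1) ((0 * (0 + RtoC t * 1) + be * 1) * Eg ((1 + RtoC s * be) * (0 + RtoC t * 1)) +
      be * (0 + RtoC t * 1) * ((- 2 * ((1 + RtoC s * be) * (0 + RtoC t * 1)) * Eg ((1 + RtoC s * be) * (0 + RtoC t * 1))) * (0 * (0 + RtoC t * 1) + (1 + RtoC s * be) * 1)))).
    { apply (Cder_mult (fun u => be * u) (fun u => Eg ((1 + RtoC s * be) * u))); [apply (Cder_mult (fun _ => be) (fun u => u)); [apply Cder_const|apply Cder_id]|].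
      apply (Cder_comp Eg (fun u => (1 + RtoC s * be) * u)); [apply Cder_Eg|].
      apply (Cder_mult (fun _ => 1 + RtoC s * be) (fun u => u)); [apply Cder_const|apply Cder_id]. }
    destruct (Cder_path _ 0 1 _ t D) as [P1 P2].
    assert (Et : forall u : R, 0 + RtoC u * 1 = RtoC u) by (intros; ring). rewrite !Et in P1, P2.
    match type of P1 with is_derive _ _ (Re ?X) => match goal with |- context [is_derive _ t (Re ?Y)] => replace Y with X by ring end end.
    split; [eapply is_derive_ext; [|exact P1]|eapply is_derive_ext; [|exact P2]]; intros u; cbv beta; rewrite Et; reflexivity.
  + apply C2cont_mult; [apply C2cont_const|]. apply C2cont_plus; auto. apply C2cont_mult; auto.
    apply C2cont_mult; auto. apply C2cont_mult; [apply C2cont_const|auto].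
  + apply C2cont_mult; auto.
  + apply C2cont_mult; auto. apply C2cont_mult; [apply C2cont_const|apply C2cont_2].
- eapply isCI_ext; [|exact H0]. intros t. cbv beta. replace (1 + RtoC 0 * be) with (RtoC 1) by ring. ring.
- eapply isCI_ext; [|exact H1]. intros t. cbv beta. replace (1 + RtoC 1 * be) with w by (unfold be; ring). reflexivity.
Qed.

Lemma t_exp_bound (c b : R) : (0 < c)%R -> b <> 0%R -> (Rabs b * exp (- (c * (b * b))) <= / (c * Rabs b))%R.
Proof.
intros Hc Hb. pose proof (Rabs_pos_lt b Hb) as Hp.
replace (b * b)%R with (Rabs b * Rabs b)%R by (rewrite <- Rabs_mult; apply Rabs_right; nra).
set (r := Rabs b) in *. rewrite exp_Ropp.
assert (H : (c * (r * r) <= exp (c * (r * r)))%R) by (pose proof (exp_ineq1_le (c * (r * r))); lra).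
assert (Hq : (0 < c * (r * r))%R) by (apply Rmult_lt_0_compat; nra).
apply Rle_trans with (r * / (c * (r * r)))%R.
- apply Rmult_le_compat_l; [lra|]. now apply Rinv_le_contravar.
- right. field. lra.
Qed.

(** By [gauss_homotopy] the integrals of e^{-u^2} along the directions 1 and w differ by an integral
    of boundary terms, which decay. The constant is left unevaluated, as it is absorbed in the D of
    [eta_const]. *)
Lemma gauss_const : exists k0 : C, forall w : C, (Rabs (Im w) < Re w)%R -> is_line (fun t => Eg (w * RtoC t)) (k0 / w).
Proof.
destruct (is_line_exists (fun t => Eg (1 * RtoC t)) 1 ltac:(lra)) as [k0 Hk0].
{ intros t. apply Rcont_Eg. }
{ intros t. rewrite Cmod_Eg. replace (Re (1 * 1)) with 1%R by (creim; ring). rewrite Rmult_1_l, exp_Ropp.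
  unfold Rdiv. rewrite Rmult_1_l. apply Rinv_le_contravar; [nra|apply exp_ineq1_le]. }
exists k0. intros w Hw.
assert (Hw0 : w <> 0) by (intros ->; simpl in Hw; rewrite Rabs_R0 in Hw; lra).
set (p := Re w) in *. set (q := Im w) in *.
set (m := Rmin 1 (p - Rabs q)). assert (Hm : (0 < m)%R) by (apply Rmin_pos; lra).
(* The real part of the square factors as (1 - s + s(p - q))(1 - s + s(p + q)). In the cone |q| < p
   both factors are at least m, which makes the decay uniform along the homotopy. *)
assert (Hmw : forall s, (0 <= s <= 1)%R -> (m * m <= Re ((1 + RtoC s * (w - 1)) * (1 + RtoC s * (w - 1))))%R).
{ intros s Hs. creim. fold p q.
  replace ((1 + (s * (p - 1) - 0 * (q - 0))) * (1 + (s * (p - 1) - 0 * (q - 0))) - (0 + (s * (q - 0) + 0 * (p - 1))) * (0 + (s * (q - 0) + 0 * (p - 1))))%R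
    with (((1 - s) + s * (p - q)) * ((1 - s) + s * (p + q)))%R by ring.
  assert (m <= 1)%R by apply Rmin_l. assert (m <= p - Rabs q)%R by apply Rmin_r.
  pose proof (Rle_abs q). pose proof (Rle_abs (- q)) as Hq'. rewrite Rabs_Ropp in Hq'.
  apply Rmult_le_compat; try lra; nra. }
assert (L : is_line (fun t => w * Eg (w * RtoC t)) k0).
{ intros e He. destruct (Hk0 (e / 2)%R ltac:(lra)) as [T HT].
  pose proof (Cmod_ge_0 (w - 1)) as Hb. set (be := Cmod (w - 1)) in *.
  assert (Hmm : (0 < m * m)%R) by nra.
  set (X := (16 * (be + 1) / (m * m) / e)%R).
  assert (HX : (0 < X)%R) by (unfold X; repeat apply Rdiv_lt_0_compat; lra).
  exists (Rabs T + X)%R. intros a b I1 Ha Hb' HI1. pose proof (Rle_abs T). pose proof (Rabs_pos T).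
  destruct (isCI_exists (fun t => Eg (1 * RtoC t)) a b ltac:(lra) (fun t _ => Rcont_Eg 1 t)) as [I0 HI0].
  specialize (HT a b I0 ltac:(lra) ltac:(lra) HI0).
  pose proof (gauss_homotopy w a b I0 I1 ltac:(lra) HI0 HI1) as HG.
  assert (S : forall c s, (X <= Rabs c)%R -> (0 <= s <= 1)%R -> (Cmod ((w - 1) * RtoC c * Eg ((1 + RtoC s * (w - 1)) * RtoC c)) <= e / 16)%R).
  { intros c s Hc Hs. rewrite !Cmod_mult, Cmod_R, Cmod_Eg. fold be.
    assert (Hc0 : c <> 0%R) by (intros ->; rewrite Rabs_R0 in Hc; lra).
    pose proof (t_exp_bound (m * m) c Hmm Hc0) as Q. specialize (Hmw s Hs).
    assert (Q2 : (exp (- (Re ((1 + s * (w - 1)) * (1 + s * (w - 1))) * (c * c))) <= exp (- (m * m * (c * c))))%R).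
    { assert (L : (- (Re ((1 + s * (w - 1)) * (1 + s * (w - 1))) * (c * c)) <= - (m * m * (c * c)))%R) by (assert (0 <= c * c)%R by nra; nra).
      destruct L as [L|L]; [left; now apply exp_increasing|right; now rewrite L]. }
    apply Rle_trans with ((be + 1) * / (m * m * Rabs c))%R.
    - rewrite Rmult_assoc. apply Rmult_le_compat; try lra.
      + apply Rmult_le_pos; [apply Rabs_pos|left; apply exp_pos].
      + eapply Rle_trans; [|exact Q]. apply Rmult_le_compat_l; [apply Rabs_pos|exact Q2].
    - apply Rle_trans with ((be + 1) * / (m * m * X))%R.
      + apply Rmult_le_compat_l; [lra|]. apply Rinv_le_contravar; [nra|]. apply Rmult_le_compat_l; lra.
      + right. unfold X. field. repeat split; lra. }
  assert (D : (Cmod (I1 - I0) <= 2 * (e / 8) * (1 - 0))%R).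
  { apply (isCI_bound _ 0 1 _ (e / 8) ltac:(lra) HG). intros s Hs. eapply Rle_trans; [apply Cmod_tri'|].
    pose proof (S b s ltac:(rewrite Rabs_right; lra) Hs). pose proof (S a s ltac:(rewrite Rabs_left1; lra) Hs). lra. }
  replace (I1 - k0) with ((I1 - I0) + (I0 - k0)) by ring. eapply Rle_lt_trans; [apply Cmod_triangle|]. lra. }
assert (Rc : forall t, Rcont (fun t => w * Eg (w * RtoC t)) t).
{ intros t. pose proof (C2cont_mult (fun _ _ => w) (fun s _ => Eg (w * RtoC s)) t 0 (C2cont_const w t 0)) as Q.
  apply (C2cont_fst (fun s _ => w * Eg (w * RtoC s)) t 0). apply Q.
  intros e He. destruct (Rcont_Eg w t e He) as [d [Hd K]]. exists d. split; auto. }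
pose proof (is_line_scal (/ w) _ _ Rc L) as Q. replace (k0 / w) with (/ w * k0) by (unfold Cdiv; ring).
eapply is_line_ext; [|exact Q]. intros t. simpl. field. auto.
Qed.

(** * The principal square root *)

Lemma Carg_spec (z : C) : (0 < Re z)%R -> cos (Carg z) = (Re z / Cmod z)%R /\ sin (Carg z) = (Im z / Cmod z)%R.
Proof.
intros Hz. assert (Hm : (0 < Cmod z)%R) by (apply Cmod_gt_0; intros ->; simpl in Hz; lra).
assert (Hc : (-1 <= Re z / Cmod z <= 1)%R).
{ pose proof (re_le_Cmod z) as Q. apply Rabs_le_between in Q.
  split; apply Rmult_le_reg_r with (Cmod z); auto; unfold Rdiv; rewrite Rmult_assoc, Rinv_l by lra; lra. }
assert (Hs : (sin (acos (Re z / Cmod z)) = Rabs (Im z) / Cmod z)%R).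
{ rewrite sin_acos by auto. rewrite <- (sqrt_Rsqr (Rabs (Im z) / Cmod z)).
  - f_equal. unfold Rsqr. pose proof (Cmod_sqr z) as Q.
    assert (Rabs (Im z) * Rabs (Im z) = Im z * Im z)%R by (rewrite <- Rabs_mult; apply Rabs_right; nra).
    replace (Rabs (Im z) / Cmod z * (Rabs (Im z) / Cmod z))%R with ((Rabs (Im z) * Rabs (Im z)) / (Cmod z * Cmod z))%R by (field; lra).
    rewrite H. replace (Im z * Im z)%R with (Cmod z * Cmod z - Re z * Re z)%R by lra. field. lra.
  - apply Rmult_le_pos; [apply Rabs_pos|left; now apply Rinv_0_lt_compat]. }
unfold Carg. destruct (Rle_dec 0 (Im z)) as [Hi|Hi].
- rewrite cos_acos, Hs, Rabs_right by lra. auto.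
- rewrite cos_neg, sin_neg, cos_acos, Hs, Rabs_left by lra. split; auto. field. lra.
Qed.

Lemma Carg_bound (z : C) : (- PI <= Carg z <= PI)%R.
Proof.
unfold Carg. pose proof (acos_bound (Re z / Cmod z)). pose proof PI_RGT_0. destruct (Rle_dec 0 (Im z)); lra.
Qed.

Lemma Csqrt_sqr (z : C) : (0 < Re z)%R -> Csqrt z * Csqrt z = z.
Proof.
intros Hz. assert (Hm : (0 < Cmod z)%R) by (apply Cmod_gt_0; intros ->; simpl in Hz; lra).
unfold Csqrt. rewrite <- Cexp_plus.
replace ((ln (Cmod z) + Ci * Carg z) / 2 + (ln (Cmod z) + Ci * Carg z) / 2) with (RtoC (ln (Cmod z)) + Ci * RtoC (Carg z)) by (field; apply C2_neq_0).
rewrite Cexp_plus, Cexp_RtoC, exp_ln, Cexp_Ci by auto. destruct (Carg_spec z Hz) as [-> ->].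
apply C_ext; creim; unfold Re, Im; simpl; field; lra.
Qed.

(** For w = [Csqrt z] the relation Re(w^2) = Re z > 0 gives |Im w| < |Re w|, and halving an argument
    in [-PI, PI] makes Re w nonnegative. This is the cone of [gauss_const]. *)
Lemma Csqrt_cone (z : C) : (0 < Re z)%R -> (Rabs (Im (Csqrt z)) < Re (Csqrt z))%R.
Proof.
intros Hz. pose proof (Csqrt_sqr z Hz) as E. apply (f_equal Re) in E. rewrite Re_mult in E.
assert (Hp : (0 <= Re (Csqrt z))%R).
{ unfold Csqrt. rewrite Re_Cexp.
  replace ((ln (Cmod z) + Ci * Carg z) / 2) with (RtoC (ln (Cmod z) / 2) + Ci * RtoC (Carg z / 2)).
  - creim. replace (0 + (0 * 0 + 1 * (Carg z / 2)))%R with (Carg z / 2)%R by ring.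
    pose proof (Carg_bound z). apply Rmult_le_pos; [left; apply exp_pos|apply cos_ge_0; lra].
  - unfold Rdiv. rewrite !RtoC_mult, RtoC_inv by lra. field. }

set (p := Re (Csqrt z)) in *. set (q := Im (Csqrt z)) in *.
destruct (Rlt_or_le (Rabs q) p) as [|Hle]; auto. exfalso.
assert (p * p <= Rabs q * Rabs q)%R by (apply Rmult_le_compat; auto).
assert (Rabs q * Rabs q = q * q)%R by (rewrite <- Rabs_mult; apply Rabs_right; nra). lra.
Qed.

Lemma Csqrt_neq_0 (z : C) : Csqrt z <> 0.
Proof. apply Cexp_neq_0. Qed.

Lemma Csqrt_1 : Csqrt 1 = 1.
Proof.
unfold Csqrt. rewrite Cmod_1, ln_1. unfold Carg. simpl. destruct (Rle_dec 0 0); [|lra].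
rewrite Cmod_1. replace (1 / 1)%R with 1%R by field. rewrite acos_1.
replace ((0 + Ci * 0) / 2) with (RtoC 0) by (unfold Cdiv; ring). apply Cexp_0.
Qed.

(** For Xi = exp and x = 0 the T_n form the pentagonal series, there are no residues, and the
    Mordell integrals become Gaussian. The dependence on z is then explicit, and D collects the
    finite exponential sums over mu and the Gaussian constant. *)
Theorem eta_const (h h' g : Z) (kn : nat) : (0 < kn)%nat -> (h * h' = -1 + Z.of_nat kn * g)%Z ->
  (Z.Even (Z.of_nat kn) -> Z.Even g) -> exists D : C, forall z : C, (0 < Re z)%R ->
  qpoch ((IZR h + Ci * z) / RtoC (INR kn)) =
    D * Cexp (PI / (12 * RtoC (INR kn)) * (z - / z)) / Csqrt z * qpoch ((IZR h' + Ci / z) / RtoC (INR kn)).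
Proof.
intros Hkn Hg Hev. destruct gauss_const as [k0 Hk0].
assert (Hk : (0 < INR kn)%R) by (apply lt_0_INR; auto).
set (K := RtoC (INR kn)). assert (HK : K <> 0) by (apply RtoC_neq; lra).
set (rho := sqrt (3 * PI / INR kn)).
assert (Hrho : (0 < rho)%R) by (apply sqrt_lt_R0; apply Rdiv_lt_0_compat; [pose proof PI_RGT_0; lra|lra]).
assert (Hrho2 : (rho * rho = 3 * PI / INR kn)%R).
{ apply sqrt_sqrt. apply Rlt_le, Rdiv_lt_0_compat; [pose proof PI_RGT_0; lra|lra]. }
set (ph := fun d : Z => Csum (fun i => Cexp (PI * Ci * IZR (Z.of_nat i) - PI * Ci * IZR h' * (3 * IZR (Z.of_nat i) * IZR (Z.of_nat i) + IZR d * IZR (Z.of_nat i)) / K)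
   * Cexp (PI * Ci * IZR (6 * Z.of_nat i + d) / (6 * K))) kn).
exists (k0 / (K * rho) * (ph (-1)%Z + ph 1%Z)). intros z Hz.
assert (Hzn : z <> 0) by (intros ->; simpl in Hz; lra).
assert (Hmod : forall th t, (Cmod (Cexp (PI * Ci * RtoC th - PI * z * RtoC t / K)) <= (1 + PI * Re z / INR kn) * exp ((1 + PI * Re z / INR kn) * Rabs t))%R).
{ intros th t. rewrite Cmod_Cexp.
  replace (PI * Ci * RtoC th - PI * z * RtoC t / K) with (Ci * RtoC (PI * th) - RtoC (PI * t / INR kn) * z).
  2:{ unfold Rdiv. cpush. rewrite RtoC_inv by lra. fold K. field. auto. }
  assert (HB : (0 <= PI * Re z / INR kn)%R) by (apply Rlt_le, Rdiv_lt_0_compat; [pose proof PI_RGT_0; nra|lra]).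
  set (B := (PI * Re z / INR kn)%R) in *. 
  match goal with |- (exp ?X <= _)%R => replace X with (- (B * t))%R by (unfold B; creim; field; lra) end.
  apply Rle_trans with (exp ((1 + B) * Rabs t)).
  - assert (L : (- (B * t) <= (1 + B) * Rabs t)%R).
    { pose proof (Rle_abs (- t)) as Q. rewrite Rabs_Ropp in Q. pose proof (Rabs_pos t). nra. }
    destruct L as [L|L]; [left; now apply exp_increasing|right; now rewrite L].
  - pose proof (exp_pos ((1 + B) * Rabs t)). nra. }
assert (HB1 : (0 <= 1 + PI * Re z / INR kn)%R).
{ assert (0 <= PI * Re z / INR kn)%R by (apply Rlt_le, Rdiv_lt_0_compat; [pose proof PI_RGT_0; nra|lra]). lra. }
assert (HXper : forall u, Cexp (u + PI * Ci) = - Cexp u) by (intros u; rewrite Cexp_plus, Cexp_PI; ring).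
assert (HXline : exists B : R, (0 <= B)%R /\ forall (mu r : Z) (t : R),
  (Cmod (Cexp (PI * Ci * RtoC (IZR (6 * mu + (2 * r + 1)) / (6 * INR kn) - 0) - PI * z * RtoC t / RtoC (INR kn))%C) <= B * exp (B * Rabs t))%R).
{ exists (1 + PI * Re z / INR kn)%R. split; [exact HB1|]. intros. apply Hmod. }
assert (Hr0 : (Rabs (3 * INR kn * 0 - IZR 0) < / 2)%R) by (rewrite Rmult_0_r, Rminus_diag, Rabs_R0; lra).
assert (Hhol : HoloOn (fun u => false = true -> forall j : Z, u <> PI * Ci * IZR j) Cexp) by apply HoloOn_exp.
assert (Him : (0 < Im ((IZR h + Ci * z) / K))%R).
{ replace ((IZR h + Ci * z) / K) with (RtoC (IZR h / INR kn) + Ci * (RtoC (/ INR kn) * z)).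
  - creim. assert (0 < / INR kn)%R by (apply Rinv_0_lt_compat; auto). nra.
  - unfold Rdiv. cpush. rewrite RtoC_inv by lra. fold K. field. auto. }
pose proof (lerch_transform h h' g kn z 0 Cexp 0 false 0 Hkn Hg Hev Hz HXper Hhol
  (PoleAt_cont _ _ (HoloOn_cont _ _ 0 (HoloOn_exp (fun _ => True)) I)) (fun _ => eq_refl) Hr0) as T.
assert (Hx0 : false = true -> forall M : Z, (INR kn * 0)%R = IZR M -> ~ (Z.of_nat kn | M)%Z) by discriminate.
specialize (T Hx0).
assert (HXbig : exists B T : R, (0 <= B)%R /\ (0 < T)%R /\ forall th t : R, (T <= Rabs t)%R ->
  (Cmod (Cexp (PI * Ci * RtoC th - PI * z * RtoC t / RtoC (INR kn))%C) <= B * exp (B * Rabs t))%R).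
{ exists (1 + PI * Re z / INR kn)%R, 1%R. split; [exact HB1|split; [lra|]]. intros. apply Hmod. }
specialize (T HXbig HXline (qpoch ((IZR h + Ci * z) / K)) 0 (qpoch (tau1 h' kn z))). fold K in T.
(* exp supplies the linear term: q^{3n^2/2} e^{pi i n tau} = q^{(3n^2 + n)/2}. *)
assert (T1 : is_zsum (Tn h kn z 0 Cexp) (qpoch ((IZR h + Ci * z) / K))).
{ eapply is_zsum_ext; [|apply pentagonal; exact Him]. intros n. unfold Tn, pent. fold K. rewrite <- Cexp_plus. f_equal. ring. }
assert (T2 : is_zsum (fun M => res2 h' kn z 0 0 M (0 - 3 * M)) 0).
{ intros e He. exists O. intros a n _ _. rewrite zs_zero; [replace (0 - 0) with (RtoC 0) by ring; now rewrite Cmod_0|].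
  intros i _. unfold res2. ring. }
pose proof (pentagonal (tau1 h' kn z) (Im_tau1_pos h' kn z Hkn Hz)) as T3.
specialize (T T1 T2 T3). unfold tau1 in T. fold K in T.
set (w := Csqrt z * rho).
assert (Hcone : (Rabs (Im w) < Re w)%R).
{ unfold w. rewrite re_scal_r, im_scal_r, Rabs_mult, (Rabs_right rho) by lra. pose proof (Csqrt_cone z Hz). nra. }
assert (Hw2 : w * w = 3 * PI * z / K).
{ unfold w. transitivity ((Csqrt z * Csqrt z) * RtoC (rho * rho)); [cpush; ring|]. rewrite Csqrt_sqr, Hrho2 by auto.
  unfold Rdiv. cpush. rewrite RtoC_inv by lra. fold K. field. auto. }
(* Completing the square in -(3 pi z/k)(t^2 + t/3) shifts t by 1/6 and leaves the factor e^{pi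
   z/(12k)}. *)
assert (HM : forall j : Z, Mint kn z 0 Cexp (2 * j + 1) = Cexp (PI * Ci * IZR (2 * j + 1) / (6 * K)) * Cexp (PI * z / (12 * K)) * (k0 / w)).
{ intros j.
  assert (Gc : forall t, Rcont (Gint kn z 0 Cexp (2 * j + 1)) t) by (intros t; apply (Gint_cont kn z 0 Cexp false 0 Hkn Hz Hhol Hr0 Hx0)).
  apply is_line_CInt; auto.
  pose proof (is_line_shift (/ 6) _ _ (Hk0 w Hcone)) as L. cbv beta in L.
  assert (Rc : forall t, Rcont (fun t => Eg (w * RtoC (t + / 6))) t).
  { intros t e He. destruct (Rcont_Eg w (t + / 6) e He) as [d [Hd Q]]. exists d. split; auto. intros s Hs. apply Q.
    replace (s + / 6 - (t + / 6))%R with (s - t)%R by ring. auto. }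
  pose proof (is_line_scal (Cexp (PI * Ci * IZR (2 * j + 1) / (6 * K)) * Cexp (PI * z / (12 * K))) _ _ Rc L) as L2.
  eapply is_line_ext; [|exact L2]. intros t. cbv beta. unfold Gint, Eg. rewrite <- !Cexp_plus. f_equal.
  replace (w * RtoC (t + / 6) * (w * RtoC (t + / 6))) with ((w * w) * (RtoC (t + / 6) * RtoC (t + / 6))) by ring. rewrite Hw2.
  unfold Rdiv. rewrite !RtoC_plus, !RtoC_minus, !RtoC_mult, !RtoC_inv, !RtoC_mult by lra. fold K. field. auto. }
assert (HW : forall d : Z, (exists i, d = 2 * i + 1)%Z -> Wsum h' kn z 0 Cexp d = Cexp (PI * z / (12 * K)) * (k0 / w) * ph d).
{ intros d [i Hd]. unfold Wsum, ph. rewrite <- Csum_scal. apply Csum_ext. intros m _.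
  replace (6 * Z.of_nat m + d)%Z with (2 * (3 * Z.of_nat m + i) + 1)%Z by lia. rewrite HM.
  fold K. ring. }
rewrite (HW (-1)%Z (ex_intro _ (-1)%Z eq_refl)), (HW 1%Z (ex_intro _ 0%Z eq_refl)) in T.
transitivity ((K * qpoch ((IZR h + Ci * z) / K) + PI * 0) / K); [field; auto|]. rewrite T.
replace (PI / (12 * K) * (z - / z)) with (- (PI / (12 * K * z)) + PI * z / (12 * K)) by (field; auto).
rewrite Cexp_plus. unfold w. field.
repeat split; auto using Csqrt_neq_0. apply RtoC_neq. lra.
Qed.

(** * The constant: Dedekind sums *)

(** The factor e^{-s} is carried along so that the errors remain summable over the points s =
    2Tj. *)
Lemma taylor1_bound (f f' f'' : R -> R) (G : R) : (0 <= G)%R ->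
  (forall s, (0 <= s)%R -> is_derive f s (f' s)) -> (forall s, (0 <= s)%R -> is_derive f' s (f'' s)) ->
  (forall s, (0 <= s)%R -> (Rabs (f'' s) <= G * exp (- s))%R) ->
  forall s x, (0 <= s)%R -> (0 <= x)%R -> (Rabs (f (s + x) - f s - x * f' s) <= G * exp (- s) * (x * x))%R.
Proof.
intros HG Hf Hf' Hb s x Hs [Hx|<-].
2:{ rewrite !Rplus_0_r, Rmult_0_l, Rminus_0_r, Rminus_diag, Rabs_R0. lra. }
destruct (MVT_gen f s (s + x) f') as [u [Hu Eu]].
{ intros t Ht. rewrite Rmin_left in Ht by lra. apply Hf. lra. }
{ intros t Ht. rewrite Rmin_left in Ht by lra. apply continuity_pt_filterlim.
  apply (ex_derive_continuous (V := R_NormedModule)). exists (f' t). apply Hf. lra. }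
rewrite Rmin_left, Rmax_right in Hu by lra.
destruct (MVT_gen f' s u f'') as [w [Hw Ew]].
{ intros t Ht. rewrite Rmin_left in Ht by lra. apply Hf'. lra. }
{ intros t Ht. rewrite Rmin_left in Ht by lra. apply continuity_pt_filterlim.
  apply (ex_derive_continuous (V := R_NormedModule)). exists (f'' t). apply Hf'. lra. }
rewrite Rmin_left, Rmax_right in Hw by lra.
replace (f (s + x) - f s - x * f' s)%R with (x * ((u - s) * f'' w))%R.
2:{ rewrite <- (Rmult_comm (f'' w)), <- Ew, Eu. ring. }
rewrite !Rabs_mult, (Rabs_right x), (Rabs_right (u - s)) by lra.
assert (E : (Rabs (f'' w) <= G * exp (- s))%R).
{ apply Rle_trans with (G * exp (- w))%R; [apply Hb; lra|]. apply Rmult_le_compat_l; auto.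
  destruct (Rle_lt_or_eq_dec s w) as [L| <-]; [lra| |lra]. left. apply exp_increasing. lra. }
pose proof (Rabs_pos (f'' w)).
replace (G * exp (- s) * (x * x))%R with (x * (x * (G * exp (- s))))%R by ring.
apply Rmult_le_compat_l; [lra|]. apply Rmult_le_compat; lra.
Qed.

(** Expanded at s, the values cancel because 2 = 1 + 1, and the slopes because 4b - b - (b + 1) =
    2(b - 1/2). What remains is of order T^2; 15 = 8 + 1 + 4 + 2 counts the four Taylor errors. *)
Lemma dup_step_bound (f f' f'' : R -> R) (G : R) : (0 <= G)%R ->
  (forall s, (0 <= s)%R -> is_derive f s (f' s)) -> (forall s, (0 <= s)%R -> is_derive f' s (f'' s)) ->
  (forall s, (0 <= s)%R -> (Rabs (f'' s) <= G * exp (- s))%R) ->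
  forall s T b, (0 <= s)%R -> (0 <= T)%R -> (0 <= b <= 1)%R ->
  (Rabs (2 * f (s + 2 * T * b) - f (s + T * b) - f (s + T * b + T) - (b - / 2) * (f (s + 2 * T) - f s))
   <= 15 * G * exp (- s) * (T * T))%R.
Proof.
intros HG Hf Hf' Hb s T b Hs HT B.
assert (Tb : (0 <= T * b)%R) by nra.
pose proof (taylor1_bound f f' f'' G HG Hf Hf' Hb s) as Q.
pose proof (Q (2 * T * b)%R Hs ltac:(lra)) as Q1. pose proof (Q (T * b)%R Hs Tb) as Q2.
pose proof (Q (T * b + T)%R Hs ltac:(lra)) as Q3. pose proof (Q (2 * T)%R Hs ltac:(lra)) as Q4.
rewrite <- !Rplus_assoc in Q3.
set (M := (G * exp (- s))%R) in *. assert (HM : (0 <= M)%R) by (unfold M; pose proof (exp_pos (- s)); nra).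
assert (bT : (T * b <= T)%R) by nra.
assert (B1 : (M * (2 * T * b * (2 * T * b)) <= 4 * (M * (T * T)))%R).
{ replace (4 * (M * (T * T)))%R with (M * (2 * T * (2 * T)))%R by ring. apply Rmult_le_compat_l; auto. apply Rmult_le_compat; nra. }
assert (B2 : (M * (T * b * (T * b)) <= M * (T * T))%R) by (apply Rmult_le_compat_l; auto; apply Rmult_le_compat; nra).
assert (B3 : (M * ((T * b + T) * (T * b + T)) <= 4 * (M * (T * T)))%R).
{ replace (4 * (M * (T * T)))%R with (M * (2 * T * (2 * T)))%R by ring. apply Rmult_le_compat_l; auto. apply Rmult_le_compat; nra. }
assert (B4 : (M * (2 * T * (2 * T)) = 4 * (M * (T * T)))%R) by ring.
apply Rabs_le_between in Q1. apply Rabs_le_between in Q2. apply Rabs_le_between in Q3. apply Rabs_le_between in Q4.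
replace (15 * G * exp (- s) * (T * T))%R with (15 * (M * (T * T)))%R by (unfold M; ring).
set (W := (M * (T * T))%R) in *.
set (e4 := (f (s + 2 * T) - f s - 2 * T * f' s)%R) in *.
assert (P : (Rabs ((b - / 2) * e4) <= 2 * W)%R).
{ rewrite Rabs_mult. assert (Rabs (b - / 2) <= / 2)%R by (apply Rabs_le; lra).
  assert (Rabs e4 <= 4 * W)%R by (apply Rabs_le; lra).
  replace (2 * W)%R with (/ 2 * (4 * W))%R by field. apply Rmult_le_compat; auto; apply Rabs_pos. }
apply Rabs_le_between in P.
apply Rabs_le. unfold e4 in P. split; nra.
Qed.

(** * The logarithm of 1 - e^{i th - s} *)

Section LogFactor.
Variable th : R.
Hypothesis Hth : (cos th < 1)%R.

Let den (s : R) := (1 - 2 * exp (- s) * cos th + exp (- s) * exp (- s))%R.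

(** Together with [log_im] the principal logarithm of 1 - e^{i th - s}. For s >= 0 the real part 1 -
    e^{-s} cos th is positive, so the argument is an arctangent; cos th < 1 excludes the singularity
    at s = 0. *)
Definition log_re (s : R) : R := (ln (1 - 2 * exp (- s) * cos th + exp (- s) * exp (- s)) / 2)%R.
Definition log_im (s : R) : R := (- atan (exp (- s) * sin th / (1 - exp (- s) * cos th)))%R.

Let e_range s : (0 <= s)%R -> (0 < exp (- s) <= 1)%R.
Proof.
intros Hs. split; [apply exp_pos|]. rewrite <- exp_0. destruct Hs as [Hs|<-]; [left; apply exp_increasing; lra|rewrite Ropp_0; lra].
Qed.

(** Twice the difference of the two sides is (1 + c)(1 - e)^2 + (1 - c)(2e + e^2), with c = cos th
    and e = e^{-s}. *)
Let den_low s : (0 <= s)%R -> ((1 - cos th) / 2 <= den s)%R.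
Proof.
intros Hs. unfold den. destruct (e_range s Hs) as [E1 E2]. set (e := exp (- s)) in *. set (c := cos th) in *.
assert (-1 <= c <= 1)%R by (unfold c; apply COS_bound).
assert (0 <= (1 + c) * ((1 - e) * (1 - e)))%R by (apply Rmult_le_pos; nra).
assert (0 <= (1 - c) * (2 * e + e * e))%R by (apply Rmult_le_pos; nra). lra.
Qed.

Let den2_pos s : (0 <= s)%R -> (0 < 1 - exp (- s) * cos th)%R.
Proof.
intros Hs. destruct (e_range s Hs) as [E1 E2]. set (e := exp (- s)) in *. pose proof (COS_bound th). nra.
Qed.

Let sc : (cos th * cos th + sin th * sin th = 1)%R.
Proof. pose proof (sin2_cos2 th) as Q. unfold Rsqr in Q. lra. Qed.

Lemma log_re_der s : (0 <= s)%R -> is_derive log_re s ((exp (- s) * cos th - exp (- s) * exp (- s)) / den s)%R.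
Proof.
intros Hs. pose proof (den_low s Hs) as D. unfold den in *. unfold log_re. auto_derive; [lra|]. field. lra.
Qed.

Lemma log_re_der2 s : (0 <= s)%R -> is_derive (fun s => (exp (- s) * cos th - exp (- s) * exp (- s)) / den s)%R s
  ((- (exp (- s) * cos th) + 2 * (exp (- s) * exp (- s))) / den s
   - (exp (- s) * cos th - exp (- s) * exp (- s)) * (2 * exp (- s) * cos th - 2 * (exp (- s) * exp (- s))) / (den s * den s))%R.
Proof.
intros Hs. pose proof (den_low s Hs) as D. unfold den in *. auto_derive; [lra|]. field. lra.
Qed.

Lemma log_im_der s : (0 <= s)%R -> is_derive log_im s (exp (- s) * sin th / den s)%R.
Proof.
intros Hs. pose proof (den_low s Hs) as D. pose proof (den2_pos s Hs) as D2. unfold den in *. unfold log_im.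
set (e := exp (- s)) in *.
assert (E : (1 - 2 * e * cos th + e * e = (1 - e * cos th) * (1 - e * cos th) + e * sin th * (e * sin th))%R).
{ replace (e * e)%R with (e * e * (cos th * cos th + sin th * sin th))%R by (rewrite sc; ring). ring. }
auto_derive; [repeat split; fold e; lra|]. fold e. rewrite E. field. split; [|lra].
rewrite E in D. lra.
Qed.

Lemma log_im_der2 s : (0 <= s)%R -> is_derive (fun s => exp (- s) * sin th / den s)%R s
  (- (exp (- s) * sin th) / den s - (exp (- s) * sin th) * (2 * exp (- s) * cos th - 2 * (exp (- s) * exp (- s))) / (den s * den s))%R.
Proof.
intros Hs. pose proof (den_low s Hs) as D. unfold den in *. auto_derive; [lra|]. field. lra.
Qed.

Let quot_bound (n1 n2 d m c1 c2 e : R) : (0 < m)%R -> (m <= d)%R -> (0 <= e)%R -> (Rabs n1 <= c1 * e)%R -> (Rabs n2 <= c2 * e)%R ->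
  (Rabs (n1 / d - n2 / (d * d)) <= (c1 / m + c2 / (m * m)) * e)%R.
Proof.
intros Hm Hd He H1 H2.
assert (I1 : (/ d <= / m)%R) by (apply Rinv_le_contravar; lra).
assert (I0 : (0 < / d)%R) by (apply Rinv_0_lt_compat; lra).
assert (I2 : (/ (d * d) <= / (m * m))%R) by (apply Rinv_le_contravar; nra).
assert (I3 : (0 < / (d * d))%R) by (apply Rinv_0_lt_compat; nra).
unfold Rminus, Rdiv. eapply Rle_trans; [apply Rabs_triang|]. rewrite Rabs_Ropp, !Rabs_mult, (Rabs_right (/ d)), (Rabs_right (/ (d * d))) by lra.
pose proof (Rabs_pos n1). pose proof (Rabs_pos n2).
rewrite Rmult_plus_distr_r. apply Rplus_le_compat.
- replace (c1 * / m * e)%R with (c1 * e * / m)%R by ring. apply Rmult_le_compat; lra.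
- replace (c2 * / (m * m) * e)%R with (c2 * e * / (m * m))%R by ring. apply Rmult_le_compat; lra.
Qed.

Let m0 := ((1 - cos th) / 2)%R.
(** With m = (1 - cos th)/2 a lower bound of [den], the second derivatives have numerators of
    modulus at most 3 e^{-s} over [den] and 8 e^{-s} over its square. *)
Definition lbound : R := (3 / ((1 - cos th) / 2) + 8 / (((1 - cos th) / 2) * ((1 - cos th) / 2)))%R.

Lemma lbound_pos : (0 <= lbound)%R.
Proof.
unfold lbound. assert (0 < 3 / ((1 - cos th) / 2))%R by (apply Rdiv_lt_0_compat; lra).
assert (0 < 8 / ((1 - cos th) / 2 * ((1 - cos th) / 2)))%R by (apply Rdiv_lt_0_compat; nra). lra.
Qed.

Lemma log_re_step s T b : (0 <= s)%R -> (0 <= T)%R -> (0 <= b <= 1)%R ->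
  (Rabs (2 * log_re (s + 2 * T * b) - log_re (s + T * b) - log_re (s + T * b + T) - (b - / 2) * (log_re (s + 2 * T) - log_re s))
   <= 15 * lbound * exp (- s) * (T * T))%R.
Proof.
apply (dup_step_bound _ _ _ _ lbound_pos log_re_der log_re_der2).
intros t Ht. destruct (e_range t Ht) as [E1 E2]. pose proof (COS_bound th). unfold lbound.
assert (A1 : (Rabs (exp (- t) * cos th) <= exp (- t))%R).
{ rewrite Rabs_mult, Rabs_right by lra. assert (Rabs (cos th) <= 1)%R by (apply Rabs_le; lra). pose proof (Rabs_pos (cos th)). nra. }
apply Rabs_le_between in A1.
assert (A2 : (0 < exp (- t) * exp (- t) <= exp (- t))%R) by nra.
apply quot_bound; try lra.
- apply den_low; auto.
- apply Rabs_le; lra.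
- rewrite Rabs_mult. replace (8 * exp (- t))%R with ((2 * exp (- t)) * 4)%R by ring.
  apply Rmult_le_compat; try apply Rabs_pos; apply Rabs_le; lra.
Qed.

Lemma log_im_step s T b : (0 <= s)%R -> (0 <= T)%R -> (0 <= b <= 1)%R ->
  (Rabs (2 * log_im (s + 2 * T * b) - log_im (s + T * b) - log_im (s + T * b + T) - (b - / 2) * (log_im (s + 2 * T) - log_im s))
   <= 15 * lbound * exp (- s) * (T * T))%R.
Proof.
apply (dup_step_bound _ _ _ _ lbound_pos log_im_der log_im_der2).
intros t Ht. destruct (e_range t Ht) as [E1 E2]. pose proof (COS_bound th). pose proof (SIN_bound th). unfold lbound.
assert (A1 : (Rabs (exp (- t) * cos th) <= exp (- t))%R).
{ rewrite Rabs_mult, Rabs_right by lra. assert (Rabs (cos th) <= 1)%R by (apply Rabs_le; lra). pose proof (Rabs_pos (cos th)). nra. }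
assert (A3 : (Rabs (exp (- t) * sin th) <= exp (- t))%R).
{ rewrite Rabs_mult, Rabs_right by lra. assert (Rabs (sin th) <= 1)%R by (apply Rabs_le; lra). pose proof (Rabs_pos (sin th)). nra. }
apply Rabs_le_between in A1.
assert (A2 : (0 < exp (- t) * exp (- t) <= exp (- t))%R) by nra.
apply quot_bound; try lra.
- apply den_low; auto.
- rewrite Rabs_Ropp. lra.
- rewrite Rabs_mult. replace (8 * exp (- t))%R with ((2 * exp (- t)) * 4)%R by ring.
  apply Rmult_le_compat; try apply Rabs_pos; [lra|apply Rabs_le; lra].
Qed.

Lemma exp_log_factor s : (0 <= s)%R -> Cexp (log_re s, log_im s) = 1 - Cexp (Ci * RtoC th - RtoC s).
Proof.
intros Hs. pose proof (den_low s Hs) as D. pose proof (den2_pos s Hs) as D2. unfold den in *.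
assert (E : (1 - 2 * exp (- s) * cos th + exp (- s) * exp (- s) = (1 - exp (- s) * cos th) * (1 - exp (- s) * cos th) + exp (- s) * sin th * (exp (- s) * sin th))%R).
{ replace (exp (- s) * exp (- s))%R with (exp (- s) * exp (- s) * (cos th * cos th + sin th * sin th))%R at 1 by (rewrite sc; ring). ring. }
assert (X : exp (log_re s) = sqrt (1 - 2 * exp (- s) * cos th + exp (- s) * exp (- s))).
{ unfold log_re. rewrite <- Rpower_sqrt by lra. unfold Rpower. f_equal. field. }
set (u := (exp (- s) * sin th / (1 - exp (- s) * cos th))%R).
assert (S : sqrt (1 + u²) = (sqrt (1 - 2 * exp (- s) * cos th + exp (- s) * exp (- s)) / (1 - exp (- s) * cos th))%R).
{ transitivity (sqrt ((1 - 2 * exp (- s) * cos th + exp (- s) * exp (- s)) / ((1 - exp (- s) * cos th) * (1 - exp (- s) * cos th))))%R.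
  - f_equal. rewrite E. unfold u, Rsqr. field. lra.
  - rewrite sqrt_div_alt by nra. rewrite sqrt_square by lra. reflexivity. }
assert (Sp : (0 < sqrt (1 - 2 * exp (- s) * cos th + exp (- s) * exp (- s)))%R) by (apply sqrt_lt_R0; lra).
assert (Ex : (exp (0 * th - 1 * 0 - s) = exp (- s))%R) by (f_equal; ring).
apply C_ext.
- rewrite Re_Cexp. change (Re (log_re s, log_im s)) with (log_re s). change (Im (log_re s, log_im s)) with (log_im s).
  unfold log_im. fold u. rewrite cos_neg, cos_atan, S, X.
  rewrite Re_minus, Re_Cexp. replace (Re (Ci * RtoC th - RtoC s)) with (- s)%R by (simpl; ring).
  replace (Im (Ci * RtoC th - RtoC s)) with th by (simpl; ring). change (Re 1) with 1%R. field. split; lra.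
- rewrite Im_Cexp. change (Re (log_re s, log_im s)) with (log_re s). change (Im (log_re s, log_im s)) with (log_im s).
  unfold log_im. fold u. rewrite sin_neg, sin_atan, S, X. unfold u.
  rewrite Im_minus, Im_Cexp. replace (Re (Ci * RtoC th - RtoC s)) with (- s)%R by (simpl; ring).
  replace (Im (Ci * RtoC th - RtoC s)) with th by (simpl; ring). change (Im 1) with 0%R. field. split; lra.
Qed.
End LogFactor.

(** * Doubling the scale in the logarithm of a product *)

Lemma Cprod_mul (u v : nat -> C) (n : nat) : Cprod (fun i => u i * v i) n = Cprod u n * Cprod v n.
Proof. induction n as [|n IH]; simpl; [ring|rewrite IH; ring]. Qed.

Lemma Cprod_blocks (u : nat -> C) (k n : nat) :
  Cprod u (k * n) = Cprod (fun j => Cprod (fun m => u (k * j + m)%nat) k) n.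
Proof.
assert (A : forall a b, Cprod u (a + b) = Cprod u a * Cprod (fun i => u (a + i)%nat) b).
{ intros a b. induction b as [|b IH]; [rewrite Nat.add_0_r; simpl; ring|].
  rewrite Nat.add_succ_r. simpl. rewrite IH. ring. }
induction n as [|n IH]; [now rewrite Nat.mul_0_r|].
rewrite Nat.mul_succ_r, A, IH. reflexivity.
Qed.

Lemma Cprod_Cexp (u : nat -> C) (n : nat) : Cprod (fun i => Cexp (u i)) n = Cexp (Csum u n).
Proof. induction n as [|n IH]; simpl; [now rewrite Cexp_0|rewrite IH, <- Cexp_plus; f_equal]. Qed.

Lemma Clim_mult (u v : nat -> C) (l m : C) : Clim u l -> Clim v m -> Clim (fun n => u n * v n) (l * m).
Proof.
intros Hu Hv.
assert (Z : Clim (fun n => (u n - l) * (v n - m)) 0).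
{ intros e He. destruct (Hu (Rmin e 1)) as [N1 H1]; [apply Rmin_pos; lra|]. destruct (Hv 1%R) as [N2 H2]; [lra|].
  exists (Nat.max N1 N2). intros n Hn. specialize (H1 n ltac:(lia)). specialize (H2 n ltac:(lia)).
  replace ((u n - l) * (v n - m) - 0) with ((u n - l) * (v n - m)) by ring. rewrite Cmod_mult.
  pose proof (Rmin_l e 1). pose proof (Cmod_ge_0 (u n - l)). pose proof (Cmod_ge_0 (v n - m)). nra. }
pose proof (Clim_plus _ _ _ _ Z (Clim_minus _ _ _ _ (Clim_plus _ _ _ _ (Clim_scal m _ _ Hu) (Clim_scal l _ _ Hv)) (Clim_const (l * m)))) as Q.
replace (l * m) with (0 + (m * l + l * m - l * m)) by ring.
eapply Clim_ext; [|exact Q]. intros n. cbv beta. ring.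
Qed.

Definition glog (th s : R) : C := (log_re th s, log_im th s).

Lemma geo_2T (T : R) (n : nat) : (0 < T <= / 2)%R -> (geo (exp (- (2 * T))) n <= / T)%R.
Proof.
intros HT.
assert (E : (exp (- (2 * T)) <= 1 - T)%R).
{ rewrite exp_Ropp. apply Rle_trans with (/ (1 + 2 * T))%R.
  - apply Rinv_le_contravar; [lra|]. left. apply exp_ineq1. lra.
  - apply Rmult_le_reg_r with (1 + 2 * T)%R; [lra|]. rewrite Rinv_l by lra. nra. }
pose proof (exp_pos (- (2 * T))).
eapply Rle_trans; [apply geo_le; lra|]. apply Rinv_le_contravar; lra.
Qed.

(** Each point of the sum with step 2T is matched with two points of the sum with step T. The
    corrections (b - 1/2)(f(s + 2T) - f(s)) telescope along s = 2Tj and leave the values at the two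
    ends; the errors add up to T^2 times a geometric sum, which is O(T) by [geo_2T]. *)
Lemma glog_dup_sum (th b T : R) (N : nat) : (cos th < 1)%R -> (0 <= b <= 1)%R -> (0 < T)%R ->
  (Cmod (2 * Csum (fun j => glog th (2 * T * (b + INR j))) N - Csum (fun j => glog th (T * (b + INR j))) (2 * N)
     - RtoC (b - / 2) * (glog th (2 * T * INR N) - glog th 0)) <= 30 * lbound th * (T * T) * geo (exp (- (2 * T))) N)%R.
Proof.
intros Hth Hb HT. induction N as [|N IH].
{ simpl. rewrite Rmult_0_r. replace (2 * 0 - 0 - RtoC (b - / 2) * (glog th 0 - glog th 0)) with (RtoC 0) by ring. rewrite Cmod_0.
  replace (geo (exp (- (2 * T))) 0) with 0%R by reflexivity. lra. }
replace (2 * S N)%nat with (S (S (2 * N))) by lia.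
change (Csum (fun j => glog th (2 * T * (b + INR j))) (S N)) with
  (Csum (fun j => glog th (2 * T * (b + INR j))) N + glog th (2 * T * (b + INR N))).
change (Csum (fun j => glog th (T * (b + INR j))) (S (S (2 * N)))) with
  (Csum (fun j => glog th (T * (b + INR j))) (2 * N) + glog th (T * (b + INR (2 * N))) + glog th (T * (b + INR (S (2 * N))))).
set (A := Csum _ N) in *. set (B := Csum _ (2 * N)) in *.
set (s := (2 * T * INR N)%R).
assert (Hs : (0 <= s)%R) by (unfold s; pose proof (pos_INR N); nra).
replace (2 * T * (b + INR N))%R with (s + 2 * T * b)%R by (unfold s; ring).
replace (T * (b + INR (2 * N)))%R with (s + T * b)%R by (unfold s; rewrite mult_INR; simpl (INR 2); ring).
replace (T * (b + INR (S (2 * N))))%R with (s + T * b + T)%R by (unfold s; rewrite S_INR, mult_INR; simpl (INR 2); ring).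
replace (2 * T * INR (S N))%R with (s + 2 * T)%R by (unfold s; rewrite S_INR; ring).
fold s in IH.
pose proof (log_re_step th Hth s T b Hs ltac:(lra) Hb) as R1.
pose proof (log_im_step th Hth s T b Hs ltac:(lra) Hb) as R2.
set (st := 2 * glog th (s + 2 * T * b) - glog th (s + T * b) - glog th (s + T * b + T) - RtoC (b - / 2) * (glog th (s + 2 * T) - glog th s)).
assert (R3 : (Cmod st <= 30 * lbound th * exp (- s) * (T * T))%R).
{ eapply Rle_trans; [apply Cmod_le_abs|].
  replace (Re st) with (2 * log_re th (s + 2 * T * b) - log_re th (s + T * b) - log_re th (s + T * b + T) - (b - / 2) * (log_re th (s + 2 * T) - log_re th s))%R
    by (unfold st, glog, Re, Im; simpl; ring).
  replace (Im st) with (2 * log_im th (s + 2 * T * b) - log_im th (s + T * b) - log_im th (s + T * b + T) - (b - / 2) * (log_im th (s + 2 * T) - log_im th s))%R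
    by (unfold st, glog, Re, Im; simpl; ring).
  lra. }
match goal with |- (Cmod ?u <= _)%R => replace u with ((2 * A - B - RtoC (b - / 2) * (glog th s - glog th 0)) + st) by (unfold st; ring) end.
eapply Rle_trans; [apply Cmod_triangle|].
replace (geo (exp (- (2 * T))) (S N)) with (geo (exp (- (2 * T))) N + exp (- (2 * T)) ^ N)%R by reflexivity.
rewrite pow_exp. replace (INR N * - (2 * T))%R with (- s)%R by (unfold s; ring). lra.
Qed.

Lemma glog_vanish (th T e : R) : (cos th < 1)%R -> (0 < T)%R -> (0 < e)%R ->
  exists N0, forall N, (N0 <= N)%nat -> (Cmod (glog th (2 * T * INR N)) <= e)%R.
Proof.
intros Hth HT He.
assert (L0 : exists s0, (0 <= s0)%R /\ forall s, (s0 <= s)%R -> (Cmod (glog th s) <= e)%R).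
{ set (d := Rmin (/ 8) (e / 8)%R). assert (Hd : (0 < d)%R) by (unfold d; apply Rmin_pos; lra).
  assert (Hd1 : (d <= / 8)%R) by apply Rmin_l. assert (Hd2 : (d <= e / 8)%R) by apply Rmin_r.
  exists (/ d)%R. split; [apply Rlt_le, Rinv_0_lt_compat; auto|]. intros s Hs.
  assert (Hi : (0 < / d)%R) by (apply Rinv_0_lt_compat; auto).
  assert (E : (0 < exp (- s) <= d)%R).
  { split; [apply exp_pos|]. rewrite exp_Ropp, <- (Rinv_inv d). apply Rinv_le_contravar; auto.
    apply Rle_trans with (1 + s)%R; [lra|]. left. apply exp_ineq1. lra. }
  set (x := exp (- s)) in *.
  pose proof (COS_bound th) as C1. pose proof (SIN_bound th) as C2.
  assert (P1 : (Rabs (x * cos th) <= x)%R) by (apply Rabs_le; nra).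
  assert (P2 : (Rabs (x * sin th) <= x)%R) by (apply Rabs_le; nra).
  apply Rabs_le_between in P1.
  eapply Rle_trans; [apply Cmod_le_abs|]. change (Re (glog th s)) with (log_re th s). change (Im (glog th s)) with (log_im th s).
  unfold log_re, log_im. fold x.
  assert (Q1 : (Rabs (ln (1 - 2 * x * cos th + x * x)) <= 6 * x)%R).
  { pose proof (ln_diff_bound (1 - 2 * x * cos th + x * x) 1 (/ 2) ltac:(lra) ltac:(nra) ltac:(lra)) as LB.
    rewrite ln_1, Rminus_0_r in LB. eapply Rle_trans; [exact LB|].
    assert (Rabs (1 - 2 * x * cos th + x * x - 1) <= 3 * x)%R by (apply Rabs_le; nra). lra. }
  assert (Q2 : (Rabs (atan (x * sin th / (1 - x * cos th))) <= 2 * x)%R).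
  { assert (AT : forall y, (Rabs (atan y) <= Rabs y)%R).
    { intros y. destruct (Rle_lt_dec 0 y) as [Hy|Hy].
      - pose proof (atan_le_id y Hy). rewrite !Rabs_right; lra.
      - pose proof (atan_le_id (- y) ltac:(lra)) as Q. rewrite atan_opp in Q. rewrite !Rabs_left1; lra. }
    eapply Rle_trans; [apply AT|]. unfold Rdiv. rewrite Rabs_mult.
    assert (I : (0 < / (1 - x * cos th) <= 2)%R).
    { split; [apply Rinv_0_lt_compat; lra|]. replace 2%R with (/ / 2)%R by field. apply Rinv_le_contravar; lra. }
    rewrite (Rabs_right (/ _)) by lra. pose proof (Rabs_pos (x * sin th)). nra. }
  rewrite Rabs_Ropp. unfold Rdiv. rewrite Rabs_mult, (Rabs_right (/ 2)) by lra. lra. }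
destruct L0 as [s0 [H0 L0]].
destruct (nfloor_ex (s0 / T)) as [N0 [_ HN0]]; [apply Rle_div_r; nra|].
exists (S N0). intros N HN. apply L0. apply le_INR in HN. rewrite S_INR in HN.
assert (s0 / T < INR N)%R by lra. apply Rlt_div_l in H; [|lra]. nra.
Qed.

Section DedekindConstant.
Variables (h h' g : Z) (k0 : nat).
Let kn := S k0.
Hypothesis Hg : (h * h' = -1 + Z.of_nat kn * g)%Z.
Let K : C := RtoC (INR kn).

(** Index m stands for the residue m + 1. The fractional part places the angle in (0, 2 PI), where
    the argument of 1 - e^{i th} is a linear function of th. *)
Definition theta (m : nat) : R := (2 * PI * frac_part (IZR h * INR (S m) / INR kn))%R.
Definition beta (m : nat) : R := (INR (S m) / INR kn)%R.

Let Hk : (0 < INR kn)%R.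
Proof. apply lt_0_INR. unfold kn. lia. Qed.

Let HK : K <> 0.
Proof. apply RtoC_neq. lra. Qed.

Lemma beta_range m : (m < k0)%nat -> (0 <= beta m <= 1)%R.
Proof.
intros Hm. pose proof Hk as Hk0. unfold beta. pose proof (pos_INR (S m)). split; [apply Rdiv_le_0_compat; lra|]. apply Rle_div_l; [exact Hk|]. rewrite Rmult_1_l. apply le_INR. unfold kn. lia.
Qed.

Lemma frac_hm m : (m < k0)%nat -> frac_part (IZR h * INR (S m) / INR kn) <> 0%R.
Proof.
intros Hm E. apply fp_nat in E as [t Ht].
assert (Q : (h * Z.of_nat (S m) = t * Z.of_nat kn)%Z).
{ apply eq_IZR. rewrite !mult_IZR, <- !INR_IZR_INZ, <- Ht. field. lra. }
assert (D : (Z.of_nat kn | Z.of_nat (S m))%Z).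
{ exists (g * Z.of_nat (S m) - h' * t)%Z. clear Ht. set (a := Z.of_nat (S m)) in *. set (b := Z.of_nat kn) in *.
  transitivity (a * (b * g) - h' * (t * b))%Z; [|ring]. rewrite <- Q. replace (b * g)%Z with (h * h' + 1)%Z by lia. ring. }
apply Z.divide_pos_le in D; [|lia]. unfold kn in D. lia.
Qed.

Lemma cos_theta m : (m < k0)%nat -> (cos (theta m) < 1)%R.
Proof.
intros Hm. pose proof (frac_hm m Hm) as F. destruct (base_fp (IZR h * INR (S m) / INR kn)) as [F1 F2].
unfold theta. set (f := frac_part _) in *. replace (2 * PI * f)%R with (2 * (PI * f))%R by ring. rewrite cos_2a_sin.
assert (0 < sin (PI * f))%R by (apply sin_gt_0; pose proof PI_RGT_0; nra). nra.
Qed.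

Lemma Cexp_theta m : Cexp (Ci * RtoC (theta m)) = Cexp (2 * PI * Ci * RtoC (IZR h * INR (S m) / INR kn)).
Proof.
unfold theta, frac_part. set (x := (IZR h * INR (S m) / INR kn)%R). apply (Cexp_eq (- Int_part x)).
cpush. ring.
Qed.

(** In the factor of index n only the root of unity e^{2 pi i h n/k} depends on the class of n,
    apart from the real exponential. In the last factor, n = k(j + 1), the root is 1, and a factor
    of the product for h = 0, k = 1 appears. *)
Lemma block_prod (z : R) (j : nat) : (0 < z)%R ->
  Cprod (fun m => 1 - nome ((IZR h + Ci * RtoC z) / K) ^ (0 + 1 + (kn * j + m))) kn =
  Cexp (Csum (fun m => glog (theta m) (2 * PI * z * (beta m + INR j))) k0) * (1 - nome ((IZR 0 + Ci * RtoC z) / RtoC (INR 1)) ^ (0 + 1 + j)).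
Proof.
intros Hz. unfold kn at 2. cbn [Cprod]. f_equal.
- rewrite <- Cprod_Cexp. apply Cprod_ext. intros m Hm. unfold glog.
  assert (Hs : (0 <= 2 * PI * z * (beta m + INR j))%R).
  { pose proof PI_RGT_0. pose proof (beta_range m Hm). pose proof (pos_INR j). apply Rmult_le_pos; nra. }
  rewrite (exp_log_factor _ (cos_theta m Hm) _ Hs), Cexp_minus, Cexp_theta, <- Cexp_minus. f_equal. f_equal.
  unfold nome. rewrite Cexp_pow. apply (Cexp_eq (h * Z.of_nat j)).
  unfold beta. replace (0 + 1 + (kn * j + m))%nat with (kn * j + S m)%nat by lia. rewrite plus_INR, mult_INR. rewrite mult_IZR, <- INR_IZR_INZ.
  unfold Rdiv. rewrite !RtoC_mult, !RtoC_plus, !RtoC_mult, !RtoC_inv by lra. fold K.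
  pose proof Ci2 as H2. field [H2]. auto.
- f_equal. unfold nome. rewrite !Cexp_pow. apply (Cexp_eq (h * (Z.of_nat j + 1))).
  replace (0 + 1 + (kn * j + k0))%nat with (kn * S j)%nat by (unfold kn; lia). replace (0 + 1 + j)%nat with (S j) by lia.
  rewrite mult_INR, !S_INR, mult_IZR, plus_IZR, <- INR_IZR_INZ. rewrite RtoC_mult. fold K.
  simpl (INR 0). rewrite !RtoC_plus, !RtoC_mult, RtoC_plus. field. auto.
Qed.

(** With T = 2 pi z this is a logarithm of the partial product of 1 - q^n over those n <= kN that k
    does not divide. *)
Definition Slog (T : R) (N : nat) : C := Csum (fun j => Csum (fun m => glog (theta m) (T * (beta m + INR j))) k0) N.

Lemma qprod_blocks (z : R) (N : nat) : (0 < z)%R ->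
  qprod (nome ((IZR h + Ci * RtoC z) / K)) 0 (kn * N) =
  Cexp (Slog (2 * PI * z) N) * qprod (nome ((IZR 0 + Ci * RtoC z) / RtoC (INR 1))) 0 N.
Proof.
intros Hz. unfold qprod, Slog. rewrite Cprod_blocks.
rewrite (Cprod_ext _ _ _ (fun j _ => block_prod z j Hz)), Cprod_mul, Cprod_Cexp. reflexivity.
Qed.

(** The limit of 2 log P(2z) - log P(z): the end values at s = 0 that the telescoping in
    [glog_dup_sum] leaves. *)
Definition Alog : C := Csum (fun m => RtoC (/ 2 - beta m) * glog (theta m) 0) k0.

(** N0 may depend on T, but B may not: the end value at s = 2TN is pushed below T by a large N. *)
Lemma Slog_dup : exists B : R, (0 <= B)%R /\ forall T, (0 < T <= / 2)%R -> exists N0, forall N, (N0 <= N)%nat ->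
  (Cmod (2 * Slog (2 * T) N - Slog T (2 * N) - Alog) <= B * T)%R.
Proof.
assert (G : forall n, (n <= k0)%nat -> exists B : R, (0 <= B)%R /\ forall T, (0 < T <= / 2)%R -> exists N0, forall N, (N0 <= N)%nat ->
  (Cmod (Csum (fun m => (2 * Csum (fun j => glog (theta m) (2 * T * (beta m + INR j))%R) N - Csum (fun j => glog (theta m) (T * (beta m + INR j))%R) (2 * N)
     - RtoC (/ 2 - beta m) * glog (theta m) 0)%C) n) <= B * T)%R).
{ induction n as [|n IH]; intros Hn.
  { exists 0%R. split; [lra|]. intros T HT. exists O. intros N _. simpl. rewrite Cmod_0. lra. }
  destruct IH as [B [HB IH]]; [lia|].
  pose proof (cos_theta n ltac:(lia)) as Hc. pose proof (beta_range n ltac:(lia)) as Hb.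
  pose proof (lbound_pos _ Hc) as LB.
  exists (B + (30 * lbound (theta n) + 1))%R. split; [lra|]. intros T HT.
  destruct (IH T HT) as [N1 H1]. destruct (glog_vanish (theta n) T T Hc ltac:(lra) ltac:(lra)) as [N2 H2].
  exists (Nat.max N1 N2). intros N HN. specialize (H1 N ltac:(lia)). specialize (H2 N ltac:(lia)).
  pose proof (glog_dup_sum (theta n) (beta n) T N Hc Hb ltac:(lra)) as D.
  pose proof (geo_2T T N HT) as GT.
  cbn [Csum]. eapply Rle_trans; [apply Cmod_triangle|]. rewrite (Rmult_plus_distr_r B). apply Rplus_le_compat; [exact H1|].
  set (A1 := Csum _ N) in *. set (A2 := Csum _ (2 * N)) in *.
  replace (2 * A1 - A2 - RtoC (/ 2 - beta n) * glog (theta n) 0)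
    with ((2 * A1 - A2 - RtoC (beta n - / 2) * (glog (theta n) (2 * T * INR N) - glog (theta n) 0)) + RtoC (beta n - / 2) * glog (theta n) (2 * T * INR N)).
  2:{ rewrite !RtoC_minus. ring. }
  eapply Rle_trans; [apply Cmod_triangle|]. rewrite Cmod_mult, Cmod_R.
  assert (X : (Rabs (beta n - / 2) <= 1)%R) by (apply Rabs_le; lra).
  assert (Y : (30 * lbound (theta n) * (T * T) * geo (exp (- (2 * T))) N <= 30 * lbound (theta n) * T)%R).
  { replace (30 * lbound (theta n) * T)%R with (30 * lbound (theta n) * (T * T) * / T)%R by (field; lra).
    apply Rmult_le_compat_l; [|exact GT]. apply Rmult_le_pos; nra. }
  pose proof (Rabs_pos (beta n - / 2)). pose proof (Cmod_ge_0 (glog (theta n) (2 * T * INR N))). nra. }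
destruct (G k0 (le_n _)) as [B [HB H]]. exists B. split; auto. intros T HT. destruct (H T HT) as [N0 H0]. exists N0.
intros N HN. specialize (H0 N HN). eapply Rle_trans; [|exact H0]. right. f_equal.
unfold Slog, Alog. rewrite (Csum_swap _ N), (Csum_swap _ (2 * N)).
transitivity (Csum (fun m => 2 * Csum (fun j => glog (theta m) (2 * T * (beta m + INR j))) N) k0
  + Csum (fun m => - (1) * Csum (fun j => glog (theta m) (T * (beta m + INR j))) (2 * N)) k0
  + Csum (fun m => - (1) * (RtoC (/ 2 - beta m) * glog (theta m) 0)) k0).
- rewrite !Csum_scal. ring.
- rewrite <- !Csum_plus. apply Csum_ext. intros. ring.
Qed.

Lemma RtoC_sum_n (f : nat -> R) (n : nat) : RtoC (sum_n f n) = Csum (fun i => RtoC (f i)) (S n).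
Proof.
induction n as [|n IH].
- rewrite sum_O. simpl. ring.
- rewrite sum_Sn. change (plus (sum_n f n) (f (S n))) with (sum_n f n + f (S n))%R. rewrite RtoC_plus, IH. reflexivity.
Qed.

Lemma cos_theta_rev m : (m < k0)%nat -> cos (theta (k0 - 1 - m)) = cos (theta m).
Proof.
intros Hm. pose proof Hk as Hk1.
assert (E : Cexp (Ci * RtoC (theta (k0 - 1 - m))) = Cexp (- (Ci * RtoC (theta m)))).
{ rewrite Cexp_opp, !Cexp_theta, <- Cexp_opp. apply (Cexp_eq h).
  replace (S (k0 - 1 - m)) with (kn - S m)%nat by (unfold kn; lia). rewrite minus_INR by (unfold kn; lia).
  unfold Rdiv. rewrite !RtoC_mult, !RtoC_minus, RtoC_inv by lra. fold K. field. auto. }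
rewrite Cexp_Ci in E. replace (- (Ci * RtoC (theta m))) with (Ci * RtoC (- theta m)) in E by (rewrite RtoC_opp; ring).
rewrite Cexp_Ci in E. apply (f_equal Re) in E. unfold Re in E. simpl in E. now rewrite cos_neg in E.
Qed.

(** sin(2 pi f)/(1 - cos(2 pi f)) = cot(pi f) = tan(PI/2 - pi f), and 0 < f < 1 puts this angle into
    the principal range of the arctangent. *)
Lemma log_im_theta_0 m : (m < k0)%nat -> log_im (theta m) 0 = (PI * sawtooth (IZR h * INR (S m) / INR kn))%R.
Proof.
intros Hm. pose proof (frac_hm m Hm) as F. destruct (base_fp (IZR h * INR (S m) / INR kn)) as [F1 F2].
unfold sawtooth. destruct (Req_dec_T _ _) as [E|_]; [contradiction|].
unfold log_im, theta. set (f := frac_part _) in *. rewrite Ropp_0, exp_0.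
pose proof PI_RGT_0 as P.
assert (S : (0 < sin (PI * f))%R) by (apply sin_gt_0; nra).
replace (2 * PI * f)%R with (2 * (PI * f))%R by ring.
replace (1 * sin (2 * (PI * f)) / (1 - 1 * cos (2 * (PI * f))))%R with (tan (PI / 2 - PI * f)).
- rewrite atan_tan by (split; nra). field.
- unfold tan. rewrite sin_shift, cos_shift, cos_2a_sin, sin_2a. field. split; nra.
Qed.

(** The residues mu and k - mu have the same log modulus and opposite weights 1/2 - mu/k, so the
    real parts of the logarithms cancel and only the arguments contribute. *)
Lemma Alog_eq : Alog = Ci * Csum (fun m => RtoC (PI * ((/ 2 - beta m) * sawtooth (IZR h * INR (S m) / INR kn)))) k0.
Proof.
assert (R0 : Csum (fun m => RtoC ((/ 2 - beta m) * log_re (theta m) 0)) k0 = 0).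
{ set (X := Csum _ k0). assert (E : X = - (1) * X).
  { unfold X at 1. rewrite Csum_rev. unfold X. rewrite <- Csum_scal. apply Csum_ext. intros m Hm.
    unfold log_re. rewrite cos_theta_rev by auto. replace (beta (k0 - 1 - m)) with (1 - beta m)%R.
    - replace (- (1)) with (RtoC (-1)) by (apply C_ext; simpl; ring). rewrite <- RtoC_mult. f_equal. field.
    - unfold beta. replace (S (k0 - 1 - m)) with (kn - S m)%nat by (unfold kn; lia). rewrite minus_INR by (unfold kn; lia).
      pose proof Hk. field. lra. }
  assert (E2 : 2 * X = 0) by (replace (2 * X) with (X - - (1) * X) by ring; rewrite <- E; ring).
  replace X with (/ 2 * (2 * X)) by (field; apply C2_neq_0). rewrite E2. ring. }
unfold Alog. transitivity (Csum (fun m => RtoC ((/ 2 - beta m) * log_re (theta m) 0)) k0 + Ci * Csum (fun m => RtoC (PI * ((/ 2 - beta m) * sawtooth (IZR h * INR (S m) / INR kn)))) k0).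
- rewrite <- Csum_scal, <- Csum_plus. apply Csum_ext. intros m Hm. unfold glog. rewrite log_im_theta_0 by auto.
  set (a := log_re _ _). set (b := sawtooth _). apply C_ext; unfold Re, Im; simpl; ring.
- rewrite R0. ring.
Qed.

(** The weights 1/2 - mu/k are -((mu/k)), so [Alog] is -pi i times the Dedekind sum; the term mu =
    0, present in [omega], vanishes. *)
Lemma Alog_omega : Cexp Alog * omega h (Z.of_nat kn) = 1.
Proof.
unfold omega. rewrite <- Cexp_plus, <- Cexp_0. f_equal.
replace (Z.to_nat (Z.of_nat kn - 1)) with k0 by (unfold kn; lia).
rewrite RtoC_sum_n, Csum_S_l, Alog_eq.
assert (S0 : sawtooth (INR 0 / IZR (Z.of_nat kn)) = 0%R).
{ unfold sawtooth. destruct (Req_dec_T _ _) as [_|E]; auto. exfalso. apply E. simpl (INR 0). unfold Rdiv. rewrite Rmult_0_l. apply fp_R0. }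
rewrite S0, Rmult_0_l. rewrite <- INR_IZR_INZ.
replace (PI * Ci * (0 + Csum (fun i => RtoC (sawtooth (INR (S i) / INR kn) * sawtooth (IZR h * INR (S i) / INR kn))) k0))
  with (Ci * Csum (fun i => PI * RtoC (sawtooth (INR (S i) / INR kn) * sawtooth (IZR h * INR (S i) / INR kn))) k0)
  by (rewrite Csum_scal; ring).
rewrite <- Cmult_plus_distr_l, <- Csum_plus. rewrite Csum_zero; [ring|]. intros m Hm.
assert (B : sawtooth (INR (S m) / INR kn) = (beta m - / 2)%R).
{ pose proof Hk as Hk1. assert (R1 : (0 < INR (S m) / INR kn < 1)%R).
  { split; [apply Rdiv_lt_0_compat; auto; apply lt_0_INR; lia|]. apply Rlt_div_l; [auto|]. rewrite Rmult_1_l. apply lt_INR. unfold kn. lia. }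
  assert (Fp : frac_part (INR (S m) / INR kn) = (INR (S m) / INR kn)%R).
  { unfold frac_part. replace (Int_part (INR (S m) / INR kn)) with 0%Z; [ring|]. apply Int_part_spec. lra. }
  unfold sawtooth. rewrite Fp. destruct (Req_dec_T _ _) as [E|_]; [lra|]. unfold beta. field. lra. }
rewrite B, <- RtoC_mult, <- RtoC_plus. f_equal. ring.
Qed.

(** * The limit z -> 0+ and the value of D *)

Hypothesis Hev : Z.Even (Z.of_nat kn) -> Z.Even g.

Let nome_small (y : R) (b : Z) (m : nat) : (0 < y)%R -> (0 < m)%nat -> (Cmod (nome ((IZR b + Ci / RtoC y) / RtoC (INR m))) <= INR m * y)%R.
Proof.
intros Hy Hm. assert (Hm' : (0 < INR m)%R) by (apply lt_0_INR; auto). rewrite Cmod_nome.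
replace ((IZR b + Ci / RtoC y) / RtoC (INR m)) with (RtoC (IZR b / INR m) + Ci * RtoC (/ (y * INR m))).
2:{ unfold Rdiv. rewrite RtoC_mult, !RtoC_inv, RtoC_mult by nra. field. split; apply RtoC_neq; lra. }
replace (Im (RtoC (IZR b / INR m) + Ci * RtoC (/ (y * INR m)))) with (/ (y * INR m))%R by (creim; ring).
assert (P : (0 < y * INR m)%R) by nra. rewrite exp_Ropp.
rewrite <- (Rinv_inv (INR m * y)). apply Rinv_le_contravar; [apply Rinv_0_lt_compat; lra|].
rewrite (Rmult_comm (INR m)). pose proof (Rinv_0_lt_compat _ P). pose proof PI2_1.
pose proof (exp_ineq1 (2 * PI * / (y * INR m)) ltac:(nra)). nra.
Qed.

Let im_pos (y : R) (b : Z) (m : nat) : (0 < y)%R -> (0 < m)%nat ->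
  (0 < Im ((IZR b + Ci * RtoC y) / RtoC (INR m)))%R /\ (0 < Im ((IZR b + Ci / RtoC y) / RtoC (INR m)))%R.
Proof.
intros Hy Hm. assert (Hm' : (0 < INR m)%R) by (apply lt_0_INR; auto). split.
- replace ((IZR b + Ci * RtoC y) / RtoC (INR m)) with (RtoC (IZR b / INR m) + Ci * RtoC (y / INR m)).
  + replace (Im _) with (y / INR m)%R by (creim; ring). apply Rdiv_lt_0_compat; auto.
  + unfold Rdiv. rewrite !RtoC_mult, !RtoC_inv by lra. field. apply RtoC_neq; lra.
- replace ((IZR b + Ci / RtoC y) / RtoC (INR m)) with (RtoC (IZR b / INR m) + Ci * RtoC (/ (y * INR m))).
  + replace (Im _) with (/ (y * INR m))%R by (creim; ring). apply Rinv_0_lt_compat. nra.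
  + unfold Rdiv. rewrite RtoC_mult, !RtoC_inv, RtoC_mult by nra. field. split; apply RtoC_neq; lra.
Qed.

(** The offset 8k makes 2k times [seqz n] at most 1/4, so the nomes satisfy the hypothesis of
    [qpoch_near_1] from the first term on. *)
Let seqz (n : nat) : R := (/ (8 * INR kn + INR n))%R.

Let seqz_pos n : (0 < seqz n)%R.
Proof. apply Rinv_0_lt_compat. pose proof Hk. pose proof (pos_INR n). lra. Qed.

Let seqz_small (e : R) : (0 < e)%R -> exists N, forall n, (N <= n)%nat -> (seqz n <= e)%R.
Proof.
intros He. assert (He' : (0 < / e)%R) by (apply Rinv_0_lt_compat; auto).
destruct (nfloor_ex (/ e)) as [N [_ HN]]; [lra|]. exists (S N). intros n Hn. apply le_INR in Hn. rewrite S_INR in Hn.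
unfold seqz. rewrite <- (Rinv_inv e). apply Rinv_le_contravar; auto. pose proof Hk. lra.
Qed.

Let qpoch_tends_1 (b : Z) (m : nat) (f : R) : (0 < m <= kn)%nat -> (0 < f <= 2)%R ->
  Clim (fun n => qpoch ((IZR b + Ci / RtoC (f * seqz n)) / RtoC (INR m))) 1.
Proof.
intros Hm Hf e He. pose proof Hk as Hk1.
assert (Hm1 : (0 < INR m)%R) by (apply lt_0_INR; lia). assert (Hm2 : (INR m <= INR kn)%R) by (apply le_INR; lia).
destruct (seqz_small (e / (16 * INR kn))%R) as [N HN]; [apply Rdiv_lt_0_compat; lra|]. exists N. intros n Hn. specialize (HN n Hn).
pose proof (seqz_pos n) as Hs.
assert (Hs2 : (8 * INR kn * seqz n <= 1)%R).
{ unfold seqz. pose proof (pos_INR n). apply Rmult_le_reg_r with (8 * INR kn + INR n)%R; [lra|]. rewrite Rmult_assoc, Rinv_l by lra. lra. }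
apply (Rmult_le_compat_l (16 * INR kn)) in HN; [|lra]. replace (16 * INR kn * (e / (16 * INR kn)))%R with e in HN by (field; lra).
assert (Hy : (0 < f * seqz n)%R) by nra.
pose proof (nome_small (f * seqz n) b m Hy ltac:(lia)) as NS.
assert (Bd : (INR m * (f * seqz n) <= INR kn * (2 * seqz n))%R) by (apply Rmult_le_compat; nra).
pose proof (qpoch_near_1 _ (proj2 (im_pos (f * seqz n) b m Hy ltac:(lia)))) as Q.
assert (C4 : (Cmod (nome ((IZR b + Ci / RtoC (f * seqz n)) / RtoC (INR m))) <= / 4)%R) by lra.
specialize (Q C4). 
assert (Hlt : (8 * (INR kn * seqz n) < e)%R) by (pose proof (Rmult_lt_0_compat _ _ Hk1 Hs); nra). lra.
Qed.

Lemma Clim_le (u v : nat -> C) (l m : C) (c : R) : Clim u l -> Clim v m -> (0 <= c)%R ->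
  (exists N, forall n, (N <= n)%nat -> (Cmod (u n) <= c * Cmod (v n))%R) -> (Cmod l <= c * Cmod m)%R.
Proof.
intros Hu Hv Hc [N HN]. apply Rnot_lt_le. intros L.
set (e := ((Cmod l - c * Cmod m) / (2 * (c + 1)))%R).
assert (He : (0 < e)%R) by (apply Rdiv_lt_0_compat; lra).
destruct (Hv e He) as [N1 H1].
assert (B : (Cmod l <= c * (Cmod m + e))%R).
{ apply (Clim_bound_le u); auto. exists (Nat.max N N1). intros n Hn. eapply Rle_trans; [apply HN; lia|].
  apply Rmult_le_compat_l; auto. specialize (H1 n ltac:(lia)). pose proof (Cmod_tri_rev (v n) m). lra. }
assert (X : ((c + 1) * e = (Cmod l - c * Cmod m) / 2)%R) by (unfold e; field; lra). nra.
Qed.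

(** Q(2z)^2 Q1(z) and Q(z) Q1(2z)^2 are compared in two ways, Q1 being the product for h = 0, k = 1.
    The blockwise logarithms give the ratio e^{Alog}(1 + O(z)). By the transformation formulas the
    square roots and the terms in 1/z cancel, and the ratio tends to D. The comparison is carried
    out in cross-multiplied form. *)
Lemma eta_constant_omega (D : C) : (forall z : C, (0 < Re z)%R ->
  qpoch ((IZR h + Ci*z) / K) = D * Cexp (PI / (12 * K) * (z - / z)) / Csqrt z * qpoch ((IZR h' + Ci / z) / K)) ->
  D = Cexp Alog.
Proof.
intros HD. pose proof Hk as Hk1.
(* For h = h' = 0 and k = 1 the point z = 1 is fixed by z -> 1/z, and comparing both sides there
   gives the constant 1. *)
destruct (eta_const 0 0 1 1 ltac:(lia) ltac:(lia) ltac:(intros [q Hq]; lia)) as [D1 HD1].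
assert (E1 : D1 = 1).
{ specialize (HD1 1 ltac:(simpl; lra)). replace (Ci * 1) with Ci in HD1 by ring. replace (Ci / 1) with Ci in HD1 by field.
  rewrite Csqrt_1 in HD1. replace (1 - / 1) with (RtoC 0) in HD1 by field. rewrite Cmult_0_r, Cexp_0 in HD1.
  set (Q := qpoch _) in HD1. assert (NQ : Q <> 0).
  { apply qpoch_neq_0. replace ((IZR 0 + Ci) / RtoC (INR 1)) with Ci by (simpl; field). simpl. lra. }
  replace D1 with (D1 * 1 / 1 * Q / Q) by (field; auto). rewrite <- HD1. field. auto. }
subst D1.
destruct Slog_dup as [B [HB HS]].
set (Q := fun z : R => qpoch ((IZR h + Ci * RtoC z) / K)).
set (P := fun z : R => qpoch ((IZR h' + Ci / RtoC z) / K)).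
set (Q1 := fun z : R => qpoch ((IZR 0 + Ci * RtoC z) / RtoC (INR 1))).
set (P1 := fun z : R => qpoch ((IZR 0 + Ci / RtoC z) / RtoC (INR 1))).
(* The estimate is proved for partial products, where 2 Slog(2T, N) - Slog(T, 2N) - Alog is at most
   B T and |e^u - 1| <= 3|u| transfers this to exponentials; the inequality then passes to the
   limit. *)
assert (Step : forall z : R, (0 < z)%R -> (2 * PI * z <= / 2)%R -> (3 * (B * (2 * PI * z)) <= 1)%R ->
  (Cmod (Q (2 * z)%R * Q (2 * z)%R * Q1 z - Cexp Alog * (Q z * Q1 (2 * z)%R * Q1 (2 * z)%R))
   <= 3 * (B * (2 * PI * z)) * Cmod (Cexp Alog) * Cmod (Q z * Q1 (2 * z)%R * Q1 (2 * z)%R))%R).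
{ intros z Hz HT HB3. set (T := (2 * PI * z)%R) in *. assert (HT0 : (0 < T)%R) by (unfold T; pose proof PI_RGT_0; nra).
  destruct (HS T (conj HT0 HT)) as [N0 H0].
  set (q := fun (y : R) N => qprod (nome ((IZR h + Ci * RtoC y) / K)) 0 (kn * N)).
  set (q1 := fun (y : R) N => qprod (nome ((IZR 0 + Ci * RtoC y) / RtoC (INR 1))) 0 N).
  assert (Lq : forall y, (0 < y)%R -> Clim (q y) (Q y)).
  { intros y Hy. apply (Clim_subseq _ _ (fun N => (kn * N)%nat)); [intros; unfold kn; lia|]. apply qpoch_prod, im_pos; auto. unfold kn; lia. }
  assert (Lq1 : forall y, (0 < y)%R -> Clim (q1 y) (Q1 y)).
  { intros y Hy. exact (qpoch_prod _ (proj1 (im_pos y 0 1 Hy (le_n 1)))). }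
  assert (L2 : forall f l, Clim f l -> Clim (fun N => f (2 * N)%nat) l).
  { intros f l. apply (Clim_subseq _ _ (fun N => (2 * N)%nat)). intros; lia. }
  assert (Hz2 : (0 < 2 * z)%R) by lra.
  pose proof (Clim_mult _ _ _ _ (Clim_mult _ _ _ _ (Lq _ Hz2) (Lq _ Hz2)) (L2 _ _ (Lq1 _ Hz))) as U.
  pose proof (Clim_mult _ _ _ _ (Clim_mult _ _ _ _ (L2 _ _ (Lq _ Hz)) (Lq1 _ Hz2)) (Lq1 _ Hz2)) as V. cbv beta in U, V.
  apply (Clim_le _ _ _ _ _ (Clim_minus _ _ _ _ U (Clim_scal (Cexp Alog) _ _ V)) V).
  { apply Rmult_le_pos; [nra|apply Cmod_ge_0]. }
  exists N0. intros N HN. specialize (H0 N HN). cbv beta. unfold q, q1.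
  rewrite !qprod_blocks by auto. replace (2 * PI * (2 * z))%R with (2 * T)%R by (unfold T; ring). fold T.
  set (S1 := Slog (2 * T) N) in *. set (S2 := Slog T (2 * N)) in *. set (p1 := qprod _ 0 N). set (p2 := qprod _ 0 (2 * N)).
  assert (E1 : Cexp S1 * Cexp S1 = Cexp S2 * Cexp Alog * Cexp (2 * S1 - S2 - Alog)) by (rewrite <- !Cexp_plus; f_equal; ring).
  replace (Cexp S1 * p1 * (Cexp S1 * p1) * p2 - Cexp Alog * (Cexp S2 * p2 * p1 * p1))
    with ((Cexp (2 * S1 - S2 - Alog) - 1) * Cexp Alog * (Cexp S2 * p2 * p1 * p1)).
  2:{ replace (Cexp S1 * p1 * (Cexp S1 * p1) * p2) with ((Cexp S1 * Cexp S1) * p1 * p1 * p2) by ring. rewrite E1. ring. }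
  rewrite !(Cmod_mult _ (Cexp S2 * p2 * p1 * p1)), (Cmod_mult _ (Cexp Alog)).
  apply Rmult_le_compat_r; [apply Cmod_ge_0|]. apply Rmult_le_compat_r; [apply Cmod_ge_0|].
  eapply Rle_trans; [apply Cexp_sub1_bound; lra|]. lra. }
(* What the exponentials leave: their terms linear in z are (pi/12)(4/k + 1)z on one side and
   (pi/12)(1/k + 4)z on the other. *)
set (c := (3 * (PI / 12) * (/ INR kn - 1))%R).
set (s := seqz).
set (ex := fun n => Cexp (RtoC (c * s n))).
assert (Lex : Clim ex 1).
{ intros e He. destruct (seqz_small (Rmin (/ 2) (e / 6) / (Rabs c + 1))%R) as [N HN].
  { apply Rdiv_lt_0_compat; [apply Rmin_pos; lra|pose proof (Rabs_pos c); lra]. }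
  exists N. intros n Hn. specialize (HN n Hn). pose proof (seqz_pos n) as Hs. pose proof (Rabs_pos c) as Ac.
  apply (Rmult_le_compat_l (Rabs c + 1)) in HN; [|lra].
  replace ((Rabs c + 1) * (Rmin (/ 2) (e / 6) / (Rabs c + 1)))%R with (Rmin (/ 2) (e / 6)) in HN by (field; lra).
  pose proof (Rmin_l (/ 2) (e / 6)). pose proof (Rmin_r (/ 2) (e / 6)).
  assert (Bc : (Cmod (RtoC (c * s n)) <= Rmin (/ 2) (e / 6))%R).
  { rewrite Cmod_R, Rabs_mult, (Rabs_right (s n)) by (unfold s; lra). unfold s. lra. }
  unfold ex. eapply Rle_lt_trans; [apply Cexp_sub1_bound; lra|]. lra. }
assert (LP : forall f, (0 < f <= 2)%R -> Clim (fun n => P (f * s n)%R) 1) by (intros f Hf; apply qpoch_tends_1; auto; unfold kn; lia).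
assert (LP1 : forall f, (0 < f <= 2)%R -> Clim (fun n => P1 (f * s n)%R) 1) by (intros f Hf; apply qpoch_tends_1; auto; unfold kn; lia).
assert (H1 : (0 < 1 <= 2)%R) by lra. assert (H2 : (0 < 2 <= 2)%R) by lra.
pose proof (Clim_mult _ _ _ _ (Clim_mult _ _ _ _ (LP 1%R H1) (LP1 2%R H2)) (LP1 2%R H2)) as V.
pose proof (Clim_scal D _ _ (Clim_mult _ _ _ _ Lex (Clim_mult _ _ _ _ (Clim_mult _ _ _ _ (LP 2%R H2) (LP 2%R H2)) (LP1 1%R H1)))) as U.
cbv beta in U, V.
pose proof (Clim_minus _ _ _ _ U (Clim_scal (Cexp Alog) _ _ V)) as W. cbv beta in W.
assert (Fin : forall e, (0 < e)%R -> (Cmod (D * (1 * (1 * 1 * 1)) - Cexp Alog * (1 * 1 * 1)) <= e * Cmod (1 * 1 * 1))%R).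
{ intros e He. apply (Clim_le _ _ _ _ _ W V); [lra|].
  pose proof PI_RGT_0 as Hpi. pose proof (Cmod_ge_0 (Cexp Alog)) as HA.
  set (d := (Rmin (Rmin (/ 2) (/ (3 * B + 1))) (e / (3 * B * Cmod (Cexp Alog) + 1)) / (2 * PI))%R).
  assert (HBA : (0 < 3 * B * Cmod (Cexp Alog) + 1)%R) by (pose proof (Rmult_le_pos _ _ HB HA); lra).
  destruct (seqz_small d) as [N HN].
  { apply Rdiv_lt_0_compat; [|lra]. repeat apply Rmin_pos; try lra; [apply Rinv_0_lt_compat; lra|]. apply Rdiv_lt_0_compat; auto. }
  exists N. intros n Hn. specialize (HN n Hn). pose proof (seqz_pos n) as Hs. fold s in HN, Hs.
  unfold d in HN. apply (Rmult_le_compat_l (2 * PI)) in HN; [|lra].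
  match type of HN with (_ <= 2 * PI * (?m / (2 * PI)))%R => replace (2 * PI * (m / (2 * PI)))%R with m in HN by (field; lra) end.
  set (z := s n) in *. set (T := (2 * PI * z)%R) in *. assert (HT0 : (0 < T)%R) by (unfold T; nra).
  assert (M1 : (T <= / 2)%R) by (eapply Rle_trans; [exact HN|]; eapply Rle_trans; [apply Rmin_l|apply Rmin_l]).
  assert (M2 : (T <= / (3 * B + 1))%R) by (eapply Rle_trans; [exact HN|]; eapply Rle_trans; [apply Rmin_l|apply Rmin_r]).
  assert (M3 : (T <= e / (3 * B * Cmod (Cexp Alog) + 1))%R) by (eapply Rle_trans; [exact HN|]; apply Rmin_r).
  assert (M2' : (T * (3 * B + 1) <= 1)%R).
  { apply (Rmult_le_compat_r (3 * B + 1)) in M2; [|lra]. now rewrite Rinv_l in M2 by lra. }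
  apply Rle_div_r in M3; [|auto].
  pose proof (Step z Hs M1) as St. fold T in St. specialize (St ltac:(nra)).
  assert (Cz : RtoC z <> 0) by (apply RtoC_neq; lra). assert (C2z : RtoC (2 * z) <> 0) by (apply RtoC_neq; lra).
  assert (ReR : forall y, Re (RtoC y) = y) by reflexivity.
  assert (Qz : forall y, (0 < y)%R -> Q y = D * Cexp (PI / (12 * K) * (RtoC y - / RtoC y)) / Csqrt (RtoC y) * P y)
    by (intros y Hy; apply HD; rewrite ReR; auto).
  assert (Q1z : forall y, (0 < y)%R -> Q1 y = 1 * Cexp (PI / (12 * RtoC (INR 1)) * (RtoC y - / RtoC y)) / Csqrt (RtoC y) * P1 y)
    by (intros y Hy; apply HD1; rewrite ReR; auto).
  rewrite !Qz, !Q1z in St by lra. rewrite !Rmult_1_l.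
  set (w := D * Cexp (PI / (12 * K) * (RtoC z - / RtoC z)) * Cexp (PI / (12 * RtoC (INR 1)) * (RtoC (2 * z) - / RtoC (2 * z))) * Cexp (PI / (12 * RtoC (INR 1)) * (RtoC (2 * z) - / RtoC (2 * z)))
    / (Csqrt (RtoC z) * Csqrt (RtoC (2 * z)) * Csqrt (RtoC (2 * z)))).
  assert (E2 : Cexp (PI / (12 * K) * (RtoC (2 * z) - / RtoC (2 * z))) * Cexp (PI / (12 * K) * (RtoC (2 * z) - / RtoC (2 * z))) * Cexp (PI / (12 * RtoC (INR 1)) * (RtoC z - / RtoC z))
    = ex n * (Cexp (PI / (12 * K) * (RtoC z - / RtoC z)) * Cexp (PI / (12 * RtoC (INR 1)) * (RtoC (2 * z) - / RtoC (2 * z))) * Cexp (PI / (12 * RtoC (INR 1)) * (RtoC (2 * z) - / RtoC (2 * z))))).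
  { unfold ex. rewrite <- !Cexp_plus. f_equal. unfold c, Rdiv. fold z. rewrite !RtoC_mult, RtoC_minus, !RtoC_inv by lra. fold K. simpl (INR 1). field. split; auto. }
  match type of St with (Cmod ?a <= _ * Cmod ?b)%R =>
    replace a with (w * (D * (ex n * (P (2 * z)%R * P (2 * z)%R * P1 z)) - Cexp Alog * (P z * P1 (2 * z)%R * P1 (2 * z)%R))) in St;
    [replace b with (w * (P z * P1 (2 * z)%R * P1 (2 * z)%R)) in St|] end.
  - assert (Hw : (0 < Cmod w)%R).
    { apply Cmod_gt_0. unfold w, Cdiv. repeat match goal with |- Cexp _ <> _ => apply Cexp_neq_0 | |- Cmult _ _ <> _ => apply Cmult_neq_0 end.
      - intros D0. apply (qpoch_neq_0 ((IZR h + Ci * RtoC z) / K)); [apply im_pos; auto; unfold kn; lia|].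
        change (Q z = 0). rewrite Qz, D0 by auto. unfold Cdiv. ring.
      - match goal with |- / ?u <> _ => set (x := u) end.
        assert (Hx : x <> 0) by (unfold x; apply Cmult_neq_0; [apply Cmult_neq_0|]; apply Csqrt_neq_0).
        intros X0. apply C1_nz. rewrite <- (Cinv_r x Hx), X0. ring. }
    rewrite !(Cmod_mult w) in St. apply Rmult_le_reg_l with (Cmod w); [auto|]. eapply Rle_trans; [exact St|].
    set (x := Cmod (P z * _ * _)). pose proof (Cmod_ge_0 (P z * P1 (2 * z)%R * P1 (2 * z)%R)) as Hx. fold x in Hx.
    replace (3 * (B * T) * Cmod (Cexp Alog) * (Cmod w * x))%R with (Cmod w * ((T * (3 * B * Cmod (Cexp Alog))) * x))%R by ring.
    apply Rmult_le_compat_l; [lra|]. apply Rmult_le_compat_r; [auto|]. nra.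
  - unfold w. field. auto using Csqrt_neq_0.
  - set (e1 := Cexp (PI / (12 * K) * (RtoC (2 * z) - / RtoC (2 * z)))) in *. set (e2 := Cexp (PI / (12 * RtoC (INR 1)) * (RtoC z - / RtoC z))) in *.
    transitivity (D / (Csqrt (RtoC z) * Csqrt (RtoC (2 * z)) * Csqrt (RtoC (2 * z))) *
      (D * (e1 * e1 * e2) * (P (2 * z)%R * P (2 * z)%R * P1 z) - Cexp Alog * (Cexp (PI / (12 * K) * (RtoC z - / RtoC z)) * Cexp (PI / (12 * RtoC (INR 1)) * (RtoC (2 * z) - / RtoC (2 * z))) * Cexp (PI / (12 * RtoC (INR 1)) * (RtoC (2 * z) - / RtoC (2 * z)))) * (P z * P1 (2 * z)%R * P1 (2 * z)%R))).
    + rewrite E2. unfold w. field. auto using Csqrt_neq_0.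
    + field. auto using Csqrt_neq_0. }
assert (Z0 : Cmod (D - Cexp Alog) = 0%R).
{ apply Rle_antisym; [|apply Cmod_ge_0]. apply le_epsilon. intros e He. specialize (Fin e He).
  replace (D * (1 * (1 * 1 * 1)) - Cexp Alog * (1 * 1 * 1)) with (D - Cexp Alog) in Fin by ring.
  replace (1 * 1 * 1) with (RtoC 1) in Fin by ring. rewrite Cmod_1 in Fin. lra. }
apply Cmod_eq_0 in Z0. replace D with (D - Cexp Alog + Cexp Alog) by ring. rewrite Z0. ring.
Qed.
End DedekindConstant.

Theorem eta_transform (h h' g : Z) (kn : nat) (z : C) : (0 < kn)%nat -> (h * h' = -1 + Z.of_nat kn * g)%Z ->
  (Z.Even (Z.of_nat kn) -> Z.Even g) -> (0 < Re z)%R ->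
  qpoch ((IZR h + Ci * z) / RtoC (INR kn)) * omega h (Z.of_nat kn) =
    Cexp (PI / (12 * RtoC (INR kn)) * (z - / z)) / Csqrt z * qpoch ((IZR h' + Ci / z) / RtoC (INR kn)).
Proof.
intros Hkn Hg Hev Hz. destruct kn as [|k0]; [lia|].
destruct (eta_const h h' g (S k0) Hkn Hg Hev) as [D HD].
assert (Do : D * omega h (Z.of_nat (S k0)) = 1).
{ rewrite (eta_constant_omega h h' g k0 Hg D HD). apply (Alog_omega h h' g k0 Hg). }
rewrite HD by auto. transitivity (D * omega h (Z.of_nat (S k0)) * (Cexp (PI / (12 * RtoC (INR (S k0))) * (z - / z)) / Csqrt z * qpoch ((IZR h' + Ci / z) / RtoC (INR (S k0))))).
- unfold Cdiv. ring.
- rewrite Do. ring.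
Qed.

(** * Rank functions as Lerch sums *)

(** (-1)^n q^{3n^2/2 + sn}/sinh(pi i((n + lam) tau - al)). The function N(x;q) corresponds to s = 0,
    lam = 0, al = x, and N(a,b,c;q) to s = s(b,c), lam = b/c, al = a/c. *)
Definition lerch (s : Z) (lam al : R) (tau : C) (n : Z) : C :=
  sgn n * Cexp (PI * Ci * tau * (3 * IZR n * IZR n + 2 * IZR s * IZR n))
  * / Csinh (PI * Ci * (RtoC (IZR n + lam) * tau - RtoC al)).

Lemma Cmod_inv_sinh (u : C) (a : R) : (0 < a)%R -> (a <= Rabs (Re u))%R -> (Cmod (/ Csinh u) <= / sinh a)%R.
Proof.
intros Ha H. pose proof (sinh_pos a Ha). pose proof (Rabs_sinh_le_Cmod u). pose proof (sinh_incr_le _ _ H).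
rewrite Cmod_inv; [apply Rinv_le_contravar; lra|].
intros E. rewrite E, Cmod_0 in *. lra.
Qed.

Lemma lerch_summable (s : Z) (lam al : R) (tau : C) : (0 <= lam < 1)%R -> (0 < Im tau)%R ->
  zsummable (lerch s lam al tau).
Proof.
intros Hl Ht. pose proof PI_RGT_0 as Hpi.
(* For n <> 0 the distance |n + lam| is at least 1 - lam, attained at n = -1. The term n = 0, where
   sinh may be small, enters B with its own value. *)
set (d := (PI * (1 - lam) * Im tau)%R). assert (Hd : (0 < d)%R) by (unfold d; apply Rmult_lt_0_compat; nra).
set (B := (Cmod (/ Csinh (PI * Ci * (RtoC (IZR 0 + lam) * tau - RtoC al))) + / sinh d)%R).
pose proof (Rinv_0_lt_compat _ (sinh_pos d Hd)) as Hi.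
pose proof (Cmod_ge_0 (/ Csinh (PI * Ci * (RtoC (IZR 0 + lam) * tau - RtoC al)))) as H0.
apply (zsummable_gauss _ B (3 * PI * Im tau) (2 * PI * Im tau * Rabs (IZR s))); [nra|unfold B; lra|].
intros n. unfold lerch. rewrite !Cmod_mult, Cmod_sgn, Cmod_Cexp, Rmult_1_l, Rmult_comm.
apply Rmult_le_compat; [apply Cmod_ge_0|left; apply exp_pos| |].
- destruct (Z.eq_dec n 0) as [-> |Hn]; [unfold B; lra|]. unfold B.
  eapply Rle_trans; [apply (Cmod_inv_sinh _ d Hd)|lra].
  replace (Re (PI * Ci * (RtoC (IZR n + lam) * tau - RtoC al))) with (- (PI * Im tau * (IZR n + lam)))%R by (creim; ring).
  rewrite Rabs_Ropp, Rabs_mult, (Rabs_right (PI * Im tau)) by nra. unfold d.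
  replace (PI * (1 - lam) * Im tau)%R with (PI * Im tau * (1 - lam))%R by ring. apply Rmult_le_compat_l; [nra|].
  destruct (Z_lt_le_dec n 0) as [L|L].
  + assert (IZR n <= -1)%R by (apply (IZR_le n (-1)); lia). rewrite Rabs_left1; lra.
  + assert (1 <= IZR n)%R by (apply (IZR_le 1 n); lia). rewrite Rabs_right; lra.
- replace (Re (PI * Ci * tau * (3 * IZR n * IZR n + 2 * IZR s * IZR n))) with
    (- (3 * PI * Im tau) * (IZR n * IZR n) - 2 * PI * Im tau * (IZR s * IZR n))%R by (creim; ring).
  assert (L : (- (3 * PI * Im tau) * (IZR n * IZR n) - 2 * PI * Im tau * (IZR s * IZR n) <=
     - (3 * PI * Im tau) * (IZR n * IZR n) + 2 * PI * Im tau * Rabs (IZR s) * Rabs (IZR n))%R).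
  { rewrite Rmult_assoc with (r3 := Rabs (IZR n)). rewrite <- Rabs_mult. pose proof (Rle_abs (- (IZR s * IZR n))) as Q. rewrite Rabs_Ropp in Q.
    assert (0 < 2 * PI * Im tau)%R by nra. nra. }
  destruct L as [L|L]; [left; now apply exp_increasing|right; now rewrite L].
Qed.

Lemma sgn_nat (n : nat) : RtoC ((-1) ^ n) = sgn (Z.of_nat n).
Proof.
induction n as [|n IH].
- simpl. now rewrite sgn_0.
- simpl pow. rewrite RtoC_mult, IH. replace (Z.of_nat (S n)) with (1 + Z.of_nat n)%Z by lia.
  rewrite sgn_plus, sgn_1. f_equal. apply C_ext; simpl; ring.
Qed.

Lemma sgn_opp (n : Z) : sgn (- n) = sgn n.
Proof.
rewrite <- (sgn_inv (- n)). assert (E : sgn n * sgn (- n) = 1) by (rewrite <- sgn_plus; replace (n + - n)%Z with 0%Z by ring; apply sgn_0).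
replace (sgn n) with (sgn n * sgn (- n) * / sgn (- n)); [rewrite E; ring|]. field. apply Cexp_neq_0.
Qed.

Lemma Csinh_neq_re (u : C) : Re u <> 0%R -> Csinh u <> 0.
Proof.
intros H E. apply Csinh_eq_0 in E as [n E]. apply H. rewrite E. creim. ring.
Qed.

Lemma Csinh_Ci (y : R) : Csinh (Ci * RtoC y) = Ci * RtoC (sin y).
Proof.
rewrite Csinh_eq. replace (- (Ci * RtoC y)) with (Ci * RtoC (- y)) by (rewrite RtoC_opp; ring). rewrite !Cexp_Ci, cos_neg, sin_neg.
apply C_ext; unfold Re, Im; simpl; field.
Qed.

Lemma Cexp_sinh (u : C) : Csinh u <> 0 -> Cexp u / (1 - Cexp u * Cexp u) = - / (2 * Csinh u).
Proof.
intros H. rewrite Csinh_eq in *. rewrite Cexp_opp in *. pose proof (Cexp_neq_0 u) as E. set (e := Cexp u) in *.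
assert (D : 1 - e * e <> 0).
{ intros D. apply H. replace ((e - / e) / 2) with (- (1 - e * e) / (2 * e)) by (field; auto using C2_neq_0). rewrite D. field. auto using C2_neq_0. }
assert (D2 : e * e - 1 <> 0) by (intros D2; apply D; replace (1 - e * e) with (- (e * e - 1)) by ring; rewrite D2; ring).
field. repeat split; auto using C2_neq_0.
Qed.

Lemma cos_Cexp (y : R) : 2 * RtoC (cos y) = Cexp (Ci * RtoC y) + Cexp (- (Ci * RtoC y)).
Proof.
replace (- (Ci * RtoC y)) with (Ci * RtoC (- y)) by (rewrite RtoC_opp; ring). rewrite !Cexp_Ci, cos_neg, sin_neg.
apply C_ext; unfold Re, Im; simpl; field.
Qed.

(** In A = e^{pi i m tau} and b = e^{pi i x} both sides are rational apart from a common
    exponential, and the two sinh factors multiply to the quadratic denominator of N(x;q). They do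
    not vanish because their arguments have nonzero real part. *)
Lemma lerch_pair (x : R) (tau : C) (m : Z) : (0 < Im tau)%R -> (1 <= IZR m)%R ->
  sgn m * (1 + qpow tau (IZR m)) * RtoC (2 - 2 * cos (2 * PI * x))
     / (1 - 2 * qpow tau (IZR m) * RtoC (cos (2 * PI * x)) + qpow tau (2 * IZR m))
     * qpow tau (IZR m * (3 * IZR m + 1) / 2)
  = RtoC (sin (PI * x)) / Ci * (lerch 0 0 x tau m + lerch 0 0 x tau (- m)).
Proof.
intros Ht Hm. pose proof PI_RGT_0 as Hpi.
set (A := Cexp (PI * Ci * IZR m * tau)). set (b := Cexp (Ci * RtoC (PI * x))).
set (E := Cexp (PI * Ci * tau * (3 * IZR m * IZR m))).
assert (HA : A <> 0) by apply Cexp_neq_0. assert (Hb : b <> 0) by apply Cexp_neq_0.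
assert (q1 : qpow tau (IZR m) = A * A) by (unfold qpow, A; rewrite <- Cexp_plus; f_equal; ring).
assert (q2 : qpow tau (2 * IZR m) = A * A * (A * A)) by (unfold qpow, A; rewrite <- !Cexp_plus; f_equal; cpush; ring).
assert (q3 : qpow tau (IZR m * (3 * IZR m + 1) / 2) = E * A).
{ unfold qpow, A, E. rewrite <- !Cexp_plus; f_equal. unfold Rdiv. cpush. rewrite RtoC_inv by lra. field. }
assert (c1 : 2 * RtoC (cos (2 * PI * x)) = b * b + / (b * b)).
{ rewrite cos_Cexp, Cexp_opp. replace (Ci * RtoC (2 * PI * x)) with (Ci * RtoC (PI * x) + Ci * RtoC (PI * x)) by (cpush; ring).
  rewrite Cexp_plus. fold b. reflexivity. }
assert (s1 : Ci * RtoC (sin (PI * x)) = (b - / b) / 2) by (rewrite <- Csinh_Ci, Csinh_eq, Cexp_opp; reflexivity).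
assert (N1 : Csinh (PI * Ci * (RtoC (IZR m + 0) * tau - RtoC x)) <> 0).
{ apply Csinh_neq_re. replace (Re _) with (- (PI * IZR m * Im tau))%R by (creim; ring). assert (0 < PI * IZR m * Im tau)%R by (apply Rmult_lt_0_compat; nra). lra. }
assert (N2 : Csinh (PI * Ci * (RtoC (IZR (- m) + 0) * tau - RtoC x)) <> 0).
{ apply Csinh_neq_re. rewrite opp_IZR. replace (Re _) with (PI * IZR m * Im tau)%R by (creim; ring). assert (0 < PI * IZR m * Im tau)%R by (apply Rmult_lt_0_compat; nra). lra. }
assert (e1 : Csinh (PI * Ci * (RtoC (IZR m + 0) * tau - RtoC x)) = (A / b - b / A) / 2).
{ rewrite Csinh_eq, Cexp_opp. replace (PI * Ci * (RtoC (IZR m + 0) * tau - RtoC x)) with (PI * Ci * IZR m * tau - Ci * RtoC (PI * x)) by (cpush; ring).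
  rewrite Cexp_minus. fold A b. field. auto. }
assert (e2 : Csinh (PI * Ci * (RtoC (IZR (- m) + 0) * tau - RtoC x)) = (/ (A * b) - A * b) / 2).
{ rewrite Csinh_eq, Cexp_opp. replace (PI * Ci * (RtoC (IZR (- m) + 0) * tau - RtoC x)) with (- (PI * Ci * IZR m * tau + Ci * RtoC (PI * x))) by (cpush; ring).
  rewrite Cexp_opp, Cexp_plus. fold A b. field. auto. }
assert (l1 : lerch 0 0 x tau m = sgn m * E / ((A / b - b / A) / 2)).
{ unfold lerch. rewrite e1. replace (PI * Ci * tau * (3 * IZR m * IZR m + 2 * IZR 0 * IZR m)) with (PI * Ci * tau * (3 * IZR m * IZR m)) by ring. reflexivity. }
assert (l2 : lerch 0 0 x tau (- m) = sgn m * E / ((/ (A * b) - A * b) / 2)).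
{ unfold lerch. rewrite e2, sgn_opp. replace (PI * Ci * tau * (3 * IZR (- m) * IZR (- m) + 2 * IZR 0 * IZR (- m))) with (PI * Ci * tau * (3 * IZR m * IZR m)) by (rewrite opp_IZR, RtoC_opp; ring). reflexivity. }
rewrite l1, l2, q1, q2, q3, RtoC_minus, RtoC_mult, c1.
replace (1 - 2 * (A * A) * RtoC (cos (2 * PI * x)) + A * A * (A * A)) with (1 - (A * A) * (2 * RtoC (cos (2 * PI * x))) + A * A * (A * A)) by ring.
rewrite c1.
assert (HCi : Ci <> 0) by (intros X; apply (f_equal Im) in X; simpl in X; lra).
replace (RtoC (sin (PI * x)) / Ci) with (- ((b - / b) / 2)).
2:{ rewrite <- s1. pose proof Ci2 as H2. field [H2]. auto. }
rewrite e1 in N1. rewrite e2 in N2. pose proof C2_neq_0.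
assert (M1 : A * A - b * b <> 0).
{ intros X. apply N1. replace ((A / b - b / A) / 2) with ((A * A - b * b) / (2 * A * b)) by (field; auto). rewrite X. field. auto. }
assert (M2 : 1 - A * A * (b * b) <> 0).
{ intros X. apply N2. replace ((/ (A * b) - A * b) / 2) with ((1 - A * A * (b * b)) / (2 * A * b)) by (field; auto). rewrite X. field. auto. }
assert (M3 : b * b - A * A <> 0) by (intros X; apply M1; replace (A * A - b * b) with (- (b * b - A * A)) by ring; rewrite X; ring).
field. repeat split; auto.
- replace (1 - A * b * (A * b)) with (1 - A * A * (b * b)) by ring. exact M2.
- replace (b * b - A * A * (b * b * (b * b) + 1) + A * A * (A * A) * (b * b)) with ((b * b - A * A) * (1 - A * A * (b * b))) by ring.
  apply Cmult_neq_0; auto.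
Qed.

Lemma rankN_lerch (x : R) (tau L : C) : (0 < Im tau)%R -> sin (PI * x) <> 0%R -> is_zsum (lerch 0 0 x tau) L ->
  rankN x tau = RtoC (sin (PI * x)) / (Ci * qpoch tau) * L.
Proof.
intros Ht Hs HL. pose proof PI_RGT_0 as Hpi. pose proof (qpoch_neq_0 tau Ht) as HQ.
destruct (zsummable_CSeries _ (lerch_summable 0 0 x tau ltac:(lra) Ht)) as (L1 & L2 & L3).
rewrite (is_zsum_unique _ _ _ HL L3). set (u := lerch 0 0 x tau) in *.
set (S1 := CSeries _) in L1. set (S2 := CSeries _) in L2. fold S1 S2.
assert (Cs : RtoC (sin (PI * x)) <> 0) by (apply RtoC_neq; auto).
assert (HCi : Ci <> 0) by (intros E; apply (f_equal Im) in E; simpl in E; lra).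
(* Multiplied by sin(pi x)/i, the term n = 0 becomes the summand 1 of N(x;q). *)
assert (U0 : u 0%Z = - / (Ci * RtoC (sin (PI * x)))).
{ unfold u, lerch. replace (PI * Ci * (RtoC (IZR 0 + 0) * tau - RtoC x)) with (- (Ci * RtoC (PI * x))) by (cpush; ring).
  rewrite Csinh_opp, Csinh_Ci, sgn_0. replace (PI * Ci * tau * (3 * IZR 0 * IZR 0 + 2 * IZR 0 * IZR 0)) with (RtoC 0) by ring.
  rewrite Cexp_0. field. auto. }
assert (L4 : Clim (Csum (fun j => u (Z.of_nat (S j)))) (S1 - u 0%Z)).
{ assert (Q : Clim (fun n => Csum (fun j => u (Z.of_nat j)) (S n) - u 0%Z) (S1 - u 0%Z)).
  { apply Clim_minus; [|apply Clim_const]. apply (Clim_subseq _ _ S); auto. }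
  eapply Clim_ext; [|exact Q]. intros n. cbv beta. rewrite Csum_S_l. simpl (Z.of_nat 0). ring. }
pose proof (Clim_scal (RtoC (sin (PI * x)) / Ci) _ _ (Clim_plus _ _ _ _ L4 L2)) as L5.
assert (E : CSeries (fun j => let n := INR (S j) in
     RtoC ((-1) ^ S j) * (1 + qpow tau n) * RtoC (2 - 2 * cos (2 * PI * x))
     / (1 - 2 * qpow tau n * RtoC (cos (2 * PI * x)) + qpow tau (2 * n))
     * qpow tau (n * (3 * n + 1) / 2)) = RtoC (sin (PI * x)) / Ci * (S1 - u 0%Z + S2)).
{ apply Clim_Clim_seq. apply (Clim_subseq _ _ S) in L5; [|auto]. eapply Clim_ext; [|exact L5]. intros n. cbv beta.
  rewrite sum_n_Csum, <- Csum_plus, <- Csum_scal. apply Csum_ext. intros j _. cbv zeta. rewrite sgn_nat.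
  set (m := Z.of_nat (S j)). rewrite INR_IZR_INZ. fold m.
  assert (Hm : (1 <= IZR m)%R) by (apply (IZR_le 1 m); lia). rewrite (lerch_pair x tau m Ht Hm). fold u. reflexivity. }
transitivity (1 / qpoch tau * (1 + RtoC (sin (PI * x)) / Ci * (S1 - u 0%Z + S2))); [unfold rankN; f_equal; f_equal; exact E|].
rewrite U0. pose proof Ci2 as H2. field [H2]. auto.
Qed.

(** By e^u/(1 - e^{2u}) = -1/(2 sinh u) the first series is the part n >= 0 and the second, with n =
    -m, the part n < 0; hence the opposite signs of s(b,c) in the two. *)
Lemma rankN3_lerch (a b c : Z) (tau L : C) : (0 < Im tau)%R -> (0 < IZR b / IZR c < 1)%R ->
  is_zsum (lerch (s_idx b c) (IZR b / IZR c) (IZR a / IZR c) tau) L ->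
  rankN3 a b c tau = - Ci / (4 * qpoch tau) * L.
Proof.
intros Ht Hl HL. pose proof PI_RGT_0 as Hpi. pose proof (qpoch_neq_0 tau Ht) as HQ.
set (s := s_idx b c) in *.
assert (Hc : IZR c <> 0%R) by (intros E; rewrite E in Hl; unfold Rdiv in Hl; rewrite Rinv_0 in Hl; lra).
assert (Hbc : (IZR b / (2 * IZR c) = IZR b / IZR c / 2)%R) by (field; lra).
set (lam := (IZR b / IZR c)%R) in *. set (al := (IZR a / IZR c)%R) in *.
destruct (zsummable_CSeries _ (lerch_summable s lam al tau ltac:(lra) Ht)) as (L1 & L2 & L3).
rewrite (is_zsum_unique _ _ _ HL L3). set (u := lerch s lam al tau) in *.
set (w := fun n : Z => PI * Ci * (RtoC (IZR n + lam) * tau - RtoC al)).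
assert (Nw : forall n, Csinh (w n) <> 0).
{ intros n. apply Csinh_neq_re. unfold w. replace (Re _) with (- (PI * Im tau * (IZR n + lam)))%R by (creim; ring).
  assert (0 < PI * Im tau)%R by nra. assert (IZR n + lam <> 0)%R.
  { destruct (Z_lt_le_dec n 0) as [N|N]; [assert (IZR n <= -1)%R by (apply (IZR_le n (-1)); lia)|assert (0 <= IZR n)%R by (apply (IZR_le 0 n); lia)]; lra. }
  intros E. apply Ropp_eq_0_compat in E. rewrite Ropp_involutive in E. apply Rmult_integral in E as [E|E]; lra. }
assert (C4 : RtoC 4 <> 0) by (apply RtoC_neq; lra).
assert (E1 : forall m : Z, sgn m * Cexp (- (PI * Ci * RtoC al)) * qpow tau (IZR m / 2 * (3 * IZR m + 1) + IZR m * IZR s + IZR b / (2 * IZR c))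
     / (1 - Cexp (- (2 * PI * Ci * RtoC al)) * qpow tau (IZR m + lam)) = - (/ 2) * u m).
{ intros m. unfold u, lerch. fold (w m). rewrite Hbc.
  replace (Cexp (- (2 * PI * Ci * RtoC al)) * qpow tau (IZR m + lam)) with (Cexp (w m) * Cexp (w m)).
  2:{ unfold qpow, w. rewrite <- !Cexp_plus. f_equal. ring. }
  set (G := PI * Ci * tau * (3 * IZR m * IZR m + 2 * IZR s * IZR m)).
  replace (sgn m * Cexp (- (PI * Ci * RtoC al)) * qpow tau (IZR m / 2 * (3 * IZR m + 1) + IZR m * IZR s + lam / 2))
    with (sgn m * Cexp G * Cexp (w m)).
  2:{ rewrite <- !Cmult_assoc. f_equal. unfold qpow, w, G. rewrite <- !Cexp_plus. f_equal. unfold Rdiv. cpush. rewrite RtoC_inv by lra. field. }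
  transitivity (sgn m * Cexp G * (Cexp (w m) / (1 - Cexp (w m) * Cexp (w m)))); [unfold Cdiv; ring|].
  rewrite Cexp_sinh by auto. field. auto. }
assert (E2 : forall m : Z, sgn m * Cexp (PI * Ci * RtoC al) * qpow tau (IZR m / 2 * (3 * IZR m + 1) - IZR m * IZR s - IZR b / (2 * IZR c))
     / (1 - Cexp (2 * PI * Ci * RtoC al) * qpow tau (IZR m - lam)) = / 2 * u (- m)%Z).
{ intros m. unfold u, lerch. fold (w (- m)%Z). rewrite Hbc. rewrite <- (sgn_opp m).
  replace (Cexp (2 * PI * Ci * RtoC al) * qpow tau (IZR m - lam)) with (Cexp (- w (- m)%Z) * Cexp (- w (- m)%Z)).
  2:{ unfold qpow, w. rewrite <- !Cexp_plus. f_equal. rewrite opp_IZR. cpush. ring. }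
  set (G := PI * Ci * tau * (3 * IZR (- m) * IZR (- m) + 2 * IZR s * IZR (- m))).
  replace (sgn (- m) * Cexp (PI * Ci * RtoC al) * qpow tau (IZR m / 2 * (3 * IZR m + 1) - IZR m * IZR s - lam / 2))
    with (sgn (- m) * Cexp G * Cexp (- w (- m)%Z)).
  2:{ rewrite <- !Cmult_assoc. f_equal. unfold qpow, w, G. rewrite <- !Cexp_plus. f_equal. rewrite opp_IZR. unfold Rdiv. cpush. rewrite RtoC_inv by lra. field. }
  transitivity (sgn (- m) * Cexp G * (Cexp (- w (- m)%Z) / (1 - Cexp (- w (- m)%Z) * Cexp (- w (- m)%Z)))); [unfold Cdiv; ring|].
  assert (Nw' : Csinh (- w (- m)%Z) <> 0).
  { rewrite Csinh_opp. intros X. apply (Nw (- m)%Z). replace (Csinh (w (- m)%Z)) with (- - Csinh (w (- m)%Z)) by ring. rewrite X. ring. }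
  rewrite Cexp_sinh, Csinh_opp by auto. field. auto. }
set (S1 := CSeries _) in L1. set (S2 := CSeries _) in L2. fold S1 S2.
assert (L4 := Clim_scal (- (/ 2)) _ _ L1). assert (L5 := Clim_scal (/ 2) _ _ L2).
transitivity (Ci / (2 * qpoch tau) * (- (/ 2) * S1 - / 2 * S2)); [|field; auto].
unfold rankN3. f_equal. f_equal.
- apply Clim_Clim_seq. apply (Clim_subseq _ _ S) in L4; [|auto]. eapply Clim_ext; [|exact L4]. intros n. cbv beta.
  rewrite sum_n_Csum, <- Csum_scal. apply Csum_ext. intros j _. cbv zeta. rewrite sgn_nat, INR_IZR_INZ. symmetry. apply E1.
- apply Clim_Clim_seq. apply (Clim_subseq _ _ S) in L5; [|auto]. eapply Clim_ext; [|exact L5]. intros n. cbv beta.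
  rewrite sum_n_Csum, <- Csum_scal. apply Csum_ext. intros j _. cbv zeta. rewrite sgn_nat, INR_IZR_INZ. symmetry. apply E2.
Qed.

(** For M = p0 - m the pole has the height kx - M = m + lam and lies in strip r = s + 3m. Inserting
    these turns the argument of sinh into -pi i((m + lam) tau1 - h' x), which makes a Lerch term in
    m; everything independent of m is collected in front. *)
Lemma res2_lerch (h' : Z) (kn : nat) (z : C) (x lam : R) (p0 s m : Z) : (0 < kn)%nat -> (0 < Re z)%R ->
  (INR kn * x = IZR p0 + lam)%R ->
  res2 h' kn z x 1 (p0 - m) (s + 3 * p0 - 3 * (p0 - m)) =
  RtoC (INR kn) / (PI * z) * Ci * sgn p0
  * Cexp (Ci * RtoC (- (3 * PI * IZR h' * INR kn * (x * x)) - 2 * PI * (IZR s - 3 * lam) * (IZR h' * x)))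
  * qpow (tau1 h' kn z) (IZR s * lam - 3 * lam * lam / 2) * lerch s lam (IZR h' * x) (tau1 h' kn z) m.
Proof.
intros Hkn Hz Hp. assert (Hk : (0 < INR kn)%R) by (apply lt_0_INR; auto).
assert (HK : RtoC (INR kn) <> 0) by (apply RtoC_neq; lra).
assert (Hz0 : z <> 0) by (intros E; rewrite E in Hz; simpl in Hz; lra).
assert (HPI : RtoC PI <> 0) by (apply RtoC_neq; pose proof PI_RGT_0; lra).
pose proof (f_equal RtoC Hp) as Hp'. rewrite RtoC_mult, RtoC_plus in Hp'.
assert (Hl : RtoC lam = RtoC (INR kn) * RtoC x - IZR p0) by (rewrite Hp'; ring).
unfold res2. set (K := RtoC (INR kn)) in *.
assert (E1 : Ss h' kn (p0 - m) (- Ci / z * RtoC (INR kn * x - IZR (p0 - m))) =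
  - (PI * Ci * (RtoC (IZR m + lam) * tau1 h' kn z - RtoC (IZR h' * x)))).
{ unfold Ss, tau1. cpush. fold K. rewrite Hl. pose proof Ci2 as H2. field [H2]. auto. }
assert (E2 : Cexp (EX h' kn z (p0 - m) (s + 3 * p0 - 3 * (p0 - m)) (- Ci / z * RtoC (INR kn * x - IZR (p0 - m)))) =
  sgn p0 * sgn m * Cexp (Ci * RtoC (- (3 * PI * IZR h' * INR kn * (x * x)) - 2 * PI * (IZR s - 3 * lam) * (IZR h' * x)))
  * qpow (tau1 h' kn z) (IZR s * lam - 3 * lam * lam / 2) * Cexp (PI * Ci * tau1 h' kn z * (3 * IZR m * IZR m + 2 * IZR s * IZR m))).
{ rewrite <- (sgn_opp m). unfold sgn, qpow. rewrite <- !Cexp_plus. f_equal. unfold EX, tau1. unfold Rdiv. cpush. rewrite RtoC_inv by lra. fold K. rewrite Hl.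
  pose proof Ci2 as H2. field [H2]. auto. }
rewrite E1, E2, Csinh_opp. unfold lerch. set (S := Csinh _).
assert (I : / - S = - / S).
{ replace (- S) with (- (1) * S) by ring. destruct (Ceq_dec S 0) as [-> |HS]; [rewrite Cmult_0_r, Cinv_0; ring|field; auto]. }
rewrite I. generalize (/ S). intros iS. field. auto.
Qed.

Lemma res2_zsum (h' : Z) (kn : nat) (z : C) (x lam : R) (p0 s : Z) (L : C) : (0 < kn)%nat -> (0 < Re z)%R ->
  (INR kn * x = IZR p0 + lam)%R -> is_zsum (lerch s lam (IZR h' * x) (tau1 h' kn z)) L ->
  is_zsum (fun M => res2 h' kn z x 1 M (s + 3 * p0 - 3 * M))
  (RtoC (INR kn) / (PI * z) * Ci * sgn p0
  * Cexp (Ci * RtoC (- (3 * PI * IZR h' * INR kn * (x * x)) - 2 * PI * (IZR s - 3 * lam) * (IZR h' * x)))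
  * qpow (tau1 h' kn z) (IZR s * lam - 3 * lam * lam / 2) * L).
Proof.
intros Hkn Hz Hp HL.
match goal with |- is_zsum _ (?c * L) => pose proof (is_zsum_shift (- p0) _ _ (is_zsum_opp _ _ (is_zsum_scal c _ _ HL))) as Q end.
eapply is_zsum_ext; [|exact Q]. intros M. cbv beta.
rewrite <- (res2_lerch h' kn z x lam p0 s (- (M + - p0)) Hkn Hz Hp). f_equal; ring.
Qed.

(** * Lower bounds for sines and operations on line integrals *)

Lemma sin_le_Cmod_sinh (u : C) : (Rabs (sin (Im u)) <= Cmod (Csinh u))%R.
Proof.
eapply Rle_trans; [|apply im_le_Cmod].
assert (E : Im (Csinh u) = (sin (Im u) * ((exp (Re u) + exp (- Re u)) / 2))%R).
{ rewrite Csinh_eq. replace ((Cexp u - Cexp (- u)) / 2) with (RtoC (/ 2) * (Cexp u - Cexp (- u))) by (rewrite RtoC_inv by lra; field).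
  creim. rewrite !Im_Cexp, !Re_Cexp. creim. rewrite sin_neg. simpl. field. }
rewrite E, Rabs_mult.
assert (P : (exp (Re u) * exp (- Re u) = 1)%R) by (rewrite <- exp_plus, Rplus_opp_r; apply exp_0).
pose proof (exp_pos (Re u)) as P1. pose proof (exp_pos (- Re u)) as P2.
assert (Q : (1 <= (exp (Re u) + exp (- Re u)) / 2)%R).
{ set (a := exp (Re u)) in *. set (b := exp (- Re u)) in *. pose proof (Rle_0_sqr (a - b)) as Sq. unfold Rsqr in Sq. apply Rnot_lt_le. intros L. nra. }
rewrite (Rabs_right ((exp _ + _) / 2)) by lra. pose proof (Rabs_pos (sin (Im u))). nra.
Qed.

Lemma Rabs_sin_le (y : R) : (Rabs (sin y) <= Rabs y)%R.
Proof.
assert (P : forall y, (0 < y)%R -> (Rabs (sin y) <= y)%R).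
{ clear y. intros y Hy. pose proof (sin_lt_x y Hy). apply Rabs_le. split; [|lra].
  destruct (Rle_lt_dec y PI) as [L|L]; [pose proof (sin_ge_0 y); lra|].
  pose proof (SIN_bound y). pose proof PI2_1. lra. }
destruct (Rtotal_order y 0) as [L|[-> |L]].
- rewrite <- (Rabs_Ropp (sin y)), <- sin_neg, (Rabs_left y) by auto. apply P. lra.
- rewrite sin_0. lra.
- rewrite (Rabs_right y) by lra. auto.
Qed.

(** Modulo n the integer m reduces to a residue between 1 and n - 1, and on [PI/n, PI - PI/n] the
    sine is least at the ends. *)
Lemma sin_lower (n m : Z) : (2 <= n)%Z -> ~ (n | m)%Z -> (sin (PI / IZR n) <= Rabs (sin (PI * IZR m / IZR n)))%R.
Proof.
intros Hn Hm. pose proof PI_RGT_0 as Hpi. assert (Hn' : (2 <= IZR n)%R) by (apply (IZR_le 2 n); lia).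
set (r := (m mod n)%Z). assert (Hr : (0 <= r < n)%Z) by (apply Z.mod_pos_bound; lia).
assert (Hr0 : r <> 0%Z) by (intros E; apply Hm; apply Z.mod_divide; auto; lia).
assert (Em : (m = n * (m / n) + r)%Z) by (apply Z.div_mod; lia).
assert (R1 : (1 <= IZR r)%R) by (apply (IZR_le 1 r); lia).
assert (R2 : (IZR r <= IZR n - 1)%R) by (rewrite <- minus_IZR; apply IZR_le; lia).
set (y := (PI * IZR r / IZR n)%R). set (y0 := (PI / IZR n)%R).
assert (Ey : y = (IZR r * y0)%R) by (unfold y, y0; field; lra).
assert (Ep : PI = (IZR n * y0)%R) by (unfold y0; field; lra).
assert (Y0 : (0 < y0)%R) by (apply Rdiv_lt_0_compat; lra).
assert (Y1 : (y0 <= PI / 2)%R) by nra.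
assert (S : (sin y0 <= sin y)%R).
{ destruct (Rle_lt_dec y (PI / 2)) as [L|L].
  - apply sin_incr_1; nra.
  - rewrite <- (sin_PI_x y). apply sin_incr_1; nra. }
assert (A : Rabs (sin (PI * IZR m / IZR n)) = Rabs (sin y)).
{ replace (PI * IZR m / IZR n)%R with (y + PI * IZR (m / n))%R.
  - rewrite sin_plus, sin_PIn, Rmult_0_r, Rplus_0_r, Rabs_mult.
    assert (C1 : (cos (PI * IZR (m / n)) * cos (PI * IZR (m / n)) = 1)%R).
    { pose proof (sin2_cos2 (PI * IZR (m / n))) as Q. rewrite sin_PIn in Q. unfold Rsqr in Q. lra. }
    assert (C2 : Rabs (cos (PI * IZR (m / n))) = 1%R).
    { apply Rsqr_inj; [apply Rabs_pos|lra|]. rewrite <- Rsqr_abs. unfold Rsqr. lra. }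
    rewrite C2. ring.
  - rewrite Em at 2. rewrite plus_IZR, mult_IZR. unfold y. field. lra. }
rewrite A. eapply Rle_trans; [exact S|apply Rle_abs].
Qed.

Lemma Rcont_plus (f g : R -> C) (t : R) : Rcont f t -> Rcont g t -> Rcont (fun s => f s + g s) t.
Proof.
intros Hf Hg e He. destruct (Hf (e / 2)%R ltac:(lra)) as [d1 [D1 H1]]. destruct (Hg (e / 2)%R ltac:(lra)) as [d2 [D2 H2]].
exists (Rmin d1 d2). split; [now apply Rmin_pos|]. intros s Hs. pose proof (Rmin_l d1 d2). pose proof (Rmin_r d1 d2).
replace (f s + g s - (f t + g t)) with ((f s - f t) + (g s - g t)) by ring.
eapply Rle_lt_trans; [apply Cmod_triangle|]. specialize (H1 s ltac:(lra)). specialize (H2 s ltac:(lra)). lra.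
Qed.

Lemma Rcont_neg (f : R -> C) (t : R) : Rcont f (- t) -> Rcont (fun s => f (- s)%R) t.
Proof.
intros Hf e He. destruct (Hf e He) as [d [D H]]. exists d. split; auto. intros s Hs. apply H.
replace (- s - - t)%R with (- (s - t))%R by ring. now rewrite Rabs_Ropp.
Qed.

Lemma Rcont_scal (c : C) (f : R -> C) (t : R) : Rcont f t -> Rcont (fun s => c * f s) t.
Proof.
intros Hf e He. pose proof (Cmod_ge_0 c) as Hc. destruct (Hf (e / (Cmod c + 1))%R) as [d [D H]]; [apply Rdiv_lt_0_compat; lra|].
exists d. split; auto. intros s Hs. specialize (H s Hs). replace (c * f s - c * f t) with (c * (f s - f t)) by ring. rewrite Cmod_mult.
apply Rlt_div_r in H; [|lra]. pose proof (Cmod_ge_0 (f s - f t)). nra.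
Qed.

Lemma is_line_neg (f : R -> C) (l : C) : is_line f l -> is_line (fun t => f (- t)%R) l.
Proof.
intros H e He. destruct (H e He) as [T HT]. exists T. intros a b I Ha Hb HI.
apply (HT (- b)%R (- a)%R I); try lra. apply isCI_neg in HI. eapply isCI_ext; [|exact HI]. intros t. cbv beta. now rewrite Ropp_involutive.
Qed.

(** * The transformation of N(a/c;q) in terms of a Lerch sum *)

Section RankTransform.
Variables (a c h h' g : Z) (kn : nat) (z : C).
Hypothesis (Hac : (0 < a < c)%Z).
Hypothesis (Hc : Z.Odd c).
Hypothesis (Hkn : (0 < kn)%nat).
Hypothesis (Hg : (h * h' = -1 + Z.of_nat kn * g)%Z).
Hypothesis (Hev : Z.Even (Z.of_nat kn) -> Z.Even g).
Hypothesis (Hz : (0 < Re z)%R).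
Let K : C := RtoC (INR kn).
Let x : R := (IZR a / IZR c)%R.
Let Xi (u : C) : C := / Csinh u.

Let Hk : (0 < INR kn)%R. Proof. apply lt_0_INR; auto. Qed.
Let HK : K <> 0. Proof. apply RtoC_neq. pose proof Hk. lra. Qed.
Let Hc0 : (0 < IZR c)%R. Proof. apply (IZR_lt 0 c). lia. Qed.

(** At t = 0 the argument of sinh is pi i m/(6kc) with m = c(6 mu + 2r + 1) - 6ka. As c is odd, m is
    odd, so 6kc does not divide it and the sine is bounded below uniformly. For small |t| the tilt
    caused by Im z costs at most half of that bound; for larger |t| the real part takes over. *)
Lemma line_sinh_lower : exists d : R, (0 < d)%R /\ forall (mu r : Z) (t : R),
  (d <= Cmod (Csinh (PI * Ci * RtoC (IZR (6 * mu + (2 * r + 1)) / (6 * INR kn) - x) - PI * z * RtoC t / RtoC (INR kn))))%R.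
Proof.
pose proof Hk as Hk1. pose proof Hc0 as Hc1. pose proof PI_RGT_0 as Hpi.
set (n := (6 * Z.of_nat kn * c)%Z). assert (Hn : (2 <= n)%Z) by (unfold n; nia).
assert (Hn' : (2 <= IZR n)%R) by (apply (IZR_le 2 n); lia).
set (s0 := sin (PI / IZR n)).
assert (Hs0 : (0 < s0)%R).
{ apply sin_gt_0; [apply Rdiv_lt_0_compat; lra|]. apply Rlt_div_l; [lra|]. nra. }
(* Below this threshold the tilt |pi Im z t/k| is at most s0/2; the summand 1 covers Im z = 0. *)
set (t1 := (s0 * INR kn / (2 * PI * (Rabs (Im z) + 1)))%R).
pose proof (Rabs_pos (Im z)) as Hiz.
assert (Ht1 : (0 < t1)%R) by (apply Rdiv_lt_0_compat; nra).
assert (Ha1 : (0 < PI * Re z * t1 / INR kn)%R).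
{ apply Rdiv_lt_0_compat; auto. apply Rmult_lt_0_compat; auto. nra. }
exists (Rmin (s0 / 2) (sinh (PI * Re z * t1 / INR kn))). split; [apply Rmin_pos; [lra|apply sinh_pos; auto]|].
intros mu r t. set (u := _ - _).
assert (Eu : u = RtoC (- (PI * Re z * t / INR kn)) + Ci * RtoC (PI * IZR (c * (6 * mu + (2 * r + 1)) - 6 * Z.of_nat kn * a) / IZR n - PI * Im z * t / INR kn)).
{ unfold u. assert (En : IZR n = (6 * INR kn * IZR c)%R) by (unfold n; rewrite !mult_IZR, <- INR_IZR_INZ; ring).
  apply C_ext; creim.
  - replace (PI * z * RtoC t / RtoC (INR kn)) with (RtoC (PI * t / INR kn) * z) by (unfold Rdiv; cpush; rewrite RtoC_inv by lra; field; exact HK). creim. field. lra.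
  - replace (PI * z * RtoC t / RtoC (INR kn)) with (RtoC (PI * t / INR kn) * z) by (unfold Rdiv; cpush; rewrite RtoC_inv by lra; field; exact HK). creim.
    rewrite En, minus_IZR, !mult_IZR, <- INR_IZR_INZ. unfold x. field. lra. }
destruct (Rle_lt_dec t1 (Rabs t)) as [L|L].
- eapply Rle_trans; [apply Rmin_r|]. eapply Rle_trans; [|apply Rabs_sinh_le_Cmod]. apply sinh_incr_le.
  replace (Re u) with (- (PI * Re z * t / INR kn))%R by (rewrite Eu; creim; ring).
  rewrite Rabs_Ropp. unfold Rdiv. rewrite !Rabs_mult, (Rabs_right PI), (Rabs_right (Re z)), (Rabs_right (/ INR kn)) by (try lra; left; apply Rinv_0_lt_compat; auto).
  apply Rmult_le_compat_r; [left; apply Rinv_0_lt_compat; auto|]. apply Rmult_le_compat_l; [nra|auto].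
- eapply Rle_trans; [apply Rmin_l|]. eapply Rle_trans; [|apply sin_le_Cmod_sinh].
  replace (Im u) with (PI * IZR (c * (6 * mu + (2 * r + 1)) - 6 * Z.of_nat kn * a) / IZR n - PI * Im z * t / INR kn)%R by (rewrite Eu; creim; ring).
  set (ph := (PI * IZR _ / IZR n)%R). set (d := (PI * Im z * t / INR kn)%R).
  assert (S : (s0 <= Rabs (sin ph))%R).
  { apply sin_lower; auto. intros [q Hq]. unfold n in Hq. destruct Hc as [c' Hc']. lia. }
  assert (D : (Rabs d <= s0 / 2)%R).
  { unfold d, Rdiv. rewrite !Rabs_mult, (Rabs_right PI), (Rabs_right (/ INR kn)) by (try lra; left; apply Rinv_0_lt_compat; auto).
    apply Rmult_le_reg_r with (INR kn); auto. rewrite Rmult_assoc, Rinv_l, Rmult_1_r by lra.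
    assert (E : (t1 * (2 * PI * (Rabs (Im z) + 1)) = s0 * INR kn)%R) by (unfold t1; field; lra).
    assert (PI * Rabs (Im z) * Rabs t <= PI * (Rabs (Im z) + 1) * t1)%R by (apply Rmult_le_compat; pose proof (Rabs_pos t); nra). lra. }
  assert (Lip : (Rabs (sin (ph - d) - sin ph) <= Rabs d)%R).
  { rewrite form4. replace ((ph - d - ph) / 2)%R with (- (d / 2))%R by field.
    rewrite !Rabs_mult, (Rabs_right 2), sin_neg, Rabs_Ropp by lra.
    assert (C1 : (Rabs (cos ((ph - d + ph) / 2)) <= 1)%R) by (apply Rabs_le, COS_bound).
    assert (C2 : (Rabs (sin (d / 2)) <= Rabs (d / 2))%R) by apply Rabs_sin_le.
    unfold Rdiv in C2 at 2. rewrite Rabs_mult, (Rabs_right (/ 2)) in C2 by lra.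
    pose proof (Rabs_pos (cos ((ph - d + ph) / 2))). pose proof (Rabs_pos (sin (d / 2))). nra. }
  pose proof (Rabs_triang_inv (sin ph) (sin ph - sin (ph - d))) as T. rewrite Rabs_minus_sym in Lip.
  replace (sin ph - (sin ph - sin (ph - d)))%R with (sin (ph - d)) in T by ring. lra.
Qed.

Let Xi_per (u : C) : Xi (u + PI * Ci) = - Xi u.
Proof.
unfold Xi. rewrite Csinh_PI. destruct (Ceq_dec (Csinh u) 0) as [E|E].
- rewrite E. replace (- (0)) with (RtoC 0) by ring. rewrite Cinv_0. ring.
- field. auto.
Qed.

Let Xi_holo : HoloOn (fun u => true = true -> forall j : Z, u <> PI * Ci * IZR j) Xi.
Proof.
apply HoloOn_inv; [apply HoloOn_sinh|]. intros u Hu E. apply Csinh_eq_0 in E as [j E]. exact (Hu eq_refl j E).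
Qed.

Let x_not_int : true = true -> forall M : Z, (INR kn * x)%R = IZR M -> ~ (Z.of_nat kn | M)%Z.
Proof.
intros _ M E [t Ht]. pose proof Hk as Hk1. pose proof Hc0 as Hc1.
assert (Q : (a = c * t)%Z).
{ apply eq_IZR. rewrite mult_IZR. apply Rmult_eq_reg_l with (INR kn); [|lra].
  rewrite Ht, mult_IZR, <- INR_IZR_INZ in E. unfold x in E.
  replace (INR kn * IZR a)%R with (INR kn * (IZR a / IZR c) * IZR c)%R by (field; lra). rewrite E. ring. }
clear - Hac Q. destruct (Z_lt_le_dec t 1); nia.
Qed.

Let Xi_big : exists B T : R, (0 <= B)%R /\ (0 < T)%R /\ forall th t : R, (T <= Rabs t)%R ->
  (Cmod (Xi (PI * Ci * RtoC th - PI * z * RtoC t / RtoC (INR kn))%C) <= B * exp (B * Rabs t))%R.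
Proof.
pose proof Hk as Hk1. pose proof PI_RGT_0 as Hpi.
set (s1 := (PI * Re z / INR kn)%R). assert (Hs : (0 < s1)%R) by (apply Rdiv_lt_0_compat; nra).
pose proof (Rinv_0_lt_compat _ (sinh_pos _ Hs)) as HB.
exists (/ sinh s1)%R, 1%R. split; [lra|]. split; [lra|]. intros th t Ht. unfold Xi.
eapply Rle_trans; [apply (Cmod_inv_sinh _ s1 Hs)|].
- replace (PI * Ci * RtoC th - PI * z * RtoC t / RtoC (INR kn)) with (PI * Ci * RtoC th - RtoC (PI * t / INR kn) * z)
    by (unfold Rdiv; cpush; rewrite RtoC_inv by lra; field; exact HK).
  replace (Re (PI * Ci * RtoC th - RtoC (PI * t / INR kn) * z)) with (- (s1 * t))%R by (unfold s1; creim; field; lra).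
  rewrite Rabs_Ropp, Rabs_mult, (Rabs_right s1) by lra. nra.
- assert (1 <= exp (/ sinh s1 * Rabs t))%R.
  { rewrite <- exp_0. destruct (Rle_lt_or_eq_dec 0 (/ sinh s1 * Rabs t)) as [L|<-]; [nra|left; now apply exp_increasing|lra]. }
  nra.
Qed.

Let Xi_line : exists B : R, (0 <= B)%R /\ forall (mu r : Z) (t : R),
  (Cmod (Xi (PI * Ci * RtoC (IZR (6 * mu + (2 * r + 1)) / (6 * INR kn) - x) - PI * z * RtoC t / RtoC (INR kn))%C) <= B * exp (B * Rabs t))%R.
Proof.
destruct line_sinh_lower as [d [Hd H]]. pose proof (Rinv_0_lt_compat _ Hd) as Hi. exists (/ d)%R. split; [lra|]. intros mu r t.
specialize (H mu r t). unfold Xi. set (u := _ - _) in *.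
assert (E : Csinh u <> 0) by (intros E; rewrite E, Cmod_0 in H; lra).
rewrite Cmod_inv by auto.
assert (1 <= exp (/ d * Rabs t))%R.
{ pose proof (Rabs_pos t). rewrite <- exp_0. destruct (Rle_lt_or_eq_dec 0 (/ d * Rabs t)) as [L|<-]; [nra|left; now apply exp_increasing|lra]. }
assert (/ Cmod (Csinh u) <= / d)%R by (apply Rinv_le_contravar; lra). nra.
Qed.

Variable (r0 : Z).
Hypothesis Hr0 : (Rabs (3 * INR kn * x - IZR r0) < / 2)%R.

Let G_cont j t : Rcont (Gint kn z x Xi (2 * j + 1)) t := Gint_cont kn z x Xi true r0 Hkn Hz Xi_holo Hr0 x_not_int j t.
Let M_line j : is_line (Gint kn z x Xi (2 * j + 1)) (Mint kn z x Xi (2 * j + 1)) :=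
  Mint_line kn z x Xi true r0 Hkn Hz Xi_holo Hr0 x_not_int Xi_line j.

Let line_neq (mu r : Z) (t : R) :
  Csinh (PI * Ci * RtoC (IZR (6 * mu + (2 * r + 1)) / (6 * INR kn) - x) - PI * z * RtoC t / RtoC (INR kn)) <> 0.
Proof.
destruct line_sinh_lower as [d [Hd H]]. specialize (H mu r t). intros E. rewrite E, Cmod_0 in H. lra.
Qed.

Lemma sin_PIx : (0 < sin (PI * x))%R.
Proof.
pose proof PI_RGT_0. pose proof Hc0. assert (0 < x < 1)%R.
{ unfold x. split; [apply Rdiv_lt_0_compat; auto; apply (IZR_lt 0 a); lia|]. apply Rlt_div_l; auto. rewrite Rmult_1_l. apply IZR_lt. lia. }
apply sin_gt_0; nra.
Qed.

Lemma Csinh_diff (y b : C) : Csinh (y + b) - Csinh (y - b) = 2 * Ccosh y * Csinh b.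
Proof.
unfold Csinh, Ccosh. replace (- (y + b)) with (- y - b) by ring. replace (- (y - b)) with (- y + b) by ring.
rewrite !Cexp_minus, !Cexp_plus, !Cexp_opp. field. auto using C2_neq_0, Cexp_neq_0.
Qed.

(** The substitution t -> -t in the second integral makes the two arguments y - b and -(y + b), with
    y the argument of H_{a,c} and b = pi i x. Then 1/sinh(y - b) - 1/sinh(y + b) = 2 cosh y sinh
    b/(sinh(y + b) sinh(y - b)). *)
Lemma Mint_pair (i : Z) : Mint kn z x Xi (6 * i - 1) + Mint kn z x Xi (- (6 * i - 1)) =
  2 * Ci * RtoC (sin (PI * x)) * Iint a c (Z.of_nat kn) i z.
Proof.
pose proof Hk as Hk1. pose proof sin_PIx as Hs.
set (S := 2 * Ci * RtoC (sin (PI * x))).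
assert (HS : S <> 0).
{ unfold S. apply Cmult_neq_0; [apply Cmult_neq_0; [apply C2_neq_0|]|apply RtoC_neq; lra]. intros X; apply (f_equal Im) in X; simpl in X; lra. }
set (Jf := fun t : R => Cexp (- (3 * PI * z * RtoC (t ^ 2) / IZR (Z.of_nat kn)))
    * Hfun a c (PI * Ci * IZR i / IZR (Z.of_nat kn) - PI * Ci / (6 * IZR (Z.of_nat kn)) - PI * z * RtoC t / IZR (Z.of_nat kn))).
set (G1 := Gint kn z x Xi (6 * i - 1)). set (G2 := fun t => Gint kn z x Xi (- (6 * i - 1)) (- t)%R).
assert (E1 : (6 * i - 1 = 2 * (3 * i - 1) + 1)%Z) by ring.
assert (E2 : (- (6 * i - 1) = 2 * (- 3 * i) + 1)%Z) by ring.
assert (C1 : forall t, Rcont G1 t) by (intros t; unfold G1; rewrite E1; apply G_cont).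
assert (C2 : forall t, Rcont G2 t) by (intros t; unfold G2; rewrite E2; apply (Rcont_neg _ _ (G_cont _ _))).
assert (L1 : is_line G1 (Mint kn z x Xi (6 * i - 1))) by (unfold G1; rewrite E1; apply M_line).
assert (L2 : is_line G2 (Mint kn z x Xi (- (6 * i - 1)))) by (unfold G2; rewrite E2; apply (is_line_neg _ _ (M_line _))).
assert (EJ : forall t, / S * (G1 t + G2 t) = Jf t).
{ intros t. unfold G1, G2, Gint, Jf, Hfun, Xi. rewrite <- INR_IZR_INZ. fold K.
  set (y := PI * Ci * IZR i / K - PI * Ci / (6 * K) - PI * z * RtoC t / K).
  fold x. set (b := PI * Ci * RtoC x).
  assert (A1 : PI * Ci * RtoC (IZR (6 * i - 1) / (6 * INR kn) - x) - PI * z * RtoC t / K = y - b).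
  { unfold y, b, Rdiv. cpush. rewrite RtoC_inv, RtoC_mult by lra. fold K. field. auto. }
  assert (A2 : PI * Ci * RtoC (IZR (- (6 * i - 1)) / (6 * INR kn) - x) - PI * z * RtoC (- t) / K = - (y + b)).
  { unfold y, b, Rdiv. cpush. rewrite RtoC_inv, RtoC_mult by lra. fold K. field. auto. }
  pose proof (line_neq i (-1) t) as N1. replace (6 * i + (2 * -1 + 1))%Z with (6 * i - 1)%Z in N1 by ring. fold K in N1. rewrite A1 in N1.
  pose proof (line_neq (- i) 0 (- t)) as N2. replace (6 * - i + (2 * 0 + 1))%Z with (- (6 * i - 1))%Z in N2 by ring. fold K in N2. rewrite A2, Csinh_opp in N2.
  rewrite A1, A2, Csinh_opp. pose proof (Csinh_diff y b) as D.
  assert (Sb : 2 * Csinh b = S).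
  { unfold S, b. replace (PI * Ci * RtoC x) with (Ci * RtoC (PI * x)) by (cpush; ring). rewrite Csinh_Ci. ring. }
  assert (N2' : Csinh (y + b) <> 0) by (intros X; apply N2; rewrite X; ring).
  replace (3 * PI * z * RtoC (- t) * RtoC (- t) / K) with (3 * PI * z * RtoC t * RtoC t / K) by (rewrite RtoC_opp; field; auto).
  replace (RtoC (t ^ 2)) with (RtoC t * RtoC t) by (rewrite <- RtoC_mult; f_equal; ring).
  replace (3 * PI * z * (RtoC t * RtoC t) / K) with (3 * PI * z * RtoC t * RtoC t / K) by (field; auto).
  set (E := Cexp _). replace (/ Csinh (y - b)) with (Csinh (y + b) / (Csinh (y + b) * Csinh (y - b))) by (field; auto).
  replace (/ - Csinh (y + b)) with (- Csinh (y - b) / (Csinh (y + b) * Csinh (y - b))) by (field; auto).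
  transitivity (/ S * E * ((Csinh (y + b) - Csinh (y - b)) / (Csinh (y + b) * Csinh (y - b)))); [unfold Cdiv; ring|].
  rewrite D. replace (2 * Ccosh y * Csinh b) with (S * Ccosh y) by (rewrite <- Sb; ring). field. auto. }
assert (CJ : forall t, Rcont Jf t).
{ intros t e He. destruct (Rcont_scal (/ S) _ _ (Rcont_plus _ _ t (C1 t) (C2 t)) e He) as [d [Hd Q]]. exists d. split; auto.
  intros s Hsd. rewrite <- !EJ. auto. }
pose proof (is_line_ext _ _ _ EJ (is_line_scal (/ S) _ _ (fun t => Rcont_plus _ _ t (C1 t) (C2 t)) (is_line_plus _ _ _ _ C1 C2 L1 L2))) as LJ.
unfold Iint. fold Jf. rewrite (is_line_CInt _ _ CJ LJ). field. auto.
Qed.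

Let wterm (d i : Z) : C := Cexp (PI * Ci * IZR i - PI * Ci * IZR h' * (3 * IZR i * IZR i + IZR d * IZR i) / K) * Mint kn z x Xi (6 * i + d).

(** Passing from mu to -mu permutes the residues and turns the index 6 mu + 1 into -(6 mu - 1), the
    partner in [Mint_pair] of the term for d = -1. *)
Lemma Wsum_reflect : Wsum h' kn z x Xi 1 = Csum (fun i => wterm 1 (- Z.of_nat i)) kn.
Proof.
pose proof Hk as Hk1.
assert (P : forall n, wterm 1 (n + Z.of_nat kn) = wterm 1 n).
{ intros n. unfold wterm. replace (6 * (n + Z.of_nat kn) + 1)%Z with (2 * (3 * n) + 1 + 6 * Z.of_nat kn)%Z by ring.
  rewrite (Mint_per kn z x Xi true r0 Hkn Hz Xi_per Xi_holo Hr0 x_not_int Xi_line).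
  replace (2 * (3 * n) + 1)%Z with (6 * n + 1)%Z by ring.
  set (M := Mint _ _ _ _ _).
  destruct (parity_h' h h' g kn Hkn Hg Hev) as [j Hj].
  assert (Hj' : 2 * RtoC (IZR j) = (K + 1) * (IZR h' + 1)).
  { apply (f_equal IZR) in Hj. apply (f_equal RtoC) in Hj. rewrite !mult_IZR, !plus_IZR, <- INR_IZR_INZ in Hj.
    rewrite !RtoC_mult, !RtoC_plus in Hj. fold K in Hj. symmetry. exact Hj. }
  assert (E : Cexp (PI * Ci * IZR (n + Z.of_nat kn) - PI * Ci * IZR h' * (3 * IZR (n + Z.of_nat kn) * IZR (n + Z.of_nat kn) + IZR 1 * IZR (n + Z.of_nat kn)) / K + PI * Ci)
    = Cexp (PI * Ci * IZR n - PI * Ci * IZR h' * (3 * IZR n * IZR n + IZR 1 * IZR n) / K)).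
  { apply (Cexp_eq (j - h' - 2 * Z.of_nat kn * h' - 3 * h' * n)). rewrite plus_IZR, !minus_IZR, !mult_IZR, <- INR_IZR_INZ.
    cpush. fold K. replace (2 * PI * Ci * (RtoC (IZR j) - IZR h' - 2 * K * IZR h' - 3 * IZR h' * IZR n)) with
      (PI * Ci * (2 * RtoC (IZR j) - 2 * (IZR h' + 2 * K * IZR h' + 3 * IZR h' * IZR n))) by ring. rewrite Hj'. field. auto. }
  rewrite <- E, (Cexp_plus _ (PI * Ci)), Cexp_PI. ring. }
change (Wsum h' kn z x Xi 1) with (Csum (fun i => wterm 1 (Z.of_nat i)) kn).
(* The shift by 1 - k moves the range to 1 - k, ..., 0, and reversal makes it 0, -1, ..., 1 - k. *)
rewrite <- (Csum_periodic (wterm 1) kn (1 - Z.of_nat kn) P), Csum_rev. apply Csum_ext. intros i Hi. f_equal. lia.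
Qed.

Lemma Wsum_pair : Wsum h' kn z x Xi (-1) + Wsum h' kn z x Xi 1 =
  2 * Ci * RtoC (sin (PI * x)) * Csum (fun i => Cexp (PI * Ci * IZR (Z.of_nat i) + Ci * RtoC (- (3 * PI * IZR h' * IZR (Z.of_nat i) ^ 2 / INR kn) + PI * IZR h' * IZR (Z.of_nat i) / INR kn))
    * Iint a c (Z.of_nat kn) (Z.of_nat i) z) kn.
Proof.
pose proof Hk as Hk1.
rewrite Wsum_reflect. change (Wsum h' kn z x Xi (-1)) with (Csum (fun i => wterm (-1) (Z.of_nat i)) kn).
rewrite <- Csum_plus, <- Csum_scal. apply Csum_ext. intros j _. set (i := Z.of_nat j).
set (P := Cexp (PI * Ci * IZR i + _)).
transitivity (P * (Mint kn z x Xi (6 * i - 1) + Mint kn z x Xi (- (6 * i - 1)))); [|rewrite Mint_pair; ring].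
assert (E1 : Cexp (PI * Ci * IZR i - PI * Ci * IZR h' * (3 * IZR i * IZR i + IZR (-1) * IZR i) / K) = P).
{ unfold P. f_equal. simpl pow. unfold Rdiv. cpush. rewrite RtoC_inv by lra. fold K. change (IZR (-1)) with (- (1))%R. rewrite RtoC_opp. field. auto. }
assert (E2 : Cexp (PI * Ci * IZR (- i) - PI * Ci * IZR h' * (3 * IZR (- i) * IZR (- i) + IZR 1 * IZR (- i)) / K) = P).
{ rewrite <- E1. apply (Cexp_eq (- i)). change (IZR (-1)) with (- (1))%R. cpush. field. auto. }
unfold wterm. rewrite E1, E2. replace (6 * i + -1)%Z with (6 * i - 1)%Z by ring. replace (6 * - i + 1)%Z with (- (6 * i - 1))%Z by ring. ring.
Qed.

Lemma lerch_rank (lam : R) (p0 s : Z) (L L1 : C) : (INR kn * x = IZR p0 + lam)%R -> r0 = (s + 3 * p0)%Z ->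
  is_zsum (lerch 0 0 x ((IZR h + Ci * z) / K)) L -> is_zsum (lerch s lam (IZR h' * x) (tau1 h' kn z)) L1 ->
  K * L + PI * (K / (PI * z) * Ci * sgn p0
  * Cexp (Ci * RtoC (- (3 * PI * IZR h' * INR kn * (x * x)) - 2 * PI * (IZR s - 3 * lam) * (IZR h' * x)))
  * qpow (tau1 h' kn z) (IZR s * lam - 3 * lam * lam / 2) * L1) =
  Cexp (- (PI / (12 * K * z))) * qpoch (tau1 h' kn z) *
  (2 * Ci * RtoC (sin (PI * x)) * Csum (fun i => Cexp (PI * Ci * IZR (Z.of_nat i) + Ci * RtoC (- (3 * PI * IZR h' * IZR (Z.of_nat i) ^ 2 / INR kn) + PI * IZR h' * IZR (Z.of_nat i) / INR kn))
    * Iint a c (Z.of_nat kn) (Z.of_nat i) z) kn).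
Proof.
intros Hp Hr HL HL1. rewrite <- Wsum_pair. unfold K.
apply (lerch_transform h h' g kn z x Xi 1 true r0 Hkn Hg Hev Hz Xi_per Xi_holo PoleAt_inv_sinh_0 ltac:(discriminate) Hr0 x_not_int Xi_big Xi_line).
- eapply is_zsum_ext; [|exact HL]. intros n. unfold lerch, Tn, Xi, sgn. rewrite <- Cexp_plus. f_equal.
  + f_equal. cpush. fold K. ring.
  + f_equal. f_equal. rewrite Rplus_0_r. fold K. ring.
- rewrite Hr. apply res2_zsum; auto.
- apply pentagonal. apply Im_tau1_pos; auto.
Qed.

(** [lerch_rank] is solved for the Lerch sum L, and (q)_oo is eliminated with [eta_transform]. As
    1/(q)_oo is z^{1/2}/(q_1)_oo up to exponentials and [omega], the residue term, which carries
    1/z, obtains z^{-1/2}, while the Mordell term obtains z^{1/2} and loses its factor (q_1)_oo. *)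
Lemma rank_transform (lam : R) (p0 s : Z) (L1 : C) : (INR kn * x = IZR p0 + lam)%R -> r0 = (s + 3 * p0)%Z ->
  is_zsum (lerch s lam (IZR h' * x) (tau1 h' kn z)) L1 ->
  rankN x ((IZR h + Ci * z) / K) =
  - (RtoC (sin (PI * x)) * omega h (Z.of_nat kn) / (Csqrt z * qpoch (tau1 h' kn z)) * sgn p0
  * Cexp (Ci * RtoC (- (3 * PI * IZR h' * INR kn * (x * x)) - 2 * PI * (IZR s - 3 * lam) * (IZR h' * x)))
  * qpow (tau1 h' kn z) (IZR s * lam - 3 * lam * lam / 2) * Cexp (PI / (12 * K) * (/ z - z)) * L1)
  + 2 * RtoC (sin (PI * x)) * RtoC (sin (PI * x)) * omega h (Z.of_nat kn) / K * Cexp (- (PI * z / (12 * K))) * Csqrt z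
  * Csum (fun i => Cexp (PI * Ci * IZR (Z.of_nat i) + Ci * RtoC (- (3 * PI * IZR h' * IZR (Z.of_nat i) ^ 2 / INR kn) + PI * IZR h' * IZR (Z.of_nat i) / INR kn))
    * Iint a c (Z.of_nat kn) (Z.of_nat i) z) kn.
Proof.
intros Hp Hr HL1. pose proof Hk as Hk1. pose proof sin_PIx as Hs.
set (tau := (IZR h + Ci * z) / K).
assert (Ht : (0 < Im tau)%R).
{ unfold tau. replace ((IZR h + Ci * z) / K) with (RtoC (IZR h / INR kn) + Ci * (RtoC (/ INR kn) * z)).
  - creim. assert (0 < / INR kn)%R by (apply Rinv_0_lt_compat; auto). nra.
  - unfold Rdiv. cpush. rewrite RtoC_inv by lra. fold K. field. auto. }
destruct (zsummable_CSeries _ (lerch_summable 0 0 x tau ltac:(lra) Ht)) as (_ & _ & HL).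
set (L := _ + _) in HL. clearbody L.
rewrite (rankN_lerch x tau L Ht ltac:(lra) HL).
pose proof (lerch_rank lam p0 s L L1 Hp Hr HL HL1) as T.
pose proof (eta_transform h h' g kn z Hkn Hg Hev Hz) as E. fold K tau in E. change ((IZR h' + Ci / z) / K) with (tau1 h' kn z) in E.
pose proof (qpoch_neq_0 tau Ht) as NQ. pose proof (qpoch_neq_0 _ (Im_tau1_pos h' kn z Hkn Hz)) as NQ1.
pose proof (Csqrt_sqr z Hz) as Hsq. pose proof (Csqrt_neq_0 z) as Nr.
assert (Nom : omega h (Z.of_nat kn) <> 0) by apply Cexp_neq_0.
assert (E1 : Cexp (PI / (12 * K) * (/ z - z)) = / Cexp (PI / (12 * K) * (z - / z))) by (rewrite <- Cexp_opp; f_equal; ring).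
assert (Hz0 : z <> 0) by (intros X; pose proof Hz as Hz2; rewrite X in Hz2; simpl in Hz2; lra).
assert (E2 : Cexp (- (PI / (12 * K * z))) = Cexp (- (PI * z / (12 * K))) * Cexp (PI / (12 * K) * (z - / z))).
{ rewrite <- Cexp_plus. f_equal. field. auto. }
rewrite E1. rewrite E2 in T. pose proof (Cexp_neq_0 (PI / (12 * K) * (z - / z))) as Ne.
assert (HCi : Ci <> 0) by (intros X; apply (f_equal Im) in X; simpl in X; lra).
assert (HPI : RtoC PI <> 0) by (apply RtoC_neq; pose proof PI_RGT_0; lra).
set (Q1 := qpoch (tau1 h' kn z)) in *. set (Q := qpoch tau) in *. set (om := omega _ _) in *. set (sn := RtoC (sin (PI * x))) in *.
set (e1 := Cexp (PI / (12 * K) * (z - / z))) in *. set (e2 := Cexp (- (PI * z / (12 * K)))) in *. set (Sg := Csum _ kn) in *.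
set (r := Csqrt z) in *. set (X1 := qpow _ _) in *. set (ph := Cexp (Ci * _)) in *. set (sg0 := sgn p0) in *.
clearbody Q1 Q om sn e1 e2 Sg r X1 ph sg0 tau.
assert (EL : L = (e2 * e1 * Q1 * (2 * Ci * sn * Sg) - K / z * Ci * sg0 * ph * X1 * L1) / K).
{ replace L with ((K * L + PI * (K / (PI * z) * Ci * sg0 * ph * X1 * L1) - K / z * Ci * sg0 * ph * X1 * L1) / K) by (field; auto). rewrite T. reflexivity. }
assert (EQ : Q = e1 * Q1 / (r * om)).
{ replace Q with (Q * om / om) by (field; auto). rewrite E. field. auto. }
rewrite EL, EQ, <- Hsq. pose proof Ci2 as H2. field [H2]. repeat split; auto.
Qed.
End RankTransform.

(** * The two cases *)

Lemma sgn_even (m n : Z) : Z.Even (m - n) -> sgn m = sgn n.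
Proof. intros [t Ht]. replace m with (n + (t + t))%Z by lia. rewrite !sgn_plus, sgn_sqr. ring. Qed.

Lemma powerRZ_sgn (n : Z) : RtoC (powerRZ (-1) n) = sgn n.
Proof.
destruct n as [|p|p]; cbn [powerRZ].
- symmetry. apply sgn_0.
- rewrite sgn_nat. f_equal. lia.
- rewrite RtoC_inv by (apply pow_nonzero; lra). rewrite sgn_nat, sgn_inv, <- sgn_opp. f_equal. lia.
Qed.

(** The thresholds 1/6, 1/2, 5/6 are the points where 3l/c is half an odd integer, so s(l,c) is the
    integer nearest to 3l/c; an odd c excludes ties. *)
Lemma s_idx_near (l c : Z) : (0 < l < c)%Z -> Z.Odd c -> (Rabs (3 * (IZR l / IZR c) - IZR (s_idx l c)) < / 2)%R.
Proof.
intros Hl Hc. assert (C0 : (0 < IZR c)%R) by (apply (IZR_lt 0 c); lia).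
assert (D : forall p q : Z, (IZR l / IZR c = IZR p / IZR q)%R -> (0 < q)%Z -> (l * q = p * c)%Z).
{ intros p q E Hq. apply eq_IZR. rewrite !mult_IZR. assert (0 < IZR q)%R by (apply (IZR_lt 0 q); lia).
  replace (IZR l * IZR q)%R with (IZR l / IZR c * (IZR c * IZR q))%R by (field; lra). rewrite E. field. lra. }
destruct Hc as [c' Hc'].
assert (N1 : (IZR l / IZR c <> 1 / 6)%R) by (intros E; apply (D 1%Z 6%Z) in E; lia).
assert (N2 : (IZR l / IZR c <> 1 / 2)%R) by (intros E; apply (D 1%Z 2%Z) in E; lia).
assert (N3 : (IZR l / IZR c <> 5 / 6)%R) by (intros E; apply (D 5%Z 6%Z) in E; lia).
assert (P0 : (0 < IZR l / IZR c)%R) by (apply Rdiv_lt_0_compat; auto; apply (IZR_lt 0 l); lia).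
assert (P1 : (IZR l / IZR c < 1)%R) by (apply Rlt_div_l; auto; rewrite Rmult_1_l; apply IZR_lt; lia).
unfold s_idx. set (y := (IZR l / IZR c)%R) in *. 
destruct (Rlt_dec y (1 / 6)); [apply Rabs_def1; simpl; lra|].
destruct (Rlt_dec y (1 / 2)); [apply Rabs_def1; simpl; lra|].
destruct (Rlt_dec y (5 / 6)); apply Rabs_def1; simpl; lra.
Qed.

Theorem theorem3 (a c h k h' : Z) (z : C)
  (Hac : (0 < a < c)%Z) (Hac1 : Z.gcd a c = 1%Z) (Hc : Z.Odd c)
  (Hk : (1 <= k)%Z) (Hhk : Z.gcd h k = 1%Z)
  (Hz : (0 < Re z)%R)
  (Hh'_odd : Z.Odd k -> (k | h * h' - (-1))%Z)
  (Hh'_even : Z.Even k -> (2 * k | h * h' - (-1))%Z) :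
  let tau : C := (h + Ci * z) / k in
  let tau1 : C := (h' + Ci / z) / k in
  let k1 : Z := (k / Z.gcd k c)%Z in
  let c1 : Z := (c / Z.gcd k c)%Z in
  let mordell_part : C :=
    RtoC (2 * (sin (PI * a / c)) ^ 2) * omega h k / k
    * Cexp (- (PI * z / (12 * k))) * Csqrt z
    * sum_n (fun n : nat => let nu := Z.of_nat n in
        RtoC (powerRZ (-1) nu)
        * Cexp (Ci * RtoC (- (3 * PI * h' * nu ^ 2 / k) + PI * h' * nu / k))
        * Iint a c k nu z) (Z.to_nat (k - 1)) in
  ((c | k)%Z ->
     rankN (a / c) tau =
       RtoC (powerRZ (-1) (a * k + 1)) * Ci * RtoC (sin (PI * a / c)) * omega h k
       / (RtoC (sin (PI * a * h' / c)) * Csqrt z)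
       * Cexp (Ci * RtoC (- (3 * PI * a ^ 2 * k1 * h' / c)))
       * Cexp (PI / (12 * k) * (/ z - z))
       * rankN (a * h' / c) tau1
       + mordell_part)
  /\
  (~ (c | k)%Z ->
   forall l : Z, (0 < l < c1)%Z -> (c1 | l - a * k1)%Z ->
     let s : Z := s_idx l c1 in
     rankN (a / c) tau =
       4 * Ci * RtoC (powerRZ (-1) (a * k + l + 1)) * RtoC (sin (PI * a / c))
       * omega h k / Csqrt z
       * Cexp (Ci * RtoC (- (2 * PI * h' * s * a / c)
                          - 3 * PI * a ^ 2 * h' * k1 / (c * c1)
                          + 6 * PI * h' * l * a / (c * c1)))
       * qpow tau1 (s * l / c1 - 3 * l ^ 2 / (2 * c1 ^ 2))
       * Cexp (PI / (12 * k) * (/ z - z))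
       * rankN3 (a * h') (l * c / c1) c tau1
       + mordell_part).
Proof.
intros tau t1 k1 c1 mp.
set (kn := Z.to_nat k). assert (Ek : Z.of_nat kn = k) by (unfold kn; lia).
assert (Hkn : (0 < kn)%nat) by (unfold kn; lia).
assert (EK : INR kn = IZR k) by (rewrite INR_IZR_INZ; now rewrite Ek).
assert (k0 : (0 < IZR k)%R) by (apply (IZR_lt 0 k); lia). assert (c0 : (0 < IZR c)%R) by (apply (IZR_lt 0 c); lia).
(* g is the quotient in h h' + 1 = k g; for even k the congruence modulo 2k makes it even. *)
assert (Hg : exists g, (h * h' = -1 + Z.of_nat kn * g)%Z /\ (Z.Even (Z.of_nat kn) -> Z.Even g)).
{ rewrite Ek. destruct (Z.Even_or_Odd k) as [E|O].
  - destruct (Hh'_even E) as [t Ht]. exists (2 * t)%Z. split; [lia|]. intros _. now exists t.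
  - destruct (Hh'_odd O) as [t Ht]. exists t. split; [lia|]. intros E. exfalso. destruct E as [e E], O as [o O]. lia. }
destruct Hg as [g [Hg Hev]].
set (y := (IZR a / IZR c)%R).
pose proof (rank_transform a c h h' g kn z Hac Hc Hkn Hg Hev Hz) as RT. cbv zeta in RT. fold y in RT.
assert (Esin : sin (PI * IZR a / IZR c) = sin (PI * y)) by (f_equal; unfold y; field; lra).
assert (Et : tau = (IZR h + Ci * z) / RtoC (INR kn)) by (rewrite EK; reflexivity).
assert (Et1 : t1 = tau1 h' kn z) by (unfold tau1; rewrite EK; reflexivity).
assert (Emp : mp = 2 * RtoC (sin (PI * y)) * RtoC (sin (PI * y)) * omega h (Z.of_nat kn) / RtoC (INR kn) * Cexp (- (PI * z / (12 * RtoC (INR kn)))) * Csqrt z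
  * Csum (fun i => Cexp (PI * Ci * IZR (Z.of_nat i) + Ci * RtoC (- (3 * PI * IZR h' * IZR (Z.of_nat i) ^ 2 / INR kn) + PI * IZR h' * IZR (Z.of_nat i) / INR kn))
    * Iint a c (Z.of_nat kn) (Z.of_nat i) z) kn).
{ unfold mp. rewrite sum_n_Csum. replace (S (Z.to_nat (k - 1))) with kn by (unfold kn; lia). rewrite Esin, EK, Ek. f_equal.
  - f_equal. f_equal. f_equal. f_equal. simpl pow. cpush. ring.
  - apply Csum_ext. intros i _. cbv zeta. rewrite powerRZ_sgn. unfold sgn. rewrite <- Cexp_plus. reflexivity. }
assert (Him1 : (0 < Im t1)%R) by (rewrite Et1; apply Im_tau1_pos; auto).
clearbody mp tau. subst tau mp. rewrite <- !Et1 in RT.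
split.
- intros Hck.
  assert (Eg : Z.gcd k c = c) by (rewrite Z.gcd_comm; apply Z.divide_gcd_iff in Hck; lia).
  assert (Ek1 : (k = k1 * c)%Z) by (unfold k1; rewrite Eg; destruct Hck as [q Hq]; rewrite Hq, Z.div_mul by lia; ring).
  clearbody k1. clear c1 Eg Hck.
  assert (EkR : IZR k = (IZR k1 * IZR c)%R) by (rewrite Ek1 at 1; apply mult_IZR).
  (* kx is an integer here, so lam = 0 and s = 0: the pole lines have integral heights, and one of
     them is the real line. *)
  assert (Hp : (INR kn * y = IZR (k1 * a) + 0)%R) by (rewrite EK, EkR, mult_IZR; unfold y; field; lra).
  assert (Hr0 : (Rabs (3 * INR kn * y - IZR (0 + 3 * (k1 * a))) < / 2)%R).
  { replace (3 * INR kn * y - IZR (0 + 3 * (k1 * a)))%R with 0%R; [rewrite Rabs_R0; lra|].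
    rewrite Z.add_0_l, mult_IZR. rewrite Rmult_assoc, Hp. ring. }
  destruct (zsummable_CSeries _ (lerch_summable 0 0 (IZR h' * y) t1 ltac:(lra) Him1)) as (_ & _ & HL).
  set (L1 := _ + _) in HL. clearbody L1.
  rewrite (RT _ Hr0 0%R (k1 * a)%Z 0%Z L1 Hp eq_refl HL). f_equal.
  assert (Eax : (IZR a * IZR h' / IZR c = IZR h' * y)%R) by (unfold y; field; lra).
  assert (Esx : sin (PI * IZR a * IZR h' / IZR c) = sin (PI * (IZR h' * y))) by (f_equal; unfold y; field; lra).
  (* A zero would mean that c divides a h', hence h'; with c | k and h h' = -1 modulo k this forces
     c | 1, whereas c > a > 0. *)
  assert (Ns : sin (PI * (IZR h' * y)) <> 0%R).
  { intros E. apply sin_eq_0_0 in E as [t Et']. assert (Q : (a * h' = t * c)%Z).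
    { apply eq_IZR. rewrite !mult_IZR. apply Rmult_eq_reg_l with PI; [|pose proof PI_RGT_0; lra].
      replace (PI * (IZR a * IZR h'))%R with (PI * (IZR h' * y) * IZR c)%R by (unfold y; field; lra). rewrite Et'. ring. }
    assert (D : (c | h')%Z) by (apply Gauss with a; [exists t; lia|apply Zgcd_1_rel_prime; rewrite Z.gcd_comm; auto]).
    rewrite Ek in Hg. destruct D as [q ->]. assert (D1 : (c | 1)%Z) by (exists (k1 * g - h * q)%Z; rewrite Ek1 in Hg; lia).
    apply Z.divide_1_r in D1. lia. }
  rewrite Eax, (rankN_lerch _ _ _ Him1 Ns HL), Esx, Esin, Ek.
  (* k = k1 c with c odd, so a k and k1 a have the same parity. *)
  assert (Esg : RtoC (powerRZ (-1) (a * k + 1)) = - sgn (k1 * a)).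
  { rewrite powerRZ_sgn, sgn_plus, sgn_1. rewrite (sgn_even (a * k) (k1 * a)); [ring|].
    destruct Hc as [c' ->]. exists (a * k1 * c')%Z. rewrite Ek1. ring. }
  rewrite Esg, EK.
  assert (Eq0 : qpow t1 (0 * 0 - 3 * 0 * 0 / 2) = 1).
  { unfold qpow. replace (0 * 0 - 3 * 0 * 0 / 2)%R with 0%R by field. rewrite Cmult_0_r, Cmult_0_l. apply Cexp_0. }
  rewrite Eq0.
  replace (- (3 * PI * IZR h' * IZR k * (y * y)) - 2 * PI * (0 - 3 * 0) * (IZR h' * y))%R with (- (3 * PI * IZR a ^ 2 * IZR k1 * IZR h' / IZR c))%R
    by (rewrite EkR; unfold y; field; lra).
  assert (Ns' : RtoC (sin (PI * (IZR h' * y))) <> 0) by (apply RtoC_neq; auto).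
  assert (HCi : Ci <> 0) by (intros X; apply (f_equal Im) in X; simpl in X; lra).
  pose proof (qpoch_neq_0 _ Him1). pose proof (Csqrt_neq_0 z).
  field. auto.
- intros Hck l Hl Hlk s.
  set (d := Z.gcd k c) in *.
  assert (Hd : (0 < d)%Z) by (pose proof (Z.gcd_nonneg k c); destruct (Z.eq_dec d 0) as [E|]; [apply Z.gcd_eq_0 in E; lia|unfold d in *; lia]).
  assert (Ek1 : (k = k1 * d)%Z) by (unfold k1; destruct (Z.gcd_divide_l k c) as [q Hq]; fold d in Hq; rewrite Hq, Z.div_mul by lia; ring).
  assert (Ec1 : (c = c1 * d)%Z) by (unfold c1; destruct (Z.gcd_divide_r k c) as [q Hq]; fold d in Hq; rewrite Hq, Z.div_mul by lia; ring).
  clearbody d k1 c1.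
  assert (Oc1 : Z.Odd c1).
  { destruct (Z.Even_or_Odd c1) as [[t Ht]|O]; auto. exfalso. destruct Hc as [c' Hc']. rewrite Ht in Ec1. lia. }
  assert (Od : Z.Odd d).
  { destruct (Z.Even_or_Odd d) as [[t Ht]|O]; auto. exfalso. destruct Hc as [c' Hc']. rewrite Ht in Ec1. lia. }
  assert (d0 : (0 < IZR d)%R) by (apply (IZR_lt 0 d); lia). assert (c10 : (0 < IZR c1)%R) by (apply (IZR_lt 0 c1); lia).
  assert (EkR : IZR k = (IZR k1 * IZR d)%R) by (rewrite Ek1 at 1; apply mult_IZR).
  assert (EcR : IZR c = (IZR c1 * IZR d)%R) by (rewrite Ec1 at 1; apply mult_IZR).
  destruct Hlk as [p Hp0].
  set (lam := (IZR l / IZR c1)%R).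
  (* kx = a k1/c1 and l = a k1 + p c1, so -p is the integral part of kx and l/c1 its fractional
     part. *)
  assert (Hp : (INR kn * y = IZR (- p) + lam)%R).
  { unfold lam, y. rewrite EK, EkR, EcR. apply (f_equal IZR) in Hp0. rewrite minus_IZR, !mult_IZR in Hp0. rewrite opp_IZR.
    replace (IZR l) with (IZR p * IZR c1 + IZR a * IZR k1)%R by lra. field. lra. }
  assert (Hlam : (0 < lam < 1)%R).
  { unfold lam. split; [apply Rdiv_lt_0_compat; auto; apply (IZR_lt 0 l); lia|]. apply Rlt_div_l; auto. rewrite Rmult_1_l. apply IZR_lt. lia. }
  assert (Hr0 : (Rabs (3 * INR kn * y - IZR (s + 3 * - p)) < / 2)%R).
  { replace (3 * INR kn * y - IZR (s + 3 * - p))%R with (3 * lam - IZR s)%R; [apply s_idx_near; auto|].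
    rewrite plus_IZR, mult_IZR, Rmult_assoc, Hp. ring. }
  set (b := (l * c / c1)%Z).
  assert (Eb : (b = l * d)%Z) by (unfold b; rewrite Ec1; replace (l * (c1 * d))%Z with (l * d * c1)%Z by ring; apply Z.div_mul; lia).
  assert (Ebc : (IZR b / IZR c = lam)%R) by (unfold lam; rewrite Eb, EcR, mult_IZR; field; lra).
  (* s(b,c) depends only on the quotient b/c = l/c1. *)
  assert (Es : s_idx b c = s).
  { unfold s, s_idx. rewrite Ebc. reflexivity. }
  destruct (zsummable_CSeries _ (lerch_summable s lam (IZR h' * y) t1 ltac:(lra) Him1)) as (_ & _ & HL).
  set (L1 := _ + _) in HL. clearbody L1.
  rewrite (RT _ Hr0 lam (- p)%Z s L1 Hp eq_refl HL). f_equal.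
  assert (HL' : is_zsum (lerch (s_idx b c) (IZR b / IZR c) (IZR (a * h') / IZR c) t1) L1).
  { rewrite Es, Ebc. replace (IZR (a * h') / IZR c)%R with (IZR h' * y)%R; [exact HL|]. rewrite mult_IZR. unfold y. field. lra. }
  rewrite (rankN3_lerch _ _ _ _ _ Him1 ltac:(rewrite Ebc; exact Hlam) HL'), Esin, Ek.
  (* a k + l + p = a k1 (d + 1) + p (c1 + 1) is even, because both factors of c = c1 d are odd. *)
  assert (Esg : RtoC (powerRZ (-1) (a * k + l + 1)) = - sgn (- p)).
  { rewrite powerRZ_sgn, sgn_plus, sgn_1. rewrite (sgn_even (a * k + l) (- p)); [ring|].
    destruct Oc1 as [c' Hc1']. destruct Od as [d' Hd']. exists (a * k1 * d' + a * k1 + p * c' + p)%Z. rewrite Ek1, Hd'.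
    replace l with (p * c1 + a * k1)%Z by lia. rewrite Hc1'. ring. }
  rewrite Esg, EK.
  replace (IZR s * IZR l / IZR c1 - 3 * IZR l ^ 2 / (2 * IZR c1 ^ 2))%R with (IZR s * lam - 3 * lam * lam / 2)%R by (unfold lam; field; lra).
  match goal with |- context [Cexp (Ci * RtoC (- (3 * PI * IZR h' * IZR k * (y * y)) - ?w))] =>
    replace (- (3 * PI * IZR h' * IZR k * (y * y)) - w)%R with (- (2 * PI * IZR h' * IZR s * IZR a / IZR c) - 3 * PI * IZR a ^ 2 * IZR h' * IZR k1 / (IZR c * IZR c1) + 6 * PI * IZR h' * IZR l * IZR a / (IZR c * IZR c1))%R
    by (unfold y, lam; rewrite EkR, EcR; field; lra) end.
  assert (HCi : Ci <> 0) by (intros X; apply (f_equal Im) in X; simpl in X; lra).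
  pose proof (qpoch_neq_0 _ Him1). pose proof (Csqrt_neq_0 z).
  assert (C4 : RtoC 4 <> 0) by (apply RtoC_neq; lra).
  pose proof Ci2 as H2. field [H2]. auto.
Qed.
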